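(* Suppose there is a changepoint $\tau^\ast=\lfloor\rho n\rfloor$ for some constant $0<\rho<1$, i.e. $(\boldsymbol\mu_i,\boldsymbol\Sigma_i)=(\boldsymbol\mu_1,\boldsymbol\Sigma_1)$ for $i\le\tau^\ast$ and $(\boldsymbol\mu_i,\boldsymbol\Sigma_i)=(\boldsymbol\mu_n,\boldsymbol\Sigma_n)$ for $i>\tau^\ast$, with $(\boldsymbol\mu_1,\boldsymbol\Sigma_1)\ne(\boldsymbol\mu_n,\boldsymbol\Sigma_n)$. Let $\lambda\in(0,0.5)$ be a constant and $\lambda_n=\lfloor\lambda n\rfloor$. Assume that, for $i\in\{1,\ldots,n\}$: (1) $\mathrm{tr}(\boldsymbol\Sigma_i^4)=o\{\mathrm{tr}^2(\boldsymbol\Sigma_i^2)\}$; (2) there is a constant $C$ independent of $n,p$ such that $\sum_{l_1,\ldots,l_h=1}^{p}\mathrm{cum}^2(y_{il_1},\ldots,y_{il_h})\le C\,\mathrm{tr}^{h/2}(\boldsymbol\Sigma_i^2)$ for $h=2,3,4$; (3) there is a constant $C$ independent of $n,p$ such that $\sum_{l_1,\ldots,l_h=1}^{p}\mathrm{cum}^2(y_{il_1},\ldots,y_{il_h})\le C\,\mathrm{tr}^{h/2}(\boldsymbol\Sigma_i^2)$ for $h=5,\ldots,8$, and moreover $\sum_{l_1,\ldots,l_4=1}^{p}\mathrm{cum}^2(y_{il_1},\ldots,y_{il_4})=o\{\mathrm{tr}^2(\boldsymbol\Sigma_i^2)\}$. Assume further that one of the following holds: (i) $n\|\boldsymbol\mu_1-\boldsymbol\mu_n\|^2/\sqrt{\mathrm{tr}\{(\boldsymbol\Sigma_1+\boldsymbol\Sigma_n)^2\}}\to\infty$,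 $\|\boldsymbol\mu_1-\boldsymbol\mu_n\|^2/\sqrt{\mathrm{tr}\{(\boldsymbol\Sigma_1+\boldsymbol\Sigma_n)^2\}}=o(1)$, and $n\,\mathrm{tr}\{(\boldsymbol\Sigma_1-\boldsymbol\Sigma_n)^2\}/\mathrm{tr}\{(\boldsymbol\Sigma_1+\boldsymbol\Sigma_n)^2\}=O(1)$; (ii) $n\|\boldsymbol\mu_1-\boldsymbol\mu_n\|^2/\sqrt{\mathrm{tr}\{(\boldsymbol\Sigma_1+\boldsymbol\Sigma_n)^2\}}=O(1)$ and $n\,\mathrm{tr}\{(\boldsymbol\Sigma_1-\boldsymbol\Sigma_n)^2\}/\mathrm{tr}\{(\boldsymbol\Sigma_1+\boldsymbol\Sigma_n)^2\}\to\infty$; (iii) $n\|\boldsymbol\mu_1-\boldsymbol\mu_n\|^2/\sqrt{\mathrm{tr}\{(\boldsymbol\Sigma_1+\boldsymbol\Sigma_n)^2\}}\to\infty$, $\|\boldsymbol\mu_1-\boldsymbol\mu_n\|^2/\sqrt{\mathrm{tr}\{(\boldsymbol\Sigma_1+\boldsymbol\Sigma_n)^2\}}=o(1)$, and $n\,\mathrm{tr}\{(\boldsymbol\Sigma_1-\boldsymbol\Sigma_n)^2\}/\mathrm{tr}\{(\boldsymbol\Sigma_1+\boldsymbol\Sigma_n)^2\}\to\infty$. Then $\widehat\tau=\arg\max_{\lambda_n\le\tau\le n-\lambda_n}T_n(\tau)$ is a consistent estimator of $\tau^\ast$, that is, $(\widehat\tau-\tau^\ast)/n=o_p(1)$ as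 $n,p\to\infty$.
   Context: For each $n$ (with dimension $p$), $\boldsymbol x_1,\ldots,\boldsymbol x_n$ are independent random vectors in $\mathbb R^p$ with means $\boldsymbol\mu_i=\mathbb E(\boldsymbol x_i)$ and covariance matrices $\boldsymbol\Sigma_i=\mathrm{cov}(\boldsymbol x_i)$; $\boldsymbol y_i=(y_{i1},\ldots,y_{ip})^\top=\boldsymbol x_i-\boldsymbol\mu_i$. All limits and order symbols are as $n,p\to\infty$. $\mathrm{cum}(\cdot)$ is the joint cumulant, $\Phi$ the standard normal distribution function, $\|\cdot\|$ the Euclidean norm, $\mathrm{tr}^a(\cdot)=\{\mathrm{tr}(\cdot)\}^a$, $P_m^k=m!/(m-k)!$, and $\sum^{\ast}$ denotes summation over mutually distinct indices. Mean statistic: for $2\le\tau\le n-2$, $$M_n(\tau)=\frac{1}{\tau(\tau-1)(n-\tau)(n-\tau-1)}\sum_{1\le i_1,i_2\le\tau}^{\ast}\ \sum_{\tau+1\le j_1,j_2\le n}^{\ast}(\boldsymbol x_{i_1}-\boldsymbol x_{j_1})^\top(\boldsymbol x_{i_2}-\boldsymbol x_{j_2}).$$ Covariance statistic: with $H(\boldsymbol x_i,\boldsymbol x_j,\boldsymbol x_k,\boldsymbol x_l)=\{(\boldsymbol x_i-\boldsymbol x_j)^\top(\boldsymbol x_k-\boldsymbol x_l)\}^2/4$, for $4\le\tau\le n-4$, $$V_n(\tau)=\frac{1}{P_\tau^4}\sum_{1\le i,j,k,l\le\tau}^{\ast}H(\boldsymbol x_i,\boldsymbol x_j,\boldsymbol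 x_k,\boldsymbol x_l)+\frac{1}{P_{n-\tau}^4}\sum_{\tau+1\le i,j,k,l\le n}^{\ast}H(\boldsymbol x_i,\boldsymbol x_j,\boldsymbol x_k,\boldsymbol x_l)-\frac{2}{P_\tau^2P_{n-\tau}^2}\sum_{1\le i,j\le\tau}^{\ast}\ \sum_{\tau+1\le k,l\le n}^{\ast}H(\boldsymbol x_i,\boldsymbol x_j,\boldsymbol x_k,\boldsymbol x_l).$$ Scale estimator: $$\widehat{\mathrm{tr}(\boldsymbol\Sigma_1^2)}=\frac{1}{4(n-3)}\sum_{i=1}^{n-3}\left\{(\boldsymbol x_i-\boldsymbol x_{i+1})^\top(\boldsymbol x_{i+2}-\boldsymbol x_{i+3})\right\}^2.$$ Standardized statistics and combined monitoring statistic: $$\tilde M_n(\tau)=\left\{2\widehat{\mathrm{tr}(\boldsymbol\Sigma_1^2)}\right\}^{-1/2}\frac{\tau(n-\tau)}{n}M_n(\tau),\qquad \tilde V_n(\tau)=\left\{2\widehat{\mathrm{tr}(\boldsymbol\Sigma_1^2)}\right\}^{-1}\frac{\tau(n-\tau)}{n}V_n(\tau),$$ $$T_n(\tau)=-2\log\{1-\Phi(\tilde M_n(\tau))\}-2\log\{1-\Phi(\tilde V_n(\tau))\}.$$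
   Formalization: The formal statement adds λ ≤ ρ ≤ 1−λ, so that τ* lies in the search range for large n; if ρ < λ or ρ > 1−λ, then (τ̂−τ* )/n stays bounded away from 0 and the claim is false. *)

(* Defs.v *)
From HB Require Import structures.
From mathcomp Require Export all_boot all_order all_algebra.
From mathcomp Require Export all_classical all_reals all_analysis.
Export Order.TTheory GRing.Theory Num.Theory.
Export numFieldNormedType.Exports.

Set Implicit Arguments.
Unset Strict Implicit.
Unset Printing Implicit Defensive.

Local Open Scope classical_set_scope.
Local Open Scope ring_scope.

Section Vectors.
Context {R : realType} {p : nat}.

Definition dotv (u v : 'cV[R]_p) : R := \sum_(l < p) u l 0 * v l 0.

Definition enorm (u : 'cV[R]_p) : R := Num.sqrt (dotv u u).

Definition borel_cV : set (set 'cV[R]_p) := <<s @open 'cV[R]_p >>.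

(* The ratios measuring the size of a mean change and of a covariance change. *)
Definition mean_gap (m1 m2 : 'cV[R]_p) (S1 S2 : 'M[R]_p) : R :=
  enorm (m1 - m2) ^+ 2 / Num.sqrt (\tr ((S1 + S2) ^+ 2)).

Definition cov_gap (S1 S2 : 'M[R]_p) : R :=
  \tr ((S1 - S2) ^+ 2) / \tr ((S1 + S2) ^+ 2).

End Vectors.

Section RandomVectors.
Context {d : measure_display} {T : measurableType d} {R : realType}.
Variable P : probability T R.

Definition random_vector p (X : T -> 'cV[R]_p) : Prop :=
  forall B, borel_cV B -> measurable (X @^-1` B).

(* Mutual independence of X 1, ..., X n. *)
Definition independent_vectors p n (X : nat -> T -> 'cV[R]_p) : Prop :=
  forall (J : seq nat) (B : nat -> set 'cV[R]_p),
    uniq J -> {subset J <= iota 1 n} -> (forall i, borel_cV (B i)) ->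
    P (\bigcap_(i in [set` J]) (X i @^-1` B i)) =
    (\prod_(i <- J) P (X i @^-1` B i))%E.

(* Necessary and sufficient for all joint cumulants of order <= k of the
   entries of X to exist. *)
Definition finite_moments k p (X : T -> 'cV[R]_p) : Prop :=
  forall l : 'I_p, P.-integrable setT (fun w => (`|X w l 0| ^+ k)%:E).

Definition meanv p (X : T -> 'cV[R]_p) : 'cV[R]_p :=
  \col_l fine ('E_P[fun w => (X w l 0)%R])%E.

Definition covmx p (X : T -> 'cV[R]_p) : 'M[R]_p :=
  \matrix_(k, l) fine (covariance P (fun w => X w k 0) (fun w => X w l 0)).

Definition centered p (X : T -> 'cV[R]_p) : T -> 'cV[R]_p :=
  fun w => X w - meanv X.

(* Joint cumulant of Z_0, ..., Z_(h-1), as the sum over the set partitions of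
   the index set of
     (-1)^(#blocks - 1) (#blocks - 1)! \prod_(blocks B) E (\prod_(j in B) Z_j). *)
Definition cum h (Z : 'I_h -> T -> R) : R :=
  \sum_(pi : {set {set 'I_h}} | finset.partition pi [set: 'I_h]%SET)
    (-1) ^+ (#|pi|.-1) * (#|pi|.-1)`!%:R *
    \prod_(B in pi) fine ('E_P[fun w => (\prod_(j in B) Z j w)%R])%E.

Definition sum_cum2 h p (Y : T -> 'cV[R]_p) : R :=
  \sum_(l : {ffun 'I_h -> 'I_p}) cum (fun j w => Y w (l j) 0) ^+ 2.

End RandomVectors.

Definition Phi {R : realType} (t : R) : R := fine (normal_prob 0 1 `]-oo, t]).

(* The sample is x 1, ..., x n; other values of x are ignored.  Divisions by
   zero are zero and only occur when tau or n - tau is small or when the scale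
   estimator vanishes. *)
Section Statistics.
Context {R : realType} {p : nat}.
Variables (n : nat) (x : nat -> 'cV[R]_p).

Definition Mstat (tau : nat) : R :=
  (\sum_(1 <= i1 < tau.+1) \sum_(1 <= i2 < tau.+1 | i1 != i2)
   \sum_(tau.+1 <= j1 < n.+1) \sum_(tau.+1 <= j2 < n.+1 | j1 != j2)
     dotv (x i1 - x j1) (x i2 - x j2))
  / (tau * tau.-1 * (n - tau) * (n - tau).-1)%:R.

Definition Hker (u v w z : 'cV[R]_p) : R := dotv (u - v) (w - z) ^+ 2 / 4.

(* The sum of H over mutually distinct indices in {a, ..., b-1}. *)
Definition Hsum (a b : nat) : R :=
  \sum_(a <= i < b) \sum_(a <= j < b)
  \sum_(a <= k < b) \sum_(a <= l < b | uniq [:: i; j; k; l])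
    Hker (x i) (x j) (x k) (x l).

Definition Vstat (tau : nat) : R :=
  Hsum 1 tau.+1 / (tau ^_ 4)%:R
  + Hsum tau.+1 n.+1 / ((n - tau) ^_ 4)%:R
  - 2 / (tau ^_ 2 * (n - tau) ^_ 2)%:R *
    (\sum_(1 <= i < tau.+1) \sum_(1 <= j < tau.+1 | i != j)
     \sum_(tau.+1 <= k < n.+1) \sum_(tau.+1 <= l < n.+1 | k != l)
       Hker (x i) (x j) (x k) (x l)).

Definition trS2hat : R :=
  (\sum_(1 <= i < (n - 3).+1)
     dotv (x i - x i.+1) (x i.+2 - x i.+3) ^+ 2) / (4 * (n - 3))%:R.

Definition Mtilde (tau : nat) : R :=
  (2 * trS2hat) `^ (- (1 / 2)) * ((tau * (n - tau))%:R / n%:R) * Mstat tau.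

Definition Vtilde (tau : nat) : R :=
  (2 * trS2hat)^-1 * ((tau * (n - tau))%:R / n%:R) * Vstat tau.

Definition Tstat (tau : nat) : R :=
  - 2 * ln (1 - Phi (Mtilde tau)) - 2 * ln (1 - Phi (Vtilde tau)).

End Statistics.

Definition is_argmax {R : realType} (f : nat -> R) (a b t : nat) : Prop :=
  (a <= t <= b)%N /\ forall s, (a <= s <= b)%N -> f s <= f t.

(* Z n = o_p(1), where Z n may live on a probability space depending on n. *)
Definition op1 {R : realType} (d : nat -> measure_display)
    (T : forall n, measurableType (d n)) (P : forall n, probability (T n) R)
    (Z : forall n, T n -> R) : Prop :=
  forall eps : R, 0 < eps ->
    P n [set w | eps < `|Z n w|] @[n --> \oo] --> 0%E.

(* Main.v *)
(* Write sigma^2 = tr((Sigma_1 + Sigma_n)^2), a = |mu_1 - mu_n|^2 / sigma,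
   b = tr((Sigma_1 - Sigma_n)^2) / sigma^2 and S = n (a + b); in each of the
   three cases S tends to infinity and a tends to 0.

   Up to noise, (tau (n - tau) / n) M_n(tau) equals kappa(tau) n sigma a and
   (tau (n - tau) / n) V_n(tau) equals kappa(tau) n sigma^2 b, where kappa is
   maximal at tau^* and drops linearly in |tau - tau^*| / n.  The
   noise is a combination of sums over blocks of products of degenerate
   functions of distinct observations.  The main terms are martingales in tau
   and are controlled uniformly in tau by Kolmogorov's inequality; for the terms
   of smaller variance a union bound over tau suffices.  Only fourth moments are
   needed, and these follow from the bound on the fourth cumulants, as the
   other set partitions of four indices are pairings or contain a singleton.
   Uniformly in tau the noise in M_n is O_p(sigma sqrt(1 + S)) and the noise in
   V_n is O_p(sigma^2 sqrt(1 + S + (a + a^2) S^2)), hence o_p(sigma S) and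
   o_p(sigma^2 S), and the scale estimator lies between two multiples of sigma^2
   with probability tending to 1.

   Since -2 log(1 - Phi(x)) is nondecreasing and lies between x^2 and
   (x + 1)^2 + const for x >= 0, T_n at tau^* exceeds T_n(tau) by a multiple of
   S^2 as soon as |tau - tau^*| > eps n. *)

Require Import Defs.
From mathcomp Require Import measurable_realfun zify ring lra.

Set Implicit Arguments.
Unset Strict Implicit.
Unset Printing Implicit Defensive.

Local Open Scope classical_set_scope.
Local Open Scope ring_scope.

(** * Moments and independence *)

(** Up to the last part a single sample is studied, with constants depending only on [eps], on the
    cumulant constant and on a number [L] such that both blocks of every candidate contain at least
    n / L observations; dimension and probability space never enter them. A union bound over tau
    costs a factor n in variance. Forms of degree three and four have variance smaller by 1/n and
    can afford it. The leading bilinear noise and the linear noise weighted by the signal cannot: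
    they are rewritten as block forms whose summands do not depend on tau, so that a maximal
    inequality applies. The two changes interfere. Inside a block containing the changepoint some
    differences of observations have mean plus or minus delta = mu_n - mu_1, so V_n sees a multiple
    of delta delta^T besides Sigma_1 - Sigma_n. The resulting bias is of order n (e sqrt f + e^2),
    where e = |delta|^2 and f is the squared Frobenius norm of Sigma_1 - Sigma_n. This is the origin
    of (a + a^2) S^2 and of the role of a -> 0. The falling factorials in V_n do not factor over
    pairs of indices. Replacing them by products of weights, at cost O(n^-5) per quadruple, turns
    V_n into a quadratic form in a difference of sample covariance matrices. *)

Section Moments.
Context {d : measure_display} {T : measurableType d} {R : realType}.
Variable P : probability T R.
Implicit Types (f g h : T -> R) (k : nat).

Definition Ex f : R := fine (\int[P]_w (f w)%:E)%E.

(** Products halve the exponent ([LmomM]), so eight moments of the coordinates make a product of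
    four of them square integrable. *)
Definition Lmom k f : Prop :=
  measurable_fun setT f /\
  P.-integrable setT (EFin \o (fun w => `|f w| ^+ k)).

Lemma integrable_EFinD f g : P.-integrable setT (EFin \o f) ->
  P.-integrable setT (EFin \o g) ->
  P.-integrable setT (EFin \o (fun w => f w + g w)).
Proof.
move=> fi gi; have := integrableD measurableT fi gi.
by apply: eq_integrable => // w _; rewrite /= EFinD.
Qed.

Lemma integrable_EFinZ (c : R) f : P.-integrable setT (EFin \o f) ->
  P.-integrable setT (EFin \o (fun w => c * f w)).
Proof.
move=> fi; have := integrableZl measurableT c fi.
by apply: eq_integrable => // w _; rewrite /= EFinM.
Qed.

Lemma Lmom_meas k f : Lmom k f -> measurable_fun setT f.
Proof. by case. Qed.

Lemma Lmom_le k f g : measurable_fun setT f ->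
  P.-integrable setT (EFin \o g) -> (forall w, `|f w| ^+ k <= g w) ->
  Lmom k f.
Proof.
move=> mf ig fg; split=> //.
apply: (le_integrable measurableT _ _ ig).
  apply/measurable_EFinP; apply: measurable_funX.
  exact: measurableT_comp.
move=> w _ /=; rewrite lee_fin ger0_norm ?exprn_ge0//.
by rewrite (le_trans (fg w))// ler_norm.
Qed.

Lemma Lmom1P f : Lmom 1 f <-> P.-integrable setT (EFin \o f).
Proof.
split=> [[mf fi]|fi].
  apply: (le_integrable measurableT _ _ fi); first exact/measurable_EFinP.
  by move=> w _ /=; rewrite lee_fin expr1 normr_id.
split; first by apply/measurable_EFinP; exact: measurable_int fi.
by have := integrable_abse fi; apply: eq_integrable => // w _; rewrite /= expr1.
Qed.

Lemma Lmom_cst k (c : R) : Lmom k (cst c).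
Proof.
split; first exact: measurable_cst.
exact: (finite_measure_integrable_cst P (`|c| ^+ k)).
Qed.

Lemma LmomD k f g : Lmom k f -> Lmom k g -> Lmom k (fun w => f w + g w).
Proof.
move=> [mf fi] [mg gi].
apply: (@Lmom_le _ _ (fun w => 2 ^+ k * (`|f w| ^+ k + `|g w| ^+ k))).
- exact: measurable_funD.
- by apply: integrable_EFinZ; exact: integrable_EFinD.
move=> w.
have [fg|gf] := leP `|f w| `|g w|.
  have h1 : `|f w + g w| <= 2 * `|g w|.
    by rewrite (le_trans (ler_normD _ _))// mulr_natl mulr2n lerD2r.
  rewrite (le_trans (lerXn2r k _ _ h1)) ?nnegrE ?mulr_ge0//.
  by rewrite exprMn ler_wpM2l ?exprn_ge0// lerDr exprn_ge0.
have h1 : `|f w + g w| <= 2 * `|f w|.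
  by rewrite (le_trans (ler_normD _ _))// mulr_natl mulr2n lerD2l ltW.
rewrite (le_trans (lerXn2r k _ _ h1)) ?nnegrE ?mulr_ge0//.
by rewrite exprMn ler_wpM2l ?exprn_ge0// lerDl exprn_ge0.
Qed.

Lemma LmomM k f g : Lmom k.*2 f -> Lmom k.*2 g ->
  Lmom k (fun w => f w * g w).
Proof.
move=> [mf fi] [mg gi].
apply: (@Lmom_le _ _ (fun w => `|f w| ^+ k.*2 + `|g w| ^+ k.*2)).
- exact: measurable_funM.
- exact: integrable_EFinD.
move=> w; rewrite normrM exprMn -muln2 !exprM.
set a := _ ^+ k; set b := _ ^+ k.
have a0 : 0 <= a by exact: exprn_ge0.
have b0 : 0 <= b by exact: exprn_ge0.
by nra.
Qed.

Lemma Lmom_half k f : Lmom k.*2 f -> Lmom k f.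
Proof.
move=> Lf; have := LmomM Lf (Lmom_cst _ 1).
by congr (Lmom k _); apply/funext => w /=; rewrite mulr1.
Qed.

Lemma LmomZ k (c : R) f : Lmom k f -> Lmom k (fun w => c * f w).
Proof.
move=> [mf fi]; apply: (@Lmom_le _ _ (fun w => `|c| ^+ k * `|f w| ^+ k)).
- by apply: measurable_funM.
- exact: integrable_EFinZ.
- by move=> w; rewrite normrM exprMn.
Qed.

Lemma LmomN k f : Lmom k f -> Lmom k (fun w => - f w).
Proof.
move=> /(LmomZ (-1)); congr (Lmom k _); apply/funext => w.
by rewrite mulN1r.
Qed.

Lemma LmomB k f g : Lmom k f -> Lmom k g -> Lmom k (fun w => f w - g w).
Proof. by move=> Lf Lg; apply: LmomD => //; exact: LmomN. Qed.

Lemma Lmom_sum k (I : Type) (r : seq I) (A : pred I) (F : I -> T -> R) :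
  (forall i, A i -> Lmom k (F i)) ->
  Lmom k (fun w => \sum_(i <- r | A i) F i w).
Proof.
move=> LF; elim: r => [|i r IH].
  rewrite (_ : (fun _ => _) = cst 0); first exact: Lmom_cst.
  by apply/funext => w; rewrite big_nil.
have [Ai|nAi] := boolP (A i); last first.
  by under eq_fun do rewrite big_cons (negbTE nAi).
by under eq_fun do rewrite big_cons Ai; apply: LmomD => //; exact: LF.
Qed.

Lemma Lmom_indic k f (A : set T) : measurable A -> Lmom k f ->
  Lmom k (fun w => f w * \1_A w).
Proof.
move=> mA [mf fi]; apply: (@Lmom_le _ _ (fun w => `|f w| ^+ k)) => //.
  by apply: measurable_funM => //; exact: measurable_indic.
move=> w; rewrite lerXn2r ?nnegrE// normrM indicE.
by rewrite ler_piMr// normr_nat; case: (w \in A).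
Qed.

Lemma Ex_ge0 f : (forall w, 0 <= f w) -> 0 <= Ex f.
Proof.
by move=> f0; apply: fine_ge0; apply: integral_ge0 => w _; rewrite lee_fin.
Qed.

Lemma ExD f g : Lmom 1 f -> Lmom 1 g ->
  Ex (fun w => f w + g w) = Ex f + Ex g.
Proof. by move=> /Lmom1P fi /Lmom1P gi; exact: RintegralD. Qed.

Lemma ExZ (c : R) f : Lmom 1 f -> Ex (fun w => c * f w) = c * Ex f.
Proof. by move=> /Lmom1P fi; exact: RintegralZl. Qed.

Lemma ExB f g : Lmom 1 f -> Lmom 1 g ->
  Ex (fun w => f w - g w) = Ex f - Ex g.
Proof. by move=> /Lmom1P fi /Lmom1P gi; exact: RintegralB. Qed.

Lemma Ex_cst (c : R) : Ex (cst c) = c.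
Proof.
rewrite /Ex -/(Rintegral P setT (cst c)) Rintegral_cst//.
by rewrite [X in fine X](_ : _ = 1%E) ?mulr1//; exact: probability_setT.
Qed.

Lemma Ex_sum (I : Type) (r : seq I) (A : pred I) (F : I -> T -> R) :
  (forall i, A i -> Lmom 1 (F i)) ->
  Ex (fun w => \sum_(i <- r | A i) F i w) = \sum_(i <- r | A i) Ex (F i).
Proof.
move=> LF; elim: r => [|i r IH].
  rewrite big_nil -[RHS](Ex_cst 0); congr Ex; apply/funext => w.
  by rewrite big_nil.
rewrite big_cons; have [Ai|nAi] := boolP (A i); last first.
  by rewrite -IH; under eq_fun do rewrite big_cons (negbTE nAi).
under eq_fun do rewrite big_cons Ai.
rewrite ExD ?IH//; first exact: LF.
exact: Lmom_sum.
Qed.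

Lemma Ex_le f g : Lmom 1 f -> Lmom 1 g -> (forall w, f w <= g w) ->
  Ex f <= Ex g.
Proof.
by move=> /Lmom1P fi /Lmom1P gi fg; apply: le_Rintegral => // w _.
Qed.

Lemma L2_int2 f : Lmom 2 f -> Lmom 1 (fun w => f w ^+ 2).
Proof.
move=> [mf fi]; apply: (@Lmom_le _ _ (fun w => `|f w| ^+ 2)) => //.
  exact: measurable_funX.
by move=> w; rewrite expr1 normrX.
Qed.

Definition prob (A : set T) : R := fine (P A).

Lemma probK A : measurable A -> (prob A)%:E = P A.
Proof. by move=> mA; rewrite fineK// fin_num_measure. Qed.

Lemma prob_mono A B : measurable A -> measurable B -> A `<=` B ->
  prob A <= prob B.
Proof.
by move=> mA mB AB; rewrite -lee_fin !probK// le_measure// inE.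
Qed.

Lemma prob_le1 A : measurable A -> prob A <= 1.
Proof. by move=> mA; rewrite -lee_fin probK// probability_le1. Qed.

Lemma prob_setU A B : measurable A -> measurable B ->
  prob (A `|` B) <= prob A + prob B.
Proof.
move=> mA mB; rewrite -lee_fin EFinD !probK//; last exact: measurableU.
exact: measureU2.
Qed.

Lemma prob_bigU (I : Type) (r : seq I) (F : I -> set T) :
  (forall i, measurable (F i)) ->
  prob (\big[setU/set0]_(i <- r) F i) <= \sum_(i <- r) prob (F i).
Proof.
move=> mF; elim: r => [|i r IH].
  by rewrite !big_nil /prob measure0.
rewrite !big_cons (le_trans (prob_setU _ _))//; last by rewrite lerD2l.
by elim: {IH} r => [|j r IH]; rewrite ?big_nil ?big_cons//; exact: measurableU.
Qed.

Lemma measurable_gt f (t : R) : measurable_fun setT f ->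
  measurable [set w | t < `|f w|].
Proof.
move=> mf; rewrite (_ : [set _ | _] = setT `&` (fun w => `|f w|) @^-1` `]t, +oo[).
  by apply: (measurableT_comp _ mf).
by rewrite setTI; apply/seteqP; split => w /=; rewrite in_itv/= andbT.
Qed.

Lemma markov_sq f (t : R) : 0 < t -> Lmom 2 f ->
  prob [set w | t < `|f w|] <= Ex (fun w => f w ^+ 2) / t ^+ 2.
Proof.
move=> t0 Lf.
have mf := Lmom_meas Lf.
have mA := measurable_gt t mf.
have iA : prob [set w | t < `|f w|] = Ex (\1_[set w | t < `|f w|]).
  by rewrite /Ex integral_indic ?setIT.
rewrite iA ler_pdivlMr ?exprn_gt0// mulrC.
rewrite -ExZ; last first.
  have := Lmom_indic mA (Lmom_cst 1 1).
  by congr (Lmom _ _); apply/funext => w /=; rewrite mul1r.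
apply: Ex_le; last 2 first.
- exact: L2_int2.
- move=> w; rewrite indicE; case: (boolP (w \in _)) => [|_].
    rewrite inE /= mulr1 -[leRHS]real_normK ?num_real// => tf.
    by rewrite lerXn2r ?nnegrE ?(ltW t0)// ltW.
  by rewrite mulr0 sqr_ge0.
apply: LmomZ; have := Lmom_indic mA (Lmom_cst 1 1).
by congr (Lmom _ _); apply/funext => w /=; rewrite mul1r.
Qed.

End Moments.

Section Independence.
Context {d : measure_display} {T : measurableType d} {R : realType}.
Variable P : probability T R.

(** Dynkin's argument: the sets independent of [B] contain the pi-system [G] and are stable under
    complements and countable disjoint unions. *)
Lemma indep_g_sigma_algebra (G : set (set T)) (B : set T) :
  G `<=` measurable -> setI_closed G -> measurable B ->
  (forall A, G A -> P (A `&` B) = (P A * P B)%E) ->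
  forall A, <<s G >> A -> P (A `&` B) = (P A * P B)%E.
Proof.
move=> Gm GI mB GB A sA.
have sm : <<s G >> `<=` measurable.
  by apply: smallest_sub => //; exact: sigma_algebra_measurable.
pose Q := [set A | P (A `&` B) = (P A * P B)%E].
have QC S : measurable S -> Q S -> Q (~` S).
  move=> mS QS; rewrite /Q/= setIC -setDE measureD//; last first.
    by rewrite -ge0_fin_numE// fin_num_measure.
  rewrite [X in (_ - X)%E](_ : _ = (P S * P B)%E); last first.
    by rewrite setIC; exact: QS.
  rewrite probability_setC// muleBl ?mul1e//.
  exact: fin_num_measure.
have QU (F : (set T)^nat) : (forall k, measurable (F k)) ->
    trivIset setT F -> (forall k, Q (F k)) -> Q (\bigcup_k F k).
  move=> mF tF QF; rewrite /Q/= setI_bigcupl measure_bigcup//=; last 2 first.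
  - by move=> k _; exact: measurableI.
  - exact: trivIset_setIr.
  rewrite (measure_bigcup P setT F)//.
  transitivity (\sum_(0 <= k <oo | k \in [set: nat]) (P B * P (F k)))%E.
    by apply: eq_eseriesr => k _; rewrite muleC; exact: QF.
  by rewrite -(probK P mB) nneseriesZl// [RHS]muleC.
apply: (@dynkin_induction _ (g_sigma_algebraType G) G Q) => //.
- by rewrite /Q/= setTI probability_setT mul1e.
- by move=> S mS; apply: QC; exact: sm.
- by move=> F mF tF QF; apply: QU => // k; exact: (sm _ (mF k)).
Qed.

Definition mfG (G : set (set T)) (f : T -> R) : Prop :=
  measurable_fun (setT : set (g_sigma_algebraType G)) f.

Lemma measurable_mfG (G : set (set T)) (f : T -> R) : G `<=` measurable ->
  mfG G f -> measurable_fun setT f.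
Proof.
move=> Gm mf _ B mB; have := mf measurableT B mB.
rewrite !setTI; apply: (smallest_sub _ Gm); exact: sigma_algebra_measurable.
Qed.

(** The centring of [f] makes the inner Fubini integral vanish at every value of [g], so
    integrability of [f] and of [f * g] is enough. General products are recovered in [Ex_mfunM] by
    subtracting the mean. *)
Lemma Ex_indep0 (f g : T -> R) :
  measurable_fun setT f -> measurable_fun setT g ->
  (forall A B : set R, measurable A -> measurable B ->
     P (f @^-1` A `&` g @^-1` B) = (P (f @^-1` A) * P (g @^-1` B))%E) ->
  Lmom P 1 f -> Ex P f = 0 -> Lmom P 1 (fun w => f w * g w) ->
  Ex P (fun w => f w * g w) = 0.
Proof.
move=> mf mg indep Lf Ef Lfg.
pose fg w := (f w, g w).
have mfg : measurable_fun setT fg by exact: measurable_fun_pair.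
pose X : {RV P >-> R} := mfun_Sub (mem_set mf).
pose Y : {RV P >-> R} := mfun_Sub (mem_set mg).
pose Z : {RV P >-> (R * R)%type} := mfun_Sub (mem_set mfg).
pose m1 := distribution P X.
pose m2 := distribution P Y.
pose m12 := distribution P Z.
(* Independence identifies the joint law with the product law, since both agree on rectangles. *)
have E12 : forall A : set (R * R), measurable A -> (m1 \x m2)%E A = m12 A.
  apply: product_measure_unique => A B mA mB.
  exact: indep.
pose h (z : R * R) : \bar R := (z.1 * z.2)%:E.
have mh : measurable_fun setT h.
  apply/measurable_EFinP; apply: measurable_funM.
    exact: measurable_fst.
  exact: measurable_snd.
have ih : P.-integrable setT (h \o Z) by have /Lmom1P := Lfg.
have EZ : (\int[P]_w (f w * g w)%:E = \int[(m1 \x m2)%E]_z h z)%E.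
  transitivity (\int[m12]_z h z)%E.
    by rewrite integral_distribution.
  by apply: eq_measure_integral => A mA _; exact/esym/E12.
have ih' : (m1 \x m2)%E.-integrable setT h.
  apply/integrableP; split => //.
  rewrite (eq_measure_integral m12); last by move=> A mA _; exact: E12.
  by have /integrableP[] := integrable_pushforward mfg mh ih measurableT.
rewrite /Ex EZ -integral21_prod_meas1//.
rewrite (_ : fubini_G _ _ = cst 0%E) ?integral0//.
apply/funext => v; rewrite /fubini_G /h /=.
have /Lmom1P fi := Lf.
rewrite (@integral_distribution _ _ _ _ _ P X (fun u : R => (u * v)%:E)); last 2 first.
- by apply/measurable_EFinP; exact: measurable_funM.
- have := integrable_EFinZ v fi; apply: eq_integrable => // w _ /=.
  by rewrite mulrC.
transitivity (v%:E * \int[P]_w (f w)%:E)%E.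
  by rewrite -integralZl//; apply: eq_integral => w _ /=; rewrite mulrC EFinM.
have <- : (Ex P f)%:E = (\int[P]_w (f w)%:E)%E.
  by rewrite fineK//; exact: integrable_fin_num.
by rewrite Ef mule0.
Qed.

End Independence.

(** * Degenerate kernels and Kolmogorov's inequality *)

Section Sample.
Context {d : measure_display} {T : measurableType d} {R : realType}.
Variable P : probability T R.
Context {p n : nat}.
Variable X : 'I_n -> T -> 'cV[R]_p.
Implicit Types (J : {set 'I_n}) (f g h : T -> R).

(** The pi-system generating the sigma-algebra of the vectors with index in [J]; [mfun J] is
    measurability for that sigma-algebra. *)
Definition cylinder J : set (set T) :=
  [set A | exists2 B : 'I_n -> set 'cV[R]_p, (forall i, borel_cV (B i)) &
     A = \bigcap_(i in [set i | i \in J]) (X i @^-1` B i)].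

Definition mfun J f := mfG (cylinder J) f.

Hypothesis rvX : forall i, random_vector (X i).
Hypothesis indX : forall J (B : 'I_n -> set 'cV[R]_p),
  (forall i, borel_cV (B i)) ->
  P (\bigcap_(i in [set i | i \in J]) (X i @^-1` B i)) =
  (\prod_(i in J) P (X i @^-1` B i))%E.

Lemma borel_cVT : borel_cV (setT : set 'cV[R]_p).
Proof. by apply: sub_gen_smallest; exact: openT. Qed.

Lemma borel_cVI (A B : set 'cV[R]_p) : borel_cV A -> borel_cV B ->
  borel_cV (A `&` B).
Proof. exact: (@measurableI _ (g_sigma_algebraType (@open 'cV[R]_p))). Qed.

Lemma cylinder_measurable J : cylinder J `<=` measurable.
Proof.
move=> _ [B mB ->]; apply: fin_bigcap_measurable; first exact: finite_finset.
by move=> i _; exact: rvX.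
Qed.

Lemma cylinder_setI J : setI_closed (cylinder J).
Proof.
move=> _ _ [A mA ->] [B mB ->]; exists (fun i => A i `&` B i).
  by move=> i; exact: borel_cVI.
apply/seteqP; split => w /=.
  by move=> [h1 h2] i iJ; split; [exact: h1|exact: h2].
by move=> h; split => i iJ; have [] := h _ iJ.
Qed.

Lemma cylinder_sub J J' : J \subset J' -> cylinder J `<=` cylinder J'.
Proof.
move=> JJ' _ [B mB ->]; exists (fun i => if i \in J then B i else setT).
  by move=> i; case: ifP => // _; exact: borel_cVT.
apply/seteqP; split => w h i /= iJ.
  by case: ifPn => // iJ'; exact: h.
by have := h i (fintype.subsetP JJ' _ iJ); rewrite /= iJ.
Qed.

Lemma mfun_sub J J' f : J \subset J' -> mfun J f -> mfun J' f.
Proof.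
move=> JJ' mf _ B mB; have := mf measurableT B mB.
by apply: sub_sigma_algebra2; exact: cylinder_sub.
Qed.

Lemma mfun_measurable J f : mfun J f -> measurable_fun setT f.
Proof. by apply: measurable_mfG; exact: cylinder_measurable. Qed.

Lemma mfun_cst J (c : R) : mfun J (cst c).
Proof. exact: measurable_cst. Qed.

Lemma mfunD J f g : mfun J f -> mfun J g -> mfun J (fun w => f w + g w).
Proof. exact: measurable_funD. Qed.

Lemma mfunM J f g : mfun J f -> mfun J g -> mfun J (fun w => f w * g w).
Proof. exact: measurable_funM. Qed.

Lemma mfunZ J (c : R) f : mfun J f -> mfun J (fun w => c * f w).
Proof. by apply: mfunM; exact: mfun_cst. Qed.

Lemma mfunB J f g : mfun J f -> mfun J g -> mfun J (fun w => f w - g w).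
Proof. exact: measurable_funB. Qed.

Lemma mfun_sum J (I : Type) (r : seq I) (A : pred I) (F : I -> T -> R) :
  (forall i : I, A i -> mfun J (F i)) ->
  mfun J (fun w => \sum_(i <- r | A i) F i w).
Proof.
move=> LF; elim: r => [|i r IH].
  rewrite (_ : (fun _ => _) = cst 0); first exact: mfun_cst.
  by apply/funext => w; rewrite big_nil.
have [Ai|nAi] := boolP (A i); last first.
  by under eq_fun do rewrite big_cons (negbTE nAi).
by under eq_fun do rewrite big_cons Ai; apply: mfunD => //; exact: LF.
Qed.

Lemma mfun_indic J (A : set T) : <<s cylinder J >> A -> mfun J (\1_A).
Proof. by move=> mA; exact: measurable_indic. Qed.

Lemma mfun_coord (i : 'I_n) (l : 'I_p) : mfun [set i]%SET (fun w => X i w l 0).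
Proof.
suff : mfG (cylinder [set i]%SET) (fun w => X i w l 0) by [].
pose T' := g_sigma_algebraType (@open 'cV[R]_p).
have mX : measurable_fun (setT : set (g_sigma_algebraType (cylinder [set i]%SET)))
    (X i : _ -> T').
  move=> _ B mB; rewrite setTI; apply: sub_gen_smallest.
  exists (fun j => B) => //.
  apply/seteqP; split => w h; first by move=> j /= /set1P ->.
  by apply: h; rewrite /= inE.
have ml : measurable_fun (setT : set T') (fun u : T' => (u : 'cV[R]_p) l 0).
  apply: (measurability _ (RGenOpens.measurableE R)) => _ [_ [a [b ->] <-]].
  apply: sub_gen_smallest; rewrite setTI.
  apply: open_comp; last exact: interval_open.
  by move=> u _; exact: coord_continuous.
exact: (measurableT_comp ml mX).
Qed.

(** Dynkin's argument is applied once to each of the two sigma-algebras. On cylinders the claim is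
    the product formula for the union of the disjoint index sets, with the two families of Borel
    sets glued together. *)
Lemma cylinder_indep J J' (A B : set T) : J' \subset (~: J)%SET ->
  <<s cylinder J >> A -> <<s cylinder J' >> B -> P (A `&` B) = (P A * P B)%E.
Proof.
move=> dJ sA sB.
have sm K : <<s cylinder K >> `<=` measurable.
  apply: smallest_sub; first exact: sigma_algebra_measurable.
  exact: cylinder_measurable.
apply: (indep_g_sigma_algebra (@cylinder_measurable J) (@cylinder_setI J)) sA.
  exact: sm sB.
move=> {}A cA; rewrite setIC muleC.
apply: (indep_g_sigma_algebra (@cylinder_measurable J') (@cylinder_setI J')) sB.
  exact: cylinder_measurable cA.
move: cA => [A' mA' ->] _ [B' mB' ->].
pose C i := if i \in J then A' i else B' i.
have mC i : borel_cV (C i) by rewrite /C; case: ifP.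
have disj i : i \in J' -> i \in J = false.
  by move=> /(fintype.subsetP dJ); rewrite inE => /negbTE.
transitivity (P (\bigcap_(i in [set i | i \in (J' :|: J)%SET]) (X i @^-1` C i))).
  congr (P _); apply/seteqP; split => w /=.
    move=> [h1 h2] i /= /setUP[] ij; rewrite /= /C.
      by rewrite (disj _ ij); exact: h1.
    by rewrite ij; exact: h2.
  move=> h; split => i /= ij.
    by have /= := h i; rewrite /C /= inE ij (disj _ ij) /= ; apply.
  by have /= := h i; rewrite /C /= inE ij orbT; apply.
rewrite (indX _ mC) (indX _ mB') (indX _ mA').
rewrite (eq_bigl [predU J' & J]) => [|i]; last by rewrite !inE.
rewrite bigU/=; last by rewrite finset.disjoints_subset.
by congr (_ * _)%E; apply: eq_bigr => i ij; rewrite /C ?(disj _ ij) ?ij.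
Qed.

Lemma Ex_mfun0 J J' f g : J' \subset (~: J)%SET -> mfun J f -> mfun J' g ->
  Lmom P 1 f -> Ex P f = 0 -> Lmom P 1 (fun w => f w * g w) ->
  Ex P (fun w => f w * g w) = 0.
Proof.
move=> dJ mf mg; apply: Ex_indep0; try exact: mfun_measurable.
  exact: mfun_measurable mf.
  exact: mfun_measurable mg.
move=> A B mA mB; apply: (cylinder_indep dJ).
  by have := mf measurableT A mA; rewrite setTI.
by have := mg measurableT B mB; rewrite setTI.
Qed.

Lemma Ex_mfunM J J' f g : J' \subset (~: J)%SET -> mfun J f -> mfun J' g ->
  Lmom P 1 f -> Lmom P 1 g -> Lmom P 1 (fun w => f w * g w) ->
  Ex P (fun w => f w * g w) = Ex P f * Ex P g.
Proof.
move=> dJ mf mg Lf Lg Lfg; apply/eqP; rewrite -subr_eq0 -ExZ// -ExB//; last first.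
  exact: LmomZ.
rewrite (_ : (fun w => _) = (fun w => (f w - Ex P f) * g w)); last first.
  by apply/funext => w; rewrite mulrBl.
apply/eqP/(Ex_mfun0 dJ) => //.
- by apply: mfunB => //; exact: mfun_cst.
- by apply: LmomB => //; exact: Lmom_cst.
- by rewrite (ExB Lf (Lmom_cst P 1 (Ex P f))) Ex_cst subrr.
- rewrite (_ : (fun w => _) = (fun w => f w * g w - Ex P f * g w)); last first.
    by apply/funext => w; rewrite mulrBl.
  by apply: LmomB => //; exact: LmomZ.
Qed.

(* [h] is centred in coordinate [i]: its conditional expectation given the
   other vectors vanishes. *)
Definition centred (i : 'I_n) h : Prop := forall G, mfun (~: [set i])%SET G ->
  Lmom P 2 G -> Ex P (fun w => h w * G w) = 0.

(** The product of [h] with a test function ignores the vector [i], hence is independent of the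
    mean-zero factor [f]. *)
Lemma centredM i f h : mfun [set i]%SET f -> Lmom P 1 f -> Ex P f = 0 ->
  mfun (~: [set i])%SET h -> Lmom P 2 (fun w => f w * h w) ->
  centred i (fun w => f w * h w).
Proof.
move=> mf Lf Ef mh Lfh G mG LG.
have L1 : Lmom P 1 (fun w => f w * (h w * G w)).
  have := @LmomM _ _ _ _ 1 _ _ Lfh LG.
  by congr (Lmom _ _ _); apply/funext => w; rewrite mulrA.
rewrite -(@Ex_mfun0 [set i]%SET (~: [set i])%SET f (fun w => h w * G w))//.
  by congr Ex; apply/funext => w; rewrite mulrA.
exact: mfunM.
Qed.

Lemma centred_sum i (I : Type) (r : seq I) (A : pred I) (F : I -> T -> R) :
  (forall j : I, A j -> Lmom P 2 (F j)) ->
  (forall j : I, A j -> centred i (F j)) ->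
  centred i (fun w => \sum_(j <- r | A j) F j w).
Proof.
move=> LF cF G mG LG.
rewrite (_ : (fun w => _) = (fun w => \sum_(j <- r | A j) F j w * G w)); last first.
  by apply/funext => w; rewrite mulr_suml.
rewrite Ex_sum ?big1// => j Aj; first exact: cF.
exact: (@LmomM _ _ _ _ 1 _ _ (LF j Aj) LG).
Qed.

Lemma centredD i f g : Lmom P 2 f -> Lmom P 2 g ->
  centred i f -> centred i g -> centred i (fun w => f w + g w).
Proof.
move=> Lf Lg cf cg G mG LG.
rewrite (_ : (fun w => _) = (fun w => f w * G w + g w * G w)); last first.
  by apply/funext => w; rewrite mulrDl.
by rewrite ExD ?cf ?cg ?addr0//; exact: (@LmomM _ _ _ _ 1).
Qed.

Lemma centredZ i (c : R) f : Lmom P 2 f ->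
  centred i f -> centred i (fun w => c * f w).
Proof.
move=> Lf cf G mG LG.
rewrite (_ : (fun w => _) = (fun w => c * (f w * G w))); last first.
  by apply/funext => w; rewrite mulrA.
by rewrite ExZ ?cf ?mulr0//; exact: (@LmomM _ _ _ _ 1).
Qed.

(** The canonical kernels of Hoeffding's decomposition: square-integrable functions of exactly the
    vectors in [J], centred in each of them. *)
Definition degenerate J h : Prop :=
  [/\ Lmom P 2 h, mfun J h & forall i, i \in J -> centred i h].

Lemma degenerateD J f g : degenerate J f -> degenerate J g ->
  degenerate J (fun w => f w + g w).
Proof.
move=> [Lf mf cf] [Lg mg cg]; split.
- exact: LmomD.
- exact: mfunD.
- by move=> i iJ; apply: centredD => //; [exact: cf|exact: cg].
Qed.

Lemma degenerateZ J (c : R) f : degenerate J f ->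
  degenerate J (fun w => c * f w).
Proof.
move=> [Lf mf cf]; split.
- exact: LmomZ.
- exact: mfunZ.
- by move=> i iJ; apply: centredZ => //; exact: cf.
Qed.

Lemma degenerate_sum J (I : Type) (r : seq I) (A : pred I) (F : I -> T -> R) :
  (forall j : I, A j -> degenerate J (F j)) ->
  degenerate J (fun w => \sum_(j <- r | A j) F j w).
Proof.
move=> dF; split.
- by apply: Lmom_sum => j /dF[].
- by apply: mfun_sum => j /dF[].
- by move=> i iJ; apply: centred_sum => j /dF[// _ _]; apply.
Qed.

(** Some index lies in exactly one of the two sets. The kernel containing it is centred in it, and
    the other kernel does not involve that vector. *)
Lemma degenerate_orth J J' f g : degenerate J f -> degenerate J' g ->
  J != J' -> Ex P (fun w => f w * g w) = 0.
Proof.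
move=> [Lf mf cf] [Lg mg cg].
rewrite finset.eqEsubset negb_and => /orP[] /subsetPn[i iJ niJ].
  apply: (cf i iJ) => //; apply: mfun_sub mg; apply/fintype.subsetP => j jJ.
  by rewrite !inE; apply: contraNneq niJ => <-.
under eq_fun do rewrite mulrC.
apply: (cg i iJ) => //; apply: mfun_sub mf; apply/fintype.subsetP => j jJ.
by rewrite !inE; apply: contraNneq niJ => <-.
Qed.

(** By orthogonality only pairs with equal supports survive, each with expectation at most [K] in
    absolute value. Supports may repeat, for instance under permutation of a tuple of indices: [B]
    bounds the weight carried by one support and [C] the total weight. *)
Lemma degenerate_var (I : finType) (A : pred I) (s : I -> {set 'I_n})
    (h : I -> T -> R) (w : I -> R) (K B C : R) :
  (forall j, A j -> degenerate (s j) (h j)) ->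
  (forall j, A j -> Ex P (fun x => h j x ^+ 2) <= K) -> 0 <= K -> 0 <= B ->
  (forall j, A j -> \sum_(j' | A j' && (s j' == s j)) `|w j'| <= B) ->
  \sum_(j | A j) `|w j| <= C ->
  Ex P (fun x => (\sum_(j | A j) w j * h j x) ^+ 2) <= K * B * C.
Proof.
move=> dh hK K0 B0 hB hC.
have L1 j j' : A j -> A j' -> Lmom P 1 (fun x => h j x * h j' x).
  by move=> /dh[Lj _ _] /dh[Lj' _ _]; exact: (@LmomM _ _ _ _ 1).
rewrite (_ : (fun x => _) = (fun x => \sum_(j | A j) \sum_(j' | A j')
    (w j * w j') * (h j x * h j' x))); last first.
  apply/funext => x; rewrite expr2 mulr_suml; apply: eq_bigr => j _.
  by rewrite mulr_sumr; apply: eq_bigr => j' _; rewrite mulrACA.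
have L2 j j' : A j -> A j' ->
    Lmom P 1 (fun x => (w j * w j') * (h j x * h j' x)).
  by move=> Aj Aj'; apply: LmomZ; exact: L1.
rewrite Ex_sum => [|j Aj]; last by apply: Lmom_sum => j'; exact: L2.
apply: (@le_trans _ _ (\sum_(j | A j) `|w j| * (K * B))); last first.
  by rewrite -mulr_suml [leLHS]mulrC ler_wpM2l// mulr_ge0.
apply: ler_sum => j Aj; rewrite Ex_sum => [|j' Aj']; last exact: L2.
apply: (@le_trans _ _ (`|w j| * (K * \sum_(j' | A j' && (s j' == s j)) `|w j'|))).
  rewrite !mulr_sumr big_mkcondr/=; apply: ler_sum => j' Aj'.
  rewrite ExZ; last exact: L1.
  case: ifPn => [_|sj]; last first.
    rewrite (degenerate_orth (dh _ Aj) (dh _ Aj')) ?mulr0//.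
    by rewrite eq_sym.
  apply: (le_trans (ler_norm _)); rewrite !normrM -mulrA ler_wpM2l//.
  rewrite mulrC ler_wpM2r//.
  have Lj := L1 _ _ Aj Aj; have Lj' := L1 _ _ Aj' Aj'.
  have Ej := hK _ Aj; have Ej' := hK _ Aj'.
  have Ls : Lmom P 1 (fun x => h j x * h j x + h j' x * h j' x).
    exact: LmomD.
  have Es : Ex P (fun x => h j x * h j x + h j' x * h j' x) <= 2 * K.
    rewrite ExD// mulr_natl mulr2n lerD//.
  rewrite ler_norml; apply/andP; split.
    rewrite -lerN2 opprK -mulN1r -ExZ; last exact: L1.
    rewrite -(@ler_pM2l _ 2)// -ExZ; last by apply: LmomZ; exact: L1.
    apply: le_trans Es; apply: Ex_le => //.
      by do 2 apply: LmomZ; exact: L1.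
    by move=> x; have := sqr_ge0 (h j x + h j' x); nra.
  rewrite -(@ler_pM2l _ 2)// -ExZ; last exact: L1.
  apply: le_trans Es; apply: Ex_le => //.
    by apply: LmomZ; exact: L1.
  by move=> x; have := sqr_ge0 (h j x - h j' x); nra.
by rewrite ler_wpM2l// ler_wpM2l// hB.
Qed.

(* Kolmogorov's argument: stop the partial sums at the first time they exceed
   [t]; the increments after that time are orthogonal to the stopped sum. *)
Lemma maximal_ineq (N : nat) (D : nat -> T -> R) (F : nat -> {set 'I_n}) (t : R) :
  0 < t -> (forall k, F k \subset F k.+1) ->
  (forall k, (k < N)%N -> Lmom P 2 (D k)) ->
  (forall k, (k < N)%N -> mfun (F k.+1) (D k)) ->
  (forall k, (k < N)%N -> forall G, mfun (F k) G -> Lmom P 2 G ->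
     Ex P (fun w => D k w * G w) = 0) ->
  prob P [set w | exists2 m, (m <= N)%N & t < `|\sum_(k < m) D k w|] <=
  (\sum_(k < N) Ex P (fun w => D k w ^+ 2)) / t ^+ 2.
Proof.
move=> t0 FS LD mD oD.
have FM k m : (k <= m)%N -> F k \subset F m.
  move=> km; rewrite -(subnKC km); elim: (m - k)%N => [|q IH]; first by rewrite addn0.
  by rewrite addnS (fintype.subset_trans IH).
pose S m w := \sum_(k < m) D k w.
pose E k := [set w | forall j, (j <= k)%N -> `|S j w| <= t].
pose c k : T -> R := \1_(E k).
have mS m : (m <= N)%N -> mfun (F m) (S m).
  move=> mN; apply: mfun_sum => k _; apply: (mfun_sub (FM k.+1 m (ltn_ord k))).
  by apply: mD; exact: leq_trans (ltn_ord k) mN.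
have LS m : (m <= N)%N -> Lmom P 2 (S m).
  move=> mN; apply: Lmom_sum => k _.
  by apply: LD; exact: leq_trans (ltn_ord k) mN.
have mE k : (k <= N)%N -> <<s cylinder (F k) >> (E k).
  move=> kN; have -> : E k = \big[setI/setT]_(j < k.+1) [set w | `|S j w| <= t].
    rewrite -(bigcap_mkord k.+1 (fun j => [set w | `|S j w| <= t])); apply/seteqP; split => w /= h j.
      by move=> /= jk; exact: h.
    by move=> jk; apply: (h j).
  apply: (@bigsetI_measurable _ (g_sigma_algebraType (cylinder (F k)))) => j _.
  have mj : mfun (F k) (S j).
    apply: (mfun_sub (FM j k _)); first by rewrite -ltnS.
    by apply: mS; rewrite (leq_trans _ kN)// -ltnS.
  have mn : mfun (F k) (fun w => `|S j w|).
    exact: (measurableT_comp (@normr_measurable R setT) mj).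
  have := mn measurableT `]-oo, t]%classic (measurable_itv _).
  by rewrite setTI; congr (<<s _ >> _); apply/seteqP; split => w /=;
     rewrite in_itv.
have mc k : (k <= N)%N -> mfun (F k) (c k).
  by move=> kN; apply: mfun_indic; exact: mE.
have mE' k : (k <= N)%N -> measurable (E k).
  move=> kN; have := mE _ kN; apply: smallest_sub.
    exact: sigma_algebra_measurable.
  exact: cylinder_measurable.
pose Dc k w := D k w * c k w.
have LDc k : (k < N)%N -> Lmom P 2 (Dc k).
  by move=> kN; apply: Lmom_indic; [exact/mE'/ltnW|exact: LD].
pose St m w := \sum_(k < m) Dc k w.
(* After the first passage the stopped sum is frozen at a value beyond [t], so a passage at any time
   is still visible at time [N]. *)
have StS w m : (m <= N)%N -> (E m w -> St m w = S m w) /\ (~ E m w -> t < `|St m w|).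
  elim: m => [|m IH] mN.
    split; first by rewrite /St /S !big_ord0.
    by move=> nE; exfalso; apply: nE => j; rewrite leqn0 => /eqP ->;
       rewrite /S big_ord0 normr0 ltW.
  have [IH1 IH2] := IH (ltnW mN).
  rewrite /St /S !big_ord_recr/= -/(St m w) -/(S m w) /Dc.
  have [Em|nEm] := pselect (E m w).
    rewrite /c indicE mem_set// mulr1 IH1//; split => // nE.
    rewrite ltNge; apply/negP => h; apply: nE => j.
    rewrite leq_eqVlt => /predU1P[->|]; last by rewrite ltnS; exact: Em.
    by rewrite /S big_ord_recr.
  split => [ES|_]; last first.
    by rewrite /c indicE memNset// mulr0 addr0; exact: IH2.
  by exfalso; apply: nEm => j jm; apply: ES; exact: leqW.
have sub : [set w | exists2 m, (m <= N)%N & t < `|S m w|] `<=`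
    [set w | t < `|St N w|].
  move=> w [m mN tS]; apply: (StS w N (leqnn _)).2 => /(_ m mN).
  by rewrite leNgt tS.
have LSt : Lmom P 2 (St N).
  by apply: Lmom_sum => k _; exact: LDc.
have mU : measurable [set w | exists2 m, (m <= N)%N & t < `|S m w|].
  rewrite (_ : [set _ | _] = \big[setU/set0]_(m < N.+1) [set w | t < `|S m w|]).
    apply: bigsetU_measurable => m _; apply: measurable_gt.
    by apply: Lmom_meas (LS m _); rewrite -ltnS.
  rewrite -(bigcup_mkord N.+1 (fun m => [set w | t < `|S m w|])); apply/seteqP; split => w [m mN h]; by exists m.
apply: (le_trans (prob_mono P mU (measurable_gt t (Lmom_meas LSt)) sub)).
apply: (le_trans (markov_sq t0 LSt)).
rewrite ler_pM2r ?invr_gt0 ?exprn_gt0//.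
have L1 k l : (k < N)%N -> (l < N)%N -> Lmom P 1 (fun w => Dc k w * Dc l w).
  by move=> kN lN; apply: (@LmomM _ _ _ _ 1); exact: LDc.
have orth k l : (k < l)%N -> (l < N)%N -> Ex P (fun w => Dc k w * Dc l w) = 0.
  move=> kl lN; have kN := ltn_trans kl lN.
  rewrite (_ : (fun w => _) = (fun w => D l w * (Dc k w * c l w))); last first.
    by apply/funext => w; rewrite /Dc; ring.
  apply: oD => //; last by apply: Lmom_indic; [exact/mE'/ltnW|exact: LDc].
  apply: mfunM; last exact: (mc _ (ltnW lN)).
  apply: (mfun_sub (FM k.+1 l kl)); apply: mfunM; first exact: mD.
  by apply: (mfun_sub (FS k)); exact: (mc _ (ltnW kN)).
rewrite (_ : (fun x => _) = (fun w => \sum_(k < N) \sum_(l < N) Dc k w * Dc l w)); last first.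
  apply/funext => w; rewrite /St expr2 mulr_suml; apply: eq_bigr => k _.
  by rewrite mulr_sumr.
rewrite Ex_sum => [|k _]; last by apply: Lmom_sum => l _; exact: L1.
apply: ler_sum => k _; rewrite Ex_sum => [|l _]; last exact: L1.
rewrite (bigD1 k)//= big1 ?addr0 => [|l lk]; last first.
  have [h|h|h] := ltngtP k l.
  - exact: orth.
  - by under eq_fun do rewrite mulrC; exact: orth.
  - by rewrite (val_inj h) eqxx in lk.
apply: Ex_le; [exact: L1|by apply: L2_int2; exact: LD|move=> w].
rewrite /Dc /c indicE; case: (w \in _); rewrite ?mulr1 ?expr2//.
by rewrite mulr0 mul0r -expr2 sqr_ge0.
Qed.

End Sample.

(** * Maximal inequalities for block sums *)

Section TailBounds.
Context {d : measure_display} {T : measurableType d} {R : realType}.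
Variable P : probability T R.
Implicit Types (r : seq nat) (xi zeta : nat -> T -> R).

(** A weak second-moment bound for the maximum over [r]. Maximal inequalities, union bounds and
    deterministic bounds all yield this form, and it is stable under sums and under bounded
    deterministic coefficients. *)
Definition tailbound r xi (v : R) : Prop :=
  (forall m, m \in r -> measurable_fun setT (xi m)) /\
  forall t : R, 0 < t -> prob P [set w | exists2 m, m \in r & t < `|xi m w|] <= v / t ^+ 2.

Lemma measurable_exceed r xi (t : R) :
  (forall m, m \in r -> measurable_fun setT (xi m)) ->
  measurable [set w | exists2 m, m \in r & t < `|xi m w|].
Proof.
move=> mxi; rewrite (_ : [set _ | _] =
    \bigcup_(m in [set` r]) [set w | t < `|xi m w|]).
  apply: fin_bigcup_measurable; first exact: finite_seq.
  by move=> m /= mr; apply: measurable_gt; exact: mxi.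
by apply/seteqP; split => w [m mr h]; exists m.
Qed.

Lemma tailbound_le r xi v v' : tailbound r xi v -> v <= v' -> tailbound r xi v'.
Proof.
move=> [mxi h] vv'; split=> // t t0; apply: (le_trans (h t t0)).
by rewrite ler_pM2r// invr_gt0 exprn_gt0.
Qed.

Lemma tailbound_eq r xi zeta v : (forall m w, m \in r -> xi m w = zeta m w) ->
  tailbound r xi v -> tailbound r zeta v.
Proof.
move=> eq [mxi h]; split=> [m mr|t t0].
  rewrite (_ : zeta m = xi m); first exact: mxi.
  by apply/funext => w; rewrite eq.
apply: le_trans (h t t0); rewrite le_eqVlt; apply/orP; left; apply/eqP.
by congr prob; apply/seteqP; split => w [m mr hm]; exists m => //; move: hm; rewrite eq.
Qed.

Lemma tailbound_comp r r' (phi : nat -> nat) xi v :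
  (forall m, m \in r -> phi m \in r') ->
  tailbound r' xi v -> tailbound r (fun m => xi (phi m)) v.
Proof.
move=> rr' [mxi h]; have mxi' m : m \in r -> measurable_fun setT (xi (phi m)).
  by move=> /rr'; exact: mxi.
split=> // t t0; apply: le_trans (h t t0).
apply: prob_mono; [exact: measurable_exceed|exact: measurable_exceed|].
by move=> w [m mr hm]; exists (phi m) => //; exact: rr'.
Qed.

(** One of the two summands must exceed [t / 2]; the square of the halving gives the factor 4. *)
Lemma tailboundD r xi zeta v v' : tailbound r xi v -> tailbound r zeta v' ->
  tailbound r (fun m w => xi m w + zeta m w) (4 * (v + v')).
Proof.
move=> [mxi h] [mzeta h']; split=> [m mr|t t0].
  by apply: measurable_funD; [exact: mxi|exact: mzeta].
have t20 : 0 < t / 2 by rewrite divr_gt0.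
apply: (@le_trans _ _ (prob P ([set w | exists2 m, m \in r & t / 2 < `|xi m w|] `|`
    [set w | exists2 m, m \in r & t / 2 < `|zeta m w|]))).
  apply: prob_mono.
  - apply: measurable_exceed => m mr.
    by apply: measurable_funD; [exact: mxi|exact: mzeta].
  - by apply: measurableU; exact: measurable_exceed.
  - move=> w [m mr hm]; have [h1|h1] := ltP (t / 2) `|xi m w|.
      by left; exists m.
    right; exists m => //; move: (ler_normD (xi m w) (zeta m w)) hm h1.
    by set a := `|_ + _|; set b := `|xi m w|; set c := `|zeta m w|; lra.
apply: (le_trans (prob_setU P _ _)); [exact: measurable_exceed|exact: measurable_exceed|].
apply: (le_trans (lerD (h _ t20) (h' _ t20))).
have t0' : t != 0 by rewrite gt_eqF.
by rewrite le_eqVlt; apply/orP; left; apply/eqP; field.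
Qed.

Lemma tailboundZ r xi v (c : nat -> R) (C : R) : 0 <= C ->
  (forall m, m \in r -> `|c m| <= C) -> tailbound r xi v ->
  tailbound r (fun m w => c m * xi m w) (C ^+ 2 * v).
Proof.
move=> C0 hc tb; have [mxi h] := tb.
have mcx m : m \in r -> measurable_fun setT (fun w => c m * xi m w).
  by move=> mr; apply: measurable_funM => //; exact: mxi.
split=> // t t0.
have [C0'|Cn0] := eqVneq C 0; first rewrite C0'.
  rewrite expr0n/= !mul0r (_ : [set _ | _] = set0) ?/prob ?measure0//.
  apply/seteqP; split => w //= [m mr].
  have -> : c m = 0.
    by apply/eqP; rewrite -normr_le0; apply: le_trans (hc m mr) _; rewrite -C0'.
  by rewrite mul0r normr0 ltNge (ltW t0).
have Cgt0 : 0 < C by rewrite lt_def Cn0.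
apply: (@le_trans _ _ (v / (t / C) ^+ 2)); last first.
  rewrite le_eqVlt; apply/orP; left; apply/eqP.
  have t0' : t != 0 by rewrite gt_eqF.
  by field; rewrite t0' Cn0.
apply: le_trans (h _ _); last by rewrite divr_gt0.
apply: prob_mono; [exact: measurable_exceed|exact: measurable_exceed|].
move=> w [m mr hm]; exists m => //; rewrite ltr_pdivrMr//.
apply: (lt_le_trans hm); rewrite normrM mulrC ler_wpM2l//.
exact: hc.
Qed.

(** The event has probability 0 or 1, and 1 only for [t < B]. This lets biases be added to the noise
    with [tailboundD]. *)
Lemma tailbound_det r (b : nat -> R) (B : R) :
  (forall m, m \in r -> `|b m| <= B) -> tailbound r (fun m _ => b m) (B ^+ 2).
Proof.
move=> hb; split=> [m _|t t0]; first exact: measurable_cst.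
have mE : measurable [set w : T | exists2 m, m \in r & t < `|b m|].
  by apply: measurable_exceed => m _; exact: measurable_cst.
have [tB|Bt] := ltP t B.
  apply: (le_trans (prob_le1 P mE)); rewrite ler_pdivlMr ?exprn_gt0// mul1r.
  by apply: lerXn2r; rewrite ?nnegrE ltW// (lt_trans t0).
rewrite (_ : [set _ | _] = set0).
  by rewrite /prob measure0 divr_ge0// sqr_ge0.
apply/seteqP; split => w //= [m mr]; apply/negP; rewrite -leNgt.
exact: le_trans (hb m mr) Bt.
Qed.

Lemma tailbound_union r xi v : (forall m, m \in r -> Lmom P 2 (xi m)) ->
  (forall m, m \in r -> Ex P (fun w => xi m w ^+ 2) <= v) ->
  tailbound r xi ((size r)%:R * v).
Proof.
move=> Lxi hv; split=> [m /Lxi|t t0]; first exact: Lmom_meas.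
pose A m := if m \in r then [set w | t < `|xi m w|] else set0.
have mA m : measurable (A m).
  rewrite /A; case: ifPn => // mr.
  by apply: measurable_gt; apply: Lmom_meas (Lxi m mr).
rewrite (_ : [set _ | _] = \big[setU/set0]_(m <- r) A m); last first.
  rewrite -bigcup_seq; apply/seteqP; split => w [m mr h]; exists m => //.
    by rewrite /A mr.
  by move: h; rewrite /A; case: ifP.
apply: (le_trans (prob_bigU P r mA)).
apply: (@le_trans _ _ (\sum_(m <- r) v / t ^+ 2)).
  rewrite [leLHS]big_seq [leRHS]big_seq; apply: ler_sum => m mr.
  rewrite /A mr; apply: (le_trans (markov_sq t0 (Lxi m mr))).
  by rewrite ler_pM2r ?invr_gt0 ?exprn_gt0//; exact: hv.
by rewrite big_const_seq count_predT iter_addr_0 -mulrA mulr_natl.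
Qed.

Lemma tailbound_dom r xi (Z : T -> R) v : Lmom P 2 Z ->
  Ex P (fun w => Z w ^+ 2) <= v ->
  (forall m, m \in r -> measurable_fun setT (xi m)) ->
  (forall m w, m \in r -> `|xi m w| <= `|Z w|) -> tailbound r xi v.
Proof.
move=> LZ hZ mxi hxi; split=> // t t0.
apply: (@le_trans _ _ (prob P [set w | t < `|Z w|])).
  apply: prob_mono; first exact: measurable_exceed.
    by apply: measurable_gt; exact: Lmom_meas LZ.
  by move=> w [m mr h]; exact: lt_le_trans h (hxi m w mr).
by apply: (le_trans (markov_sq t0 LZ)); rewrite ler_pM2r ?invr_gt0 ?exprn_gt0.
Qed.

End TailBounds.

Section Processes.
Context {d : measure_display} {T : measurableType d} {R : realType}.
Variable P : probability T R.
Context {p n : nat}.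
Variable X : 'I_n -> T -> 'cV[R]_p.
Hypothesis rvX : forall i, random_vector (X i).
Let degenerate := degenerate P X.

Definition psum (xi : 'I_n -> T -> R) m w := \sum_(i : 'I_n | (i < m)%N) xi i w.

Lemma tailbound_psum (xi : 'I_n -> T -> R) (K : R) :
  (forall i, degenerate [set i]%SET (xi i)) ->
  (forall i, Ex P (fun w => xi i w ^+ 2) <= K) ->
  tailbound P (iota 0 n.+1) (psum xi) (n%:R * K).
Proof.
move=> dxi hK.
split=> [m _|t t0].
  by apply: (@Lmom_meas _ _ _ P 2); apply: Lmom_sum => i _; have [] := dxi i.
pose D k w := if insub k is Some i then xi i w else 0.
have DE (k : 'I_n) w : D k w = xi k w by rewrite /D valK.
pose F k := [set i : 'I_n | (i < k)%N]%SET.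
have := @maximal_ineq _ _ _ P _ _ X rvX n D F t t0.
have -> : [set w | exists2 m, (m <= n)%N & t < `|\sum_(k < m) D k w|] =
    [set w | exists2 m, m \in iota 0 n.+1 & t < `|psum xi m w|].
  have E m w : (m <= n)%N -> \sum_(k < m) D k w = psum xi m w.
    move=> mn; rewrite /psum (big_ord_widen n (fun k => D k w) mn).
    by apply: eq_bigr => i _; exact: DE.
  have iE m : (m \in iota 0 n.+1) = (m <= n)%N by rewrite mem_iota.
  apply/seteqP; split => w [m mn h].
    by exists m; rewrite ?iE// -E.
  by rewrite iE in mn; exists m => //; rewrite E.
move=> /(_ _ _ _ _)/le_trans; apply.
- move=> k; apply/fintype.subsetP => i; rewrite !inE; exact: ltnW.
- by move=> k kn; rewrite -[k]/(val (Ordinal kn)) (_ : D _ = xi (Ordinal kn));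
    [have [] := dxi (Ordinal kn)|apply/funext => w; exact: DE].
- move=> k kn; rewrite (_ : D k = xi (Ordinal kn)); last first.
    by apply/funext => w; rewrite -(DE (Ordinal kn)).
  have [_ + _] := dxi (Ordinal kn); apply: mfun_sub.
  by apply/fintype.subsetP => i /set1P ->; rewrite inE /= ltnSn.
- move=> k kn G mG LG; rewrite (_ : D k = xi (Ordinal kn)); last first.
    by apply/funext => w; rewrite -(DE (Ordinal kn)).
  have [_ _ /(_ (Ordinal kn))] := dxi (Ordinal kn); apply => //; first exact/set1P.
  apply: mfun_sub mG; apply/fintype.subsetP => i; rewrite !inE => ik.
  by apply: contraTneq ik => ->; rewrite ltnn.
rewrite ler_pM2r ?invr_gt0 ?exprn_gt0//.
apply: (@le_trans _ _ (\sum_(k < n) K)).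
  apply: ler_sum => k _; rewrite (_ : D k = xi k); first exact: hK.
  by apply/funext => w; exact: DE.
by rewrite sumr_const card_ord mulr_natl.
Qed.

(** Ordering each pair by its larger index makes the double sum over an initial block a sum of
    increments, each of which is centred given its past. *)
Lemma double_sum_lt (g : 'I_n -> 'I_n -> R) m :
  \sum_(i : 'I_n | (i < m)%N) \sum_(j : 'I_n | (j < m)%N && (j != i)) g i j =
  \sum_(i : 'I_n | (i < m)%N) \sum_(j : 'I_n | (j < i)%N) (g i j + g j i).
Proof.
transitivity (\sum_(i : 'I_n | (i < m)%N) (\sum_(j : 'I_n | (j < i)%N) g i j +
    \sum_(j : 'I_n | (j < m)%N && (i < j)%N) g i j)).
  apply: eq_bigr => i im; rewrite (bigID (fun j : 'I_n => (j < i)%N))/=.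
  congr (_ + _); apply: eq_bigl => j; rewrite -val_eqE/=.
    by case: (ltngtP j i) => ji; rewrite ?andbF ?andbT//= (ltn_trans ji im).
  by case: (ltngtP j i) => ji; rewrite ?andbF ?andbT.
rewrite big_split/= [X in _ + X](exchange_big_dep (fun j : 'I_n => (j < m)%N))/=; last first.
  by move=> i j _ /andP[].
rewrite -big_split/=; apply: eq_bigr => i im.
rewrite big_split/=; congr (_ + _); apply: eq_bigl => j.
by rewrite im/=; case: (ltnP j i) => [/ltn_trans-> //|]; rewrite ?andbF.
Qed.

Lemma degenerate_sqrD J (f g : T -> R) (K K' : R) :
  degenerate J f -> degenerate J g ->
  Ex P (fun w => f w ^+ 2) <= K -> Ex P (fun w => g w ^+ 2) <= K' ->
  Ex P (fun w => (f w + g w) ^+ 2) <= 2 * (K + K').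
Proof.
move=> df dg; have [Lf _ _] := df; have [Lg _ _] := dg => fK gK.
have L2f := L2_int2 Lf; have L2g := L2_int2 Lg.
apply: (@le_trans _ _ (Ex P (fun w => 2 * (f w ^+ 2 + g w ^+ 2)))).
  apply: Ex_le.
  - by apply: L2_int2; exact: LmomD.
  - by apply: LmomZ; exact: LmomD.
  - by move=> w; have := sqr_ge0 (f w - g w); nra.
rewrite ExZ; last exact: LmomD.
by rewrite ler_pM2l// ExD// lerD.
Qed.

(* The increments in [m] are martingale differences.  With [e] the order
   reversal the same bound controls the sums over a final block. *)
Lemma tailbound_double (e : 'I_n -> 'I_n) (f : 'I_n -> 'I_n -> T -> R) (K : R) :
  injective e -> 0 <= K ->
  (forall i j, i != j -> degenerate [set i; j]%SET (f i j)) ->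
  (forall i j, i != j -> Ex P (fun w => f i j w ^+ 2) <= K) ->
  tailbound P (iota 0 n.+1) (fun m w => \sum_(i : 'I_n | (i < m)%N)
    \sum_(j : 'I_n | (j < m)%N && (j != i)) f (e i) (e j) w) (4 * n%:R ^+ 2 * K).
Proof.
move=> inje K0 df hK.
have dff i j : i != j -> degenerate [set i; j]%SET (fun w => f i j w + f j i w).
  move=> ij; apply: degenerateD; first exact: df.
  by rewrite finset.setUC; apply: df; rewrite eq_sym.
have hKK i j : i != j -> Ex P (fun w => (f i j w + f j i w) ^+ 2) <= 4 * K.
  move=> ij; rewrite (_ : 4 * K = 2 * (K + K)); last by ring.
  apply: (degenerate_sqrD (df _ _ ij)); last 2 first.
  - exact: hK.
  - by apply: hK; rewrite eq_sym.
  by rewrite finset.setUC; apply: df; rewrite eq_sym.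
split=> [m _|t t0].
  apply: (@Lmom_meas _ _ _ P 2); apply: Lmom_sum => i _.
  apply: Lmom_sum => j /andP[_ ji].
  by have [] := df (e i) (e j); rewrite ?(inj_eq inje) 1?eq_sym.
pose Dn (i : 'I_n) w := \sum_(j : 'I_n | (j < i)%N) (f (e i) (e j) w + f (e j) (e i) w).
pose D k w := if insub k is Some i then Dn i w else 0.
have DE (k : 'I_n) w : D k w = Dn k w by rewrite /D valK.
pose F k := [set e i | i : 'I_n & (i < k)%N]%SET.
have neq (i j : 'I_n) : (j < i)%N -> e i != e j.
  by move=> ji; rewrite (inj_eq inje) -val_eqE/= gtn_eqF.
have LDn i : Lmom P 2 (Dn i).
  by apply: Lmom_sum => j ji; have [] := dff _ _ (neq _ _ ji).
have := @maximal_ineq _ _ _ P _ _ X rvX n D F t t0.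
have -> : [set w | exists2 m, (m <= n)%N & t < `|\sum_(k < m) D k w|] =
    [set w | exists2 m, m \in iota 0 n.+1 & t < `|\sum_(i : 'I_n | (i < m)%N)
    \sum_(j : 'I_n | (j < m)%N && (j != i)) f (e i) (e j) w|].
  have E m w : (m <= n)%N -> \sum_(k < m) D k w = \sum_(i : 'I_n | (i < m)%N)
      \sum_(j : 'I_n | (j < m)%N && (j != i)) f (e i) (e j) w.
    move=> mn; rewrite (double_sum_lt (fun i j => f (e i) (e j) w)).
    rewrite (big_ord_widen n (fun k => D k w) mn).
    by apply: eq_bigr => i _; exact: DE.
  have iE m : (m \in iota 0 n.+1) = (m <= n)%N by rewrite mem_iota.
  apply/seteqP; split => w [m mn h].
    by exists m; rewrite ?iE// -E.
  by rewrite iE in mn; exists m => //; rewrite E.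
have DnE k (kn : (k < n)%N) : D k = Dn (Ordinal kn).
  by apply/funext => w; rewrite -(DE (Ordinal kn)).
move=> /(_ _ _ _ _)/le_trans; apply.
- move=> k; apply: imsetS; apply/fintype.subsetP => i; rewrite !inE; exact: ltnW.
- by move=> k kn; rewrite DnE.
- move=> k kn; rewrite DnE; apply: mfun_sum => j jk.
  have [_ + _] := dff _ _ (neq _ _ jk); apply: mfun_sub.
  apply/fintype.subsetP => i /set2P[]->; apply/imsetP.
    by exists (Ordinal kn); rewrite // inE /= ltnSn.
  by exists j; rewrite // inE /= ltnS ltnW.
- move=> k kn G mG LG; rewrite DnE.
  have : centred P X (e (Ordinal kn)) (Dn (Ordinal kn)).
    apply: centred_sum => j jk; have [Lj _ cj] := dff _ _ (neq _ _ jk) => //.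
    by apply: cj; rewrite !inE eqxx.
  apply => //; apply: mfun_sub mG; apply/fintype.subsetP => _ /imsetP[i + ->].
  by rewrite !inE => ik; rewrite eq_sym; apply: neq.
rewrite ler_pM2r ?invr_gt0 ?exprn_gt0//.
(* For fixed [i] the supports are pairwise distinct, so each carries weight 1 and the total weight
   is at most n. *)
have hn i : Ex P (fun w => Dn i w ^+ 2) <= 4 * K * 1 * n%:R.
  rewrite (_ : (fun w => _) = (fun w => (\sum_(j : 'I_n | (j < i)%N)
    1 * (f (e i) (e j) w + f (e j) (e i) w)) ^+ 2)); last first.
    by apply/funext => w; congr (_ ^+ 2); apply: eq_bigr => j _; rewrite mul1r.
  apply: (@degenerate_var _ _ _ P _ _ X _ (fun j : 'I_n => (j < i)%N)
    (fun j => [set e i; e j]%SET) (fun j w => f (e i) (e j) w + f (e j) (e i) w)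
    (fun=> 1)) => //.
  - by move=> j ji; apply: dff; exact: neq.
  - by move=> j ji; apply: hKK; exact: neq.
  - by rewrite mulr_ge0.
  - move=> j ji; rewrite (big_pred1 j) ?normr1// => j' /=.
    apply/andP/eqP => [[j'i /eqP /finset.setP /(_ (e j'))]|->]; last by rewrite ji eqxx.
    rewrite set22 => /esym/set2P[ee|/inje//].
    by have := neq _ _ j'i; rewrite ee eqxx.
  - apply: (@le_trans _ _ (\sum_(j < n) `|1 : R|)); last first.
      by rewrite normr1 sumr_const card_ord.
    by rewrite [leRHS](bigID (fun j : 'I_n => (j < i)%N))/= lerDl sumr_ge0.
apply: (@le_trans _ _ (\sum_(k < n) 4 * K * 1 * n%:R)).
  apply: ler_sum => k _; rewrite (_ : D k = Dn k); first exact: hn.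
  by apply/funext => w; exact: DE.
by rewrite sumr_const card_ord -mulr_natl; nra.
Qed.

(** The form equals [al - be] times the partial sum up to [m] plus [be] times the full sum; 20 = 4
    (4 + 1). *)
Lemma tailbound_linear_form r (xi : 'I_n -> T -> R) (K C : R) (al be : nat -> R) :
  {subset r <= iota 0 n.+1} -> 0 <= C ->
  (forall m, m \in r -> `|al m| <= C /\ `|be m| <= C) ->
  (forall i, degenerate [set i]%SET (xi i)) ->
  (forall i, Ex P (fun w => xi i w ^+ 2) <= K) ->
  tailbound P r (fun m w => \sum_(i < n) (if (i < m)%N then al m else be m) * xi i w)
    (20 * C ^+ 2 * (n%:R * K)).
Proof.
move=> rn C0 hc dxi hK.
have tb := tailbound_psum dxi hK.
have tb1 : tailbound P r (fun m w => (al m - be m) * psum xi m w)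
    ((2 * C) ^+ 2 * (n%:R * K)).
  apply: tailboundZ; first by rewrite mulr_ge0.
    by move=> m /hc[h1 h2]; rewrite (le_trans (ler_normB _ _))//; lra.
  exact: (tailbound_comp (phi := id) rn tb).
have tb2 : tailbound P r (fun m w => be m * psum xi n w) (C ^+ 2 * (n%:R * K)).
  apply: tailboundZ => //; first by move=> m /hc[].
  apply: (tailbound_comp (phi := fun=> n) _ tb) => m _.
  by rewrite mem_iota /= add0n.
apply: (tailbound_eq _ (tailbound_le (tailboundD tb1 tb2) _)); last first.
  by rewrite le_eqVlt; apply/orP; left; apply/eqP; ring.
move=> m w mr; rewrite /psum !mulr_sumr.
rewrite [X in X + _]big_mkcond [X in _ + X]big_mkcond -big_split/=.
by apply: eq_bigr => i _; rewrite ltn_ord; case: ifP => _; ring.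
Qed.

(** Subtracting the cross weight [ga] everywhere leaves an initial block, a final block and the full
    sum, so no sum over mixed pairs has to be treated. The final block becomes an initial one under
    [rev_ord]; 528 = 4 (4 (16 + 16) + 4). *)
Lemma tailbound_quadratic_form r (f : 'I_n -> 'I_n -> T -> R) (K C : R)
    (al be ga : nat -> R) :
  {subset r <= iota 0 n.+1} -> 0 <= C -> 0 <= K ->
  (forall m, m \in r -> [/\ `|al m| <= C, `|be m| <= C & `|ga m| <= C]) ->
  (forall i j, i != j -> degenerate [set i; j]%SET (f i j)) ->
  (forall i j, i != j -> Ex P (fun w => f i j w ^+ 2) <= K) ->
  tailbound P r (fun m w => \sum_(i < n) \sum_(j < n | j != i)
    (if (i < m)%N then if (j < m)%N then al m else ga m
     else if (j < m)%N then ga m else be m) * f i j w)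
    (528 * C ^+ 2 * (n%:R ^+ 2 * K)).
Proof.
move=> rn C0 K0 hc df hK.
have tbp := tailbound_double (@inj_id _) K0 df hK.
have tbr := tailbound_double (@rev_ord_inj n) K0 df hK.
have tb1 : tailbound P r (fun m w => (al m - ga m) * \sum_(i : 'I_n | (i < m)%N)
    \sum_(j : 'I_n | (j < m)%N && (j != i)) f i j w)
    ((2 * C) ^+ 2 * (4 * n%:R ^+ 2 * K)).
  apply: tailboundZ; first by rewrite mulr_ge0.
    by move=> m /hc[h1 h2 h3]; rewrite (le_trans (ler_normB _ _))//; lra.
  exact: (tailbound_comp (phi := id) rn tbp).
have tb3 : tailbound P r (fun m w => ga m * \sum_(i : 'I_n | (i < n)%N)
    \sum_(j : 'I_n | (j < n)%N && (j != i)) f i j w) (C ^+ 2 * (4 * n%:R ^+ 2 * K)).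
  apply: tailboundZ => //; first by move=> m /hc[].
  apply: (tailbound_comp (phi := fun=> n) _ tbp) => m _.
  by rewrite mem_iota /= add0n.
have tb2 : tailbound P r (fun m w => (be m - ga m) * \sum_(i : 'I_n | (i < n - m)%N)
    \sum_(j : 'I_n | (j < n - m)%N && (j != i)) f (rev_ord i) (rev_ord j) w)
    ((2 * C) ^+ 2 * (4 * n%:R ^+ 2 * K)).
  apply: tailboundZ; first by rewrite mulr_ge0.
    by move=> m /hc[h1 h2 h3]; rewrite (le_trans (ler_normB _ _))//; lra.
  apply: (tailbound_comp (phi := fun m => (n - m)%N) _ tbr) => m _.
  by rewrite mem_iota /= add0n ltnS leq_subr.
apply: (tailbound_eq _ (tailbound_le (tailboundD (tailboundD tb1 tb2) tb3) _)); last first.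
  by rewrite le_eqVlt; apply/orP; left; apply/eqP; ring.
move=> m w mr; have mn : (m <= n)%N by have := rn _ mr; rewrite mem_iota /= add0n ltnS.
have -> : \sum_(i : 'I_n | (i < n - m)%N)
    \sum_(j : 'I_n | (j < n - m)%N && (j != i)) f (rev_ord i) (rev_ord j) w =
    \sum_(i : 'I_n | ~~ (i < m)%N) \sum_(j : 'I_n | ~~ (j < m)%N && (j != i)) f i j w.
  have E (i : 'I_n) : (rev_ord i < n - m)%N = ~~ (i < m)%N.
    by rewrite -leqNgt /= (ltn_sub2lE).
  rewrite (reindex_inj (@rev_ord_inj n))/=; apply: eq_big => i; first exact: E.
  move=> _; rewrite (reindex_inj (@rev_ord_inj n))/=; apply: eq_big => j.
    by rewrite (inj_eq (@rev_ord_inj n)) E.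
  by rewrite !rev_ordK.
rewrite !mulr_sumr.
rewrite [X in X + _ + _]big_mkcond [X in _ + X + _]big_mkcond.
rewrite [X in _ + X]big_mkcond -!big_split/=.
apply: eq_bigr => i _; rewrite ltn_ord.
rewrite (_ : (if (i < m)%N then _ else 0) = \sum_(j < n | j != i)
   (if (i < m)%N && (j < m)%N then (al m - ga m) * f i j w else 0)); last first.
  by case: ifP => _; [rewrite -big_mkcondl/= mulr_sumr; apply: eq_bigl => j; rewrite andbC|rewrite big1].
rewrite (_ : (if ~~ (i < m)%N then _ else 0) = \sum_(j < n | j != i)
   (if ~~ (i < m)%N && ~~ (j < m)%N then (be m - ga m) * f i j w else 0)); last first.
  by case: ifP => _; [rewrite -big_mkcondl/= mulr_sumr; apply: eq_bigl => j; rewrite andbC|rewrite big1].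
rewrite [X in _ + ga m * X](eq_bigl (fun j => j != i)) => [|j]; last by rewrite ltn_ord.
rewrite mulr_sumr -!big_split/=; apply: eq_bigr => j _.
by case: (i < m)%N; case: (j < m)%N => /=; ring.
Qed.

End Processes.

(** The optimal parameter is [be / (2 * al)]; if [al] or [be] vanishes the product is reached only
    in the limit. With this lemma a Cauchy-Schwarz inequality for sums or expectations follows from
    a pointwise inequality with a free parameter. *)
Lemma le_amgm {R : realType} (x al be : R) : 0 <= al -> 0 <= be ->
  (forall th, 0 < th -> x <= th * al ^+ 2 + be ^+ 2 / th / 4) -> x <= al * be.
Proof.
move=> al0 be0 h.
have [b0|bn0] := eqVneq be 0.
  rewrite b0 mulr0; apply/ler_addgt0Pl => e e0.
  have al1 : 0 < al ^+ 2 + 1 by rewrite ltr_wpDl// sqr_ge0.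
  apply: (le_trans (h (e / (al ^+ 2 + 1)) _)); first exact: divr_gt0.
  rewrite b0 expr0n/= !mul0r !addr0 -mulrA ger_pMr// mulrC ler_pdivrMr// mul1r.
  by rewrite lerDl.
have bgt0 : 0 < be by rewrite lt_def bn0.
have [a0|an0] := eqVneq al 0.
  rewrite a0 mul0r; apply/ler_addgt0Pl => e e0; rewrite addr0.
  apply: (le_trans (h (be ^+ 2 / e) _)); first by rewrite divr_gt0// exprn_gt0.
  rewrite a0 expr0n/= mulr0 add0r.
  rewrite (_ : _ / 4 = e / 4); first lra.
  by field; rewrite bn0 gt_eqF.
have agt0 : 0 < al by rewrite lt_def an0.
apply: (le_trans (h (be / al / 2) _)); first by rewrite !divr_gt0.
rewrite le_eqVlt; apply/orP; left; apply/eqP; field.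
by rewrite bn0 an0.
Qed.

(** * Moment bounds for degenerate forms *)

Section FourfoldSums.
Context {R : realType} {I : finType}.
Implicit Types u v : I -> I -> I -> I -> R.

Lemma mul_sum22 (F G : I -> I -> R) :
  (\sum_a \sum_b F a b) * (\sum_c \sum_e G c e) =
  \sum_a \sum_b \sum_c \sum_e F a b * G c e.
Proof.
rewrite mulr_suml; apply: eq_bigr => a _; rewrite mulr_suml.
apply: eq_bigr => b _; rewrite mulr_sumr; apply: eq_bigr => c _.
by rewrite mulr_sumr.
Qed.

Lemma sum4_cauchy u v (al be : R) : 0 <= al -> 0 <= be ->
  \sum_a \sum_b \sum_c \sum_e u a b c e ^+ 2 <= al ^+ 2 ->
  \sum_a \sum_b \sum_c \sum_e v a b c e ^+ 2 <= be ^+ 2 ->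
  \sum_a \sum_b \sum_c \sum_e u a b c e * v a b c e <= al * be.
Proof.
move=> al0 be0 hu hv; apply: le_amgm => // th th0.
apply: (@le_trans _ _ (\sum_a \sum_b \sum_c \sum_e
    (th * u a b c e ^+ 2 + (th^-1 / 4) * v a b c e ^+ 2))).
  do 4 (apply: ler_sum => ? _).
  move: (u _ _ _ _) (v _ _ _ _) => x y; rewrite -subr_ge0.
  rewrite (_ : _ - _ = th * (x - y / th / 2) ^+ 2).
    by rewrite mulr_ge0 ?sqr_ge0// ltW.
  by field; rewrite gt_eqF.
under eq_bigr do under eq_bigr do under eq_bigr do rewrite big_split/= -!mulr_sumr.
under eq_bigr do under eq_bigr do rewrite big_split/= -!mulr_sumr.
under eq_bigr do rewrite big_split/= -!mulr_sumr.
rewrite big_split/= -!mulr_sumr; apply: lerD; first by rewrite ler_pM2l.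
by rewrite -[leRHS]mulrA [leRHS]mulrC ler_pM2l// divr_gt0 ?invr_gt0.
Qed.

(** Lagrange's identity. *)
Lemma sqr_sum_le (x y : I -> R) :
  (\sum_a x a * y a) ^+ 2 <= (\sum_a x a ^+ 2) * (\sum_a y a ^+ 2).
Proof.
have h : 0 <= \sum_a \sum_b (x a * y b - x b * y a) ^+ 2.
  by do 2 (apply: sumr_ge0 => ? _); exact: sqr_ge0.
have E : \sum_a \sum_b (x a * y b - x b * y a) ^+ 2 =
    \sum_a \sum_b (x a ^+ 2 * y b ^+ 2) + \sum_a \sum_b (y a ^+ 2 * x b ^+ 2)
    - 2 * \sum_a \sum_b (x a * y a) * (x b * y b).
  rewrite mulr_sumr -big_split/= -sumrB; apply: eq_bigr => a _.
  rewrite mulr_sumr -big_split/= -sumrB; apply: eq_bigr => b _; ring.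
move: h; rewrite E -!big_distrlr/= expr2.
by set u := \sum_a x a ^+ 2; set v := \sum_a y a ^+ 2; set z := \sum_a _; lra.
Qed.

End FourfoldSums.

Section FourthMoments.
Context {d : measure_display} {T : measurableType d} {R : realType}.
Variable P : probability T R.
Implicit Types f g : T -> R.

Lemma Lmom4_sq f : Lmom P 4 f -> Lmom P 1 (fun w => f w ^+ 4).
Proof.
move=> Lf; have := L2_int2 (@LmomM _ _ _ P 2 _ _ Lf Lf).
by congr (Lmom _ _ _); apply/funext => w; ring.
Qed.

Lemma Ex_prod_le f g (al be : R) : 0 <= al -> 0 <= be ->
  Lmom P 4 f -> Lmom P 4 g ->
  Ex P (fun w => f w ^+ 4) <= al ^+ 2 -> Ex P (fun w => g w ^+ 4) <= be ^+ 2 ->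
  Ex P (fun w => (f w * g w) ^+ 2) <= al * be.
Proof.
move=> al0 be0 Lf Lg hf hg; apply: le_amgm => // th th0.
have L4f := Lmom4_sq Lf; have L4g := Lmom4_sq Lg.
apply: (@le_trans _ _ (Ex P (fun w => th * f w ^+ 4 + (th^-1 / 4) * g w ^+ 4))).
  apply: Ex_le.
  - by apply: L2_int2; exact: (@LmomM _ _ _ P 2).
  - by apply: LmomD; exact: LmomZ.
  move=> w; rewrite -subr_ge0.
  rewrite (_ : _ - _ = th * (f w ^+ 2 - g w ^+ 2 / th / 2) ^+ 2).
    by rewrite mulr_ge0 ?sqr_ge0// ltW.
  by field; rewrite gt_eqF.
rewrite ExD ?ExZ//; try exact: LmomZ.
apply: lerD; first by rewrite ler_pM2l.
by rewrite -[leRHS]mulrA [leRHS]mulrC ler_pM2l// divr_gt0 ?invr_gt0.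
Qed.

Lemma Ex_sq_le f (al : R) : 0 <= al -> Lmom P 4 f ->
  Ex P (fun w => f w ^+ 4) <= al ^+ 2 -> Ex P (fun w => f w ^+ 2) <= al.
Proof.
move=> al0 Lf hf; have := @Ex_prod_le f (cst 1) al 1 al0 ler01 Lf (Lmom_cst _ _ _) hf.
rewrite mulr1 /= (_ : (fun w => (f w * 1) ^+ 2) = (fun w => f w ^+ 2)).
  by apply; rewrite !expr1n Ex_cst.
by apply/funext => w; rewrite mulr1.
Qed.

Lemma Ex_sub_sq f : Lmom P 2 f ->
  Ex P (fun w => (f w - Ex P f) ^+ 2) <= Ex P (fun w => f w ^+ 2).
Proof.
move=> Lf; have L1f := @Lmom_half _ _ _ P 1 _ Lf.
have L2f := L2_int2 Lf.
set c := Ex P f.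
rewrite (_ : (fun w => _) = (fun w => f w ^+ 2 + ((- 2 * c) * f w + cst (c ^+ 2) w))).
  rewrite ExD//; last by apply: LmomD; [exact: LmomZ|exact: Lmom_cst].
  rewrite ExD//; [|exact: LmomZ|exact: Lmom_cst].
  rewrite ExZ// Ex_cst -/c.
  by rewrite gerDl (_ : _ + _ = - c ^+ 2); [rewrite oppr_le0 sqr_ge0|ring].
by apply/funext => w /=; ring.
Qed.

Lemma Ex_sqrD f g (al be : R) : Lmom P 2 f -> Lmom P 2 g ->
  Ex P (fun w => f w ^+ 2) <= al -> Ex P (fun w => g w ^+ 2) <= be ->
  Ex P (fun w => (f w + g w) ^+ 2) <= 2 * (al + be).
Proof.
move=> Lf Lg hf hg; have L2f := L2_int2 Lf; have L2g := L2_int2 Lg.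
apply: (@le_trans _ _ (Ex P (fun w => 2 * (f w ^+ 2 + g w ^+ 2)))).
  apply: Ex_le.
  - by apply: L2_int2; exact: LmomD.
  - by apply: LmomZ; exact: LmomD.
  - by move=> w; have := sqr_ge0 (f w - g w); nra.
rewrite ExZ; last exact: LmomD.
by rewrite ler_pM2l// ExD// lerD.
Qed.

Lemma Ex_sqrB f g (al be : R) : Lmom P 2 f -> Lmom P 2 g ->
  Ex P (fun w => f w ^+ 2) <= al -> Ex P (fun w => g w ^+ 2) <= be ->
  Ex P (fun w => (f w - g w) ^+ 2) <= 2 * (al + be).
Proof.
move=> Lf Lg hf hg; apply: (Ex_sqrD Lf (LmomN Lg)) => //.
by apply: le_trans hg; rewrite le_eqVlt; apply/orP; left; apply/eqP; congr Ex;
   apply/funext => w; rewrite sqrrN.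
Qed.

End FourthMoments.

Section MomentBounds.
Context {d : measure_display} {T : measurableType d} {R : realType}.
Variable P : probability T R.
Context {p n : nat}.
Variable X : 'I_n -> T -> 'cV[R]_p.
Hypothesis rvX : forall i, random_vector (X i).
Hypothesis indX : forall (J : {set 'I_n}) (B : 'I_n -> set 'cV[R]_p),
  (forall i, borel_cV (B i)) ->
  P (\bigcap_(i in [set i | i \in J]) (X i @^-1` B i)) =
  (\prod_(i in J) P (X i @^-1` B i))%E.
Local Notation degenerate := (degenerate P X).
Local Notation Ex := (Ex P).
Local Notation Lmom := (Lmom P).
Local Notation mfun := (mfun X).

Definition centred1 (i : 'I_n) (f : T -> R) : Prop :=
  [/\ mfun [set i]%SET f, Lmom 1 f & Ex f = 0].

Let mfunN1 i J f : mfun J f -> i \notin J -> mfun (~: [set i])%SET f.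
Proof.
move=> mf iJ; apply: mfun_sub mf; apply/fintype.subsetP => j jJ.
by rewrite !inE; apply: contraNneq iJ => <-.
Qed.

Let centred_prod (i : 'I_n) (J : {set 'I_n}) (f g : T -> R) :
  centred1 i f -> mfun J g -> i \notin J ->
  Lmom 2 (fun w => f w * g w) -> centred P X i (fun w => f w * g w).
Proof.
by move=> [mf Lf Ef] mg iJ L2; apply: centredM => //; exact: mfunN1 mg iJ.
Qed.

Lemma degenerate1 i f : centred1 i f -> Lmom 2 f -> degenerate [set i]%SET f.
Proof.
move=> cf L2; have [mf _ _] := cf; split=> // j /set1P ->.
have E : f = (fun w => f w * cst 1 w) by apply/funext => w; rewrite /= mulr1.
rewrite E; apply: (@centred_prod _ finset.set0 _ _ cf) => //; rewrite -?E ?inE//.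
exact: mfun_cst.
Qed.

Lemma degenerate2 i j f g : centred1 i f -> centred1 j g -> i != j ->
  Lmom 2 (fun w => f w * g w) ->
  degenerate [set i; j]%SET (fun w => f w * g w).
Proof.
move=> cf cg ij L2; have [mf _ _] := cf; have [mg _ _] := cg; split=> //.
  apply: mfunM; first by apply: mfun_sub mf; rewrite finset.subsetUl.
  by apply: mfun_sub mg; rewrite finset.subsetUr.
move=> k /set2P[] ->; first by apply: (centred_prod cf mg); rewrite ?inE.
have E : (fun w => f w * g w) = (fun w => g w * f w).
  by apply/funext => w; rewrite mulrC.
by rewrite E; apply: (centred_prod cg mf); rewrite -?E// inE eq_sym.
Qed.

Lemma degenerate3 i j k f g h : centred1 i f -> centred1 j g -> centred1 k h ->
  uniq [:: i; j; k] -> Lmom 2 (fun w => f w * (g w * h w)) ->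
  degenerate [set i; j; k]%SET (fun w => f w * (g w * h w)).
Proof.
move=> cf cg ch; rewrite /= !inE negb_or !andbT => /andP[/andP[ij ik] jk] L2.
have [mf _ _] := cf; have [mg _ _] := cg; have [mh _ _] := ch.
have m2 a b u v : mfun [set a]%SET u -> mfun [set b]%SET v ->
    mfun [set a; b]%SET (fun w => u w * v w).
  move=> mu mv; apply: mfunM; first by apply: mfun_sub mu; rewrite finset.subsetUl.
  by apply: mfun_sub mv; rewrite finset.subsetUr.
split=> //.
  apply: mfunM; first by apply: mfun_sub mf; rewrite -finset.setUA finset.subsetUl.
  by apply: mfun_sub (m2 _ _ _ _ mg mh); rewrite -finset.setUA finset.subsetUr.
move=> l; rewrite !inE => /orP[/orP[]|] /eqP ->.
- by apply: (centred_prod cf (m2 _ _ _ _ mg mh)); rewrite // !inE negb_or ij.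
- have E : (fun w => f w * (g w * h w)) = (fun w => g w * (f w * h w)).
    by apply/funext => w; ring.
  rewrite E; apply: (centred_prod cg (m2 _ _ _ _ mf mh)); rewrite -?E//.
  by rewrite !inE negb_or eq_sym ij.
- have E : (fun w => f w * (g w * h w)) = (fun w => h w * (f w * g w)).
    by apply/funext => w; ring.
  rewrite E; apply: (centred_prod ch (m2 _ _ _ _ mf mg)); rewrite -?E//.
  by rewrite !inE negb_or ![k == _]eq_sym ik.
Qed.

Lemma degenerate4 i j k l f g h q : centred1 i f -> centred1 j g ->
  centred1 k h -> centred1 l q -> uniq [:: i; j; k; l] ->
  Lmom 2 (fun w => f w * (g w * (h w * q w))) ->
  degenerate [set i; j; k; l]%SET (fun w => f w * (g w * (h w * q w))).
Proof.
move=> cf cg ch cq; rewrite /= !inE !negb_or !andbT.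
move=> /and3P[/and3P[ij ik il] /andP[jk jl] kl] L2.
have [mf _ _] := cf; have [mg _ _] := cg; have [mh _ _] := ch.
have [mq _ _] := cq.
have m3 a b c u v z : mfun [set a]%SET u -> mfun [set b]%SET v ->
    mfun [set c]%SET z -> mfun [set a; b; c]%SET (fun w => u w * (v w * z w)).
  move=> mu mv mz; do 2?apply: mfunM.
  - by apply: mfun_sub mu; rewrite -finset.setUA finset.subsetUl.
  - by apply: mfun_sub mv; apply/fintype.subsetP => x; rewrite !inE => ->; rewrite orbT.
  - by apply: mfun_sub mz; rewrite finset.subsetUr.
split=> //.
  apply: mfunM.
    by apply: mfun_sub mf; rewrite -!finset.setUA finset.subsetUl.
  apply: mfun_sub (m3 _ _ _ _ _ _ mg mh mq).
  by apply/fintype.subsetP => x; rewrite !inE => /orP[/orP[]|] ->; rewrite ?orbT.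
move=> x; rewrite !inE => /orP[/orP[/orP[]|]|] /eqP ->.
- by apply: (centred_prod cf (m3 _ _ _ _ _ _ mg mh mq)); rewrite // !inE !negb_or ij ik.
- have E : (fun w => f w * (g w * (h w * q w))) = (fun w => g w * (f w * (h w * q w))).
    by apply/funext => w; ring.
  rewrite E; apply: (centred_prod cg (m3 _ _ _ _ _ _ mf mh mq)); rewrite -?E//.
  by rewrite !inE !negb_or [j == i]eq_sym ij jk.
- have E : (fun w => f w * (g w * (h w * q w))) = (fun w => h w * (f w * (g w * q w))).
    by apply/funext => w; ring.
  rewrite E; apply: (centred_prod ch (m3 _ _ _ _ _ _ mf mg mq)); rewrite -?E//.
  by rewrite !inE !negb_or [k == i]eq_sym [k == j]eq_sym ik jk.
- have E : (fun w => f w * (g w * (h w * q w))) = (fun w => q w * (f w * (g w * h w))).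
    by apply/funext => w; ring.
  rewrite E; apply: (centred_prod cq (m3 _ _ _ _ _ _ mf mg mh)); rewrite -?E//.
  by rewrite !inE !negb_or ![l == _]eq_sym il jl.
Qed.

Definition fro (K : 'M[R]_p) : R := \sum_a \sum_b K a b ^+ 2.

Lemma fro_ge0 K : 0 <= fro K.
Proof. by do 2 (apply: sumr_ge0 => ? _); rewrite sqr_ge0. Qed.

Variable Y : 'I_n -> 'I_p -> T -> R.
Variable S : 'I_n -> 'M[R]_p.
Hypothesis Ymf : forall i a, mfun [set i]%SET (Y i a).
Hypothesis Y8 : forall i a, Lmom 8 (Y i a).
Hypothesis Y0 : forall i a, Ex (Y i a) = 0.
Hypothesis YS : forall i a b, Ex (fun w => Y i a w * Y i b w) = S i a b.

Let Y4 i a : Lmom 4 (Y i a). Proof. exact: (@Lmom_half _ _ _ P 4 _ (Y8 i a)). Qed.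
Let Y2 i a : Lmom 2 (Y i a). Proof. exact: (@Lmom_half _ _ _ P 2 _ (Y4 i a)). Qed.
Let Y1 i a : Lmom 1 (Y i a). Proof. exact: (@Lmom_half _ _ _ P 1 _ (Y2 i a)). Qed.
Let YY4 i a j b : Lmom 4 (fun w => Y i a w * Y j b w).
Proof. exact: (@LmomM _ _ _ _ 4). Qed.
Let YY2 i a j b : Lmom 2 (fun w => Y i a w * Y j b w).
Proof. exact: (@Lmom_half _ _ _ P 2 _ (YY4 _ _ _ _)). Qed.
Let YY1 i a j b : Lmom 1 (fun w => Y i a w * Y j b w).
Proof. exact: (@Lmom_half _ _ _ P 1 _ (YY2 _ _ _ _)). Qed.

Lemma centred1_Y i a : centred1 i (Y i a).
Proof. by split. Qed.

Definition Bm i a b w : R := Y i a w * Y i b w - S i a b.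

Lemma Lmom_Bm i a b : Lmom 4 (Bm i a b).
Proof. by apply: LmomB => //; exact: Lmom_cst. Qed.

Lemma centred1_Bm i a b : centred1 i (Bm i a b).
Proof.
split.
- by apply: mfunB; [exact: mfunM|exact: mfun_cst].
- by apply: LmomB; [exact: YY1|exact: Lmom_cst].
- by rewrite (ExB (YY1 _ _ _ _) (Lmom_cst P 1 (S i a b))) YS Ex_cst subrr.
Qed.

Definition ip i j w : R := \sum_a Y i a w * Y j a w.
Definition lin (u : 'I_p -> R) i w : R := \sum_a u a * Y i a w.
Definition qf (K : 'M[R]_p) i w : R := \sum_a \sum_b K a b * (Y i a w * Y i b w).
Definition bf (K : 'M[R]_p) i j w : R := \sum_a \sum_b K a b * (Y i a w * Y j b w).

Lemma Lmom_ip i j : Lmom 4 (ip i j).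
Proof. by apply: Lmom_sum. Qed.

Lemma Lmom_lin u i : Lmom 4 (lin u i).
Proof. by apply: Lmom_sum => a _; exact: LmomZ. Qed.

Lemma Lmom_qf K i : Lmom 4 (qf K i).
Proof. by do 2 (apply: Lmom_sum => ? _); exact: LmomZ. Qed.

(** The tensor of fourth moments. The bound [fourthC] on its squared norm and the bound [Ssg] on the
    covariances are the only quantitative information on the law used below; [fourthC] is derived
    from the cumulants in [smp_fourth]. *)
Definition fourth i a b c e : R :=
  Ex (fun w => (Y i a w * Y i b w) * (Y i c w * Y i e w)).

Variables (sg C : R).
Hypothesis sg0 : 0 < sg.
Hypothesis C1 : 1 <= C.
Hypothesis Ssg : forall i, fro (S i) <= sg ^+ 2.
Hypothesis fourthC : forall i,
  \sum_a \sum_b \sum_c \sum_e fourth i a b c e ^+ 2 <= C * sg ^+ 4.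

Let L1_4 i a b c e j a' b' c' e' :
  Lmom 1 (fun w => ((Y i a w * Y i b w) * (Y i c w * Y i e w)) *
                     ((Y j a' w * Y j b' w) * (Y j c' w * Y j e' w))).
Proof.
apply: (@LmomM _ _ _ _ 1); apply: (@LmomM _ _ _ _ 2); exact: YY4.
Qed.

Lemma Ex_sum4 (F : 'I_p -> 'I_p -> 'I_p -> 'I_p -> T -> R) :
  (forall a b c e, Lmom 1 (F a b c e)) ->
  Ex (fun w => \sum_a \sum_b \sum_c \sum_e F a b c e w) =
  \sum_a \sum_b \sum_c \sum_e Ex (F a b c e).
Proof.
move=> LF; rewrite Ex_sum => [|a _]; last by do 3 (apply: Lmom_sum => ? _).
apply: eq_bigr => a _; rewrite Ex_sum => [|b _]; last by do 2 (apply: Lmom_sum => ? _).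
apply: eq_bigr => b _; rewrite Ex_sum => [|c _]; last by apply: Lmom_sum => ? _.
by apply: eq_bigr => c _; rewrite Ex_sum.
Qed.

(** Independence turns the expectation into the contraction of two fourth-moment tensors. *)
Lemma Ex_ip4 i j : i != j -> Ex (fun w => ip i j w ^+ 4) <= C * sg ^+ 4.
Proof.
move=> ij.
have -> : (fun w => ip i j w ^+ 4) = (fun w => \sum_a \sum_b \sum_c \sum_e
    ((Y i a w * Y i b w) * (Y i c w * Y i e w)) *
    ((Y j a w * Y j b w) * (Y j c w * Y j e w))).
  apply/funext => w; rewrite -[4%N]/(2 * 2)%N exprM !expr2 /ip big_distrlr/=.
  rewrite mul_sum22; do 4 (apply: eq_bigr => ? _); ring.
rewrite Ex_sum4; last by move=> *; exact: L1_4.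
have E a b c e : Ex (fun w => ((Y i a w * Y i b w) * (Y i c w * Y i e w)) *
    ((Y j a w * Y j b w) * (Y j c w * Y j e w))) =
    fourth i a b c e * fourth j a b c e.
  have m4 k : mfun [set k]%SET (fun w => (Y k a w * Y k b w) * (Y k c w * Y k e w)).
    by do 2 apply: mfunM; exact: Ymf.
  have l4 k : Lmom 1 (fun w => (Y k a w * Y k b w) * (Y k c w * Y k e w)).
    by apply: (@LmomM _ _ _ _ 1); exact: YY2.
  apply: (Ex_mfunM rvX indX _ (m4 i) (m4 j) (l4 i) (l4 j) (L1_4 _ _ _ _ _ _ _ _ _ _)).
  by apply/fintype.subsetP => k; rewrite !inE => /eqP ->; rewrite eq_sym.
have AG : \sum_a \sum_b \sum_c \sum_e fourth i a b c e * fourth j a b c e <=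
    \sum_a \sum_b \sum_c \sum_e (fourth i a b c e ^+ 2 / 2 + fourth j a b c e ^+ 2 / 2).
  do 4 (apply: ler_sum => ? _).
  set u := fourth i _ _ _ _; set v := fourth j _ _ _ _.
  by have := sqr_ge0 (u - v); nra.
under eq_bigr do under eq_bigr do under eq_bigr do under eq_bigr do rewrite E.
apply: (le_trans AG).
under eq_bigr do under eq_bigr do under eq_bigr do rewrite big_split/= -!mulr_suml.
under eq_bigr do under eq_bigr do rewrite big_split/= -!mulr_suml.
under eq_bigr do rewrite big_split/= -!mulr_suml.
rewrite big_split/= -!mulr_suml.
by have := fourthC i; have := fourthC j; lra.
Qed.

(** The contraction of K (x) K with the fourth-moment tensor is bounded by Cauchy-Schwarz. The root
    of [C] that results is at most [C], as [C >= 1]. *)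
Lemma Ex_qf2 K i : Ex (fun w => qf K i w ^+ 2) <= C * fro K * sg ^+ 2.
Proof.
have -> : (fun w => qf K i w ^+ 2) = (fun w => \sum_a \sum_b \sum_c \sum_e
    (K a b * K c e) * ((Y i a w * Y i b w) * (Y i c w * Y i e w))).
  apply/funext => w; rewrite expr2 /qf mul_sum22.
  do 4 (apply: eq_bigr => ? _); ring.
have l4 a b c e : Lmom 1 (fun w => (Y i a w * Y i b w) * (Y i c w * Y i e w)).
  by apply: (@LmomM _ _ _ _ 1); exact: YY2.
rewrite Ex_sum4; last by move=> *; exact: LmomZ.
under eq_bigr do under eq_bigr do under eq_bigr do under eq_bigr do rewrite ExZ//.
rewrite [leRHS](_ : _ = fro K * (C * sg ^+ 2)); last by ring.
have C0 : 0 <= C by apply: le_trans C1.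
apply: (@sum4_cauchy _ _ (fun a b c e => K a b * K c e) (fourth i)).
- exact: fro_ge0.
- by rewrite mulr_ge0// sqr_ge0.
- rewrite le_eqVlt; apply/orP; left; apply/eqP; rewrite expr2 /fro mul_sum22.
  by do 4 (apply: eq_bigr => ? _); rewrite exprMn.
- apply: (le_trans (fourthC i)); rewrite exprMn -exprM ler_wpM2r ?exprn_ge0 ?(ltW sg0)//.
  by rewrite expr2 ler_peMl.
Qed.

(** Only second moments enter: the tensor contracted with K (x) K is S_i (x) S_j, with norm at most
    [sg ^+ 2]. *)
Lemma Ex_bf2 K i j : i != j -> Ex (fun w => bf K i j w ^+ 2) <= fro K * sg ^+ 2.
Proof.
move=> ij.
have -> : (fun w => bf K i j w ^+ 2) = (fun w => \sum_a \sum_b \sum_c \sum_e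
    (K a b * K c e) * ((Y i a w * Y i c w) * (Y j b w * Y j e w))).
  apply/funext => w; rewrite expr2 /bf mul_sum22.
  do 4 (apply: eq_bigr => ? _); ring.
have l4 a b c e : Lmom 1 (fun w => (Y i a w * Y i c w) * (Y j b w * Y j e w)).
  by apply: (@LmomM _ _ _ _ 1); exact: YY2.
rewrite Ex_sum4; last by move=> *; exact: LmomZ.
have E a b c e : Ex (fun w => (Y i a w * Y i c w) * (Y j b w * Y j e w)) =
    S i a c * S j b e.
  have m2 k a' b' : mfun [set k]%SET (fun w => Y k a' w * Y k b' w).
    by apply: mfunM; exact: Ymf.
  rewrite (Ex_mfunM rvX indX _ (m2 i a c) (m2 j b e) (YY1 _ _ _ _) (YY1 _ _ _ _) (l4 _ _ _ _)).
    by rewrite !YS.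
  by apply/fintype.subsetP => k; rewrite !inE => /eqP ->; rewrite eq_sym.
under eq_bigr do under eq_bigr do under eq_bigr do under eq_bigr do rewrite ExZ// E.
apply: (@sum4_cauchy _ _ (fun a b c e => K a b * K c e)
  (fun a b c e => S i a c * S j b e)).
- exact: fro_ge0.
- exact: sqr_ge0.
- rewrite le_eqVlt; apply/orP; left; apply/eqP; rewrite expr2 /fro mul_sum22.
  by do 4 (apply: eq_bigr => ? _); rewrite exprMn.
- apply: (@le_trans _ _ (fro (S i) * fro (S j))); last first.
    by rewrite [leRHS]expr2 ler_pM// ?fro_ge0.
  rewrite le_eqVlt; apply/orP; left; apply/eqP; rewrite /fro mulr_suml.
  apply: eq_bigr => a _; rewrite exchange_big mulr_suml; apply: eq_bigr => c _.
  rewrite mulr_sumr; apply: eq_bigr => b _; rewrite mulr_sumr.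
  by apply: eq_bigr => e _; rewrite exprMn.
Qed.

Let C0 : 0 <= C. Proof. exact: le_trans C1. Qed.
Let sg0' : 0 <= sg. Proof. exact: ltW. Qed.

Lemma Ex_ip2 i j : i != j -> Ex (fun w => ip i j w ^+ 2) <= C * sg ^+ 2.
Proof.
move=> ij; apply: Ex_sq_le; [by rewrite mulr_ge0 ?sqr_ge0|exact: Lmom_ip|].
apply: (le_trans (Ex_ip4 ij)); rewrite exprMn -exprM ler_wpM2r ?exprn_ge0//.
by rewrite expr2 ler_peMl.
Qed.

Let Ex_ip4' i j : i != j -> Ex (fun w => ip i j w ^+ 4) <= (C * sg ^+ 2) ^+ 2.
Proof.
move=> ij; apply: (le_trans (Ex_ip4 ij)); rewrite exprMn -exprM.
by rewrite ler_wpM2r ?exprn_ge0// expr2 ler_peMl.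
Qed.

Definition nsq (u : 'I_p -> R) : R := \sum_a u a ^+ 2.

Lemma nsq_ge0 u : 0 <= nsq u.
Proof. by apply: sumr_ge0 => a _; exact: sqr_ge0. Qed.

(** The square of a linear form is the quadratic form of u u^T, whose Frobenius norm is |u|^2. *)
Lemma Ex_lin4 u i : Ex (fun w => lin u i w ^+ 4) <= (C * nsq u * sg) ^+ 2.
Proof.
have := Ex_qf2 (\matrix_(a, b) (u a * u b)) i.
have -> : fro (\matrix_(a, b) (u a * u b)) = nsq u ^+ 2.
  rewrite expr2 /nsq /fro big_distrlr/=; apply: eq_bigr => a _.
  by apply: eq_bigr => b _; rewrite mxE exprMn.
have -> : (fun w => qf (\matrix_(a, b) (u a * u b)) i w ^+ 2) =
    (fun w => lin u i w ^+ 4).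
  apply/funext => w; rewrite -[4%N]/(2 * 2)%N [in RHS]exprM; congr (_ ^+ 2).
  rewrite expr2 /lin big_distrlr/=; apply: eq_bigr => a _; apply: eq_bigr => b _.
  by rewrite mxE; ring.
move/le_trans; apply; rewrite !exprMn ler_wpM2r ?sqr_ge0//.
by rewrite ler_wpM2r ?sqr_ge0// expr2 ler_peMl.
Qed.

Lemma Ex_lin2 u i : Ex (fun w => lin u i w ^+ 2) <= C * nsq u * sg.
Proof.
apply: Ex_sq_le; [by rewrite !mulr_ge0 ?nsq_ge0|exact: Lmom_lin|exact: Ex_lin4].
Qed.

Lemma degenerate_lin u i : degenerate [set i]%SET (lin u i).
Proof.
apply: degenerate_sum => a _; apply: degenerateZ.
by apply: degenerate1; first exact: centred1_Y.
Qed.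

Definition qfc (K : 'M[R]_p) i w : R := \sum_a \sum_b K a b * Bm i a b w.

Lemma degenerate_qfc K i : degenerate [set i]%SET (qfc K i).
Proof.
apply: degenerate_sum => a _; apply: degenerate_sum => b _; apply: degenerateZ.
apply: degenerate1; first exact: centred1_Bm.
exact: (@Lmom_half _ _ _ P 2 _ (Lmom_Bm _ _ _)).
Qed.

Definition ipm (K L : 'M[R]_p) : R := \sum_a \sum_b K a b * L a b.

Lemma qfcE K i w : qfc K i w = qf K i w - ipm K (S i).
Proof.
rewrite /qfc /qf /ipm -sumrB; apply: eq_bigr => a _; rewrite -sumrB.
by apply: eq_bigr => b _; rewrite /Bm mulrBr.
Qed.

Lemma Ex_qf K i : Ex (qf K i) = ipm K (S i).
Proof.
rewrite /qf Ex_sum => [|a _]; last by apply: Lmom_sum => b _; exact: LmomZ.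
apply: eq_bigr => a _; rewrite Ex_sum => [|b _]; last exact: LmomZ.
by apply: eq_bigr => b _; rewrite ExZ// YS.
Qed.

Lemma Ex_qfc2 K i : Ex (fun w => qfc K i w ^+ 2) <= C * fro K * sg ^+ 2.
Proof.
apply: le_trans (Ex_qf2 K i).
rewrite (_ : (fun w => qfc K i w ^+ 2) = (fun w => (qf K i w - Ex (qf K i)) ^+ 2)).
  by apply: Ex_sub_sq; exact: (@Lmom_half _ _ _ P 2 _ (Lmom_qf K i)).
by apply/funext => w; rewrite qfcE Ex_qf.
Qed.

(** The Frobenius product of y_i y_i^T - S_i and y_j y_j^T - S_j, the leading noise of the
    covariance statistic. *)
Definition BB i j w : R := \sum_a \sum_b Bm i a b w * Bm j a b w.

Lemma degenerate_BB i j : i != j -> degenerate [set i; j]%SET (BB i j).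
Proof.
move=> ij; apply: degenerate_sum => a _; apply: degenerate_sum => b _.
apply: degenerate2 => //; try exact: centred1_Bm.
by apply: (@LmomM _ _ _ _ 2); exact: Lmom_Bm.
Qed.

Lemma sum2_cauchy (u v : 'I_p -> 'I_p -> R) (al be : R) : 0 <= al -> 0 <= be ->
  \sum_a \sum_b u a b ^+ 2 <= al ^+ 2 -> \sum_a \sum_b v a b ^+ 2 <= be ^+ 2 ->
  \sum_a \sum_b u a b * v a b <= al * be.
Proof.
move=> al0 be0 hu hv; apply: le_amgm => // th th0.
apply: (@le_trans _ _ (\sum_a \sum_b
    (th * u a b ^+ 2 + (th^-1 / 4) * v a b ^+ 2))).
  do 2 (apply: ler_sum => ? _).
  move: (u _ _) (v _ _) => x y; rewrite -subr_ge0.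
  rewrite (_ : _ - _ = th * (x - y / th / 2) ^+ 2).
    by rewrite mulr_ge0 ?sqr_ge0// ltW.
  by field; rewrite gt_eqF.
under eq_bigr do rewrite big_split/= -!mulr_sumr.
rewrite big_split/= -!mulr_sumr; apply: lerD; first by rewrite ler_pM2l.
by rewrite -[leRHS]mulrA [leRHS]mulrC ler_pM2l// divr_gt0 ?invr_gt0.
Qed.

Lemma ipmN K L : ipm (- K) L = - ipm K L.
Proof.
rewrite /ipm -sumrN; apply: eq_bigr => a _; rewrite -sumrN; apply: eq_bigr => b _.
by rewrite mxE mulNr.
Qed.

Lemma froN K : fro (- K) = fro K.
Proof. by do 2 (apply: eq_bigr => ? _); rewrite mxE sqrrN. Qed.

Lemma ipm_le K L (al be : R) : 0 <= al -> 0 <= be ->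
  fro K <= al ^+ 2 -> fro L <= be ^+ 2 -> `|ipm K L| <= al * be.
Proof.
move=> al0 be0 hK hL; rewrite ler_norml; apply/andP; split; last exact: sum2_cauchy.
rewrite lerNl -ipmN; apply: sum2_cauchy => //.
by move: hK; rewrite -froN.
Qed.

(** The centred form shows that the kernel is degenerate; the expanded form gives access to its
    moments. [YBuE] and [YBYE] serve the same purpose. *)
Lemma BBE i j w : BB i j w = (ip i j w ^+ 2 - qf (S j) i w) - qfc (S i) j w.
Proof.
rewrite qfcE opprB addrCA /BB /ip /qf /ipm expr2 big_distrlr/= -!sumrB -big_split/=.
apply: eq_bigr => a _; rewrite -!sumrB -big_split/=; apply: eq_bigr => b _.
rewrite /Bm; ring.
Qed.

Lemma Ex_BB2 i j : i != j -> Ex (fun w => BB i j w ^+ 2) <= 12 * C ^+ 2 * sg ^+ 4.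
Proof.
move=> ij; under eq_fun do rewrite BBE.
have Lq K k : Lmom 2 (qf K k) by exact: (@Lmom_half _ _ _ P 2 _ (Lmom_qf _ _)).
have Lqc K k : Lmom 2 (qfc K k) by have [] := degenerate_qfc K k.
have Lip : Lmom 2 (fun w => ip i j w ^+ 2).
  by apply: (@LmomM _ _ _ _ 2); exact: Lmom_ip.
have CC : C <= C ^+ 2 by rewrite expr2 ler_peMl.
have s4 : 0 <= sg ^+ 4 by rewrite exprn_ge0.
have E1 : Ex (fun w => (ip i j w ^+ 2) ^+ 2) <= C ^+ 2 * sg ^+ 4.
  rewrite (_ : (fun w => _) = (fun w => ip i j w ^+ 4)); last first.
    by apply/funext => w; rewrite -exprM.
  by apply: (le_trans (Ex_ip4 ij)); rewrite ler_wpM2r.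
have E2 (K : 'M[R]_p) : fro K <= sg ^+ 2 -> C * fro K * sg ^+ 2 <= C ^+ 2 * sg ^+ 4.
  move=> hK; apply: (@le_trans _ _ (C * sg ^+ 2 * sg ^+ 2)).
    by rewrite ler_wpM2r ?sqr_ge0// ler_wpM2l.
  by rewrite -mulrA -exprD ler_wpM2r.
have E3 := le_trans (Ex_qf2 (S j) i) (E2 (S j) (Ssg j)).
have E4 := le_trans (Ex_qfc2 (S i) j) (E2 (S i) (Ssg i)).
have E5 := Ex_sqrB Lip (Lq _ _) E1 E3.
apply: (le_trans (Ex_sqrB (LmomB Lip (Lq _ _)) (Lqc _ _) E5 E4)).
have : 0 <= C ^+ 2 * sg ^+ 4 by rewrite mulr_ge0 ?sqr_ge0.
lra.
Qed.

Lemma degenerate_bf K i j : i != j -> degenerate [set i; j]%SET (bf K i j).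
Proof.
move=> ij; apply: degenerate_sum => a _; apply: degenerate_sum => b _.
apply: degenerateZ; apply: degenerate2 => //; exact: centred1_Y.
Qed.

Lemma degenerate_ip i j : i != j -> degenerate [set i; j]%SET (ip i j).
Proof.
by move=> ij; apply: degenerate_sum => a _; apply: degenerate2 => //; exact: centred1_Y.
Qed.

Lemma degenerate_lin2 u i j : i != j ->
  degenerate [set i; j]%SET (fun w => lin u i w * lin u j w).
Proof.
move=> ij; rewrite (_ : (fun w => _) = (fun w => \sum_a \sum_b
    u a * u b * (Y i a w * Y j b w))); last first.
  apply/funext => w; rewrite /lin big_distrlr/=.
  by do 2 (apply: eq_bigr => ? _); ring.
apply: degenerate_sum => a _; apply: degenerate_sum => b _.
apply: degenerateZ; apply: degenerate2 => //; exact: centred1_Y.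
Qed.

Lemma Ex_lin22 u i j :
  Ex (fun w => (lin u i w * lin u j w) ^+ 2) <= (C * nsq u * sg) ^+ 2.
Proof.
have h : 0 <= C * nsq u * sg by rewrite !mulr_ge0 ?nsq_ge0.
rewrite [leRHS]expr2.
by apply: (Ex_prod_le h h (Lmom_lin _ _) (Lmom_lin _ _)); exact: Ex_lin4.
Qed.

(** The form y_i^T (y_j y_j^T - S_j) u. *)
Definition YBu u i j w : R := \sum_a \sum_b u b * (Y i a w * Bm j a b w).

Lemma degenerate_YBu u i j : i != j -> degenerate [set i; j]%SET (YBu u i j).
Proof.
move=> ij; apply: degenerate_sum => a _; apply: degenerate_sum => b _.
apply: degenerateZ; apply: degenerate2 => //.
- exact: centred1_Bm.
- apply: (@LmomM _ _ _ _ 2); [exact: Y4|exact: Lmom_Bm].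
Qed.

Definition mulSu j u a : R := \sum_b S j a b * u b.

Lemma nsq_mulSu j u : nsq (mulSu j u) <= sg ^+ 2 * nsq u.
Proof.
apply: (@le_trans _ _ (fro (S j) * nsq u)); last by rewrite ler_wpM2r ?nsq_ge0.
rewrite /nsq /fro mulr_suml; apply: ler_sum => a _.
exact: sqr_sum_le.
Qed.

Lemma YBuE u i j w : YBu u i j w = ip i j w * lin u j w - lin (mulSu j u) i w.
Proof.
rewrite /YBu /ip /lin /mulSu big_distrlr/= -sumrB; apply: eq_bigr => a _.
rewrite mulr_suml -sumrB; apply: eq_bigr => b _; rewrite /Bm; ring.
Qed.

Lemma Ex_YBu2 u i j : i != j ->
  Ex (fun w => YBu u i j w ^+ 2) <= 4 * C ^+ 2 * nsq u * sg ^+ 3.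
Proof.
move=> ij; under eq_fun do rewrite YBuE.
have h : 0 <= C * nsq u * sg by rewrite !mulr_ge0 ?nsq_ge0.
have h2 : 0 <= C * sg ^+ 2 by rewrite mulr_ge0 ?sqr_ge0.
have CC : C <= C ^+ 2 by rewrite expr2 ler_peMl.
have E1 := Ex_prod_le h2 h (Lmom_ip i j) (Lmom_lin u j) (Ex_ip4' ij) (Ex_lin4 u j).
have E2 := Ex_lin2 (mulSu j u) i.
have Ll v k : Lmom 2 (lin v k) by have [] := degenerate_lin v k.
have Lp : Lmom 2 (fun w => ip i j w * lin u j w).
  by apply: (@LmomM _ _ _ _ 2); [exact: Lmom_ip|exact: Lmom_lin].
apply: (le_trans (Ex_sqrB Lp (Ll _ _) E1 E2)).
have h3 : C * nsq (mulSu j u) * sg <= C ^+ 2 * nsq u * sg ^+ 3.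
  apply: (@le_trans _ _ (C * (sg ^+ 2 * nsq u) * sg)).
    by rewrite ler_wpM2r// ler_wpM2l// nsq_mulSu.
  rewrite (_ : C * _ * _ = C * nsq u * sg ^+ 3); last by ring.
  by rewrite ler_wpM2r ?exprn_ge0// ler_wpM2r ?nsq_ge0.
rewrite (_ : 4 * C ^+ 2 * nsq u * sg ^+ 3 =
  2 * (C * sg ^+ 2 * (C * nsq u * sg) + C ^+ 2 * nsq u * sg ^+ 3)); last by ring.
by rewrite ler_pM2l// lerD2l.
Qed.

(** The form y_j^T (y_i y_i^T - S_i) y_k. *)
Definition YBY i j k w : R := \sum_a \sum_b Bm i a b w * (Y j a w * Y k b w).

Lemma degenerate_YBY i j k : uniq [:: i; j; k] ->
  degenerate [set i; j; k]%SET (YBY i j k).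
Proof.
move=> ijk; apply: degenerate_sum => a _; apply: degenerate_sum => b _.
apply: degenerate3 => //; try exact: centred1_Y; first exact: centred1_Bm.
apply: (@LmomM _ _ _ _ 2); [exact: Lmom_Bm|exact: YY4].
Qed.

Lemma YBYE i j k w : YBY i j k w = ip i j w * ip i k w - bf (S i) j k w.
Proof.
rewrite /YBY /ip /bf big_distrlr/= -sumrB; apply: eq_bigr => a _.
by rewrite -sumrB; apply: eq_bigr => b _; rewrite /Bm; ring.
Qed.

Lemma Ex_ip22 i j k l : i != j -> k != l ->
  Ex (fun w => (ip i j w * ip k l w) ^+ 2) <= C ^+ 2 * sg ^+ 4.
Proof.
move=> ij kl; have h2 : 0 <= C * sg ^+ 2 by rewrite mulr_ge0 ?sqr_ge0.
rewrite (_ : C ^+ 2 * _ = (C * sg ^+ 2) * (C * sg ^+ 2)); last by ring.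
by apply: (Ex_prod_le h2 h2 (Lmom_ip _ _) (Lmom_ip _ _)); exact: Ex_ip4'.
Qed.

Lemma Ex_YBY2 i j k : uniq [:: i; j; k] ->
  Ex (fun w => YBY i j k w ^+ 2) <= 4 * C ^+ 2 * sg ^+ 4.
Proof.
rewrite /= !inE negb_or !andbT => /andP[/andP[ij ik] jk].
under eq_fun do rewrite YBYE.
have CC : 1 <= C ^+ 2 by rewrite (le_trans C1)// expr2 ler_peMl.
have Lp : Lmom 2 (fun w => ip i j w * ip i k w).
  by apply: (@LmomM _ _ _ _ 2); exact: Lmom_ip.
have Lb : Lmom 2 (bf (S i) j k) by have [] := degenerate_bf (S i) jk.
apply: (le_trans (Ex_sqrB Lp Lb (Ex_ip22 ij ik) (Ex_bf2 (S i) jk))).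
have h3 : fro (S i) * sg ^+ 2 <= C ^+ 2 * sg ^+ 4.
  apply: (@le_trans _ _ (sg ^+ 2 * sg ^+ 2)); first by rewrite ler_wpM2r ?sqr_ge0.
  by rewrite -exprD ler_peMl// exprn_ge0.
rewrite (_ : 4 * C ^+ 2 * sg ^+ 4 = 2 * (C ^+ 2 * sg ^+ 4 + C ^+ 2 * sg ^+ 4)); last by ring.
by rewrite ler_pM2l// lerD2l.
Qed.

Lemma degenerate_iplin u i j k : uniq [:: i; j; k] ->
  degenerate [set i; j; k]%SET (fun w => ip i j w * lin u k w).
Proof.
move=> ijk; rewrite (_ : (fun w => _) = (fun w => \sum_a \sum_b
    u b * (Y i a w * (Y j a w * Y k b w)))); last first.
  apply/funext => w; rewrite /ip /lin big_distrlr/=.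
  by do 2 (apply: eq_bigr => ? _); ring.
apply: degenerate_sum => a _; apply: degenerate_sum => b _; apply: degenerateZ.
apply: degenerate3 => //; try exact: centred1_Y.
by apply: (@LmomM _ _ _ _ 2); [exact: Y4|exact: YY4].
Qed.

Lemma Ex_iplin2 u i j k : i != j ->
  Ex (fun w => (ip i j w * lin u k w) ^+ 2) <= C ^+ 2 * nsq u * sg ^+ 3.
Proof.
move=> ij; have h : 0 <= C * nsq u * sg by rewrite !mulr_ge0 ?nsq_ge0.
have h2 : 0 <= C * sg ^+ 2 by rewrite mulr_ge0 ?sqr_ge0.
have := Ex_prod_le h2 h (Lmom_ip i j) (Lmom_lin u k) (Ex_ip4' ij) (Ex_lin4 u k).
by move/le_trans; apply; rewrite le_eqVlt; apply/orP; left; apply/eqP; ring.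
Qed.

Lemma degenerate_ipip i j k l : uniq [:: i; j; k; l] ->
  degenerate [set i; j; k; l]%SET (fun w => ip i j w * ip k l w).
Proof.
move=> ijk; rewrite (_ : (fun w => _) = (fun w => \sum_a \sum_b
    (Y i a w * (Y j a w * (Y k b w * Y l b w))))); last first.
  apply/funext => w; rewrite /ip big_distrlr/=.
  by do 2 (apply: eq_bigr => ? _); ring.
apply: degenerate_sum => a _; apply: degenerate_sum => b _.
apply: degenerate4 => //; try exact: centred1_Y.
have := @LmomM _ _ _ P 2 _ _ (YY4 i a j a) (YY4 k b l b).
by congr (Lmom _ _); apply/funext => w; ring.
Qed.

Lemma Ex_ipE i j : i != j -> Ex (fun w => ip i j w ^+ 2) = ipm (S i) (S j).
Proof.
move=> ij; rewrite (_ : (fun w => _) = (fun w => \sum_a \sum_b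
    (Y i a w * Y i b w) * (Y j a w * Y j b w))); last first.
  apply/funext => w; rewrite /ip expr2 big_distrlr/=.
  by do 2 (apply: eq_bigr => ? _); ring.
have l4 a b : Lmom 1 (fun w => (Y i a w * Y i b w) * (Y j a w * Y j b w)).
  by apply: (@LmomM _ _ _ _ 1); exact: YY2.
rewrite Ex_sum => [|a _]; last by apply: Lmom_sum => b _.
apply: eq_bigr => a _; rewrite Ex_sum => [|b _//]; apply: eq_bigr => b _.
have m2 k : mfun [set k]%SET (fun w => Y k a w * Y k b w).
  by apply: mfunM; exact: Ymf.
rewrite (Ex_mfunM rvX indX _ (m2 i) (m2 j) (YY1 _ _ _ _) (YY1 _ _ _ _) (l4 _ _)).
  by rewrite !YS.
by apply/fintype.subsetP => k; rewrite !inE => /eqP ->; rewrite eq_sym.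
Qed.

End MomentBounds.

(** * Decomposition of the covariance statistic *)

Section Decomposition.
Context {d : measure_display} {T : measurableType d} {R : realType} {p n : nat}.
Variables (Y : 'I_n -> 'I_p -> T -> R) (S : 'I_n -> 'M[R]_p).
Variables (g : 'I_n -> R) (dl : 'I_p -> R).
Hypothesis Ssym : forall i a b, S i a b = S i b a.
Local Notation Bm := (Bm Y S).
Local Notation ip := (ip Y).
Local Notation lin := (lin Y).
Local Notation bf := (bf Y).
Local Notation qfc := (qfc Y S).
Local Notation BB := (BB Y S).
Local Notation YBu := (YBu Y S).
Local Notation YBY := (YBY Y S).

(** Observation i has mean mu_1 + g_i delta, so this is the coefficient of delta in the mean of x_i
    - x_j, and [zz] below is x_i - x_j itself. *)
Definition gg i j : R := g i - g j.

Definition zz i j a w : R := Y i a w - Y j a w + gg i j * dl a.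

(** The mean of [Amx i j] for distinct indices. Its second summand is the trace that a mean change
    leaves in the covariance statistic. *)
Definition Kmx i j : 'M[R]_p := \matrix_(a, b) (S i a b + gg i j ^+ 2 / 2 * (dl a * dl b)).

Definition mulKd (K : 'M[R]_p) a : R := \sum_b K a b * dl b.

(* Half of [(x_i - x_j) (x_i - x_j)^T], up to symmetrisation in [(i, j)]. *)
Definition Amx i j a b w : R := Y i a w * Y i b w - Y i a w * Y j b w +
  gg i j * (Y i a w * dl b + dl a * Y i b w) + gg i j ^+ 2 / 2 * (dl a * dl b).

Definition ipf (F G : 'I_p -> 'I_p -> R) : R := \sum_a \sum_b F a b * G a b.

Definition LL i j k l w : R := ipf (fun a b => Amx i j a b w) (fun a b => Amx k l a b w).

Lemma ipfD F G H : ipf (fun a b => F a b + G a b) H = ipf F H + ipf G H.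
Proof.
rewrite /ipf -big_split/=; apply: eq_bigr => a _; rewrite -big_split/=.
by apply: eq_bigr => b _; ring.
Qed.

Lemma ipfZ (c : R) F H : ipf (fun a b => c * F a b) H = c * ipf F H.
Proof.
rewrite /ipf mulr_sumr; apply: eq_bigr => a _; rewrite mulr_sumr.
by apply: eq_bigr => b _; ring.
Qed.

Lemma ipfC F G : ipf F G = ipf G F.
Proof. by do 2 (apply: eq_bigr => ? _); rewrite mulrC. Qed.

Lemma ipf_tr F G : ipf (fun a b => F b a) (fun a b => G b a) = ipf F G.
Proof. by rewrite /ipf exchange_big. Qed.

(** The square is the Frobenius product of the rank-one matrices of x_i - x_j and x_k - x_l, each of
    which is [Amx] plus [Amx] with exchanged indices. *)
Lemma zz_sqr i j k l w : (\sum_a zz i j a w * zz k l a w) ^+ 2 =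
  LL i j k l w + LL j i k l w + LL i j l k w + LL j i l k w.
Proof.
rewrite expr2 big_distrlr/= /LL /ipf -!big_split/=; apply: eq_bigr => a _.
rewrite -!big_split/=; apply: eq_bigr => b _.
by rewrite /zz /Amx /gg; field.
Qed.

(** [Kmx], [Fmx] and [Cmx] are the parts of degree zero, one and two of [Amx] in Hoeffding's
    decomposition. Since [Amx] is not symmetric in its indices, the part of degree one involves the
    first of them only. *)
Definition Fmx i j a b w : R := Bm i a b w + gg i j * (Y i a w * dl b + dl a * Y i b w).
Definition Cmx i j a b w : R := Y i a w * Y j b w.

Lemma AmxE i j a b w : Amx i j a b w = Kmx i j a b + Fmx i j a b w - Cmx i j a b w.
Proof. by rewrite /Amx /Fmx /Cmx mxE /Bm; ring. Qed.

Lemma ipf_expand (K F C K' F' C' : 'I_p -> 'I_p -> R) :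
  ipf (fun a b => K a b + F a b - C a b) (fun a b => K' a b + F' a b - C' a b) =
  ipf K K' + ipf F K' + ipf F' K + ipf F F' - ipf C K' - ipf C' K
  - ipf F C' - ipf F' C + ipf C C'.
Proof.
rewrite /ipf; do 2 rewrite -?big_split/= -?sumrB -?big_split/=.
apply: eq_bigr => a _.
do 2 rewrite -?big_split/= -?sumrB -?big_split/=.
apply: eq_bigr => b _; ring.
Qed.

Lemma ipf_mx (K L : 'M[R]_p) : ipf (fun a b => K a b) (fun a b => L a b) = ipm K L.
Proof. by []. Qed.

Lemma Kmx_sym i j a b : Kmx i j a b = Kmx i j b a.
Proof. by rewrite !mxE Ssym [dl a * _]mulrC. Qed.

Lemma Bm_sym i a b w : Bm i a b w = Bm i b a w.
Proof. by rewrite /Bm Ssym [Y i a w * _]mulrC. Qed.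

Lemma ipf_sym2 (F : 'I_p -> 'I_p -> R) (u v : 'I_p -> R) :
  (forall a b, F a b = F b a) ->
  ipf F (fun a b => u a * v b + v a * u b) = 2 * \sum_a \sum_b F a b * (u a * v b).
Proof.
move=> Fs; rewrite ipfC ipfD mulr_natl mulr2n; congr (_ + _).
  by rewrite ipfC.
rewrite ipfC -ipf_tr; do 2 (apply: eq_bigr => ? _).
by rewrite Fs [v _ * _]mulrC.
Qed.

Lemma ipf_FK i j (K : 'M[R]_p) w : (forall a b, K a b = K b a) ->
  ipf (fun a b => Fmx i j a b w) (fun a b => K a b) =
  qfc K i w + 2 * gg i j * lin (mulKd K) i w.
Proof.
move=> Ks; rewrite /Fmx ipfD ipfZ; congr (_ + _).
  by rewrite ipfC.
rewrite [2 * _]mulrC -mulrA; congr (_ * _).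
rewrite ipfC ipf_sym2//; congr (_ * _).
rewrite /lin /mulKd; apply: eq_bigr => a _.
by rewrite mulr_suml; apply: eq_bigr => b _; ring.
Qed.

Lemma ipf_CK i j (K : 'M[R]_p) w :
  ipf (fun a b => Cmx i j a b w) (fun a b => K a b) = bf K i j w.
Proof. by rewrite ipfC. Qed.

Lemma ipf_FC i j k l w :
  ipf (fun a b => Fmx i j a b w) (fun a b => Cmx k l a b w) =
  YBY i k l w + gg i j * (ip i k w * lin dl l w + ip i l w * lin dl k w).
Proof.
rewrite /Fmx ipfD ipfZ; congr (_ + _ * _).
rewrite ipfD; congr (_ + _).
  rewrite /ip /lin big_distrlr/=.
  by do 2 (apply: eq_bigr => ? _); rewrite /Cmx; ring.
rewrite /ip /lin big_distrlr/= exchange_big/=.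
by do 2 (apply: eq_bigr => ? _); rewrite /Cmx; ring.
Qed.

Lemma ipf_CC i j k l w :
  ipf (fun a b => Cmx i j a b w) (fun a b => Cmx k l a b w) = ip i k w * ip j l w.
Proof.
rewrite /ip big_distrlr/=.
by do 2 (apply: eq_bigr => ? _); rewrite /Cmx; ring.
Qed.

(** The part of the product of two matrices [Fmx] that is due to the mean change; it vanishes with
    [dl]. *)
Definition order2 i j k l w : R :=
  2 * gg k l * YBu dl k i w + 2 * gg i j * YBu dl i k w
  + 2 * gg i j * gg k l * (nsq dl * ip i k w + lin dl i w * lin dl k w).

Lemma ipf_FF i j k l w :
  ipf (fun a b => Fmx i j a b w) (fun a b => Fmx k l a b w) =
  BB i k w + order2 i j k l w.
Proof.
have E i' k' : ipf (fun a b => Bm i' a b w)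
    (fun a b => Y k' a w * dl b + dl a * Y k' b w) = 2 * YBu dl k' i' w.
  rewrite ipf_sym2 => [|a b]; last exact: Bm_sym.
  congr (_ * _); do 2 (apply: eq_bigr => ? _).
  by rewrite mulrCA; ring.
rewrite /Fmx ipfD ipfZ ipfC ipfD ipfZ.
rewrite [ipf _ (fun a b => Bm i a b w)]ipfC [X in gg k l * X]ipfC E.
rewrite [ipf (fun a b => Y i a w * _ + _) _]ipfC ipfD ipfZ E.
have -> : ipf (fun a b => Y k a w * dl b + dl a * Y k b w)
    (fun a b => Y i a w * dl b + dl a * Y i b w) =
    2 * (nsq dl * ip i k w + lin dl i w * lin dl k w).
  rewrite ipf_sym2 => [|a b]; last by ring.
  congr (_ * _); rewrite /nsq /ip /lin mulrC big_distrlr/=.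
  rewrite big_distrlr/= -big_split/=; apply: eq_bigr => a _.
  by rewrite -big_split/=; apply: eq_bigr => b _; ring.
rewrite /order2 /BB -[ipf _ _]/(\sum_a \sum_b Bm i a b w * Bm k a b w).
ring.
Qed.

Definition order3 i j k l w : R :=
  YBY i k l w + gg i j * (ip i k w * lin dl l w + ip i l w * lin dl k w).

(** Sorted by the set of indices involved: for four distinct indices each random term is a
    degenerate kernel on its own indices, which reduces its variance to counting. *)
Lemma LL_expand i j k l w : LL i j k l w =
  ipm (Kmx i j) (Kmx k l)
  + (qfc (Kmx k l) i w + 2 * gg i j * lin (mulKd (Kmx k l)) i w)
  + (qfc (Kmx i j) k w + 2 * gg k l * lin (mulKd (Kmx i j)) k w)
  + (BB i k w + order2 i j k l w)
  - bf (Kmx k l) i j w - bf (Kmx i j) k l w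
  - order3 i j k l w - order3 k l i j w + ip i k w * ip j l w.
Proof.
have E i' j' w' : (fun a b => Amx i' j' a b w') =
    (fun a b => Kmx i' j' a b + Fmx i' j' a b w' - Cmx i' j' a b w').
  by apply/funext => a; apply/funext => b; exact: AmxE.
rewrite /LL !E ipf_expand ipf_mx !ipf_CK ipf_FF ipf_CC.
by rewrite !ipf_FC !ipf_FK//; move=> a b; exact: Kmx_sym.
Qed.

End Decomposition.

(** * Counting index tuples with a given support *)

Section Counting.
Context {n : nat}.
Local Notation pair2 := ('I_n * 'I_n)%type.

Definition uniq4 (x y : pair2) := uniq [:: x.1; x.2; y.1; y.2].

Lemma uniq4E x y : uniq4 x y = [&& x.1 != x.2, x.1 != y.1, x.1 != y.2,
  x.2 != y.1, x.2 != y.2 & y.1 != y.2].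
Proof. by rewrite /uniq4 /= !inE !negb_or !andbT -!andbA. Qed.

Lemma uniq4C x y : uniq4 x y = uniq4 y x.
Proof.
rewrite !uniq4E ![y.1 == x.1]eq_sym ![y.1 == x.2]eq_sym ![y.2 == x.1]eq_sym.
rewrite ![y.2 == x.2]eq_sym.
by do 6 case: (_ == _).
Qed.

Lemma card_set2 (i j : 'I_n) : (#|[set i; j]%SET| <= 2)%N.
Proof. by rewrite cards2; case: (_ != _). Qed.

Lemma card_set3 (i j k : 'I_n) : (#|[set i; j; k]%SET| <= 3)%N.
Proof.
rewrite (leq_trans (leq_card_setU _ _))// cards1 addn1 ltnS.
exact: card_set2.
Qed.

Lemma card_set4 (i j k l : 'I_n) : (#|[set i; j; k; l]%SET| <= 4)%N.
Proof.
rewrite (leq_trans (leq_card_setU _ _))// cards1 addn1 ltnS.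
exact: card_set3.
Qed.

Context {R : realType}.

Lemma sum_norm_card (I : finType) (A : pred I) (w : I -> R) (W : R) (N : nat) :
  0 <= W -> (forall t, A t -> `|w t| <= W) -> (#|A| <= N)%N ->
  \sum_(t | A t) `|w t| <= W * N%:R.
Proof.
move=> W0 hW hN; apply: (@le_trans _ _ (\sum_(t | A t) W)); first exact: ler_sum.
rewrite big_const iter_addr_0 -(mulr_natr W) ler_wpM2l// ler_nat.
exact: leq_trans hN.
Qed.

Lemma card_not_uniq4 (x : pair2) : x.1 != x.2 ->
  (#|[pred y | ~~ uniq4 x y]| <= 5 * n)%N.
Proof.
move=> x12.
pose B := (finset.setX [set x.1; x.2]%SET [set: 'I_n]%SET :|: finset.setX [set: 'I_n]%SET [set x.1; x.2]%SET :|: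
  [set (i, i) | i : 'I_n])%SET.
apply: (@leq_trans #|B|).
  apply: subset_leq_card; apply/fintype.subsetP => -[k l].
  have -> : ((k, l) \in [pred y | ~~ uniq4 x y]) = ~~ uniq4 x (k, l) by [].
  rewrite uniq4E /= x12 /= !negb_and !negbK => H.
  rewrite !inE /=; move: H; rewrite ![x.1 == _]eq_sym ![x.2 == _]eq_sym andbT.
  case/or4P => [->|->|->|/orP[->|/eqP <-]]; rewrite ?orbT//.
  by apply/orP; right; apply/imsetP; exists k.
apply: (leq_trans (leq_card_setU _ _)).
rewrite mulSn addnC leq_add//; first by rewrite (leq_trans (leq_imset_card _ _))// card_ord.
apply: (leq_trans (leq_card_setU _ _)).
rewrite !cardsX cardsT card_ord cards2 x12 mulnC -mulnDr addnn -mul2n.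
by rewrite mulnC.
Qed.

End Counting.

Section FourfoldForms.
Context {d : measure_display} {T : measurableType d} {R : realType}.
Variable P : probability T R.
Context {p n : nat}.
Variable X : 'I_n -> T -> 'cV[R]_p.
Local Notation pair2 := ('I_n * 'I_n)%type.
Local Notation degenerate := (degenerate P X).

(** [N] bounds the number of quadruples with a given support: it is of order n^2, n or 1 when the
    kernel involves two, three or all four of the indices. *)
Lemma fourfold_var (s : pair2 * pair2 -> {set 'I_n}) (h : pair2 * pair2 -> T -> R)
    (w : pair2 * pair2 -> R) (K W : R) (N : nat) :
  0 <= K -> 0 <= W ->
  (forall t, uniq4 t.1 t.2 -> degenerate (s t) (h t)) ->
  (forall t, uniq4 t.1 t.2 -> Ex P (fun x => h t x ^+ 2) <= K) ->
  (forall t, uniq4 t.1 t.2 -> `|w t| <= W) ->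
  (forall t, uniq4 t.1 t.2 ->
    (#|[pred t' | uniq4 t'.1 t'.2 && (s t' == s t)]| <= N)%N) ->
  Ex P (fun x => (\sum_(t | uniq4 t.1 t.2) w t * h t x) ^+ 2) <=
  K * (W * N%:R) * (W * (n ^ 4)%:R).
Proof.
move=> K0 W0 dh hK hw hN.
apply: (@degenerate_var _ _ _ P _ _ X _ (fun t => uniq4 t.1 t.2) s) => //.
- by rewrite mulr_ge0.
- move=> t ut; apply: sum_norm_card => //; last exact: hN.
  by move=> t' /andP[ut' _]; exact: hw.
- apply: sum_norm_card => //; rewrite (leq_trans (max_card _))//.
  by rewrite !card_prod !card_ord -[4%N]/(2 * 2)%N expnM -!mulnn.
Qed.

Lemma card_support2 (S : {set 'I_n}) : (#|S| <= 2)%N ->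
  (#|[pred t : pair2 * pair2 | uniq4 t.1 t.2 && ([set t.1.1; t.2.1]%SET == S)]|
   <= 4 * n ^ 2)%N.
Proof.
move=> S2; apply: (@leq_trans #|finset.setX (finset.setX S [set: 'I_n]%SET) (finset.setX S [set: 'I_n]%SET)|).
  apply: subset_leq_card; apply/fintype.subsetP => -[[i j] [k l]].
  rewrite !inE /= => /andP[_ /eqP <-]; by rewrite !inE !eqxx orbT.
rewrite !cardsX cardsT card_ord mulnACA -mulnn leq_mul//.
by rewrite -[4%N]/(2 * 2)%N leq_mul.
Qed.

Lemma card_support3 (S : {set 'I_n}) : (#|S| <= 3)%N ->
  (#|[pred t : pair2 * pair2 | uniq4 t.1 t.2 && ([set t.1.1; t.2.1; t.2.2]%SET == S)]|
   <= 27 * n)%N.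
Proof.
move=> S3; apply: (@leq_trans #|finset.setX (finset.setX S [set: 'I_n]%SET) (finset.setX S S)|).
  apply: subset_leq_card; apply/fintype.subsetP => -[[i j] [k l]].
  rewrite !inE /= => /andP[_ /eqP <-]; by rewrite !inE !eqxx ?orbT.
rewrite !cardsX cardsT card_ord -mulnA [(n * _)%N]mulnC mulnA leq_mul//.
by rewrite -[27%N]/(3 * (3 * 3))%N !leq_mul.
Qed.

Lemma card_support4 (S : {set 'I_n}) : (#|S| <= 4)%N ->
  (#|[pred t : pair2 * pair2 | uniq4 t.1 t.2 &&
     ([set t.1.1; t.2.1; t.1.2; t.2.2]%SET == S)]| <= 256)%N.
Proof.
move=> S4; apply: (@leq_trans #|finset.setX (finset.setX S S) (finset.setX S S)|).
  apply: subset_leq_card; apply/fintype.subsetP => -[[i j] [k l]].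
  rewrite !inE /= => /andP[_ /eqP <-]; by rewrite !inE !eqxx ?orbT.
by rewrite !cardsX -[256%N]/((4 * 4) * (4 * 4))%N !leq_mul.
Qed.

End FourfoldForms.

(** * Uniform noise bound for the covariance statistic *)

Section CovarianceNoise.
Context {d : measure_display} {T : measurableType d} {R : realType}.
Variable P : probability T R.
Context {p n : nat}.
Variable X : 'I_n -> T -> 'cV[R]_p.
Hypothesis rvX : forall i, random_vector (X i).
Hypothesis indX : forall (J : {set 'I_n}) (B : 'I_n -> set 'cV[R]_p),
  (forall i, borel_cV (B i)) ->
  P (\bigcap_(i in [set i | i \in J]) (X i @^-1` B i)) =
  (\prod_(i in J) P (X i @^-1` B i))%E.
Variable Y : 'I_n -> 'I_p -> T -> R.
Variable S : 'I_n -> 'M[R]_p.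
Hypothesis Ymf : forall i a, mfun X [set i]%SET (Y i a).
Hypothesis Y8 : forall i a, Lmom P 8 (Y i a).
Hypothesis Y0 : forall i a, Ex P (Y i a) = 0.
Hypothesis YS : forall i a b, Ex P (fun w => Y i a w * Y i b w) = S i a b.
Variables (sg C : R).
Hypothesis sg0 : 0 < sg.
Hypothesis C1 : 1 <= C.
Hypothesis Ssg : forall i, fro (S i) <= sg ^+ 2.
Hypothesis fourthC : forall i,
  \sum_a \sum_b \sum_c \sum_e fourth P Y i a b c e ^+ 2 <= C * sg ^+ 4.
Variables (g : 'I_n -> R) (dl : 'I_p -> R) (S1 Dl : 'M[R]_p).
Hypothesis g01 : forall i, 0 <= g i <= 1.
Hypothesis Sg : forall i, S i = S1 - g i *: Dl.
Hypothesis dlsg : nsq dl <= sg.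
Variables (r : seq nat) (L : R).
Hypothesis L1 : 1 <= L.
Hypothesis n0 : (0 < n)%N.
Hypothesis rL : forall m, m \in r -> [/\ (4 <= m)%N, (4 <= n - m)%N,
  n%:R <= L * m%:R & n%:R <= L * (n - m)%:R].
Hypothesis rn : (size r <= n)%N.

Local Notation pair2 := ('I_n * 'I_n)%type.
Local Notation degenerate := (degenerate P X).
Local Notation Ex := (Ex P).
Local Notation Lmom := (Lmom P).
Local Notation e := (nsq dl).
Local Notation f := (fro Dl).
Local Notation nR := (n%:R : R).
Local Notation ip := (ip Y).
Local Notation lin := (lin Y).
Local Notation bf := (bf Y).
Local Notation qfc := (qfc Y S).
Local Notation BB := (BB Y S).
Local Notation YBu := (YBu Y S).
Local Notation YBY := (YBY Y S).
Local Notation gd := (gg g).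
Local Notation Kmx := (Kmx S g dl).
Local Notation ord2 := (order2 Y S g dl).
Local Notation ord3 := (order3 Y S g dl).
Local Notation LL := (LL Y g dl).
Local Notation Kd := (mulKd dl).

Let nR0 : 0 < nR. Proof. by rewrite ltr0n. Qed.
Let L0 : 0 < L. Proof. exact: lt_le_trans L1. Qed.
Let C0 : 0 < C. Proof. exact: lt_le_trans C1. Qed.
Let e0 : 0 <= e. Proof. exact: nsq_ge0. Qed.
Let f0 : 0 <= f. Proof. exact: fro_ge0. Qed.

Definition scale m : R := m%:R * (n - m)%:R / n%:R.

(* [omega m (i, j)] is the weight of [A_ij] in the difference of the two
   sample covariance matrices. *)
Definition omega m (x : pair2) : R :=
  if (x.1 < m)%N then (if (x.2 < m)%N then (m%:R ^+ 2)^-1 else 0)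
  else (if (x.2 < m)%N then 0 else - ((n - m)%:R ^+ 2)^-1).

Lemma r_facts m : m \in r -> [/\ 0 < m%:R :> R, 0 < (n - m)%:R :> R,
  (m <= n)%N, m%:R <= nR & (n - m)%:R <= nR].
Proof.
move=> /rL[m4 nm4 _ _]; have mn : (m <= n)%N.
  by rewrite leqNgt; apply/negP => h; move: nm4; rewrite (eqP (ltnW h : (n - m == 0)%N)).
rewrite !ltr0n !ler_nat leq_subr mn; split=> //; first exact: leq_trans m4.
exact: leq_trans nm4.
Qed.

Lemma invL_le m : m \in r ->
  (m%:R)^-1 <= L / nR /\ ((n - m)%:R)^-1 <= L / nR.
Proof.
move=> mr; have [_ _ h1 h2] := rL mr; have [p1 p2 _ _ _] := r_facts mr.
by split; rewrite ler_pdivlMr// mulrC ler_pdivrMr.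
Qed.

Lemma omega_le m x : m \in r -> `|omega m x| <= L ^+ 2 / nR ^+ 2.
Proof.
move=> mr; have [h1 h2] := invL_le mr; have [p1 p2 _ _ _] := r_facts mr.
have k1 : (m%:R ^+ 2)^-1 <= L ^+ 2 / nR ^+ 2.
  by rewrite -exprVn -expr_div_n lerXn2r// nnegrE ?invr_ge0 ?divr_ge0// ltW.
have k2 : ((n - m)%:R ^+ 2)^-1 <= L ^+ 2 / nR ^+ 2.
  by rewrite -exprVn -expr_div_n lerXn2r// nnegrE ?invr_ge0 ?divr_ge0// ltW.
have k0 : 0 <= L ^+ 2 / nR ^+ 2 by rewrite divr_ge0// sqr_ge0.
rewrite /omega; case: ifP => _; case: ifP => _; rewrite ?normr0// ?normrN.
  by rewrite ger0_norm// invr_ge0 sqr_ge0.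
by rewrite ger0_norm// invr_ge0 sqr_ge0.
Qed.

Lemma scale_le m : m \in r -> `|scale m| <= nR.
Proof.
move=> mr; have [p1 p2 _ h1 h2] := r_facts mr.
rewrite /scale ger0_norm; last by rewrite divr_ge0// mulr_ge0// ltW.
by rewrite ler_pdivrMr// ler_pM// ltW.
Qed.

(** The square of [scale] contributes n^2 and the union over the candidates another n. *)
Lemma tailbound_scaled (Z : nat -> T -> R) (v : R) : 0 <= v ->
  (forall m, m \in r -> Lmom 2 (Z m)) ->
  (forall m, m \in r -> Ex (fun w => Z m w ^+ 2) <= v) ->
  tailbound P r (fun m w => scale m * Z m w) (nR ^+ 3 * v).
Proof.
move=> v0 LZ hZ.
have := tailboundZ (ltW nR0) scale_le (tailbound_union LZ hZ).
move/tailbound_le; apply; rewrite exprSr -!mulrA ler_wpM2l ?sqr_ge0//.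
by rewrite ler_pM2l// ler_wpM2r// ler_nat.
Qed.

Lemma Ex_sqZ (c v : R) h : Lmom 2 h -> Ex (fun w => h w ^+ 2) <= v -> `|c| <= 1 ->
  Ex (fun w => (c * h w) ^+ 2) <= v.
Proof.
move=> Lh hv c1; rewrite (_ : (fun w => _) = (fun w => c ^+ 2 * h w ^+ 2)); last first.
  by apply/funext => w; rewrite exprMn.
rewrite ExZ; last exact: L2_int2.
apply: le_trans hv; rewrite ler_piMl//; first by apply: Ex_ge0 => w; exact: sqr_ge0.
by rewrite -real_normK ?num_real// expr_le1.
Qed.

Lemma gg_le i j : `|gd i j| <= 1.
Proof.
by have /andP[? ?] := g01 i; have /andP[? ?] := g01 j; rewrite /gg ler_norml; lra.
Qed.

Lemma degenerate_order2 i j k l : i != k ->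
  degenerate [set i; k]%SET (ord2 i j k l).
Proof.
move=> ik; have ki : k != i by rewrite eq_sym.
apply: degenerateD; first apply: degenerateD.
- by rewrite finset.setUC; apply: degenerateZ; apply: (degenerate_YBu rvX indX Ymf).
- by apply: degenerateZ; apply: (degenerate_YBu rvX indX Ymf).
- apply: degenerateZ; apply: degenerateD.
    by apply: degenerateZ; apply: (degenerate_ip rvX indX Ymf).
  exact: (degenerate_lin2 rvX indX Ymf).
Qed.

Lemma degenerate_order3 i j k l : uniq [:: i; k; l] ->
  degenerate [set i; k; l]%SET (ord3 i j k l).
Proof.
move=> ikl; have ilk : uniq [:: i; l; k].
  by move: ikl; rewrite /= !inE !negb_or !andbT [l == k]eq_sym => /andP[/andP[-> ->] ->].
apply: degenerateD; first exact: (degenerate_YBY rvX indX Ymf).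
apply: degenerateZ; apply: degenerateD; first exact: (degenerate_iplin rvX indX Ymf).
rewrite (_ : [set i; k; l]%SET = [set i; l; k]%SET); last first.
  by apply/finset.setP => x; rewrite !inE -!orbA [(x == k) || _]orbC.
exact: (degenerate_iplin rvX indX Ymf).
Qed.

Lemma Ex_order2 i j k l : i != k ->
  Ex (fun w => ord2 i j k l w ^+ 2) <= 160 * C ^+ 2 * (e * sg ^+ 3).
Proof.
move=> ik; have ki : k != i by rewrite eq_sym.
have [LB1 _ _] := degenerate_YBu rvX indX Ymf Y8 Y0 YS dl ik.
have [LB2 _ _] := degenerate_YBu rvX indX Ymf Y8 Y0 YS dl ki.
have [Lip _ _] := degenerate_ip rvX indX Ymf Y8 Y0 ik.
have [Lll _ _] := degenerate_lin2 rvX indX Ymf Y8 Y0 dl ik.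
have C0' := ltW C0; have sg0' := ltW sg0.
have C2 : 0 <= C ^+ 2 by rewrite sqr_ge0.
have CC : C <= C ^+ 2 by rewrite expr2 ler_peMl.
have es : 0 <= e * sg ^+ 3 by rewrite mulr_ge0 ?exprn_ge0.
have B i' k' (ik' : i' != k') (c : R) : `|c| <= 1 ->
    Ex (fun w => (c * YBu dl i' k' w) ^+ 2) <= 4 * C ^+ 2 * (e * sg ^+ 3).
  have [Lb _ _] := degenerate_YBu rvX indX Ymf Y8 Y0 YS dl ik'.
  apply: Ex_sqZ => //; rewrite mulrA.
  exact: (Ex_YBu2 rvX indX Ymf Y8 Y0 sg0 C1 Ssg fourthC dl ik').
have L2Z (c : R) h : Lmom 2 h -> Lmom 2 (fun w => c * h w) by exact: LmomZ.
have E12 := Ex_sqrD (L2Z _ _ LB2) (L2Z _ _ LB1) (B _ _ ki _ (gg_le k l)) (B _ _ ik _ (gg_le i j)).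
have e2 : e ^+ 2 <= e * sg by rewrite expr2 ler_wpM2l.
have Ea : Ex (fun w => (e * ip i k w) ^+ 2) <= C ^+ 2 * (e * sg ^+ 3).
  rewrite (_ : (fun w => _) = (fun w => e ^+ 2 * ip i k w ^+ 2)); last first.
    by apply/funext => w; rewrite exprMn.
  rewrite ExZ; last exact: L2_int2.
  apply: (le_trans (ler_wpM2l (sqr_ge0 _)
    (Ex_ip2 rvX indX Ymf Y8 sg0 C1 fourthC ik))).
  apply: (@le_trans _ _ (e * sg * (C ^+ 2 * sg ^+ 2))).
    by rewrite ler_pM ?sqr_ge0 ?mulr_ge0 ?sqr_ge0// ler_wpM2r ?sqr_ge0.
  by rewrite le_eqVlt; apply/orP; left; apply/eqP; ring.
have Eb : Ex (fun w => (lin dl i w * lin dl k w) ^+ 2) <= C ^+ 2 * (e * sg ^+ 3).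
  apply: (le_trans (Ex_lin22 Y8 sg0 C1 fourthC dl i k)).
  rewrite !exprMn -mulrA ler_wpM2l//.
  rewrite (_ : e * sg ^+ 3 = e * sg * sg ^+ 2); last by ring.
  by rewrite ler_wpM2r ?sqr_ge0.
have L3 := LmomD (L2Z e _ Lip) Lll.
have E3 := Ex_sqrD (L2Z _ _ Lip) Lll Ea Eb.
have g1 : `|gd i j * gd k l| <= 1 by rewrite normrM mulr_ile1// gg_le.
have E4 := Ex_sqZ L3 E3 g1.
have L12 := LmomD (L2Z (gd k l) _ LB2) (L2Z (gd i j) _ LB1).
have E5 := Ex_sqrD L12 (L2Z _ _ L3) E12 E4.
rewrite (_ : (fun w => _) = (fun w => 2 ^+ 2 * (gd k l * YBu dl k i w + gd i j * YBu dl i k w +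
   gd i j * gd k l * (e * ip i k w + lin dl i w * lin dl k w)) ^+ 2)); last first.
  by apply/funext => w; rewrite /order2; ring.
rewrite ExZ; last by apply: L2_int2; apply: LmomD => //; exact: L2Z.
apply: (le_trans (ler_wpM2l _ E5)) => //.
have : 0 <= C ^+ 2 * (e * sg ^+ 3) by rewrite mulr_ge0.
lra.
Qed.

Lemma Ex_order3 i j k l : uniq [:: i; k; l] ->
  Ex (fun w => ord3 i j k l w ^+ 2) <= 16 * C ^+ 2 * sg ^+ 4.
Proof.
move=> ikl; have ilk : uniq [:: i; l; k].
  by move: ikl; rewrite /= !inE !negb_or !andbT [l == k]eq_sym => /andP[/andP[-> ->] ->].
have [LB _ _] := degenerate_YBY rvX indX Ymf Y8 Y0 YS ikl.
have [La _ _] := degenerate_iplin rvX indX Ymf Y8 Y0 dl ikl.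
have [Lb _ _] := degenerate_iplin rvX indX Ymf Y8 Y0 dl ilk.
have C0' := ltW C0; have sg0' := ltW sg0.
have C2 : 0 <= C ^+ 2 by rewrite sqr_ge0.
have B i' j' k' : i' != j' -> Ex (fun w => (ip i' j' w * lin dl k' w) ^+ 2) <= C ^+ 2 * sg ^+ 4.
  move=> ij'; apply: (le_trans (Ex_iplin2 rvX indX Ymf Y8 sg0 C1 fourthC dl k' ij')).
  by rewrite -mulrA ler_wpM2l// [leRHS]exprS ler_wpM2r ?exprn_ge0.
have /andP[ik il] : (i != k) && (i != l).
  by move: ikl; rewrite /= !inE negb_or => /andP[].
have E1 := Ex_sqrD La Lb (B _ _ _ ik) (B _ _ _ il).
have E2 := Ex_sqZ (LmomD La Lb) E1 (gg_le i j).
have E3 := Ex_sqrD LB (LmomZ (gd i j) (LmomD La Lb))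
  (Ex_YBY2 rvX indX Ymf Y8 Y0 YS sg0 C1 Ssg fourthC ikl) E2.
apply: (le_trans E3).
have : 0 <= C ^+ 2 * sg ^+ 4 by rewrite mulr_ge0 ?exprn_ge0.
lra.
Qed.

Lemma omega2_le m t : m \in r -> `|omega m t.1 * omega m t.2| <= L ^+ 4 / nR ^+ 4.
Proof.
move=> mr; rewrite normrM.
rewrite (_ : L ^+ 4 / _ = (L ^+ 2 / nR ^+ 2) * (L ^+ 2 / nR ^+ 2)).
  by apply: ler_pM => //; exact: omega_le.
by field; rewrite gt_eqF.
Qed.

(** A multiplicity of order n^2 costs a factor n here, while multiplicities of order n are free. *)
Lemma tailbound_fourfold (h : pair2 * pair2 -> T -> R) (s : pair2 * pair2 -> {set 'I_n})
    (K : R) (N q : nat) : 0 <= K ->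
  (forall t, uniq4 t.1 t.2 -> degenerate (s t) (h t)) ->
  (forall t, uniq4 t.1 t.2 -> Ex (fun x => h t x ^+ 2) <= K) ->
  (forall t, uniq4 t.1 t.2 ->
    (#|[pred t' | uniq4 t'.1 t'.2 && (s t' == s t)]| <= N * q)%N) ->
  tailbound P r (fun m w => scale m * \sum_(t | uniq4 t.1 t.2)
    omega m t.1 * omega m t.2 * h t w)
    (N%:R * L ^+ 8 * (K * (q%:R / nR))).
Proof.
move=> K0 dh hK hN.
have W0 : 0 <= L ^+ 4 / nR ^+ 4 by rewrite divr_ge0 ?exprn_ge0 ?(ltW L0).
have v0 : 0 <= K * (L ^+ 4 / nR ^+ 4 * (N * q)%:R) * (L ^+ 4 / nR ^+ 4 * (n ^ 4)%:R).
  by apply: mulr_ge0; [apply: mulr_ge0 => //|]; apply: mulr_ge0.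
apply: tailbound_le (tailbound_scaled v0 _ _) _.
- move=> m mr; apply: Lmom_sum => t ut; apply: LmomZ.
  by have [] := dh _ ut.
- move=> m mr; apply: (fourfold_var K0 W0 dh hK) => // t _.
  exact: omega2_le.
- rewrite natrX natrM le_eqVlt; apply/orP; left; apply/eqP; field.
  by rewrite gt_eqF.
Qed.

(** The factor n lost by the union bound is affordable, because the kernel carries the factor [e]
    and n e is part of the signal. *)
Lemma tailbound_order2 : tailbound P r (fun m w => scale m *
    \sum_(t | uniq4 t.1 t.2) omega m t.1 * omega m t.2 * ord2 t.1.1 t.1.2 t.2.1 t.2.2 w)
  (640 * L ^+ 8 * C ^+ 2 * (nR * (e * sg ^+ 3))).
Proof.
have es : 0 <= e * sg ^+ 3 by rewrite mulr_ge0 ?exprn_ge0// ltW.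
apply: tailbound_le (@tailbound_fourfold _ (fun t => [set t.1.1; t.2.1]%SET)
  (160 * C ^+ 2 * (e * sg ^+ 3)) 4 (n ^ 2) _ _ _ _) _.
- by rewrite mulr_ge0// mulr_ge0// sqr_ge0.
- by move=> t; rewrite uniq4E => /and5P[_ h _ _ _]; exact: degenerate_order2.
- by move=> t; rewrite uniq4E => /and5P[_ h _ _ _]; exact: Ex_order2.
- by move=> t _; apply: card_support2; exact: card_set2.
- rewrite natrX le_eqVlt; apply/orP; left; apply/eqP; field.
  by rewrite gt_eqF.
Qed.

Let uniq3 (t : pair2 * pair2) : uniq4 t.1 t.2 -> uniq [:: t.1.1; t.2.1; t.2.2].
Proof.
by rewrite uniq4E /= !inE negb_or !andbT => /and5P[_ -> -> _ /andP[_ ->]].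
Qed.

Lemma tailbound_order3 : tailbound P r (fun m w => scale m *
    \sum_(t | uniq4 t.1 t.2) omega m t.1 * omega m t.2 * ord3 t.1.1 t.1.2 t.2.1 t.2.2 w)
  (432 * L ^+ 8 * C ^+ 2 * sg ^+ 4).
Proof.
apply: tailbound_le (@tailbound_fourfold _ (fun t => [set t.1.1; t.2.1; t.2.2]%SET)
  (16 * C ^+ 2 * sg ^+ 4) 27 n _ _ _ _) _.
- by rewrite mulr_ge0 ?exprn_ge0 ?(ltW sg0)// mulr_ge0// sqr_ge0.
- by move=> t /uniq3 h; exact: degenerate_order3.
- by move=> t /uniq3 h; exact: Ex_order3.
- by move=> t _; apply: card_support3; exact: card_set3.
- rewrite le_eqVlt; apply/orP; left; apply/eqP; field.
  by rewrite gt_eqF.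
Qed.

Lemma tailbound_order4 : tailbound P r (fun m w => scale m *
    \sum_(t | uniq4 t.1 t.2) omega m t.1 * omega m t.2 *
      (ip t.1.1 t.2.1 w * ip t.1.2 t.2.2 w))
  (256 * L ^+ 8 * C ^+ 2 * sg ^+ 4).
Proof.
apply: tailbound_le (@tailbound_fourfold _
  (fun t => [set t.1.1; t.2.1; t.1.2; t.2.2]%SET)
  (C ^+ 2 * sg ^+ 4) 256 n _ _ _ _) _.
- by rewrite mulr_ge0 ?exprn_ge0 ?(ltW sg0)// ltW.
- move=> t; rewrite uniq4E => /and5P[h1 h2 h3 h4 /andP[h5 h6]].
  apply: (degenerate_ipip rvX indX Ymf Y8 Y0).
  by rewrite /= !inE !negb_or h1 h2 h3 h5 h6 eq_sym h4.
- move=> t; rewrite uniq4E => /and5P[h1 h2 h3 h4 /andP[h5 h6]].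
  exact: (Ex_ip22 rvX indX Ymf Y8 sg0 C1 fourthC).
(* The multiplicity is bounded; it is rounded up to 256 n, which already gives a bound of order
   one. *)
- move=> t _; apply: (@leq_trans 256); last by rewrite leq_pmulr.
  by apply: card_support4; exact: card_set4.
- rewrite le_eqVlt; apply/orP; left; apply/eqP; field.
  by rewrite gt_eqF.
Qed.

Lemma sum_uniq4 (F : pair2 -> pair2 -> R) :
  \sum_(t | uniq4 t.1 t.2) F t.1 t.2 = \sum_(x | x.1 != x.2) \sum_(y | uniq4 x y) F x y.
Proof.
rewrite -[LHS](pair_big_dep xpredT uniq4 F)/= [RHS]big_mkcond; apply: eq_bigr => x _.
case: ifPn => // /negbNE/eqP x12; rewrite big_pred0// => y.
by rewrite uniq4E x12 eqxx.
Qed.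

Lemma ipm_sum (I : finType) (A : pred I) (c : I -> R) (K : I -> 'M[R]_p) H :
  ipm (\sum_(y | A y) c y *: K y) H = \sum_(y | A y) c y * ipm (K y) H.
Proof.
rewrite /ipm.
transitivity (\sum_a \sum_b \sum_(y | A y) c y * (K y a b * H a b)).
  apply: eq_bigr => a _; apply: eq_bigr => b _; rewrite summxE mulr_suml.
  by apply: eq_bigr => y _; rewrite mxE mulrA.
under eq_bigr do rewrite exchange_big/=.
rewrite exchange_big/=; apply: eq_bigr => y _; rewrite mulr_sumr.
by apply: eq_bigr => a _; rewrite mulr_sumr.
Qed.

(** The triangle inequality for the Frobenius norm: pairing the sum with itself bounds the squared
    norm by W B times the norm, which is then divided out. *)
Lemma fro_sum (I : finType) (A : pred I) (c : I -> R) (K : I -> 'M[R]_p) (B W : R) :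
  (forall y, A y -> fro (K y) <= B ^+ 2) -> 0 <= B ->
  \sum_(y | A y) `|c y| <= W ->
  fro (\sum_(y | A y) c y *: K y) <= (W * B) ^+ 2.
Proof.
move=> hK B0 hW; set M := \sum_(y | A y) _.
have W0 : 0 <= W by apply: le_trans hW; apply: sumr_ge0.
have E : fro M = \sum_(y | A y) c y * ipm (K y) M.
  by rewrite -ipm_sum /fro /ipm; do 2 (apply: eq_bigr => ? _); rewrite expr2.
have b0 := fro_ge0 M.
have sq : fro M = Num.sqrt (fro M) ^+ 2 by rewrite sqr_sqrtr.
have h : fro M <= W * B * Num.sqrt (fro M).
  rewrite {1}E; apply: (@le_trans _ _ (\sum_(y | A y) `|c y| * (B * Num.sqrt (fro M)))).
    apply: ler_sum => y Ay; apply: (le_trans (ler_norm _)).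
    rewrite normrM ler_wpM2l//; apply: ipm_le => //; first exact: hK.
    by rewrite -sq.
  by rewrite -mulr_suml -mulrA ler_wpM2r// mulr_ge0.
set q := Num.sqrt (fro M) in sq h *; rewrite sq in h *.
have q0 : 0 <= q by exact: sqrtr_ge0.
have [qz|qp] := eqVneq q 0.
  by rewrite qz expr0n/= sqr_ge0.
have qgt : 0 < q by rewrite lt_def qp.
rewrite lerXn2r ?nnegrE ?mulr_ge0//.
by rewrite -(ler_pM2r qgt) -expr2.
Qed.

Definition Kx (x : pair2) := Kmx x.1 x.2.
(** The mean difference of the two weighted sample covariance matrices, coinciding indices included.
    [Dmx m x] omits the pairs that collide with [x] and thus depends on [x]; the omitted part [Rmx]
    is smaller by a factor of order 1/n. *)
Definition Dfull m : 'M[R]_p := \sum_y omega m y *: Kx y.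
Definition Dmx m x : 'M[R]_p := \sum_(y | uniq4 x y) omega m y *: Kx y.
Definition Rmx m x : 'M[R]_p := \sum_(y | ~~ uniq4 x y) omega m y *: Kx y.

Lemma DmxE m x : Dmx m x = Dfull m - Rmx m x.
Proof. by rewrite /Dfull (bigID (uniq4 x))/= addrK. Qed.

Lemma fro_dl : fro (\matrix_(a, b) (dl a * dl b)) = e ^+ 2.
Proof.
rewrite expr2 /nsq /fro big_distrlr/=; apply: eq_bigr => a _.
by apply: eq_bigr => b _; rewrite mxE exprMn.
Qed.

Lemma fro_le2 (K K' : 'M[R]_p) : fro (K + K') <= 2 * (fro K + fro K').
Proof.
rewrite /fro -big_split/= mulr_sumr; apply: ler_sum => a _.
rewrite -big_split/= mulr_sumr; apply: ler_sum => b _; rewrite mxE.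
by have := sqr_ge0 (K a b - K' a b); nra.
Qed.

Lemma froZ c (K : 'M[R]_p) : fro (c *: K) = c ^+ 2 * fro K.
Proof.
rewrite /fro mulr_sumr; apply: eq_bigr => a _; rewrite mulr_sumr.
by apply: eq_bigr => b _; rewrite mxE exprMn.
Qed.

Lemma fro_Kx x : fro (Kx x) <= (2 * sg) ^+ 2.
Proof.
have -> : Kx x = S x.1 + (gd x.1 x.2 ^+ 2 / 2) *: (\matrix_(a, b) (dl a * dl b)).
  by apply/matrixP => a b; rewrite !mxE.
apply: (le_trans (fro_le2 _ _)); rewrite froZ fro_dl.
have g1 : gd x.1 x.2 ^+ 2 <= 1.
  by rewrite -real_normK ?num_real// expr_le1// gg_le.
have g2 : (gd x.1 x.2 ^+ 2 / 2) ^+ 2 <= 1.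
  by rewrite expr_le1// ?divr_ge0 ?sqr_ge0//; lra.
have e2 : e ^+ 2 <= sg ^+ 2 by rewrite lerXn2r ?nnegrE ?(ltW sg0).
have : (gd x.1 x.2 ^+ 2 / 2) ^+ 2 * e ^+ 2 <= sg ^+ 2.
  by apply: le_trans e2; rewrite ler_piMl ?sqr_ge0.
have := Ssg x.1; rewrite exprMn; lra.
Qed.

Lemma sum_omega_not_uniq4 m x : m \in r -> x.1 != x.2 ->
  \sum_(y | ~~ uniq4 x y) `|omega m y| <= 5 * L ^+ 2 / nR.
Proof.
move=> mr x12; have W0 : 0 <= L ^+ 2 / nR ^+ 2 by rewrite divr_ge0// sqr_ge0.
apply: le_trans (sum_norm_card W0 _ (card_not_uniq4 x12)) _.
  by move=> y _; exact: omega_le.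
rewrite natrM le_eqVlt; apply/orP; left; apply/eqP; field.
by rewrite gt_eqF.
Qed.

Lemma fro_Rmx m x : m \in r -> x.1 != x.2 ->
  fro (Rmx m x) <= 100 * L ^+ 4 * sg ^+ 2 / nR ^+ 2.
Proof.
move=> mr x12; have s0 : 0 <= 2 * sg by rewrite mulr_ge0// ltW.
apply: le_trans (fro_sum _ s0 (sum_omega_not_uniq4 mr x12)) _.
  by move=> y _; exact: fro_Kx.
rewrite le_eqVlt; apply/orP; left; apply/eqP; field.
by rewrite gt_eqF.
Qed.

Lemma sum_block_lt m : (m <= n)%N -> \sum_(i < n | (i < m)%N) 1 = m%:R :> R.
Proof.
move=> mn; rewrite -(big_ord_widen n (fun=> 1) mn) sumr_const card_ord.
by [].
Qed.

Lemma sum_block_ge m : (m <= n)%N -> \sum_(i < n | ~~ (i < m)%N) 1 = (n - m)%:R :> R.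
Proof.
move=> mn; have := sum_block_lt mn.
have : \sum_(i < n) 1 = n%:R :> R by rewrite sumr_const card_ord.
rewrite (bigID (fun i : 'I_n => (i < m)%N))/= natrB//.
by move=> <- <-; rewrite addrAC subrr add0r.
Qed.

Lemma sum_omega_row m i (F : 'I_n -> R) : \sum_j omega m (i, j) * F j =
  if (i < m)%N then (m%:R ^+ 2)^-1 * \sum_(j < n | (j < m)%N) F j
  else - ((n - m)%:R ^+ 2)^-1 * \sum_(j < n | ~~ (j < m)%N) F j.
Proof.
rewrite /omega /=; case: ifP => _.
  rewrite mulr_sumr [RHS]big_mkcond; apply: eq_bigr => j _.
  by case: ifP; rewrite ?mul0r.
rewrite mulr_sumr [RHS]big_mkcond; apply: eq_bigr => j _.
by case: ifP; rewrite ?mul0r.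
Qed.

Lemma sum_omega_pair m (F : 'I_n -> 'I_n -> R) : \sum_x omega m x * F x.1 x.2 =
  (m%:R ^+ 2)^-1 * (\sum_(i < n | (i < m)%N) \sum_(j < n | (j < m)%N) F i j)
  - ((n - m)%:R ^+ 2)^-1 *
    (\sum_(i < n | ~~ (i < m)%N) \sum_(j < n | ~~ (j < m)%N) F i j).
Proof.
rewrite -(pair_bigA _ (fun i j => omega m (i, j) * F i j))/=.
under eq_bigr do rewrite sum_omega_row.
rewrite (bigID (fun i : 'I_n => (i < m)%N))/= !mulr_sumr -sumrN; congr (_ + _).
  by apply: eq_bigr => i ->.
by apply: eq_bigr => i /negbTE ->; rewrite mulNr.
Qed.

Lemma sum_omega_norm m : m \in r -> \sum_x `|omega m x| = 2.
Proof.
move=> mr; have [p1 p2 mn _ _] := r_facts mr.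
have E x : `|omega m x| = omega m x * (if (x.1 < m)%N then 1 else - 1).
  rewrite /omega; case: ifP => _; case: ifP => _; rewrite ?normr0 ?mul0r//.
    by rewrite mulr1 ger0_norm// invr_ge0 sqr_ge0.
  by rewrite mulrN1 normrN opprK ger0_norm// invr_ge0 sqr_ge0.
under eq_bigr do rewrite E.
rewrite (sum_omega_pair m (fun i _ => if (i < m)%N then 1 else - 1)).
have Sl (c : R) : \sum_(i < n | (i < m)%N) c = c * m%:R.
  by rewrite -[in LHS](mulr1 c) -mulr_sumr sum_block_lt.
have Sg' (c : R) : \sum_(i < n | ~~ (i < m)%N) c = c * (n - m)%:R.
  by rewrite -[in LHS](mulr1 c) -mulr_sumr sum_block_ge.
rewrite (eq_bigr (fun=> m%:R)) => [|i ->]; last exact: sum_block_lt.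
rewrite [X in _ - _ * X](eq_bigr (fun=> - (n - m)%:R)) => [|i /negbTE ->]; last first.
  by rewrite Sg' mulN1r.
by rewrite Sl Sg'; field; rewrite !gt_eqF.
Qed.

Lemma sum_omega_fst m (x : pair2) : m \in r ->
  \sum_(x' : pair2 | x'.1 == x.1) `|omega m x'| <= L ^+ 2 / nR.
Proof.
move=> mr; have W0 : 0 <= L ^+ 2 / nR ^+ 2 by rewrite divr_ge0// sqr_ge0.
apply: le_trans (@sum_norm_card _ _ _ _ _ n W0 _ _) _.
- by move=> y _; exact: omega_le.
- apply: (@leq_trans #|finset.setX [set x.1]%SET [set: 'I_n]%SET|).
    apply: subset_leq_card; apply/fintype.subsetP => -[i j].
    by move=> h; rewrite !inE andbT; exact: h.
  by rewrite cardsX cards1 cardsT card_ord mul1n.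
- rewrite le_eqVlt; apply/orP; left; apply/eqP; field.
  by rewrite gt_eqF.
Qed.

Lemma sum_omega_support m (x : pair2) : m \in r -> x.1 != x.2 ->
  \sum_(x' : pair2 | (x'.1 != x'.2) && ([set x'.1; x'.2]%SET == [set x.1; x.2]%SET))
    `|omega m x'| <= 4 * L ^+ 2 / nR ^+ 2.
Proof.
move=> mr x12; have W0 : 0 <= L ^+ 2 / nR ^+ 2 by rewrite divr_ge0// sqr_ge0.
apply: le_trans (@sum_norm_card _ _ _ _ _ 4 W0 _ _) _.
- by move=> y _; exact: omega_le.
- apply: (@leq_trans #|finset.setX [set x.1; x.2]%SET [set x.1; x.2]%SET|).
    apply: subset_leq_card; apply/fintype.subsetP => -[i j].
    rewrite unfold_in /= => /andP[_ /eqP E].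
    by have := set21 i j; have := set22 i j; rewrite E !inE => -> ->.
  by rewrite cardsX cards2 x12.
- rewrite le_eqVlt; apply/orP; left; apply/eqP; field.
  by rewrite gt_eqF.
Qed.

(** Average values of [g] on the two sides of [m]. As S_i = S1 - g_i Dl, their difference [dcoef1]
    is the coefficient of [Dl] in [Dfull], and [dcoef2] is that of delta delta^T. *)
Definition gbar1 m : R := m%:R^-1 * \sum_(i < n | (i < m)%N) g i.
Definition gbar2 m : R := (n - m)%:R^-1 * \sum_(i < n | ~~ (i < m)%N) g i.
Definition dcoef1 m : R := gbar2 m - gbar1 m.
Definition dcoef2 m : R := \sum_x omega m x * (gd x.1 x.2 ^+ 2 / 2).
Definition dlmx : 'M[R]_p := \matrix_(a, b) (dl a * dl b).

Lemma gbar_le m : m \in r -> 0 <= gbar1 m <= 1 /\ 0 <= gbar2 m <= 1.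
Proof.
move=> mr; have [p1 p2 mn _ _] := r_facts mr; split; apply/andP; split.
- rewrite mulr_ge0 ?invr_ge0 ?(ltW p1)//; apply: sumr_ge0 => i _.
  by have /andP[] := g01 i.
- rewrite /gbar1 mulrC ler_pdivrMr// mul1r -(sum_block_lt mn); apply: ler_sum => i _.
  by have /andP[] := g01 i.
- rewrite mulr_ge0 ?invr_ge0 ?(ltW p2)//; apply: sumr_ge0 => i _.
  by have /andP[] := g01 i.
- rewrite /gbar2 mulrC ler_pdivrMr// mul1r -(sum_block_ge mn); apply: ler_sum => i _.
  by have /andP[] := g01 i.
Qed.

Lemma dcoef1_le m : m \in r -> `|dcoef1 m| <= 1.
Proof.
by move=> /gbar_le[/andP[? ?] /andP[? ?]]; rewrite /dcoef1 ler_norml; lra.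
Qed.

Lemma dcoef2_le m : m \in r -> `|dcoef2 m| <= 1.
Proof.
move=> mr; apply: (le_trans (ler_norm_sum _ _ _)).
apply: (@le_trans _ _ (\sum_x `|omega m x| * (1 / 2))).
  apply: ler_sum => x _; rewrite normrM ler_wpM2l// ger0_norm ?divr_ge0 ?sqr_ge0//.
  by rewrite ler_pM2r// -real_normK ?num_real// expr_le1// gg_le.
by rewrite -mulr_suml sum_omega_norm//; lra.
Qed.

Lemma sum_omega0 m : m \in r -> \sum_x omega m x = 0.
Proof.
move=> mr; have [p1 p2 mn _ _] := r_facts mr.
have Sl (c : R) : \sum_(i < n | (i < m)%N) c = c * m%:R.
  by rewrite -[in LHS](mulr1 c) -mulr_sumr sum_block_lt.
have Sg' (c : R) : \sum_(i < n | ~~ (i < m)%N) c = c * (n - m)%:R.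
  by rewrite -[in LHS](mulr1 c) -mulr_sumr sum_block_ge.
under eq_bigr do rewrite -[omega m _]mulr1.
rewrite (sum_omega_pair m (fun _ _ => 1)).
under eq_bigr do rewrite Sl.
under [X in _ - _ * X]eq_bigr do rewrite Sg'.
by rewrite Sl Sg'; field; rewrite !gt_eqF.
Qed.

Lemma sum_omega_g m : m \in r -> \sum_x omega m x * g x.1 = - dcoef1 m.
Proof.
move=> mr; have [p1 p2 mn _ _] := r_facts mr.
have Sl (c : R) : \sum_(i < n | (i < m)%N) c = c * m%:R.
  by rewrite -[in LHS](mulr1 c) -mulr_sumr sum_block_lt.
have Sg' (c : R) : \sum_(i < n | ~~ (i < m)%N) c = c * (n - m)%:R.
  by rewrite -[in LHS](mulr1 c) -mulr_sumr sum_block_ge.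
rewrite (sum_omega_pair m (fun i _ => g i)).
under eq_bigr do rewrite Sl.
under [X in _ - _ * X]eq_bigr do rewrite Sg'.
by rewrite -!mulr_suml /dcoef1 /gbar1 /gbar2; field; rewrite !gt_eqF.
Qed.

Lemma DfullE m : m \in r -> Dfull m = dcoef1 m *: Dl + dcoef2 m *: dlmx.
Proof.
move=> mr; apply/matrixP => a b; rewrite summxE !mxE.
transitivity (\sum_x (omega m x * S1 a b - omega m x * g x.1 * Dl a b +
    omega m x * (gd x.1 x.2 ^+ 2 / 2) * (dl a * dl b))).
  by apply: eq_bigr => x _; rewrite !mxE Sg !mxE; ring.
rewrite big_split/= sumrB -!mulr_suml sum_omega0// sum_omega_g//.
by rewrite -/(dcoef2 m); ring.
Qed.

Lemma fro_Dfull m : m \in r -> fro (Dfull m) <= 2 * (f + e ^+ 2).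
Proof.
move=> mr; rewrite DfullE//; apply: (le_trans (fro_le2 _ _)); rewrite !froZ fro_dl.
rewrite ler_pM2l// lerD// ler_piMl ?sqr_ge0//.
  by rewrite -real_normK ?num_real// expr_le1// dcoef1_le.
by rewrite -real_normK ?num_real// expr_le1// dcoef2_le.
Qed.

(** The largest powers that occur. As [L] and [C] are at least 1, every contribution is a numeral
    times [Gc * Vsize]. *)
Definition Gc : R := L ^+ 8 * C ^+ 2.
(** The four summands stand for pure noise, noise against covariance change, noise against mean
    change, and the deterministic bias that the mean change leaves in the covariance statistic. *)
Definition Vsize : R := sg ^+ 4 + nR * f * sg ^+ 2 + nR * e * sg ^+ 3
  + nR ^+ 2 * e ^+ 2 * (f + e ^+ 2).

Let sg0' : 0 <= sg. Proof. exact: ltW. Qed.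
Let nR1 : 1 <= nR. Proof. by rewrite ler1n. Qed.
Let e2sg : e ^+ 2 <= e * sg. Proof. by rewrite expr2 ler_wpM2l. Qed.

Lemma Gc_ge k q : (k <= 8)%N -> (q <= 2)%N -> L ^+ k * C ^+ q <= Gc.
Proof.
by move=> k8 q2; rewrite /Gc ler_pM ?exprn_ge0 ?(ltW L0) ?(ltW C0)// ler_weXn2l.
Qed.

Lemma Vsize_ge : [/\ sg ^+ 4 <= Vsize, nR * f * sg ^+ 2 <= Vsize,
  nR * e * sg ^+ 3 <= Vsize, nR ^+ 2 * e ^+ 2 * (f + e ^+ 2) <= Vsize & 0 <= Vsize].
Proof.
have h1 : 0 <= sg ^+ 4 by exact: exprn_ge0.
have h2 : 0 <= nR * f * sg ^+ 2 by rewrite !mulr_ge0 ?sqr_ge0.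
have h3 : 0 <= nR * e * sg ^+ 3 by rewrite !mulr_ge0 ?exprn_ge0.
have h4 : 0 <= nR ^+ 2 * e ^+ 2 * (f + e ^+ 2).
  by rewrite mulr_ge0 ?mulr_ge0 ?addr_ge0 ?sqr_ge0.
by rewrite /Vsize; split; lra.
Qed.

Lemma Gc_bound k q (c : nat) (v : R) : (k <= 8)%N -> (q <= 2)%N -> 0 <= v ->
  v <= Vsize -> c%:R * (L ^+ k * C ^+ q) * v <= c%:R * (Gc * Vsize).
Proof.
move=> k8 q2 v0 vV; rewrite -mulrA ler_wpM2l ?ler0n//.
by rewrite ler_pM ?Gc_ge// mulr_ge0// exprn_ge0// ltW.
Qed.

Lemma bf_ipm K i j w : bf K i j w = ipm K (\matrix_(a, b) (Y i a w * Y j b w)).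
Proof. by do 2 (apply: eq_bigr => ? _); rewrite mxE. Qed.

Definition phi (x : pair2) K w : R :=
  qfc K x.1 w + 2 * gd x.1 x.2 * lin (Kd K) x.1 w.

Lemma qfc_ipm K i w : qfc K i w = ipm K (\matrix_(a, b) Bm Y S i a b w).
Proof. by do 2 (apply: eq_bigr => ? _); rewrite mxE. Qed.

Lemma lin_ipm K i w : lin (Kd K) i w = ipm K (\matrix_(a, b) (Y i a w * dl b)).
Proof.
apply: eq_bigr => a _; rewrite /mulKd mulr_suml; apply: eq_bigr => b _.
by rewrite mxE; ring.
Qed.

Lemma phi_ipm x K w : phi x K w = ipm K (\matrix_(a, b)
  (Bm Y S x.1 a b w + 2 * gd x.1 x.2 * (Y x.1 a w * dl b))).
Proof.
rewrite /phi qfc_ipm lin_ipm /ipm mulr_sumr -big_split/=; apply: eq_bigr => a _.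
by rewrite mulr_sumr -big_split/=; apply: eq_bigr => b _; rewrite !mxE; ring.
Qed.

(** Summation over the second pair replaces its mean matrix by the signed total [Dmx], in which the
    common covariance nearly cancels; without this cancellation the terms linear in [Kmx] would be
    too large. *)
Lemma sum_omega2_ipm m (H : pair2 -> 'M[R]_p) :
  \sum_(t | uniq4 t.1 t.2) omega m t.1 * omega m t.2 * ipm (Kx t.2) (H t.1) =
  \sum_(x | x.1 != x.2) omega m x * ipm (Dmx m x) (H x).
Proof.
rewrite (sum_uniq4 (fun x y => omega m x * omega m y * ipm (Kx y) (H x))).
apply: eq_bigr => x _; rewrite ipm_sum mulr_sumr.
by apply: eq_bigr => y _; rewrite mulrA.
Qed.

Lemma fro_Dmx m x : m \in r -> x.1 != x.2 ->
  fro (Dmx m x) <= 4 * (f + e ^+ 2) + 200 * L ^+ 4 * sg ^+ 2 / nR ^+ 2.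
Proof.
move=> mr x12; rewrite DmxE; apply: (le_trans (fro_le2 _ _)); rewrite froN.
have := fro_Dfull mr; have := fro_Rmx mr x12.
lra.
Qed.

(** A union bound suffices because a support of two indices occurs for at most four pairs. The three
    summands of 1664 = 32 + 32 + 1600 come from [Dl], from delta delta^T and from the collisions in
    [Rmx]. *)
Lemma tailbound_CK : tailbound P r (fun m w => scale m *
    \sum_(t | uniq4 t.1 t.2) omega m t.1 * omega m t.2 * bf (Kx t.2) t.1.1 t.1.2 w)
  (1664 * (Gc * Vsize)).
Proof.
have E m w : \sum_(t | uniq4 t.1 t.2) omega m t.1 * omega m t.2 *
    bf (Kx t.2) t.1.1 t.1.2 w =
    \sum_(x | x.1 != x.2) omega m x * bf (Dmx m x) x.1 x.2 w.
  under eq_bigr do rewrite bf_ipm.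
  rewrite (sum_omega2_ipm m (fun x => \matrix_(a, b) (Y x.1 a w * Y x.2 b w))).
  by apply: eq_bigr => x _; rewrite bf_ipm.
pose KD : R := (4 * (f + e ^+ 2) + 200 * L ^+ 4 * sg ^+ 2 / nR ^+ 2) * sg ^+ 2.
have KD0 : 0 <= KD.
  apply: mulr_ge0; last exact: sqr_ge0.
  apply: addr_ge0; first by apply: mulr_ge0 => //; apply: addr_ge0 => //; exact: sqr_ge0.
  apply: divr_ge0; last exact: sqr_ge0.
  apply: mulr_ge0; last exact: sqr_ge0.
  by apply: mulr_ge0 => //; apply: exprn_ge0; exact: ltW.
have B0 : 0 <= 4 * L ^+ 2 / nR ^+ 2 by rewrite divr_ge0 ?sqr_ge0// mulr_ge0 ?sqr_ge0.
apply: tailbound_le (tailbound_eq _ (@tailbound_scaled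
  (fun m w => \sum_(x : pair2 | x.1 != x.2) omega m x * bf (Dmx m x) x.1 x.2 w)
  (KD * (4 * L ^+ 2 / nR ^+ 2) * 2) _ _ _)) _.
- by move=> m w mr; rewrite E.
- by apply: mulr_ge0 => //; exact: mulr_ge0.
- move=> m mr; apply: Lmom_sum => x x12; apply: LmomZ.
  by have [] := degenerate_bf rvX indX Ymf Y8 Y0 (Dmx m x) x12.
- move=> m mr; apply: (@degenerate_var _ _ _ P _ _ X _ (fun x : pair2 => x.1 != x.2)
    (fun x => [set x.1; x.2]%SET) (fun x => bf (Dmx m x) x.1 x.2)) => //.
  + by move=> x x12; exact: (degenerate_bf rvX indX Ymf Y8 Y0).
  + move=> x x12; apply: (le_trans (Ex_bf2 rvX indX Ymf Y8 YS Ssg (Dmx m x) x12)).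
    by rewrite ler_wpM2r ?sqr_ge0// fro_Dmx.
  + by move=> x x12; exact: sum_omega_support.
  + rewrite -(sum_omega_norm mr) [leRHS](bigID (fun x : pair2 => x.1 != x.2))/= lerDl.
    exact: sumr_ge0.
- have -> : nR ^+ 3 * (KD * (4 * L ^+ 2 / nR ^+ 2) * 2) =
    32 * (L ^+ 2 * C ^+ 0) * (nR * f * sg ^+ 2) +
    32 * (L ^+ 2 * C ^+ 0) * (nR * e ^+ 2 * sg ^+ 2) +
    1600 * (L ^+ 6 * C ^+ 0) * (sg ^+ 4 / nR).
    by rewrite /KD; field; rewrite gt_eqF.
  have [V1 V2 V3 V4 V0] := Vsize_ge.
  rewrite (_ : 1664 * _ = 32 * (Gc * Vsize) + 32 * (Gc * Vsize) + 1600 * (Gc * Vsize)); last by ring.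
  apply: lerD; first apply: lerD.
  + by apply: Gc_bound; [by []|by []|rewrite !mulr_ge0 ?sqr_ge0|].
  + apply: Gc_bound; [by []|by []|by rewrite !mulr_ge0 ?sqr_ge0|].
    apply: le_trans V3; rewrite (_ : nR * e * sg ^+ 3 = nR * (e * sg) * sg ^+ 2); last by ring.
    by rewrite ler_wpM2r ?sqr_ge0// ler_wpM2l.
  + apply: Gc_bound; [by []|by []|by rewrite divr_ge0 ?exprn_ge0|].
    by apply: le_trans V1; rewrite ler_pdivrMr// ler_peMr// exprn_ge0.
Qed.

Lemma nsq_mulKd (K : 'M[R]_p) : nsq (Kd K) <= fro K * e.
Proof.
rewrite /nsq /fro mulr_suml; apply: ler_sum => a _; exact: sqr_sum_le.
Qed.

Lemma degenerate_phi x K : degenerate [set x.1]%SET (phi x K).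
Proof.
apply: degenerateD; first exact: (degenerate_qfc rvX indX Ymf Y8 YS).
by apply: degenerateZ; exact: (degenerate_lin rvX indX Ymf Y8 Y0).
Qed.

Lemma Ex_phi x K : Ex (fun w => phi x K w ^+ 2) <= 10 * C * fro K * sg ^+ 2.
Proof.
have [Lq _ _] := degenerate_qfc rvX indX Ymf Y8 YS K x.1.
have [Ll _ _] := degenerate_lin rvX indX Ymf Y8 Y0 (Kd K) x.1.
have Eq := Ex_qfc2 Y8 YS sg0 C1 fourthC K x.1.
have El := Ex_sqZ Ll (Ex_lin2 Y8 sg0 C1 fourthC (Kd K) x.1) (gg_le x.1 x.2).
have Ll2 := LmomZ (gd x.1 x.2) Ll.
have El2 : Ex (fun w => (2 * gd x.1 x.2 * lin (Kd K) x.1 w) ^+ 2) <=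
    4 * (C * nsq (Kd K) * sg).
  rewrite (_ : (fun w => _) = (fun w => 2 ^+ 2 * (gd x.1 x.2 * lin (Kd K) x.1 w) ^+ 2)); last first.
    by apply/funext => w; ring.
  rewrite ExZ; last exact: L2_int2.
  rewrite (_ : 2 ^+ 2 = 4); last by ring.
  by rewrite ler_pM2l.
apply: (le_trans (Ex_sqrD Lq (LmomZ _ Ll) Eq El2)).
have h : C * nsq (Kd K) * sg <= C * fro K * sg ^+ 2.
  rewrite [sg ^+ 2]expr2 -!mulrA ler_pM2l// [leRHS]mulrA ler_wpM2r//.
  by apply: (le_trans (nsq_mulKd K)); rewrite ler_wpM2l// fro_ge0.
lra.
Qed.

(** Each index is the first entry of about n pairs, so the multiplicity is larger than for [bf]; the
    factor 1/n^2 in [fro_Rmx] pays for it and for the union bound. *)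
Lemma tailbound_FK_remainder : tailbound P r (fun m w => scale m *
    \sum_(x | x.1 != x.2) omega m x * phi x (Rmx m x) w) (2000 * (Gc * Vsize)).
Proof.
pose KD : R := 10 * C * (100 * L ^+ 4 * sg ^+ 2 / nR ^+ 2) * sg ^+ 2.
have KD0 : 0 <= KD.
  have h : 0 <= 100 * L ^+ 4 * sg ^+ 2 / nR ^+ 2.
    by rewrite divr_ge0 ?sqr_ge0// mulr_ge0 ?sqr_ge0// mulr_ge0 ?exprn_ge0// ltW.
  by rewrite /KD mulr_ge0 ?sqr_ge0// mulr_ge0// mulr_ge0// ltW.
have B0 : 0 <= L ^+ 2 / nR by rewrite divr_ge0// sqr_ge0.
apply: tailbound_le (@tailbound_scaled _ (KD * (L ^+ 2 / nR) * 2) _ _ _) _.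
- by apply: mulr_ge0 => //; exact: mulr_ge0.
- move=> m mr; apply: Lmom_sum => x x12; apply: LmomZ.
  by have [] := degenerate_phi x (Rmx m x).
- move=> m mr; apply: (@degenerate_var _ _ _ P _ _ X _ (fun x : pair2 => x.1 != x.2)
    (fun x => [set x.1]%SET) (fun x => phi x (Rmx m x))) => //.
  + by move=> x _; exact: degenerate_phi.
  + move=> x x12; apply: (le_trans (Ex_phi x (Rmx m x))).
    rewrite /KD ler_wpM2r ?sqr_ge0// ler_wpM2l ?fro_Rmx//.
    by rewrite mulr_ge0// ltW.
  + move=> x x12; apply: le_trans (sum_omega_fst x mr).
    rewrite [leRHS](bigID (fun x' : pair2 => x'.1 != x'.2))/=.
    rewrite (eq_bigl (fun x' : pair2 => (x'.1 == x.1) && (x'.1 != x'.2))).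
      by rewrite lerDl; exact: sumr_ge0.
    move=> x'; rewrite andbC; congr (_ && _); apply/eqP/eqP => [|->//].
    by move/finset.setP/(_ x'.1); rewrite !inE eqxx => /esym/eqP.
  + rewrite -(sum_omega_norm mr) [leRHS](bigID (fun x : pair2 => x.1 != x.2))/= lerDl.
    exact: sumr_ge0.
- have -> : nR ^+ 3 * (KD * (L ^+ 2 / nR) * 2) = 2000 * (L ^+ 6 * C ^+ 1) * sg ^+ 4.
    by rewrite /KD; field; rewrite gt_eqF.
  by have [V1 _ _ _ _] := Vsize_ge; apply: Gc_bound; [by []|by []|exact: exprn_ge0|].
Qed.

Lemma tailbound_scaled_linear (xi : 'I_n -> T -> R) (K : R) (u u' : nat -> R) :
  (forall m, m \in r -> `|u m| <= 1 /\ `|u' m| <= 1) ->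
  (forall i, degenerate [set i]%SET (xi i)) ->
  (forall i, Ex (fun w => xi i w ^+ 2) <= K) ->
  tailbound P r (fun m w => scale m *
    \sum_(i < n) (if (i < m)%N then m%:R^-1 * u m else (n - m)%:R^-1 * u' m) * xi i w)
    (20 * L ^+ 2 * (nR * K)).
Proof.
move=> hu dxi hK.
have := @tailbound_linear_form _ _ _ P _ _ X rvX r xi K L
  (fun m => scale m * (m%:R^-1 * u m)) (fun m => scale m * ((n - m)%:R^-1 * u' m)).
move=> /(_ _ _ _ dxi hK) tb; apply: (tailbound_eq _ (tb _ _ _)).
- move=> m w mr; rewrite mulr_sumr; apply: eq_bigr => i _.
  by case: ifP => _; rewrite !mulrA.
- move=> m mr; have [_ _ mn _ _] := r_facts mr.
  by rewrite mem_iota /= add0n ltnS.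
- exact: ltW.
- move=> m mr; have [k1 k2] := invL_le mr; have [p1 p2 _ _ _] := r_facts mr.
  have [h1 h2] := hu _ mr; have hs := scale_le mr.
  have E : L = nR * (L / nR * 1) by field; rewrite gt_eqF.
  have q (c v : R) : 0 < c -> c^-1 <= L / nR -> `|v| <= 1 -> `|scale m * (c^-1 * v)| <= L.
    move=> c0 cl v1; rewrite normrM [X in _ * X]normrM [leRHS]E.
    rewrite [`|c^-1|]gtr0_norm ?invr_gt0//.
    apply: ler_pM => //; first by rewrite mulr_ge0// invr_ge0 ltW.
    by apply: ler_pM => //; rewrite invr_ge0 ltW.
  by split; exact: q.
Qed.

Definition rowsum m i := \sum_(j | i != j) omega m (i, j).

Lemma rowsumE m i : m \in r -> rowsum m i =
  if (i < m)%N then m%:R^-1 * (1 - m%:R^-1) else (n - m)%:R^-1 * - (1 - (n - m)%:R^-1).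
Proof.
move=> mr; have [p1 p2 mn _ _] := r_facts mr.
have E : rowsum m i = \sum_j omega m (i, j) * 1 - omega m (i, i).
  rewrite [in RHS](bigD1 i)//= mulr1 addrAC subrr add0r /rowsum.
  by apply: eq_big => j; [rewrite eq_sym|rewrite mulr1].
rewrite E sum_omega_row /omega /=; case: ifP => _.
  by rewrite sum_block_lt//; field; rewrite gt_eqF.
by rewrite sum_block_ge//; field; rewrite gt_eqF.
Qed.

Lemma rowgapE m i : m \in r -> \sum_j omega m (i, j) * gd i j =
  (if (i < m)%N then m%:R^-1 * 1 else (n - m)%:R^-1 * -1) * g i
  + (if (i < m)%N then m%:R^-1 * - gbar1 m else (n - m)%:R^-1 * gbar2 m).
Proof.
move=> mr; have [p1 p2 mn _ _] := r_facts mr.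
rewrite sum_omega_row /gg /gbar1 /gbar2; case: ifP => _; rewrite sumrB.
  rewrite -[X in X - _](mulr1 _) -[in X in X - _](mulr1 (g i)) -mulr_sumr.
  by rewrite sum_block_lt//; field; rewrite gt_eqF.
rewrite -[in X in X - _](mulr1 (g i)) -mulr_sumr.
by rewrite sum_block_ge//; field; rewrite gt_eqF.
Qed.

Lemma ipm_lin2 (a b : R) (K K' H : 'M[R]_p) :
  ipm (a *: K + b *: K') H = a * ipm K H + b * ipm K' H.
Proof.
rewrite /ipm !mulr_sumr -big_split/=; apply: eq_bigr => i _.
rewrite !mulr_sumr -big_split/=; apply: eq_bigr => j _; rewrite !mxE; ring.
Qed.

Lemma lin_dlmx i w : lin (Kd dlmx) i w = e * lin dl i w.
Proof.
rewrite /lin /nsq mulrC mulr_suml; apply: eq_bigr => a _.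
rewrite /mulKd mulr_suml mulr_sumr; apply: eq_bigr => b _; rewrite mxE; ring.
Qed.

(** [Dfull m] lies in the span of the fixed matrices [Dl] and [dlmx], so the dependence on [m] is
    confined to scalars. What remains are six linear block forms with summands free of [m]; a union
    bound on them would lose a factor n. *)
Lemma FK_main m w : m \in r ->
  \sum_(x | x.1 != x.2) omega m x * phi x (Dfull m) w =
  \sum_(i < n) (if (i < m)%N then m%:R^-1 * (dcoef1 m * (1 - m%:R^-1))
     else (n - m)%:R^-1 * (dcoef1 m * - (1 - (n - m)%:R^-1))) * qfc Dl i w
  + \sum_(i < n) (if (i < m)%N then m%:R^-1 * (dcoef2 m * (1 - m%:R^-1))
     else (n - m)%:R^-1 * (dcoef2 m * - (1 - (n - m)%:R^-1))) * qfc dlmx i w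
  + (\sum_(i < n) (if (i < m)%N then m%:R^-1 * dcoef1 m else (n - m)%:R^-1 * - dcoef1 m)
       * (2 * (g i * lin (Kd Dl) i w))
  + \sum_(i < n) (if (i < m)%N then m%:R^-1 * - (dcoef1 m * gbar1 m)
      else (n - m)%:R^-1 * (dcoef1 m * gbar2 m)) * (2 * lin (Kd Dl) i w))
  + (\sum_(i < n) (if (i < m)%N then m%:R^-1 * dcoef2 m else (n - m)%:R^-1 * - dcoef2 m)
       * (2 * (g i * (e * lin dl i w)))
  + \sum_(i < n) (if (i < m)%N then m%:R^-1 * - (dcoef2 m * gbar1 m)
      else (n - m)%:R^-1 * (dcoef2 m * gbar2 m)) * (2 * (e * lin dl i w))).
Proof.
move=> mr; rewrite -!big_split/=.
transitivity (\sum_(i < n) (rowsum m i * qfc (Dfull m) i w +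
    2 * (\sum_j omega m (i, j) * gd i j) * lin (Kd (Dfull m)) i w)).
  rewrite -(pair_big_dep xpredT (fun i j : 'I_n => i != j)
    (fun i j => omega m (i, j) * phi (i, j) (Dfull m) w))/=.
  apply: eq_bigr => i _; rewrite [in X in _ + X](bigD1 i)//=.
  have -> : gd i i = 0 by rewrite /gg subrr.
  rewrite mulr0 add0r /rowsum mulr_suml.
  rewrite -mulrA [X in _ + _ * X]mulr_suml [X in _ + X]mulr_sumr.
  rewrite [X in _ + X](eq_bigl (fun j => i != j)) => [|j]; last by rewrite eq_sym.
  by rewrite -big_split/=; apply: eq_bigr => j _; rewrite /phi/=; ring.
apply: eq_bigr => i _; rewrite rowsumE// rowgapE// DfullE//.
rewrite !qfc_ipm !lin_ipm !ipm_lin2 -!qfc_ipm -!lin_ipm lin_dlmx.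
by case: (i < m)%N; ring.
Qed.

Lemma tailbound_FK_main : tailbound P r (fun m w => scale m *
    \sum_(x | x.1 != x.2) omega m x * phi x (Dfull m) w) (23040 * (Gc * Vsize)).
Proof.
have inv01 m : m \in r ->
    `|1 - m%:R^-1 : R| <= 1 /\ `|1 - (n - m)%:R^-1 : R| <= 1.
  move=> mr; have [p1 p2 _ _ _] := r_facts mr.
  have h (k : nat) : 0 < k%:R :> R -> `|1 - k%:R^-1 : R| <= 1.
    move=> k0; have i0 : 0 < k%:R^-1 :> R by rewrite invr_gt0.
    have i1 : k%:R^-1 <= 1 :> R by rewrite invf_le1// ler1n -(ltr0n R).
    by rewrite ler_norml; lra.
  by split; exact: h.
have dd m (c c' : R) : `|c| <= 1 -> `|c'| <= 1 -> `|c * c'| <= 1.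
  by move=> h1 h2; rewrite normrM mulr_ile1.
have gb m : m \in r -> `|gbar1 m| <= 1 /\ `|gbar2 m| <= 1.
  by move=> /gbar_le[/andP[? ?] /andP[? ?]]; split; rewrite ger0_norm.
have [V1 V2 V3 V4 V0] := Vsize_ge.
have C0' := ltW C0.
have dq K i := degenerate_qfc rvX indX Ymf Y8 YS K i.
have dlin u i := degenerate_lin rvX indX Ymf Y8 Y0 u i.
have [Ll Lq] : (forall u i, Lmom 2 (lin u i)) /\ True.
  by split => // u i; have [] := dlin u i.
have E2 (c v : R) h : Lmom 2 h -> Ex (fun w => h w ^+ 2) <= v ->
    Ex (fun w => (c * h w) ^+ 2) <= c ^+ 2 * v.
  move=> Lh hv; rewrite (_ : (fun w => _) = (fun w => c ^+ 2 * h w ^+ 2)).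
    by rewrite ExZ ?ler_wpM2l ?sqr_ge0//; exact: L2_int2.
  by apply/funext => w; rewrite exprMn.
have g1 i : `|g i| <= 1 by have /andP[? ?] := g01 i; rewrite ger0_norm.
have fe : nsq (Kd Dl) * sg <= f * sg ^+ 2.
  rewrite expr2 mulrA ler_wpM2r//; apply: (le_trans (nsq_mulKd _)).
  by rewrite ler_wpM2l.
have Elin i : Ex (fun w => lin (Kd Dl) i w ^+ 2) <= C * (f * sg ^+ 2).
  apply: (le_trans (Ex_lin2 Y8 sg0 C1 fourthC _ _)).
  by rewrite -mulrA ler_wpM2l.
have Edl i : Ex (fun w => (e * lin dl i w) ^+ 2) <= C * (e * sg ^+ 3).
  apply: (le_trans (E2 e _ _ (Ll _ _) (Ex_lin2 Y8 sg0 C1 fourthC dl i))).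
  rewrite (_ : e ^+ 2 * _ = C * (e * (e ^+ 2 * sg))); last by ring.
  rewrite ler_wpM2l// ler_wpM2l// [sg ^+ 3]exprSr ler_wpM2r//.
  by rewrite lerXn2r ?nnegrE.
have Ele i : Lmom 2 (fun w => e * lin dl i w) by apply: LmomZ.
have G80 (v : R) : 0 <= v -> v <= Vsize -> 20 * L ^+ 2 * (2 ^+ 2 * (C * v)) <= 80 * (Gc * Vsize).
  move=> v0 vV; rewrite (_ : 20 * L ^+ 2 * _ = 80 * (L ^+ 2 * C ^+ 1) * v); last by ring.
  exact: Gc_bound.
have G1 (v : R) : 0 <= v -> v <= Vsize -> 20 * L ^+ 2 * (C * v) <= 80 * (Gc * Vsize).
  move=> v0 vV; apply: le_trans (G80 _ v0 vV).
  apply: ler_wpM2l; first by rewrite mulr_ge0 ?sqr_ge0.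
  by rewrite ler_peMl ?mulr_ge0// expr2 -natrM ler1n.
have U1 m : m \in r -> `|dcoef1 m * (1 - m%:R^-1)| <= 1 /\
    `|dcoef1 m * - (1 - (n - m)%:R^-1)| <= 1.
  by move=> mr; have [h1 h2] := inv01 m mr; rewrite mulrN normrN; split;
     apply: dd => //; exact: dcoef1_le.
have U2 m : m \in r -> `|dcoef2 m * (1 - m%:R^-1)| <= 1 /\
    `|dcoef2 m * - (1 - (n - m)%:R^-1)| <= 1.
  by move=> mr; have [h1 h2] := inv01 m mr; rewrite mulrN normrN; split;
     apply: dd => //; exact: dcoef2_le.
have U3 m : m \in r -> `|dcoef1 m| <= 1 /\ `|- dcoef1 m| <= 1.
  by move=> mr; rewrite normrN; split; exact: dcoef1_le.
have U5 m : m \in r -> `|dcoef2 m| <= 1 /\ `|- dcoef2 m| <= 1.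
  by move=> mr; rewrite normrN; split; exact: dcoef2_le.
have U4 m : m \in r -> `|- (dcoef1 m * gbar1 m)| <= 1 /\ `|dcoef1 m * gbar2 m| <= 1.
  by move=> mr; have [h1 h2] := gb m mr; rewrite normrN; split;
     apply: dd => //; exact: dcoef1_le.
have U6 m : m \in r -> `|- (dcoef2 m * gbar1 m)| <= 1 /\ `|dcoef2 m * gbar2 m| <= 1.
  by move=> mr; have [h1 h2] := gb m mr; rewrite normrN; split;
     apply: dd => //; exact: dcoef2_le.
have nfs : 0 <= nR * (f * sg ^+ 2) by rewrite !mulr_ge0 ?sqr_ge0.
have nes : 0 <= nR * (e * sg ^+ 3) by rewrite !mulr_ge0 ?exprn_ge0.
have nfsV : nR * (f * sg ^+ 2) <= Vsize by rewrite mulrA.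
have nesV : nR * (e * sg ^+ 3) <= Vsize by rewrite mulrA.
have Q1 : 20 * L ^+ 2 * (nR * (C * f * sg ^+ 2)) <= 80 * (Gc * Vsize).
  by apply: le_trans (G1 _ nfs nfsV); rewrite le_eqVlt; apply/orP; left; apply/eqP; ring.
have Q2 : 20 * L ^+ 2 * (nR * (C * fro dlmx * sg ^+ 2)) <= 80 * (Gc * Vsize).
  apply: le_trans (G1 _ nes nesV); rewrite fro_dl; apply: ler_wpM2l; first by rewrite mulr_ge0 ?sqr_ge0.
  rewrite (_ : nR * _ = C * (nR * (e ^+ 2 * sg ^+ 2))); last by ring.
  rewrite (_ : e * sg ^+ 3 = e * sg * sg ^+ 2); last by ring.
  by rewrite ler_wpM2l// ler_wpM2l// ler_wpM2r ?sqr_ge0.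
have Q3 : 20 * L ^+ 2 * (nR * (2 ^+ 2 * (C * (f * sg ^+ 2)))) <= 80 * (Gc * Vsize).
  by apply: le_trans (G80 _ nfs nfsV); rewrite le_eqVlt; apply/orP; left; apply/eqP; ring.
have Q5 : 20 * L ^+ 2 * (nR * (2 ^+ 2 * (C * (e * sg ^+ 3)))) <= 80 * (Gc * Vsize).
  by apply: le_trans (G80 _ nes nesV); rewrite le_eqVlt; apply/orP; left; apply/eqP; ring.
have gE i h v : Lmom 2 h -> Ex (fun w => h w ^+ 2) <= v ->
    Ex (fun w => (2 * (g i * h w)) ^+ 2) <= 2 ^+ 2 * v.
  by move=> Lh hv; apply: E2; [exact: LmomZ|exact: Ex_sqZ].
have T1 := tailbound_le (tailbound_scaled_linear U1 (dq _)
  (fun i => Ex_qfc2 Y8 YS sg0 C1 fourthC _ i)) Q1.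
have T2 := tailbound_le (tailbound_scaled_linear U2 (dq _)
  (fun i => Ex_qfc2 Y8 YS sg0 C1 fourthC _ i)) Q2.
have T3 := tailbound_le (tailbound_scaled_linear U3
  (fun i => degenerateZ 2 (degenerateZ (g i) (dlin (Kd Dl) i)))
  (fun i => gE i _ _ (Ll _ _) (Elin i))) Q3.
have T4 := tailbound_le (tailbound_scaled_linear U4
  (fun i => degenerateZ 2 (dlin (Kd Dl) i))
  (fun i => E2 2 _ _ (Ll _ _) (Elin i))) Q3.
have T5 := tailbound_le (tailbound_scaled_linear U5
  (fun i => degenerateZ 2 (degenerateZ (g i) (degenerateZ e (dlin dl i))))
  (fun i => gE i _ _ (Ele i) (Edl i))) Q5.
have T6 := tailbound_le (tailbound_scaled_linear U6
  (fun i => degenerateZ 2 (degenerateZ e (dlin dl i)))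
  (fun i => E2 2 _ _ (Ele i) (Edl i))) Q5.
(* Six bounds of 80 give 640, 640 and 640, then 5120, and 4 (5120 + 640) = 23040. *)
have TT := tailboundD (tailboundD (tailboundD T1 T2) (tailboundD T3 T4)) (tailboundD T5 T6).
apply: (tailbound_eq _ (tailbound_le TT _)).
  by move=> m w mr; rewrite FK_main// !mulrDr !addrA.
by rewrite le_eqVlt; apply/orP; left; apply/eqP; ring.
Qed.

Lemma sum_excl2 (i k : 'I_n) (G : 'I_n -> R) : i != k ->
  \sum_(j | (j != i) && (j != k)) G j = \sum_j G j - G i - G k.
Proof.
move=> ik; rewrite [in RHS](bigD1 i)//= [X in G i + X](bigD1 k)/=; last by rewrite eq_sym.
ring.
Qed.

Lemma sum_excl3 (i k l : 'I_n) (G : 'I_n -> R) : i != k -> l != i -> l != k ->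
  \sum_(j | [&& j != i, j != k & j != l]) G j = \sum_j G j - G i - G k - G l.
Proof.
move=> ik li lk; rewrite -sum_excl2// [in RHS](bigD1 l)/= ?li// addrAC subrr add0r.
by apply: eq_bigl => j; rewrite -andbA.
Qed.

(** The number of admissible second entries [j] and [l], times the weights. It depends only on the
    blocks of [i] and [k], so the sum becomes a quadratic block form in [BB]. *)
Definition BBcoef m (i k : 'I_n) : R :=
  if (i < m)%N then
    if (k < m)%N then (m%:R - 2) * (m%:R - 3) / m%:R ^+ 4
    else - ((m%:R - 1) * ((n - m)%:R - 1)) / (m%:R * (n - m)%:R) ^+ 2
  else if (k < m)%N then - ((m%:R - 1) * ((n - m)%:R - 1)) / (m%:R * (n - m)%:R) ^+ 2
    else ((n - m)%:R - 2) * ((n - m)%:R - 3) / (n - m)%:R ^+ 4.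

Lemma sum_uniq4_fst (F : pair2 -> pair2 -> R) (G : 'I_n -> 'I_n -> R) :
  \sum_(t | uniq4 t.1 t.2) F t.1 t.2 * G t.1.1 t.2.1 =
  \sum_i \sum_(k | k != i) (\sum_(j | (j != i) && (j != k))
    \sum_(l | [&& l != i, l != k & l != j]) F (i, j) (k, l)) * G i k.
Proof.
rewrite (sum_uniq4 (fun x y => F x y * G x.1 y.1)).
transitivity (\sum_(x : pair2 | x.1 != x.2)
    \sum_(y | uniq4 (x.1, x.2) y) F (x.1, x.2) y * G x.1 y.1).
  by apply: eq_bigr => -[].
rewrite -(pair_big_dep xpredT (fun i j : 'I_n => i != j)
  (fun i j => \sum_(y | uniq4 (i, j) y) F (i, j) y * G i y.1))/=.
apply: eq_bigr => i _.
under [RHS]eq_bigr do rewrite mulr_suml.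
rewrite (exchange_big_dep (fun j => i != j))/=; last first.
  by move=> k j _ /andP[]; rewrite eq_sym.
apply: eq_bigr => j ij.
rewrite (eq_bigl (fun y : pair2 => [&& y.1 != i & (j != i) && (j != y.1)] &&
    [&& y.2 != i, y.2 != y.1 & y.2 != j])); last first.
  move=> [k l]; rewrite uniq4E /= ij [k == i]eq_sym [j == i]eq_sym ij.
  rewrite [l == i]eq_sym [l == k]eq_sym [l == j]eq_sym.
  by do 5 case: (_ == _).
under [RHS]eq_bigr do rewrite mulr_suml.
rewrite (pair_big_dep (fun k => [&& k != i & (j != i) && (j != k)])
  (fun k l => [&& l != i, l != k & l != j]) (fun k l => F (i, j) (k, l) * G i k))/=.
by apply: eq_bigr => -[].
Qed.

Lemma BBcoefE m i k : m \in r -> i != k ->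
  \sum_(j | (j != i) && (j != k)) \sum_(l | [&& l != i, l != k & l != j])
    omega m (i, j) * omega m (k, l) = BBcoef m i k.
Proof.
move=> mr ik; have [p1 p2 mn _ _] := r_facts mr.
have N1 := gt_eqF p1; have N2 := gt_eqF p2.
have Sl (c : R) : \sum_(i < n | (i < m)%N) c = c * m%:R.
  by rewrite -[in LHS](mulr1 c) -mulr_sumr sum_block_lt.
have Sg' (c : R) : \sum_(i < n | ~~ (i < m)%N) c = c * (n - m)%:R.
  by rewrite -[in LHS](mulr1 c) -mulr_sumr sum_block_ge.
have rowk c : \sum_l c * omega m (k, l) = c * (if (k < m)%N then m%:R^-1 else - (n - m)%:R^-1).
  rewrite -mulr_sumr; congr (_ * _); under eq_bigr do rewrite -[omega m _]mulr1.
  rewrite sum_omega_row; case: ifP => _; first by rewrite Sl; field; rewrite N1.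
  by rewrite Sg'; field; rewrite N2.
transitivity (\sum_(j | (j != i) && (j != k)) omega m (i, j) *
   ((if (k < m)%N then m%:R^-1 else - (n - m)%:R^-1) - omega m (k, i) - omega m (k, k)
     - (if (i < m)%N == (k < m)%N then omega m (k, k) else 0))).
  apply: eq_bigr => j /andP[ji jk]; rewrite sum_excl3// rowk.
  rewrite /omega /=; case: (i < m)%N; case: (j < m)%N; case: (k < m)%N; rewrite /=; ring.
rewrite -mulr_suml sum_excl2//.
have -> : \sum_j omega m (i, j) = if (i < m)%N then m%:R^-1 else - (n - m)%:R^-1.
  under eq_bigr do rewrite -[omega m _]mulr1.
  rewrite sum_omega_row; case: ifP => _; first by rewrite Sl; field; rewrite N1.
  by rewrite Sg'; field; rewrite N2.
rewrite /BBcoef /omega /=.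
by case: (i < m)%N; case: (k < m)%N => /=; field; rewrite ?N1 ?N2.
Qed.

(** The scaled coefficients are of order 1/n and there are n^2 pairs, so the variance is of order
    one at each [m]; only the maximal inequality keeps it so uniformly. 6336 = 528 * 12, with 12
    from [Ex_BB2]. *)
Lemma tailbound_BB : tailbound P r (fun m w => scale m *
    \sum_(t | uniq4 t.1 t.2) omega m t.1 * omega m t.2 * BB t.1.1 t.2.1 w)
  (6336 * (Gc * Vsize)).
Proof.
have [V1 _ _ _ V0] := Vsize_ge.
have K0 : 0 <= 12 * C ^+ 2 * sg ^+ 4.
  by rewrite mulr_ge0 ?exprn_ge0// mulr_ge0// sqr_ge0.
have B0 : 0 <= L ^+ 2 / nR by rewrite divr_ge0// sqr_ge0.
have := @tailbound_quadratic_form _ _ _ P _ _ X rvX r BB (12 * C ^+ 2 * sg ^+ 4) (L ^+ 2 / nR)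
  (fun m => scale m * ((m%:R - 2) * (m%:R - 3) / m%:R ^+ 4))
  (fun m => scale m * (((n - m)%:R - 2) * ((n - m)%:R - 3) / (n - m)%:R ^+ 4))
  (fun m => scale m * (- ((m%:R - 1) * ((n - m)%:R - 1)) / (m%:R * (n - m)%:R) ^+ 2)).
move=> /(_ _ B0 K0 _ _ _) tb; apply: (tailbound_eq _ (tailbound_le (tb _ _ _ _) _)).
- move=> m w mr.
  rewrite (sum_uniq4_fst (fun x y => omega m x * omega m y) (fun i k => BB i k w)).
  rewrite mulr_sumr; apply: eq_bigr => i _; rewrite mulr_sumr; apply: eq_bigr => k ki.
  rewrite BBcoefE// 1?eq_sym// mulrA; congr (_ * _).
  by rewrite /BBcoef; case: ifP => _; case: ifP.
- move=> m mr; have [_ _ mn _ _] := r_facts mr.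
  by rewrite mem_iota /= add0n ltnS.
- move=> m mr; have [k1 k2] := invL_le mr; have [p1 p2 _ _ _] := r_facts mr.
  have [m4 nm4 _ _] := rL mr; have hs := scale_le mr.
  have q4 (k : nat) : (4 <= k)%N -> 4 <= k%:R :> R by rewrite (ler_nat _ 4 k).
  have a4 := q4 _ m4; have b4 := q4 _ nm4.
  have i0 (k : R) : 0 < k -> 0 <= k^-1 by move=> k0; rewrite invr_ge0 ltW.
  have ln0 : 0 <= L / nR by rewrite divr_ge0// ltW.
  have E : L ^+ 2 / nR = nR * ((L / nR) * (L / nR)) by field; rewrite gt_eqF.
  have fin (c : R) : `|c| <= (L / nR) * (L / nR) -> `|scale m * c| <= L ^+ 2 / nR.
    by move=> hc; rewrite normrM E ler_pM.
  have sq (k : R) : 4 <= k -> k^-1 <= L / nR ->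
      `|(k - 2) * (k - 3) / k ^+ 4| <= (L / nR) * (L / nR).
    move=> k4 kl; have k0 : 0 < k by lra.
    rewrite ger0_norm; last by rewrite divr_ge0 ?exprn_ge0// ?mulr_ge0//; lra.
    rewrite (_ : _ / _ = ((k - 2) / k * k^-1) * ((k - 3) / k * k^-1)).
      have h c : 0 <= c <= k -> 0 <= c / k * k^-1 <= L / nR.
        move=> /andP[c0 ck]; rewrite mulr_ge0 ?i0 ?divr_ge0 ?(ltW k0)//=.
        apply: le_trans kl; rewrite ler_piMl ?i0//.
        by rewrite ler_pdivrMr// mul1r.
      have /andP[h1 h2] : 0 <= (k - 2) / k * k^-1 <= L / nR by apply: h; lra.
      have /andP[h3 h4] : 0 <= (k - 3) / k * k^-1 <= L / nR by apply: h; lra.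
      exact: ler_pM.
    by field; rewrite gt_eqF.
  split; apply: fin; [exact: sq|exact: sq|].
  rewrite mulNr normrN.
  rewrite (_ : _ / _ = ((m%:R - 1) / m%:R * m%:R^-1) *
    (((n - m)%:R - 1) / (n - m)%:R * (n - m)%:R^-1) :> R); last first.
    by field; rewrite !gt_eqF.
  have h (k : R) : 4 <= k -> k^-1 <= L / nR -> 0 <= (k - 1) / k * k^-1 <= L / nR.
    move=> k4 kl; have k0 : 0 < k by lra.
    rewrite mulr_ge0 ?i0 ?divr_ge0 ?(ltW k0)//=; last by lra.
    apply: le_trans kl; rewrite ler_piMl ?i0//.
    by rewrite ler_pdivrMr// mul1r; lra.
  have /andP[h1 h2] := h _ a4 k1; have /andP[h3 h4] := h _ b4 k2.
  by rewrite (ger0_norm (mulr_ge0 h1 h3)); exact: ler_pM.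
- by move=> i j ij; exact: (degenerate_BB rvX indX Ymf Y8 YS).
- move=> i j ij.
  by apply: (Ex_BB2 rvX indX Ymf Y8 YS sg0 C1 Ssg fourthC).
- have s4 : 0 <= sg ^+ 4 by exact: exprn_ge0.
  rewrite (_ : 528 * _ * _ = 6336 * (L ^+ 4 * C ^+ 2) * sg ^+ 4).
    exact: (Gc_bound _ (k := 4) (q := 2)).
  by field; rewrite gt_eqF.
Qed.

Lemma ipmC (K H : 'M[R]_p) : ipm K H = ipm H K.
Proof. by do 2 (apply: eq_bigr => ? _); rewrite mulrC. Qed.

Lemma ipmB (K K' H : 'M[R]_p) : ipm (K - K') H = ipm K H - ipm K' H.
Proof.
rewrite /ipm -sumrB; apply: eq_bigr => i _.
by rewrite -sumrB; apply: eq_bigr => j _; rewrite !mxE mulrBl.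
Qed.

Lemma ipm_fro (K : 'M[R]_p) : ipm K K = fro K.
Proof. by do 2 (apply: eq_bigr => ? _); rewrite expr2. Qed.

Lemma sum_omega_diag m : m \in r -> \sum_(x : pair2 | x.1 == x.2) `|omega m x| <= L ^+ 2 / nR.
Proof.
move=> mr; have W0 : 0 <= L ^+ 2 / nR ^+ 2 by rewrite divr_ge0// sqr_ge0.
apply: le_trans (@sum_norm_card _ _ _ _ _ n W0 _ _) _.
- by move=> y _; exact: omega_le.
- apply: (@leq_trans #|[set (i, i) | i : 'I_n]%SET|).
    apply: subset_leq_card; apply/fintype.subsetP => -[i j].
    by rewrite unfold_in /= => /eqP <-; apply/imsetP; exists i.
  by rewrite (leq_trans (leq_imset_card _ _))// card_ord.
- by rewrite le_eqVlt; apply/orP; left; apply/eqP; field; rewrite gt_eqF.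
Qed.

(** The statistic uses distinct indices, [fro (Dfull m)] does not. Of the constant 48, collisions
    between the two pairs account for 40 and pairs with equal entries for 8. *)
Lemma order0_le m : m \in r ->
  `|\sum_(t | uniq4 t.1 t.2) omega m t.1 * omega m t.2 * ipm (Kx t.2) (Kx t.1)
    - fro (Dfull m)| <= 48 * L ^+ 2 * sg ^+ 2 / nR.
Proof.
move=> mr; rewrite (sum_omega2_ipm m Kx).
have s2 : 0 <= 2 * sg by rewrite mulr_ge0.
have Ls : 0 <= 10 * L ^+ 2 * sg / nR.
  by rewrite divr_ge0// mulr_ge0// mulr_ge0// sqr_ge0.
have D4 : fro (Dfull m) <= (4 * sg) ^+ 2.
  rewrite (_ : 4 * sg = 2 * (2 * sg)); last by ring.
  apply: fro_sum => //; first by move=> y _; exact: fro_Kx.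
  by rewrite sum_omega_norm.
have E : fro (Dfull m) = \sum_(x | x.1 != x.2) omega m x * ipm (Dfull m) (Kx x) +
    \sum_(x | x.1 == x.2) omega m x * ipm (Dfull m) (Kx x).
  rewrite -ipm_fro [in LHS]/Dfull ipm_sum (bigID (fun x : pair2 => x.1 == x.2))/= addrC.
  by congr (_ + _); apply: eq_bigr => x _; rewrite ipmC.
rewrite E (eq_bigr (fun x => omega m x * ipm (Dfull m) (Kx x) - omega m x * ipm (Rmx m x) (Kx x))); last first.
  by move=> x _; rewrite DmxE ipmB mulrBr.
rewrite sumrB opprD addrACA subrr add0r -opprD normrN.
apply: (le_trans (ler_normD _ _)).
have B1 : `|\sum_(x | x.1 != x.2) omega m x * ipm (Rmx m x) (Kx x)| <=
    2 * (10 * L ^+ 2 * sg / nR * (2 * sg)).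
  apply: (le_trans (ler_norm_sum _ _ _)).
  apply: (@le_trans _ _ (\sum_(x | x.1 != x.2) `|omega m x| * (10 * L ^+ 2 * sg / nR * (2 * sg)))).
    apply: ler_sum => x x12; rewrite normrM ler_wpM2l//.
    apply: ipm_le => //; last exact: fro_Kx.
    apply: (le_trans (fro_Rmx mr x12)); rewrite le_eqVlt; apply/orP; left; apply/eqP.
    by field; rewrite gt_eqF.
  rewrite -mulr_suml; apply: ler_wpM2r; first exact: mulr_ge0.
  rewrite -(sum_omega_norm mr) [leRHS](bigID (fun x : pair2 => x.1 != x.2))/=.
  by rewrite lerDl sumr_ge0.
have B2 : `|\sum_(x | x.1 == x.2) omega m x * ipm (Dfull m) (Kx x)| <=
    L ^+ 2 / nR * (4 * sg * (2 * sg)).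
  apply: (le_trans (ler_norm_sum _ _ _)).
  apply: (@le_trans _ _ (\sum_(x : pair2 | x.1 == x.2) `|omega m x| * (4 * sg * (2 * sg)))).
    apply: ler_sum => x x12; rewrite normrM ler_wpM2l//.
    by apply: ipm_le => //; [rewrite mulr_ge0|exact: fro_Kx].
  rewrite -mulr_suml; apply: ler_wpM2r; first by rewrite !mulr_ge0.
  exact: sum_omega_diag.
apply: (le_trans (lerD B1 B2)); rewrite le_eqVlt; apply/orP; left; apply/eqP.
by field; rewrite gt_eqF.
Qed.

(** By [DfullE], [fro (Dfull m)] is the wanted signal plus a cross term between [Dl] and delta
    delta^T and the square of the latter. After scaling these are at most n (2 sqrt f e + e^2), the
    last summand of [Vsize] up to a constant and a square. *)
Lemma tailbound_order0 : tailbound P r (fun m w => scale m *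
    \sum_(t | uniq4 t.1 t.2) omega m t.1 * omega m t.2 * ipm (Kx t.2) (Kx t.1)
    - scale m * (dcoef1 m ^+ 2 * f)) (9280 * (Gc * Vsize)).
Proof.
have [V1 _ _ V4 V0] := Vsize_ge.
have s4 : 0 <= sg ^+ 4 by exact: exprn_ge0.
pose sf : R := Num.sqrt f.
have sf0 : 0 <= sf by exact: sqrtr_ge0.
have sf2 : sf ^+ 2 = f by exact: sqr_sqrtr.
pose b1 : R := 48 * L ^+ 2 * sg ^+ 2.
pose b2 : R := nR * (2 * sf * e + e ^+ 2).
have h1 m : m \in r -> `|scale m * (\sum_(t | uniq4 t.1 t.2) omega m t.1 * omega m t.2 *
    ipm (Kx t.2) (Kx t.1) - fro (Dfull m))| <= b1.
  move=> mr; rewrite normrM; apply: (le_trans (ler_pM _ _ (scale_le mr) (order0_le mr))) => //.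
  by rewrite /b1 mulrC divfK// gt_eqF.
have h2 m : m \in r -> `|scale m * (fro (Dfull m) - dcoef1 m ^+ 2 * f)| <= b2.
  move=> mr; rewrite normrM; apply: ler_pM => //; first exact: scale_le.
  have d1 := dcoef1_le mr; have d2 := dcoef2_le mr.
  have -> : fro (Dfull m) - dcoef1 m ^+ 2 * f =
      2 * (dcoef1 m * dcoef2 m) * ipm Dl dlmx + dcoef2 m ^+ 2 * e ^+ 2.
    rewrite -fro_dl -!ipm_fro DfullE// -/dlmx ipm_lin2 ipmC ipm_lin2 [X in _ + _ * X]ipmC ipm_lin2.
    by rewrite [ipm dlmx Dl]ipmC; ring.
  apply: (le_trans (ler_normD _ _)); apply: lerD.
    have hi : `|ipm Dl dlmx| <= sf * e.
      by apply: ipm_le => //; rewrite ?sf2// fro_dl.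
    rewrite -[2 * sf * e]mulrA -[X in `|X| <= _]mulrA normrM ger0_norm// ler_pM2l//.
    by rewrite -[leRHS]mul1r normrM ler_pM// normrM mulr_ile1.
  have ee : `|e ^+ 2| = e ^+ 2 by rewrite ger0_norm// sqr_ge0.
  by rewrite normrM ee; apply: ler_piMl; rewrite ?sqr_ge0// normrX expr_le1.
have TT := tailboundD (tailbound_det P h1) (tailbound_det P h2).
apply: (tailbound_eq _ (tailbound_le TT _)).
  by move=> m w mr; rewrite -mulrDr addrA subrK mulrBr.
have q1 : b1 ^+ 2 <= 2304 * (Gc * Vsize).
  rewrite (_ : b1 ^+ 2 = 2304 * (L ^+ 4 * C ^+ 0) * sg ^+ 4); last by rewrite /b1; ring.
  exact: (Gc_bound _ (k := 4) (q := 0)).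
have q2 : b2 ^+ 2 <= 16 * (Gc * Vsize).
  have G1 := Gc_ge (isT : (0 <= 8)%N) (isT : (0 <= 2)%N); rewrite !expr0 mulr1 in G1.
  apply: (@le_trans _ _ (16 * (1 * (nR ^+ 2 * e ^+ 2 * (f + e ^+ 2))))).
    rewrite -sf2 /b2.
    have : (2 * sf * e + e ^+ 2) ^+ 2 <= 16 * (e ^+ 2 * (sf ^+ 2 + e ^+ 2)).
      rewrite (_ : 2 * sf * e + e ^+ 2 = e * (2 * sf + e)); last by ring.
      rewrite exprMn (_ : 16 * _ = e ^+ 2 * (16 * (sf ^+ 2 + e ^+ 2))); last by ring.
      by rewrite ler_wpM2l ?sqr_ge0//; have := sqr_ge0 (sf - e); nra.
    move=> h; rewrite exprMn (_ : 16 * _ = nR ^+ 2 * (16 * (e ^+ 2 * (sf ^+ 2 + e ^+ 2)))).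
      by rewrite ler_wpM2l ?sqr_ge0.
    by ring.
  by rewrite ler_pM2l// ler_pM// mulr_ge0 ?mulr_ge0 ?addr_ge0 ?sqr_ge0.
apply: (@le_trans _ _ (4 * (2304 * (Gc * Vsize) + 16 * (Gc * Vsize)))).
  by rewrite ler_pM2l// lerD.
by rewrite le_eqVlt; apply/orP; left; apply/eqP; ring.
Qed.

Lemma uniq4_swap (F : pair2 -> pair2 -> R) :
  \sum_(t | uniq4 t.1 t.2) F t.2 t.1 = \sum_(t | uniq4 t.1 t.2) F t.1 t.2.
Proof.
rewrite (reindex_inj (h := fun t : pair2 * pair2 => (t.2, t.1)))/=; last first.
  by move=> [a b] [a' b'] /= [-> ->].
by apply: eq_bigl => t; rewrite uniq4C.
Qed.

(** Weights and range are invariant under exchange of the two pairs, so mirror terms of [LL_expand]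
    have equal sums; hence the factors 2. *)
Lemma sum_LL m w : \sum_(t | uniq4 t.1 t.2) omega m t.1 * omega m t.2 *
    LL t.1.1 t.1.2 t.2.1 t.2.2 w =
  \sum_(t | uniq4 t.1 t.2) omega m t.1 * omega m t.2 * ipm (Kx t.2) (Kx t.1)
  + 2 * (\sum_(x | x.1 != x.2) omega m x * phi x (Dfull m) w
         - \sum_(x | x.1 != x.2) omega m x * phi x (Rmx m x) w)
  + \sum_(t | uniq4 t.1 t.2) omega m t.1 * omega m t.2 * BB t.1.1 t.2.1 w
  + \sum_(t | uniq4 t.1 t.2) omega m t.1 * omega m t.2 * ord2 t.1.1 t.1.2 t.2.1 t.2.2 w
  - 2 * (\sum_(t | uniq4 t.1 t.2) omega m t.1 * omega m t.2 * bf (Kx t.2) t.1.1 t.1.2 w)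
  - 2 * (\sum_(t | uniq4 t.1 t.2) omega m t.1 * omega m t.2 * ord3 t.1.1 t.1.2 t.2.1 t.2.2 w)
  + \sum_(t | uniq4 t.1 t.2) omega m t.1 * omega m t.2 *
      (ip t.1.1 t.2.1 w * ip t.1.2 t.2.2 w).
Proof.
have Ssym i a b : S i a b = S i b a.
  by rewrite -!YS; congr (Ex _); apply/funext => ?; rewrite mulrC.
have FK : \sum_(x | x.1 != x.2) omega m x * phi x (Dfull m) w
    - \sum_(x | x.1 != x.2) omega m x * phi x (Rmx m x) w =
    \sum_(t | uniq4 t.1 t.2) omega m t.1 * omega m t.2 * phi t.1 (Kx t.2) w.
  under [RHS]eq_bigr do rewrite phi_ipm.
  rewrite (sum_omega2_ipm m (fun x => \matrix_(a, b)
    (Bm Y S x.1 a b w + 2 * gd x.1 x.2 * (Y x.1 a w * dl b)))).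
  rewrite -sumrB; apply: eq_bigr => x _.
  by rewrite !phi_ipm DmxE ipmB [RHS]mulrBr.
rewrite FK !mulr_natl !mulr2n.
rewrite -[X in _ + (X + _)](uniq4_swap (fun x y => omega m x * omega m y * phi x (Kx y) w)).
rewrite -[X in _ - (X + _) - (_ + _)](uniq4_swap (fun x y => omega m x * omega m y *
  bf (Kx y) x.1 x.2 w)).
rewrite -{1}(uniq4_swap (fun x y => omega m x * omega m y * ord3 x.1 x.2 y.1 y.2 w)).
rewrite -!(sumrN, big_split)/=; apply: eq_bigr => t _.
by rewrite (LL_expand _ _ _ Ssym) /phi [ipm (Kx t.2) _]ipmC; ring.
Qed.

Lemma tailbound_LL : tailbound P r (fun m w => scale m *
    \sum_(t | uniq4 t.1 t.2) omega m t.1 * omega m t.2 * LL t.1.1 t.1.2 t.2.1 t.2.2 w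
    - scale m * (dcoef1 m ^+ 2 * f)) (2 ^+ 28 * (Gc * Vsize)).
Proof.
have [V1 _ V3 _ V0] := Vsize_ge.
have s4 : 0 <= sg ^+ 4 by exact: exprn_ge0.
have nes : 0 <= nR * (e * sg ^+ 3) by rewrite !mulr_ge0 ?exprn_ge0.
have nesV : nR * (e * sg ^+ 3) <= Vsize by rewrite mulrA.
have GV : 0 <= Gc * Vsize.
  by rewrite mulr_ge0// /Gc mulr_ge0// exprn_ge0// ltW.
(* Constants are rounded up to powers of two: a sum of equal bounds then adds three to the exponent,
   a multiplication by 2 adds two. *)
have le2 (c : nat) k : (c <= 2 ^ k)%N -> c%:R * (Gc * Vsize) <= 2 ^+ k * (Gc * Vsize).
  by move=> ck; rewrite ler_wpM2r// -natrX ler_nat.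
have dbl xi (k : nat) : tailbound P r xi (2 ^+ k * (Gc * Vsize)) ->
    tailbound P r (fun m w => 2 * xi m w) (2 ^+ k.+2 * (Gc * Vsize)).
  have h2 m : m \in r -> `|2| <= 2 :> R by rewrite ger0_norm.
  move=> /(tailboundZ (c := fun=> 2) (ler0n R 2) h2) /tailbound_le; apply.
  by rewrite mulrA -exprD.
have neg xi (v : R) : tailbound P r xi v -> tailbound P r (fun m w => - xi m w) v.
  have h1 m : m \in r -> `|-1| <= 1 :> R by rewrite normrN1.
  move=> /(tailboundZ (c := fun=> -1) ler01 h1) tb.
  apply: (tailbound_eq _ (tailbound_le tb _)); first by move=> m w _; rewrite mulN1r.
  by rewrite expr1n mul1r.
have add xi zeta (k : nat) : tailbound P r xi (2 ^+ k * (Gc * Vsize)) ->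
    tailbound P r zeta (2 ^+ k * (Gc * Vsize)) ->
    tailbound P r (fun m w => xi m w + zeta m w) (2 ^+ k.+3 * (Gc * Vsize)).
  move=> h1 h2; apply: (tailbound_le (tailboundD h1 h2)).
  by rewrite !exprS le_eqVlt; apply/orP; left; apply/eqP; ring.
have up xi (k k' : nat) : (k <= k')%N -> tailbound P r xi (2 ^+ k * (Gc * Vsize)) ->
    tailbound P r xi (2 ^+ k' * (Gc * Vsize)).
  move=> kk /tailbound_le; apply.
  by rewrite ler_wpM2r// ler_weXn2l// ler1n.
have O0 := up _ 14%N 20%N isT (tailbound_le tailbound_order0 (le2 9280%N 14%N isT)).
have F1 := up _ 15%N 15%N isT (tailbound_le tailbound_FK_main (le2 23040%N 15%N isT)).
have F2 := up _ 11%N 15%N isT (tailbound_le tailbound_FK_remainder (le2 2000%N 11%N isT)).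
have FF := dbl _ _ (add _ _ _ F1 (neg _ _ F2)).
have B1 := up _ 13%N 17%N isT (tailbound_le tailbound_BB (le2 6336%N 13%N isT)).
have C1' := neg _ _ (dbl _ _ (tailbound_le tailbound_CK (le2 1664%N 11%N isT))).
have O2 : tailbound P r (fun m w => scale m *
    \sum_(t | uniq4 t.1 t.2) omega m t.1 * omega m t.2 * ord2 t.1.1 t.1.2 t.2.1 t.2.2 w)
    (2 ^+ 10 * (Gc * Vsize)).
  apply: (tailbound_le tailbound_order2); apply: le_trans (le2 640%N 10%N isT).
  rewrite -[640 * _ * _]mulrA.
  exact: (Gc_bound _ (k := 8) (q := 2)).
have O3 : tailbound P r (fun m w => scale m *
    \sum_(t | uniq4 t.1 t.2) omega m t.1 * omega m t.2 * ord3 t.1.1 t.1.2 t.2.1 t.2.2 w)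
    (2 ^+ 9 * (Gc * Vsize)).
  apply: (tailbound_le tailbound_order3); apply: le_trans (le2 432%N 9%N isT).
  rewrite -[432 * _ * _]mulrA.
  exact: (Gc_bound _ (k := 8) (q := 2)).
have O4 : tailbound P r (fun m w => scale m *
    \sum_(t | uniq4 t.1 t.2) omega m t.1 * omega m t.2 *
      (ip t.1.1 t.2.1 w * ip t.1.2 t.2.2 w)) (2 ^+ 8 * (Gc * Vsize)).
  apply: (tailbound_le tailbound_order4); apply: le_trans (le2 256%N 8%N isT).
  rewrite -[256 * _ * _]mulrA.
  exact: (Gc_bound _ (k := 8) (q := 2)).
have A1 := add _ _ _ O0 FF.
have A2 := add _ _ _ B1 (up _ 10%N 17%N isT O2).
have A3 := add _ _ _ C1' (up _ 11%N 13%N isT (neg _ _ (dbl _ _ O3))).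
have A4 := add _ _ _ A3 (up _ 8%N 16%N isT O4).
have A5 := add _ _ _ (up _ 20%N 22%N isT A2) (up _ 19%N 22%N isT A4).
have A6 := add _ _ _ (up _ 23%N 25%N isT A1) A5.
apply: (tailbound_eq _ A6) => m w mr; rewrite sum_LL; ring.
Qed.

Definition dd i j k l w : R := \sum_a zz Y g dl i j a w * zz Y g dl k l a w.

Lemma ddE i j k l w : dd i j k l w =
  (ip i k w + - 1 * ip i l w) + (- 1 * ip j k w + ip j l w) +
  ((gd k l * (lin dl i w + - 1 * lin dl j w) + gd i j * (lin dl k w + - 1 * lin dl l w))
   + gd i j * gd k l * e).
Proof.
rewrite /dd /nsq /ip /lin.
do 4 (rewrite ?mulr_sumr -?big_split/=).
by apply: eq_bigr => a _; rewrite /zz; ring.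
Qed.

Definition M4 (h : T -> R) v := Lmom 4 h /\ Ex (fun w => h w ^+ 4) <= v.

(** From (s + t)^4 <= 8 (s^4 + t^4). *)
Let M4D h h' v v' : M4 h v -> M4 h' v' -> M4 (fun w => h w + h' w) (8 * (v + v')).
Proof.
move=> [L1' h1] [L2 h2]; split; first exact: LmomD.
have I1 := Lmom4_sq L1'; have I2 := Lmom4_sq L2.
apply: (@le_trans _ _ (Ex (fun w => 8 * (h w ^+ 4 + h' w ^+ 4)))).
  apply: Ex_le; first by apply: Lmom4_sq; exact: LmomD.
    by apply: LmomZ; exact: LmomD.
  move=> w; set a := h w; set b := h' w.
  have q (s t : R) : (s + t) ^+ 2 <= 2 * (s ^+ 2 + t ^+ 2) by have := sqr_ge0 (s - t); nra.
  rewrite -[4%N]/(2 * 2)%N !exprM; apply: (@le_trans _ _ ((2 * (a ^+ 2 + b ^+ 2)) ^+ 2)).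
    by rewrite lerXn2r ?nnegrE ?sqr_ge0// mulr_ge0// addr_ge0 ?sqr_ge0.
  by have := q (a ^+ 2) (b ^+ 2); rewrite exprMn; lra.
by rewrite ExZ ?ExD//; [lra|exact: LmomD].
Qed.

Let M4Z h v (c : R) : `|c| <= 1 -> M4 h v -> M4 (fun w => c * h w) v.
Proof.
move=> c1 [Lh hv]; split; first exact: LmomZ.
have I := Lmom4_sq Lh.
rewrite (_ : (fun w => _) = (fun w => c ^+ 4 * h w ^+ 4)); last first.
  by apply/funext => w; rewrite exprMn.
rewrite ExZ//; apply: le_trans hv; apply: ler_piMl.
  by apply: Ex_ge0 => w; rewrite -[4%N]/(2 * 2)%N exprM sqr_ge0.
have c2 : c ^+ 2 <= 1 by rewrite -real_normK ?num_real// expr_le1.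
by rewrite -[4%N]/(2 * 2)%N exprM expr_le1// sqr_ge0.
Qed.

Lemma M4_dd i j k l : uniq [:: i; j; k; l] ->
  M4 (dd i j k l) (2 ^+ 16 * (C ^+ 2 * sg ^+ 4)).
Proof.
rewrite /= !inE !negb_or !andbT => /and3P[/and3P[ij ik il] /andP[jk jl] kl].
set v := C ^+ 2 * sg ^+ 4.
have s4 : 0 <= sg ^+ 4 by exact: exprn_ge0.
have C0' := ltW C0.
have CC : C <= C ^+ 2 by rewrite expr2 ler_peMl.
have v0 : 0 <= v by rewrite /v mulr_ge0 ?sqr_ge0.
have Mip a b : a != b -> M4 (ip a b) v.
  move=> ab; split; first exact: (Lmom_ip Y8).
  apply: (le_trans (Ex_ip4 rvX indX Ymf Y8 fourthC ab)).
  by rewrite /v ler_wpM2r.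
have Mlin a : M4 (lin dl a) v.
  split; first exact: (Lmom_lin Y8).
  apply: (le_trans (Ex_lin4 Y8 sg0 C1 fourthC dl a)).
  rewrite exprMn exprMn -mulrA /v ler_wpM2l ?sqr_ge0//.
  rewrite -[leRHS]/(sg ^+ (2 + 2)) exprD ler_wpM2r ?sqr_ge0//.
  by rewrite lerXn2r ?nnegrE.
have Me : M4 (fun=> e) v.
  split; first exact: Lmom_cst.
  rewrite (_ : (fun w => _) = cst (e ^+ 4))// Ex_cst /v -[leLHS]mul1r.
  apply: ler_pM; rewrite ?exprn_ge0//; first by rewrite expr_ge1.
  by rewrite lerXn2r ?nnegrE.
have n1 : `|-1| <= 1 :> R by rewrite normrN1.
have up h u u' : u <= u' -> M4 h u -> M4 h u' by move=> uu [? hu]; split=> //; exact: le_trans hu uu.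
have g1 a b : `|gd a b| <= 1 by exact: gg_le.
have g2 : `|gd i j * gd k l| <= 1 by rewrite normrM mulr_ile1.
have A1 := M4D (M4D (Mip _ _ ik) (M4Z n1 (Mip _ _ il))) (M4D (M4Z n1 (Mip _ _ jk)) (Mip _ _ jl)).
have A2 := M4D (M4D (M4Z (g1 k l) (M4D (Mlin i) (M4Z n1 (Mlin j))))
   (M4Z (g1 i j) (M4D (Mlin k) (M4Z n1 (Mlin l))))) (M4Z g2 Me).
have A3 := M4D A1 A2.
rewrite (_ : dd i j k l = (fun w => (ip i k w + - 1 * ip i l w) + (- 1 * ip j k w + ip j l w) +
  ((gd k l * (lin dl i w + - 1 * lin dl j w) + gd i j * (lin dl k w + - 1 * lin dl l w))
   + gd i j * gd k l * e))); last by apply/funext => w; exact: ddE.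
apply: up A3; rewrite !exprS expr0; lra.
Qed.

Definition HH t w : R := dd t.1.1 t.1.2 t.2.1 t.2.2 w ^+ 2 / 4.

(** By [zz_sqr] the kernel is the average of the four versions of [LL] in which the entries of each
    pair are exchanged or not; [omega] and the range of summation are invariant under these
    exchanges. *)
Lemma sum_HH_LL m w :
  \sum_(t | uniq4 t.1 t.2) omega m t.1 * omega m t.2 * HH t w =
  \sum_(t | uniq4 t.1 t.2) omega m t.1 * omega m t.2 * LL t.1.1 t.1.2 t.2.1 t.2.2 w.
Proof.
pose sw (x : pair2) : pair2 := (x.2, x.1).
have os x : omega m (sw x) = omega m x.
  by rewrite /omega /=; case: (x.1 < m)%N; case: (x.2 < m)%N.
have u1 x y : uniq4 (sw x) y = uniq4 x y.
  by rewrite !uniq4E /= [x.2 == x.1]eq_sym; do 6 case: (_ == _).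
have u2 x y : uniq4 x (sw y) = uniq4 x y by rewrite uniq4C u1 uniq4C.
pose F x y := omega m x * omega m y * LL x.1 x.2 y.1 y.2 w.
have R1 (G : pair2 -> pair2 -> R) : \sum_(t | uniq4 t.1 t.2) G (sw t.1) t.2 =
    \sum_(t | uniq4 t.1 t.2) G t.1 t.2.
  rewrite [in RHS](reindex_inj (h := fun t : pair2 * pair2 => (sw t.1, t.2)))/=.
    by apply: eq_bigl => t; rewrite u1.
  by move=> [[a b] c] [[a' b'] c'] /= [-> -> ->].
have R2 (G : pair2 -> pair2 -> R) : \sum_(t | uniq4 t.1 t.2) G t.1 (sw t.2) =
    \sum_(t | uniq4 t.1 t.2) G t.1 t.2.
  rewrite [in RHS](reindex_inj (h := fun t : pair2 * pair2 => (t.1, sw t.2)))/=.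
    by apply: eq_bigl => t; rewrite u2.
  by move=> [a [b c]] [a' [b' c']] /= [-> -> ->].
transitivity (4^-1 * (\sum_(t | uniq4 t.1 t.2) F t.1 t.2
   + \sum_(t | uniq4 t.1 t.2) F (sw t.1) t.2 + \sum_(t | uniq4 t.1 t.2) F t.1 (sw t.2)
   + \sum_(t | uniq4 t.1 t.2) F (sw t.1) (sw t.2))).
  rewrite -!big_split/= mulr_sumr; apply: eq_bigr => t _.
  by rewrite /HH /dd zz_sqr /F !os /=; field.
by rewrite (R1 (fun x y => F x (sw y))) R2 R1 /F; field.
Qed.

(** The exact coefficient in [Vstat]. The factor 2 of the cross term is shared between the two
    orders of the blocks. *)
Definition weight m (t : pair2 * pair2) : R :=
  if (t.1.1 < m)%N && (t.1.2 < m)%N then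
    if (t.2.1 < m)%N && (t.2.2 < m)%N then (m ^_ 4)%:R^-1
    else if ~~ (t.2.1 < m)%N && ~~ (t.2.2 < m)%N then - (m ^_ 2 * (n - m) ^_ 2)%:R^-1 else 0
  else if ~~ (t.1.1 < m)%N && ~~ (t.1.2 < m)%N then
    if (t.2.1 < m)%N && (t.2.2 < m)%N then - (m ^_ 2 * (n - m) ^_ 2)%:R^-1
    else if ~~ (t.2.1 < m)%N && ~~ (t.2.2 < m)%N then ((n - m) ^_ 4)%:R^-1 else 0
  else 0.

Lemma ffact2R (k : nat) : (4 <= k)%N -> (k ^_ 2)%:R = k%:R * (k%:R - 1) :> R.
Proof.
by case: k => // k k4; rewrite !ffactnS ffactn0 muln1 natrM /= [k.+1%:R]mulrS addrAC subrr add0r.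
Qed.

Lemma ffact4R (k : nat) : (4 <= k)%N ->
  (k ^_ 4)%:R = k%:R * (k%:R - 1) * (k%:R - 2) * (k%:R - 3) :> R.
Proof.
case: k => [|[|[|[|k]]]]// _; rewrite !ffactnS ffactn0 muln1 !natrM /=.
by rewrite [k.+4%:R]mulrS [k.+3%:R]mulrS [k.+2%:R]mulrS [k.+1%:R]mulrS; ring.
Qed.

Lemma inv_ffact4 (k : R) : 4 <= k ->
  `|(k * (k - 1) * (k - 2) * (k - 3))^-1 - (k ^+ 4)^-1| <= 64 * k^-1 ^+ 5.
Proof.
move=> k4; have k0 : 0 < k by lra.
have P0 : 0 < k * (k - 1) * (k - 2) * (k - 3) by rewrite !mulr_gt0//; lra.
have K0 : 0 < k ^+ 4 by rewrite exprn_gt0.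
have kt : 0 <= (k - 4) by lra.
have h1 : k * (k - 1) * (k - 2) * (k - 3) <= k ^+ 4.
  rewrite -subr_ge0 (_ : _ - _ = k * (6 * k * (k - 4) + 13 * (k - 4) + 58)); last by ring.
  by rewrite mulr_ge0 ?(ltW k0)// !addr_ge0 ?mulr_ge0 ?(ltW k0).
rewrite ger0_norm ?subr_ge0 ?lef_pV2// lerBlDr.
have -> : 64 * k^-1 ^+ 5 + (k ^+ 4)^-1 = (64 + k) / k ^+ 5 by field; rewrite gt_eqF.
rewrite -[leLHS]div1r ler_pdivrMr// mulrAC ler_pdivlMr ?exprn_gt0// mul1r.
(* In powers of [k - 4] all coefficients are positive, so the inequality is evident for [k >= 4]. *)
rewrite -subr_ge0 (_ : _ - _ = k * (58 * (k - 4) ^+ 3 + 323 * (k - 4) ^+ 2 +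
  498 * (k - 4) + 152)); last by ring.
apply: mulr_ge0; first exact: ltW.
have t2 := exprn_ge0 2 kt; have t3 := exprn_ge0 3 kt.
by apply: addr_ge0; [apply: addr_ge0; [apply: addr_ge0; apply: mulr_ge0|apply: mulr_ge0]|];
  rewrite ?ler0n.
Qed.

Lemma inv_ffact2 (k l : R) (w : R) : 4 <= k -> 4 <= l -> k^-1 <= w -> l^-1 <= w ->
  `|- (k * (k - 1) * (l * (l - 1)))^-1 + (k ^+ 2)^-1 * (l ^+ 2)^-1| <= 64 * w ^+ 5.
Proof.
move=> k4 l4 kw lw; have k0 : 0 < k by lra.
have l0 : 0 < l by lra.
have ki0 : 0 < k^-1 by rewrite invr_gt0.
have li0 : 0 < l^-1 by rewrite invr_gt0.
have w0 : 0 <= w by lra.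
have q (x : R) : 4 <= x -> 0 <= (x * (x - 1))^-1 - (x ^+ 2)^-1 <= 2 * x^-1 ^+ 3 /\
    0 <= (x ^+ 2)^-1.
  move=> x4; have x0 : 0 < x by lra.
  have x1 : 0 < x - 1 by lra.
  split; last by rewrite invr_ge0 sqr_ge0.
  have -> : (x * (x - 1))^-1 - (x ^+ 2)^-1 = x^-1 ^+ 3 * (x / (x - 1)).
    by field; rewrite !gt_eqF.
  have h0 : 0 <= x^-1 ^+ 3 by rewrite exprn_ge0// invr_ge0 ltW.
  rewrite mulr_ge0 ?divr_ge0 ?(ltW x0) ?(ltW x1)//= mulrC ler_wpM2r//.
  by rewrite ler_pdivrMr//; lra.
have [/andP[a1 a2] a3] := q _ k4; have [/andP[b1 b2] b3] := q _ l4.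
rewrite invfM; set a := (k * (k - 1))^-1 in a1 a2 *; set b := (l * (l - 1))^-1 in b1 b2 *.
set x := (k ^+ 2)^-1 in a1 a2 a3 *; set y := (l ^+ 2)^-1 in b1 b2 b3 *.
have pw (s : nat) : k^-1 ^+ s <= w ^+ s by rewrite lerXn2r ?nnegrE// ltW.
have pw' (s : nat) : l^-1 ^+ s <= w ^+ s by rewrite lerXn2r ?nnegrE// ltW.
have xw : x <= w ^+ 2 by rewrite /x -exprVn.
have yw : y <= w ^+ 2 by rewrite /y -exprVn.
rewrite (_ : - (a * b) + x * y = - (x * (b - y) + (a - x) * y + (a - x) * (b - y))); last by ring.
have h1 : x * (b - y) <= w ^+ 2 * (2 * w ^+ 3).
  by apply: ler_pM => //; apply: (le_trans b2); rewrite ler_pM2l.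
have h2 : (a - x) * y <= 2 * w ^+ 3 * w ^+ 2.
  by apply: ler_pM => //; apply: (le_trans a2); rewrite ler_pM2l.
have a4 : a - x <= w ^+ 2.
  apply: (le_trans a2); apply: le_trans (pw 2%N); rewrite exprS mulrA ler_piMl ?exprn_ge0 ?(ltW ki0)//.
  by rewrite ler_pdivrMr//; lra.
have h3 : (a - x) * (b - y) <= w ^+ 2 * (2 * w ^+ 3).
  by apply: ler_pM => //; apply: (le_trans b2); rewrite ler_pM2l.
rewrite normrN ger0_norm; last by rewrite !addr_ge0// mulr_ge0.
have w5 : 0 <= w ^+ 5 by exact: exprn_ge0.
have e5 : w ^+ 2 * (2 * w ^+ 3) = 2 * w ^+ 5 by ring.
have e5' : 2 * w ^+ 3 * w ^+ 2 = 2 * w ^+ 5 by ring.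
rewrite e5 in h1 h3; rewrite e5' in h2; lra.
Qed.

Lemma weight_omega m t : m \in r ->
  `|weight m t - omega m t.1 * omega m t.2| <= 64 * (L / nR) ^+ 5.
Proof.
move=> mr; have [k1 k2] := invL_le mr; have [p1 p2 _ _ _] := r_facts mr.
have [m4 nm4 _ _] := rL mr.
have q4 (k : nat) : (4 <= k)%N -> 4 <= k%:R :> R by rewrite (ler_nat _ 4 k).
have a4 := q4 _ m4; have b4 := q4 _ nm4.
have ln0 : 0 <= L / nR by rewrite divr_ge0// ltW.
have z0 : 0 <= 64 * (L / nR) ^+ 5 by rewrite mulr_ge0// exprn_ge0.
have h4 (k : R) : 4 <= k -> k^-1 <= L / nR ->
    `|(k * (k - 1) * (k - 2) * (k - 3))^-1 - (k ^+ 2)^-1 * (k ^+ 2)^-1| <= 64 * (L / nR) ^+ 5.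
  move=> k4 kl; have k0 : 0 < k by lra.
  rewrite (_ : (k ^+ 2)^-1 * (k ^+ 2)^-1 = (k ^+ 4)^-1); last by field; rewrite gt_eqF.
  apply: (le_trans (inv_ffact4 k4)); by rewrite ler_pM2l// lerXn2r ?nnegrE ?invr_ge0 ?(ltW k0).
have h2 := inv_ffact2 a4 b4 k1 k2.
rewrite /weight /omega natrM !ffact2R// !ffact4R//.
case: (t.1.1 < m)%N; case: (t.1.2 < m)%N; case: (t.2.1 < m)%N; case: (t.2.2 < m)%N => /=;
  rewrite ?mulr0 ?mul0r ?subr0 ?normr0// ?mulrNN ?mulNr ?mulrN ?opprK; try exact: h4.
- exact: h2.
- by rewrite [X in _ + X]mulrC; exact: h2.
Qed.

Definition Vord m w : R := \sum_(t | uniq4 t.1 t.2) weight m t * HH t w.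

Lemma Lmom_HH t : uniq4 t.1 t.2 -> Lmom 2 (HH t).
Proof.
move=> /M4_dd[Ld _].
rewrite (_ : HH t = (fun w => 4^-1 * (dd t.1.1 t.1.2 t.2.1 t.2.2 w * dd t.1.1 t.1.2 t.2.1 t.2.2 w))).
  by apply: LmomZ; exact: (@LmomM _ _ _ P 2).
by apply/funext => w; rewrite /HH expr2 mulrC.
Qed.

Lemma Ex_HH2 t : uniq4 t.1 t.2 -> Ex (fun w => HH t w ^+ 2) <= 2 ^+ 12 * (C ^+ 2 * sg ^+ 4).
Proof.
move=> /M4_dd[Ld hd].
rewrite (_ : (fun w => _) = (fun w => (2 ^+ 4)^-1 * dd t.1.1 t.1.2 t.2.1 t.2.2 w ^+ 4)); last first.
  by apply/funext => w; rewrite /HH; field.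
rewrite ExZ; last exact: Lmom4_sq.
rewrite mulrC ler_pdivrMr ?exprn_gt0// mulrAC -exprD; exact: hd.
Qed.

Let HT w : R := \sum_(t : pair2 * pair2 | uniq4 t.1 t.2) HH t w.

Let Ex_HT2 : Ex (fun w => HT w ^+ 2) <= nR ^+ 8 * (2 ^+ 12 * (C ^+ 2 * sg ^+ 4)).
Proof.
have I t : uniq4 t.1 t.2 -> Lmom 1 (fun w => HH t w ^+ 2).
  by move=> ut; apply: L2_int2; exact: Lmom_HH.
have LHT : Lmom 2 HT by apply: Lmom_sum => t; exact: Lmom_HH.
have v0 : 0 <= 2 ^+ 12 * (C ^+ 2 * sg ^+ 4).
  by rewrite mulr_ge0 ?exprn_ge0// mulr_ge0 ?exprn_ge0// ltW.
have cn : \sum_(t : pair2 * pair2) 1 = nR ^+ 4 :> R.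
  by rewrite sumr_const !card_prod card_ord !natrM; ring.
apply: (@le_trans _ _ (Ex (fun w => nR ^+ 4 * \sum_(t : pair2 * pair2 | uniq4 t.1 t.2) HH t w ^+ 2))).
  apply: Ex_le; first exact: L2_int2.
    by apply: LmomZ; apply: Lmom_sum => t; exact: I.
  move=> w; rewrite /HT big_mkcond.
  rewrite (eq_bigr (fun t : pair2 * pair2 => (if uniq4 t.1 t.2 then HH t w else 0) * 1)).
    apply: (le_trans (sqr_sum_le _ _)); rewrite mulrC; apply: ler_pM.
    - by apply: sumr_ge0 => t _; exact: sqr_ge0.
    - by apply: sumr_ge0 => t _; exact: sqr_ge0.
    - by rewrite -cn; apply: ler_sum => t _; rewrite expr1n.
    rewrite [leRHS]big_mkcond; apply: ler_sum => t _.
    by case: ifP => _; rewrite ?expr0n.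
  by move=> t _; rewrite mulr1.
rewrite ExZ; last by apply: Lmom_sum => t; exact: I.
rewrite Ex_sum//; apply: (@le_trans _ _ (nR ^+ 4 * \sum_(t : pair2 * pair2)
    (2 ^+ 12 * (C ^+ 2 * sg ^+ 4)))).
  rewrite ler_wpM2l ?exprn_ge0// [leLHS]big_mkcond; apply: ler_sum => t _.
  by case: ifP => // ut; exact: Ex_HH2.
rewrite (eq_bigr (fun=> (2 ^+ 12 * (C ^+ 2 * sg ^+ 4)) * 1)) => [|? _]; last by rewrite mulr1.
by rewrite -mulr_sumr cn le_eqVlt; apply/orP; left; apply/eqP; ring.
Qed.

(** The passage from [omega] products to [weight] costs O(n^-5) per quadruple. As the kernel is
    nonnegative, the error is dominated for all [m] at once by a multiple of the single variable
    [HT], so neither cancellation nor a union bound is involved. *)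
Lemma tailbound_Vord : tailbound P r (fun m w => scale m * Vord m w
    - scale m * (dcoef1 m ^+ 2 * f)) (2 ^+ 32 * (L ^+ 2 * (Gc * Vsize))).
Proof.
have [V1 _ _ _ V0] := Vsize_ge.
have G0 : 0 <= Gc by rewrite /Gc mulr_ge0 ?exprn_ge0// ltW.
have L2 : 1 <= L ^+ 2 by rewrite exprn_ege1.
have LHT : Lmom 2 HT by apply: Lmom_sum => t; exact: Lmom_HH.
have LV m : Lmom 2 (fun w => scale m * \sum_(t | uniq4 t.1 t.2)
    (weight m t - omega m t.1 * omega m t.2) * HH t w).
  by apply: LmomZ; apply: Lmom_sum => t ut; apply: LmomZ; exact: Lmom_HH.
have HH0 t w : 0 <= HH t w by rewrite /HH divr_ge0// sqr_ge0.
have Tr : tailbound P r (fun m w => scale m * \sum_(t | uniq4 t.1 t.2)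
    (weight m t - omega m t.1 * omega m t.2) * HH t w) (2 ^+ 24 * (L ^+ 2 * (Gc * Vsize))).
  apply: (@tailbound_le _ _ _ _ _ _ ((nR * (64 * (L / nR) ^+ 5)) ^+ 2 * (nR ^+ 8 *
      (2 ^+ 12 * (C ^+ 2 * sg ^+ 4))))); last first.
    rewrite (_ : _ * _ = 2 ^+ 24 * (L ^+ 2 * (Gc * sg ^+ 4))); last first.
      by rewrite /Gc; field; rewrite gt_eqF.
    by rewrite !ler_wpM2l ?exprn_ge0// ltW.
  apply: (@tailbound_dom _ _ _ _ _ _ (fun w => (nR * (64 * (L / nR) ^+ 5)) * HT w)).
  - exact: LmomZ.
  - rewrite (_ : (fun w => _) = (fun w => (nR * (64 * (L / nR) ^+ 5)) ^+ 2 * HT w ^+ 2)).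
      by rewrite ExZ ?ler_wpM2l ?sqr_ge0//; exact: L2_int2.
    by apply/funext => w; rewrite exprMn.
  - by move=> m _; exact: Lmom_meas (LV m).
  - move=> m w mr.
    have ln0 : 0 <= L / nR by rewrite divr_ge0// ltW.
    have k0 : 0 <= 64 * (L / nR) ^+ 5 by rewrite mulr_ge0 ?exprn_ge0.
    have HT0 : 0 <= HT w by apply: sumr_ge0 => t _; exact: HH0.
    rewrite (ger0_norm (mulr_ge0 (mulr_ge0 (ltW nR0) k0) HT0)).
    rewrite [`|scale m * _|]normrM -[leRHS]mulrA; apply: ler_pM => //; first exact: scale_le.
    apply: (le_trans (ler_norm_sum _ _ _)).
    rewrite /HT mulr_sumr; apply: ler_sum => t _.
    by rewrite normrM (ger0_norm (HH0 _ _)) ler_wpM2r// weight_omega.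
have := tailboundD tailbound_LL Tr.
move=> tb; apply: (tailbound_eq _ (tailbound_le tb _)).
  move=> m w mr; rewrite -sum_HH_LL /Vord addrAC -mulrDr -big_split/=; congr (_ * _ - _).
  by apply: eq_bigr => t _; ring.
have GV : Gc * Vsize <= L ^+ 2 * (Gc * Vsize) by rewrite ler_peMl// mulr_ge0.
have GV0 : 0 <= Gc * Vsize by rewrite mulr_ge0.
move: GV GV0; set v := Gc * Vsize; set v' := L ^+ 2 * v => vv v0.
apply: (@le_trans _ _ (4 * (2 ^+ 28 * v' + 2 ^+ 28 * v'))).
  rewrite ler_pM2l// lerD ?ler_wpM2l ?exprn_ge0// ler_wpM2r ?ler_weXn2l ?ler1n//.
  exact: le_trans vv.
have D a : 4 * (a * v' + a * v') = 2 ^+ 3 * a * v' by ring.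
by rewrite D -exprD ler_wpM2r ?ler_weXn2l ?ler1n// (le_trans v0).
Qed.

End CovarianceNoise.

(** * The mean statistic *)

Section MeanNoise.
Context {d : measure_display} {T : measurableType d} {R : realType}.
Variable P : probability T R.
Context {p n : nat}.
Variable X : 'I_n -> T -> 'cV[R]_p.
Hypothesis rvX : forall i, random_vector (X i).
Hypothesis indX : forall (J : {set 'I_n}) (B : 'I_n -> set 'cV[R]_p),
  (forall i, borel_cV (B i)) ->
  P (\bigcap_(i in [set i | i \in J]) (X i @^-1` B i)) =
  (\prod_(i in J) P (X i @^-1` B i))%E.
Variable Y : 'I_n -> 'I_p -> T -> R.
Hypothesis Ymf : forall i a, mfun X [set i]%SET (Y i a).
Hypothesis Y8 : forall i a, Lmom P 8 (Y i a).
Hypothesis Y0 : forall i a, Ex P (Y i a) = 0.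
Variables (sg C : R).
Hypothesis sg0 : 0 < sg.
Hypothesis C1 : 1 <= C.
Hypothesis fourthC : forall i,
  \sum_a \sum_b \sum_c \sum_e fourth P Y i a b c e ^+ 2 <= C * sg ^+ 4.
Variables (g : 'I_n -> R) (dl : 'I_p -> R).
Hypothesis g01 : forall i, 0 <= g i <= 1.
Hypothesis dlsg : nsq dl <= sg.
Variables (r : seq nat) (L : R).
Hypothesis L1 : 1 <= L.
Hypothesis n0 : (0 < n)%N.
Hypothesis rL : forall m, m \in r -> [/\ (4 <= m)%N, (4 <= n - m)%N,
  n%:R <= L * m%:R & n%:R <= L * (n - m)%:R].

Local Notation e := (nsq dl).
Local Notation nR := (n%:R : R).
Local Notation ip := (ip Y).
Local Notation lin := (lin Y).
Local Notation scale := (@scale R n).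
Local Notation gbar1 := (gbar1 g).
Local Notation gbar2 := (gbar2 g).
Local Notation dcoef1 := (dcoef1 g).

Definition mcoef m (i k : 'I_n) : R :=
  if (i < m)%N then if (k < m)%N then (m%:R * (m%:R - 1))^-1 else - (m%:R * (n - m)%:R)^-1
  else if (k < m)%N then - (m%:R * (n - m)%:R)^-1
    else ((n - m)%:R * ((n - m)%:R - 1))^-1.

Definition zdot i k w : R :=
  \sum_a (Y i a w + g i * dl a) * (Y k a w + g k * dl a).

Definition Mord m w : R := \sum_i \sum_(k | k != i) mcoef m i k * zdot i k w.

Lemma zdotE i k w : zdot i k w =
  ip i k w + g k * lin dl i w + g i * lin dl k w + g i * g k * e.
Proof.
rewrite /zdot /nsq /ip /lin !mulr_sumr -!big_split/=.
by apply: eq_bigr => a _; ring.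
Qed.

Lemma mcoefC m i k : mcoef m i k = mcoef m k i.
Proof. by rewrite /mcoef; case: (i < m)%N; case: (k < m)%N. Qed.

(** The division by 2 keeps the first coefficient within [-1, 1] although m / (m - 1) exceeds 1, as
    [tailbound_scaled_linear] requires; the last term compensates for the omitted diagonal. *)
Lemma mcoef_g m i : m \in r -> \sum_(k | k != i) mcoef m i k * g k =
  (if (i < m)%N then m%:R^-1 * ((gbar1 m * (m%:R / (m%:R - 1)) - gbar2 m) / 2)
    else (n - m)%:R^-1 * ((gbar2 m * ((n - m)%:R / ((n - m)%:R - 1)) - gbar1 m) / 2)) * 2
  + (if (i < m)%N then m%:R^-1 * - (m%:R - 1)^-1
     else (n - m)%:R^-1 * - ((n - m)%:R - 1)^-1) * g i.
Proof.
move=> mr; have [p1 p2 mn _ _] := r_facts rL mr.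
have [m4 nm4 _ _] := rL mr.
have q1 (k : nat) : (4 <= k)%N -> 0 < k%:R - 1 :> R.
  by move=> k4; rewrite subr_gt0 ltr1n (leq_trans _ k4).
have := q1 _ m4; have := q1 _ nm4; move=> h2 h1.
have E : \sum_(k | k != i) mcoef m i k * g k = \sum_k mcoef m i k * g k - mcoef m i i * g i.
  by rewrite [in RHS](bigD1 i)//= addrAC subrr add0r.
rewrite E (bigID (fun k : 'I_n => (k < m)%N))/= /gbar1 /gbar2 /mcoef.
set G1 := \sum_(k < n | (k < m)%N) g k; set G2 := \sum_(k < n | ~~ (k < m)%N) g k.
case: (i < m)%N.
  rewrite (eq_bigr (fun k : 'I_n => (m%:R * (m%:R - 1))^-1 * g k)) => [|k ->]//.
  rewrite [X in _ + X - _](eq_bigr (fun k : 'I_n => - (m%:R * (n - m)%:R)^-1 * g k)); last first.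
    by move=> k /negbTE ->.
  by rewrite -!mulr_sumr -/G1 -/G2; field; rewrite !gt_eqF.
rewrite (eq_bigr (fun k : 'I_n => - (m%:R * (n - m)%:R)^-1 * g k)) => [|k ->]//.
rewrite [X in _ + X - _](eq_bigr (fun k : 'I_n => ((n - m)%:R * ((n - m)%:R - 1))^-1 * g k)); last first.
  by move=> k /negbTE ->.
by rewrite -!mulr_sumr -/G1 -/G2; field; rewrite !gt_eqF.
Qed.

(** With the diagonal excluded, each block gives the square of its mean up to (mean^2 - mean of
    squares) / (m - 1), an error of order 1/n. *)
Lemma mcoef_gg m : m \in r ->
  `|\sum_i (\sum_(k | k != i) mcoef m i k * g k) * g i - dcoef1 m ^+ 2| <= 4 * L / nR.
Proof.
move=> mr; have [p1 p2 mn _ _] := r_facts rL mr.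
have [m4 nm4 _ _] := rL mr; have [k1 k2] := invL_le n0 rL mr.
have [/andP[a0 a1] /andP[b0 b1]] := gbar_le g01 rL mr.
have q1 (k : nat) : (4 <= k)%N -> 4 <= k%:R :> R by rewrite (ler_nat _ 4 k).
have h1 := q1 _ m4; have h2 := q1 _ nm4.
pose s1 := m%:R^-1 * \sum_(i < n | (i < m)%N) g i ^+ 2.
pose s2 := (n - m)%:R^-1 * \sum_(i < n | ~~ (i < m)%N) g i ^+ 2.
have gg1 i : 0 <= g i ^+ 2 <= 1.
  by rewrite sqr_ge0 /=; have /andP[? ?] := g01 i; rewrite expr_le1.
have s1b : 0 <= s1 <= 1.
  rewrite mulr_ge0 ?invr_ge0 ?(ltW p1) ?sumr_ge0//= => [|i _]; last by have /andP[] := gg1 i.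
  rewrite /s1 mulrC ler_pdivrMr// mul1r -(sum_block_lt mn); apply: ler_sum => i _.
  by have /andP[] := gg1 i.
have s2b : 0 <= s2 <= 1.
  rewrite mulr_ge0 ?invr_ge0 ?(ltW p2) ?sumr_ge0//= => [|i _]; last by have /andP[] := gg1 i.
  rewrite /s2 mulrC ler_pdivrMr// mul1r -(sum_block_ge mn); apply: ler_sum => i _.
  by have /andP[] := gg1 i.
have -> : \sum_i (\sum_(k | k != i) mcoef m i k * g k) * g i - dcoef1 m ^+ 2 =
   (gbar1 m ^+ 2 - s1) / (m%:R - 1) + (gbar2 m ^+ 2 - s2) / ((n - m)%:R - 1).
  under eq_bigr => i _ do rewrite mcoef_g//.
  rewrite (bigID (fun k : 'I_n => (k < m)%N))/=.
  rewrite (eq_bigr (fun i => m%:R^-1 * (gbar1 m * (m%:R / (m%:R - 1)) - gbar2 m) * g i +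
     m%:R^-1 * - (m%:R - 1)^-1 * g i ^+ 2)); last first.
    by move=> i ->; field; rewrite !gt_eqF//; lra.
  rewrite [X in _ + X - _](eq_bigr (fun i => (n - m)%:R^-1 *
     (gbar2 m * ((n - m)%:R / ((n - m)%:R - 1)) - gbar1 m) * g i +
     (n - m)%:R^-1 * - ((n - m)%:R - 1)^-1 * g i ^+ 2)); last first.
    by move=> i /negbTE ->; field; rewrite !gt_eqF//; lra.
  rewrite !big_split/= -!mulr_sumr /dcoef1 /s1 /s2 /gbar1 /gbar2.
  by field; rewrite !gt_eqF//; lra.
have B (k gb s : R) : 4 <= k -> k^-1 <= L / nR -> 0 <= gb -> gb <= 1 -> 0 <= s <= 1 ->
    `|(gb ^+ 2 - s) / (k - 1)| <= 2 * (L / nR).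
  move=> k4 kl g0' g1' /andP[? ?]; have k0 : 0 < k by lra.
  rewrite normrM; apply: (@le_trans _ _ (1 * (2 * k^-1))); last by rewrite mul1r ler_pM2l.
  apply: ler_pM => //.
    have : 0 <= gb ^+ 2 <= 1 by rewrite sqr_ge0 /= expr_le1.
    by move=> /andP[? ?]; rewrite ler_norml; lra.
  rewrite ger0_norm ?invr_ge0; last by lra.
  rewrite -[leLHS]div1r ler_pdivrMr; last by lra.
  rewrite mulrAC ler_pdivlMr//; lra.
apply: (le_trans (ler_normD _ _)).
apply: (le_trans (lerD (B _ _ _ h1 k1 a0 a1 s1b) (B _ _ _ h2 k2 b0 b1 s2b))).
by rewrite le_eqVlt; apply/orP; left; apply/eqP; ring.
Qed.

Lemma MordE m w : m \in r -> Mord m w =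
  \sum_i \sum_(k | k != i) mcoef m i k * ip i k w
  + 2 * \sum_i (\sum_(k | k != i) mcoef m i k * g k) * lin dl i w
  + e * \sum_i (\sum_(k | k != i) mcoef m i k * g k) * g i.
Proof.
move=> mr; rewrite /Mord.
have S : \sum_i \sum_(k | k != i) mcoef m i k * (g i * lin dl k w) =
    \sum_i (\sum_(k | k != i) mcoef m i k * g k) * lin dl i w.
  rewrite (exchange_big_dep xpredT)//=; apply: eq_bigr => k _; rewrite mulr_suml.
  by apply: eq_big => [i|i _]; [rewrite eq_sym|rewrite mcoefC; ring].
rewrite mulr_natl mulr2n -[X in _ + (X + _)]S mulr_sumr -!big_split/=.
apply: eq_bigr => i _; under eq_bigr => k _ do rewrite zdotE.
set c := e; rewrite [X in _ + (_ + X)]mulr_suml [X in _ + c * X]mulr_suml.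
rewrite [X in _ + X]mulr_sumr -!big_split/=; apply: eq_bigr => k _; ring.
Qed.

Definition Msize : R := sg ^+ 2 + nR * e * sg.

(** The bilinear form falls under the quadratic block bound and the noise against delta under the
    linear one; the mean differs from the signal by the deterministic error of [mcoef_gg]. The sums
    of bounds amount to 36 * 2^12 <= 2^18. *)
Lemma tailbound_Mord : tailbound P r (fun m w => scale m * Mord m w
    - scale m * (dcoef1 m ^+ 2 * e)) (2 ^+ 18 * (L ^+ 4 * C ^+ 2 * Msize)).
Proof.
have nR0 : 0 < nR by rewrite ltr0n.
have L0 := lt_le_trans ltr01 L1; have C0 := ltW (lt_le_trans ltr01 C1).
have e0 : 0 <= e by exact: nsq_ge0.
have sg0' := ltW sg0.
have nes : 0 <= nR * e * sg by rewrite !mulr_ge0.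
have M1 : sg ^+ 2 <= Msize by rewrite /Msize lerDl.
have M2 : nR * e * sg <= Msize by rewrite /Msize lerDr sqr_ge0.
have GC : 0 <= L ^+ 4 * C ^+ 2 by rewrite mulr_ge0 ?exprn_ge0// ltW.
set G := L ^+ 4 * C ^+ 2 * Msize.
have G0 : 0 <= G by rewrite /G mulr_ge0 ?addr_ge0 ?sqr_ge0.
have bnd (c : nat) k q (v : R) : (k <= 4)%N -> (q <= 2)%N -> 0 <= v -> v <= Msize ->
    c%:R * (L ^+ k * C ^+ q * v) <= c%:R * G.
  move=> k4 q2 v0 vM; rewrite ler_wpM2l//; apply: ler_pM => //.
    by rewrite mulr_ge0 ?exprn_ge0// ltW.
  by apply: ler_pM; rewrite ?exprn_ge0 ?(ltW L0)// ler_weXn2l.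
have ln0 : 0 <= L / nR by rewrite divr_ge0// ltW.
have q4 (k : nat) : (4 <= k)%N -> 4 <= k%:R :> R by rewrite (ler_nat _ 4 k).
have T1 : tailbound P r (fun m w => scale m * \sum_i \sum_(k | k != i) mcoef m i k * ip i k w)
    (2112 * G).
  have K0 : 0 <= C * sg ^+ 2 by rewrite mulr_ge0 ?sqr_ge0.
  have c0 : 0 <= 2 * L ^+ 2 / nR by rewrite divr_ge0// mulr_ge0 ?sqr_ge0.
  have := @tailbound_quadratic_form _ _ _ P _ _ X rvX r ip (C * sg ^+ 2) (2 * L ^+ 2 / nR)
    (fun m => scale m * (m%:R * (m%:R - 1))^-1)
    (fun m => scale m * ((n - m)%:R * ((n - m)%:R - 1))^-1)
    (fun m => scale m * - (m%:R * (n - m)%:R)^-1).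
  move=> /(_ _ c0 K0 _ _ _) tb; apply: (tailbound_eq _ (tailbound_le (tb _ _ _ _) _)).
  - move=> m w mr; rewrite mulr_sumr; apply: eq_bigr => i _; rewrite mulr_sumr.
    apply: eq_bigr => k ki; rewrite [RHS]mulrA; congr (_ * _).
    by rewrite /mcoef; case: ifP => _; case: ifP.
  - move=> m mr; have [_ _ mn _ _] := r_facts rL mr.
    by rewrite mem_iota /= add0n ltnS.
  - move=> m mr; have [k1 k2] := invL_le n0 rL mr; have [p1 p2 _ _ _] := r_facts rL mr.
    have [m4 nm4 _ _] := rL mr; have hs := scale_le n0 rL mr.
    have a4 := q4 _ m4; have b4 := q4 _ nm4.
    have E : 2 * L ^+ 2 / nR = nR * (2 * ((L / nR) * (L / nR))) by field; rewrite gt_eqF.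
    have fin (c : R) : 0 <= c -> c <= 2 * ((L / nR) * (L / nR)) -> `|scale m * c| <= 2 * L ^+ 2 / nR.
      by move=> c0' hc; rewrite normrM E ler_pM// ger0_norm.
    have ll : (L / nR) * (L / nR) <= 2 * ((L / nR) * (L / nR)) by have := mulr_ge0 ln0 ln0; lra.
    have sq (k : R) : 4 <= k -> k^-1 <= L / nR ->
        0 <= (k * (k - 1))^-1 /\ (k * (k - 1))^-1 <= 2 * ((L / nR) * (L / nR)).
      move=> k4 kl; have k0 : 0 < k by lra.
      have k1' : 0 < k - 1 by lra.
      split; first by rewrite invr_ge0 mulr_ge0 ?(ltW k0) ?(ltW k1').
      apply: (@le_trans _ _ (2 * (k^-1 * k^-1))).
        rewrite (_ : (k * (k - 1))^-1 = k / (k - 1) * (k^-1 * k^-1)); last first.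
          by field; rewrite !gt_eqF.
        rewrite ler_wpM2r//; first by rewrite mulr_ge0 ?invr_ge0 ?(ltW k0).
        by rewrite ler_pdivrMr//; lra.
      by rewrite ler_pM2l// ler_pM ?invr_ge0 ?(ltW k0).
    have [s1 s2] := sq _ a4 k1; have [s3 s4] := sq _ b4 k2.
    split; [exact: fin|exact: fin|].
    rewrite mulrN normrN; apply: fin; first by rewrite invr_ge0 mulr_ge0 ?ltW.
    apply: le_trans ll; rewrite invfM.
    by apply: ler_pM => //; rewrite invr_ge0 ltW.
  - by move=> i j ij; exact: (degenerate_ip rvX indX Ymf Y8 Y0).
  - move=> i j ij.
    exact: (Ex_ip2 rvX indX Ymf Y8 sg0 C1 fourthC).
  - rewrite (_ : 528 * _ * _ = 2112 * (L ^+ 4 * C ^+ 1 * sg ^+ 2)).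
      by apply: (bnd _ 4%N 1%N) => //; exact: sqr_ge0.
    by field; rewrite gt_eqF.
have gb m : m \in r -> [/\ 0 <= gbar1 m, gbar1 m <= 1, 0 <= gbar2 m & gbar2 m <= 1].
  by move=> /(gbar_le g01 rL)[/andP[? ?] /andP[? ?]].
have U1 m : m \in r -> `|(gbar1 m * (m%:R / (m%:R - 1)) - gbar2 m) / 2| <= 1 /\
   `|(gbar2 m * ((n - m)%:R / ((n - m)%:R - 1)) - gbar1 m) / 2| <= 1.
  move=> mr; have [a0 a1 b0 b1] := gb m mr; have [m4 nm4 _ _] := rL mr.
  have h (k gb1 gb2 : R) : 4 <= k -> 0 <= gb1 -> gb1 <= 1 -> 0 <= gb2 -> gb2 <= 1 ->
      `|(gb1 * (k / (k - 1)) - gb2) / 2| <= 1.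
    move=> k4 *; have k0 : 0 < k - 1 by lra.
    have c1 : 0 <= k / (k - 1) by rewrite divr_ge0//; lra.
    have c2 : k / (k - 1) <= 2 by rewrite ler_pdivrMr//; lra.
    rewrite ler_norml; move: c1 c2; set c := k / _ => c1 c2.
    by apply/andP; split; nra.
  by split; apply: h => //; exact: q4.
have U2 m : m \in r -> `|- (m%:R - 1)^-1 : R| <= 1 /\ `|- ((n - m)%:R - 1)^-1 : R| <= 1.
  move=> mr; have [m4 nm4 _ _] := rL mr.
  have h (k : R) : 4 <= k -> `|- (k - 1)^-1| <= 1.
    move=> k4; rewrite normrN ger0_norm ?invr_ge0; last by lra.
    by rewrite invf_le1; lra.
  by split; apply: h; exact: q4.
have dlin i := degenerate_lin rvX indX Ymf Y8 Y0 dl i.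
have Llin i : Lmom P 2 (lin dl i) by have [] := dlin i.
have Elin i : Ex P (fun w => lin dl i w ^+ 2) <= C * (e * sg).
  by rewrite mulrA; exact: (Ex_lin2 Y8 sg0 C1 fourthC).
have E4 (c : R) h v : 0 <= c <= 4 -> Lmom P 2 h -> Ex P (fun w => h w ^+ 2) <= v ->
    Ex P (fun w => (c * h w) ^+ 2) <= 16 * v.
  move=> /andP[c0 c4] Lh hv; rewrite (_ : (fun w => _) = (fun w => c ^+ 2 * h w ^+ 2)).
    rewrite ExZ; last exact: L2_int2.
    apply: ler_pM => //; [exact: sqr_ge0|by apply: Ex_ge0 => w; exact: sqr_ge0|by nra].
  by apply/funext => w; rewrite exprMn.
have c4 : 0 <= (4 : R) <= 4 by rewrite lexx ler0n.
have c2 : 0 <= (2 : R) <= 4 by rewrite ler_nat ler0n.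
have T2 := tailbound_scaled_linear rvX L1 n0 rL U1
  (fun i => degenerateZ 4 (dlin i)) (fun i => E4 _ _ _ c4 (Llin i) (Elin i)).
have Eg i : Ex P (fun w => (2 * (g i * lin dl i w)) ^+ 2) <= 16 * (C * (e * sg)).
  apply: E4 => //; first exact: LmomZ.
  apply: Ex_sqZ => //.
  by have /andP[? ?] := g01 i; rewrite ger0_norm.
have T3 := tailbound_scaled_linear rvX L1 n0 rL U2
  (fun i => degenerateZ 2 (degenerateZ (g i) (dlin i))) Eg.
have Q : 20 * L ^+ 2 * (nR * (16 * (C * (e * sg)))) <= 320 * G.
  rewrite (_ : _ * _ = 320 * (L ^+ 2 * C ^+ 1 * (nR * e * sg))); last by ring.
  exact: (bnd _ 2%N 1%N).
have T23 := tailboundD (tailbound_le T2 Q) (tailbound_le T3 Q).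
have h4 m : m \in r -> `|scale m * (e * (\sum_i (\sum_(k | k != i) mcoef m i k * g k) * g i -
    dcoef1 m ^+ 2))| <= 4 * L * sg.
  move=> mr; rewrite normrM [X in _ * X <= _]normrM (ger0_norm e0).
  rewrite (_ : 4 * L * sg = nR * (sg * (4 * L / nR))); last by field; rewrite gt_eqF.
  apply: ler_pM; rewrite ?mulr_ge0//; first exact: (scale_le n0 rL mr).
  by apply: ler_pM => //; exact: mcoef_gg.
have T4 := tailbound_det P h4.
have h4' : (4 * L * sg) ^+ 2 <= 16 * G.
  rewrite (_ : _ ^+ 2 = 16 * (L ^+ 2 * C ^+ 0 * sg ^+ 2)); last by ring.
  by apply: (bnd _ 2%N 0%N) => //; exact: sqr_ge0.
have TT := tailboundD (tailboundD T1 T23) (tailbound_le T4 h4').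
apply: (tailbound_eq _ (tailbound_le TT _)).
  move=> m w mr; rewrite MordE//.
  have -> : 2 * (\sum_i (\sum_(k | k != i) mcoef m i k * g k) * lin dl i w) =
      \sum_(i < n) (if (i < m)%N then m%:R^-1 * ((gbar1 m * (m%:R / (m%:R - 1)) - gbar2 m) / 2)
    else (n - m)%:R^-1 * ((gbar2 m * ((n - m)%:R / ((n - m)%:R - 1)) - gbar1 m) / 2)) * (4 * lin dl i w)
    + \sum_(i < n) (if (i < m)%N then m%:R^-1 * - (m%:R - 1)^-1
     else (n - m)%:R^-1 * - ((n - m)%:R - 1)^-1) * (2 * (g i * lin dl i w)).
    rewrite mulr_sumr -big_split/=; apply: eq_bigr => i _; rewrite mcoef_g//.
    have aux (a b c l : R) : 2 * ((a * 2 + b * c) * l) = a * (4 * l) + b * (2 * (c * l)) by ring.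
    exact: aux.
  have aux (s a b c y x z : R) : s * a + (s * b + s * c) + s * (x * (y - z)) =
    s * (a + (b + c) + x * y) - s * (z * x) by ring.
  exact: aux.
have le12 (c : nat) : (c <= 2 ^ 12)%N -> c%:R * G <= 2 ^+ 12 * G.
  by move=> c12; rewrite ler_wpM2r// -natrX ler_nat.
have G23 : 4 * (320 * G + 320 * G) = 2560 * G by ring.
apply: (@le_trans _ _ (4 * (4 * (2 ^+ 12 * G + 2 ^+ 12 * G) + 2 ^+ 12 * G))).
  rewrite ler_pM2l// lerD ?le12// ler_pM2l// G23.
  by rewrite lerD ?le12.
have D (v : R) : 4 * (4 * (v + v) + v) = 36 * v by ring.
rewrite D (exprD 2 6 12) -[leRHS]mulrA ler_wpM2r//.
  by rewrite mulr_ge0 ?exprn_ge0.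
by rewrite -natrX ler_nat.
Qed.

End MeanNoise.

Lemma leq_mul_sub3 n : (12 <= n)%N -> (n <= 4 * (n - 3))%N.
Proof. lia. Qed.

(** There are ts - 3 windows of four consecutive observations before the change, at least half of ts
    once ts >= 6. This is where the lower bound 6 on both blocks comes from. *)
Lemma sum_ord_before (R : realType) n ts : (6 <= ts)%N -> (6 <= n - ts)%N ->
  ts%:R / 2 <= \sum_(k < n - 3 | (k + 3 < ts)%N) 1 :> R.
Proof.
move=> ts6 nts6.
rewrite (eq_bigl (fun k : 'I_(n - 3) => (k < ts - 3)%N)) => [|k]; last by lia.
rewrite -(big_ord_widen (n - 3) (fun=> 1 : R) (n1 := ts - 3)); last by lia.
rewrite sumr_const card_ord ler_pdivrMr// -natrM ler_nat; lia.
Qed.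

Lemma sum_ord_after (R : realType) n ts : (6 <= ts)%N -> (6 <= n - ts)%N ->
  (n - ts)%:R / 2 <= \sum_(k < n - 3 | (ts <= k)%N) 1 :> R.
Proof.
move=> ts6 nts6.
have E : \sum_(k < n - 3 | (ts <= k)%N) 1 + \sum_(k < n - 3 | (k < ts)%N) 1 = (n - 3)%:R :> R.
  rewrite -[in RHS](card_ord (n - 3)) -sumr_const [RHS](bigID (fun k : 'I_(n - 3) => (ts <= k)%N))/=.
  by congr (_ + _); apply: eq_bigl => k; lia.
have E2 : \sum_(k < n - 3 | (k < ts)%N) 1 = ts%:R :> R.
  rewrite -(big_ord_widen (n - 3) (fun=> 1 : R) (n1 := ts)); last by lia.
  by rewrite sumr_const card_ord.
have -> : \sum_(k < n - 3 | (ts <= k)%N) 1 = (n - 3)%:R - ts%:R :> R by rewrite -E E2 addrK.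
rewrite ler_pdivrMr// -natrB; last by lia.
by rewrite -natrM ler_nat; lia.
Qed.

(** * The scale estimator *)

Section Windows.
Context {n : nat}.

(** The default of [insubd] is never reached for s <= 3, by [shiftE]. *)
Definition shift (s : nat) (k : 'I_(n - 3)) : 'I_n :=
  insubd (widen_ord (leq_subr 3 n) k) (k + s)%N.

Lemma shiftE s k : (s <= 3)%N -> shift s k = (k + s)%N :> nat.
Proof.
move=> s3; rewrite /shift val_insubd; case: ifPn => // /negP[].
have := ltn_ord k; move: s3; lia.
Qed.

Definition blk k : {set 'I_n} := [set shift 0 k; shift 1 k; shift 2 k; shift 3 k]%SET.

Lemma uniq_shift k : uniq [:: shift 0 k; shift 1 k; shift 2 k; shift 3 k].
Proof. by rewrite -(map_inj_uniq val_inj) /= !shiftE// !inE; lia. Qed.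

Lemma blk_disjoint (k l : 'I_(n - 3)) : (k + 4 <= l)%N || (l + 4 <= k)%N -> blk l \subset (~: blk k)%SET.
Proof.
move=> kl; apply/fintype.subsetP => i; rewrite !inE -!orbA !negb_or.
by case/or4P => /eqP ->; rewrite -!val_eqE /= !shiftE//; lia.
Qed.

(** Overlapping windows start at distance at most 3, so [l + 3 - k] takes seven values. *)
Lemma card_near (k : 'I_(n - 3)) :
  (#|[pred l : 'I_(n - 3) | ~~ ((k + 4 <= l)%N || (l + 4 <= k)%N)]| <= 7)%N.
Proof.
rewrite -(card_ord 7).
pose f (l : 'I_(n - 3)) : 'I_7 := inord (l + 3 - k)%N.
rewrite -(@card_in_imset _ _ f); first exact: max_card.
move=> l l'; rewrite !inE /f => hl hl' /(congr1 val); rewrite /= !inordK; last first.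
- by move: hl; lia.
- by move: hl'; lia.
move=> e; apply: val_inj; move: e hl hl' => /=; lia.
Qed.

End Windows.

Section ScaleEstimator.
Context {d : measure_display} {T : measurableType d} {R : realType}.
Variable P : probability T R.
Context {p n : nat}.
Variable X : 'I_n -> T -> 'cV[R]_p.
Hypothesis rvX : forall i, random_vector (X i).
Hypothesis indX : forall (J : {set 'I_n}) (B : 'I_n -> set 'cV[R]_p),
  (forall i, borel_cV (B i)) ->
  P (\bigcap_(i in [set i | i \in J]) (X i @^-1` B i)) =
  (\prod_(i in J) P (X i @^-1` B i))%E.
Variable Y : 'I_n -> 'I_p -> T -> R.
Variable S : 'I_n -> 'M[R]_p.
Hypothesis Ymf : forall i a, mfun X [set i]%SET (Y i a).
Hypothesis Y8 : forall i a, Lmom P 8 (Y i a).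
Hypothesis Y0 : forall i a, Ex P (Y i a) = 0.
Hypothesis YS : forall i a b, Ex P (fun w => Y i a w * Y i b w) = S i a b.
Variables (sg C : R).
Hypothesis sg0 : 0 < sg.
Hypothesis C1 : 1 <= C.
Hypothesis fourthC : forall i,
  \sum_a \sum_b \sum_c \sum_e fourth P Y i a b c e ^+ 2 <= C * sg ^+ 4.
Variables (ts : nat) (dl : 'I_p -> R) (S1 Dl : 'M[R]_p) (L : R).
Let g (i : 'I_n) : R := (ts <= i)%N%:R.
Hypothesis Sg : forall i, S i = S1 - g i *: Dl.
Hypothesis dlsg : nsq dl <= sg.
Hypothesis L1 : 1 <= L.
Hypothesis ts6 : (6 <= ts)%N.
Hypothesis nts6 : (6 <= n - ts)%N.
Hypothesis Lts : n%:R <= L * ts%:R.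
Hypothesis Lnts : n%:R <= L * (n - ts)%:R.
Hypothesis sgS : sg ^+ 2 <= 2 * (fro S1 + fro (S1 - Dl)).

Local Notation Ex := (Ex P).
Local Notation Lmom := (Lmom P).
Local Notation nR := (n%:R : R).
Local Notation ip := (ip Y).
Local Notation dd := (dd Y g dl).

Let g01 i : 0 <= g i <= 1.
Proof. by rewrite /g ler0n lern1 leq_b1. Qed.

Definition xi (k : 'I_(n - 3)) w : R :=
  dd (shift 0 k) (shift 1 k) (shift 2 k) (shift 3 k) w ^+ 2.

Definition What w : R := (\sum_k xi k w) / (4 * (n - 3))%:R.

Let V : R := 2 ^+ 16 * (C ^+ 2 * sg ^+ 4).

Lemma mfun_xi k : mfun X (blk k) (xi k).
Proof.
have mY i a : i \in blk k -> mfun X (blk k) (Y i a).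
  move=> ik; have sub : [set i]%SET \subset blk k.
    by apply/fintype.subsetP => j; rewrite inE => /eqP ->.
  exact: (mfun_sub sub (@Ymf i a)).
have mz i j a : i \in blk k -> j \in blk k -> mfun X (blk k) (zz Y g dl i j a).
  move=> ik jk; apply: mfunD; first by apply: mfunB; exact: mY.
  exact: mfun_cst.
have mdd : mfun X (blk k) (dd (shift 0 k) (shift 1 k) (shift 2 k) (shift 3 k)).
  by apply: mfun_sum => a _; apply: mfunM; apply: mz; rewrite !inE eqxx ?orbT.
rewrite (_ : xi k = fun w => dd (shift 0 k) (shift 1 k) (shift 2 k) (shift 3 k) w *
  dd (shift 0 k) (shift 1 k) (shift 2 k) (shift 3 k) w); first exact: mfunM.
by apply/funext => w; rewrite /xi expr2.
Qed.

Let ddm k := M4_dd rvX indX Ymf Y8 sg0 C1 fourthC g01 dlsg (uniq_shift k).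

Lemma Lmom_xi k : Lmom 2 (xi k).
Proof.
have [Ld _] := ddm k; have := @LmomM _ _ _ P 2 _ _ Ld Ld.
by congr (Lmom _ _); apply/funext => w; rewrite /xi expr2.
Qed.

Lemma Ex_xi2 k : Ex (fun w => xi k w ^+ 2) <= V.
Proof.
have [_] := ddm k; rewrite -/V; congr (Ex _ <= _).
by apply/funext => w; rewrite /xi -exprM.
Qed.

Lemma Ex_xi_le k : Ex (xi k) <= 2 ^+ 8 * (C * sg ^+ 2).
Proof.
have C0 := le_trans ler01 C1.
have [Ld h] := ddm k; apply: (Ex_sq_le _ Ld).
  by apply: mulr_ge0; rewrite ?exprn_ge0// mulr_ge0 ?sqr_ge0.
by rewrite (_ : (_ * _) ^+ 2 = 2 ^+ 16 * (C ^+ 2 * sg ^+ 4)) //; ring.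
Qed.

(** Within one regime the means cancel and four inner products of distinct pairs remain. They are
    uncorrelated and each has second moment tr(S^2). *)
Lemma Ex_xi_same (k : 'I_(n - 3)) : (k + 3 < ts)%N || (ts <= k)%N ->
  Ex (xi k) = 4 * fro (S (shift 0 k)).
Proof.
move=> hk.
have gs s : (s <= 3)%N -> g (shift s k) = g (shift 0 k).
  by move=> s3; rewrite /g !shiftE//; congr ((_ : bool)%:R); move: hk s3; lia.
have Ss s : (s <= 3)%N -> S (shift s k) = S (shift 0 k) by move=> s3; rewrite !Sg gs.
have := uniq_shift k; move: (gs 1%N isT) (gs 2%N isT) (gs 3%N isT) (Ss 1%N isT) (Ss 2%N isT) (Ss 3%N isT).
rewrite /xi; set i := shift 0 k; set j := shift 1 k; set a := shift 2 k; set b := shift 3 k.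
move=> gj ga gb Sj Sa Sb; rewrite /= !inE !negb_or !andbT.
move=> /and3P[/and3P[ij ia ib] /andP[ja jb] ab].
have E : (fun w => dd i j a b w ^+ 2) = (fun w => (ip i a w - ip i b w) ^+ 2 +
    (ip j a w - ip j b w) ^+ 2 - 2 * ((ip i a w - ip i b w) * (ip j a w - ip j b w))).
  by apply/funext => w; rewrite ddE /gg gj ga gb subrr; ring.
have dg u v : u != v -> degenerate P X [set u; v]%SET (ip u v).
  by move=> uv; exact: (degenerate_ip rvX indX Ymf Y8 Y0).
have Lip u v : u != v -> Lmom 2 (ip u v) by move=> /dg[].
have L1M h h' : Lmom 2 h -> Lmom 2 h' -> Lmom 1 (fun w => h w * h' w).
  exact: (@LmomM _ _ _ P 1).
have orth u v u' v' : u != v -> u' != v' -> [set u; v]%SET != [set u'; v']%SET ->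
    Ex (fun w => ip u v w * ip u' v' w) = 0.
  by move=> uv uv' ne; exact: (degenerate_orth (dg _ _ uv) (dg _ _ uv')).
have E2 u v v' : u != v -> u != v' -> v != v' -> S v = S u -> S v' = S u ->
    Ex (fun w => (ip u v w - ip u v' w) ^+ 2) = 2 * fro (S u).
  move=> uv uv' vv' Sv Sv'.
  rewrite (_ : (fun w => _) = (fun w => ip u v w ^+ 2 + ip u v' w ^+ 2 -
    2 * (ip u v w * ip u v' w))); last by apply/funext => w; ring.
  have I1 := L2_int2 (Lip _ _ uv); have I2 := L2_int2 (Lip _ _ uv').
  have I3 := L1M _ _ (Lip _ _ uv) (Lip _ _ uv').
  rewrite ExB ?ExD ?ExZ//; [|exact: LmomD|exact: LmomZ].
  rewrite orth//; last first.
    apply/eqP => /finset.setP/(_ v); rewrite !inE eqxx orbT.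
    by rewrite eq_sym (negbTE uv) (negbTE vv').
  rewrite !(Ex_ipE rvX indX Ymf Y8 YS)// Sv Sv' ipm_fro; ring.
have Lb u v v' : u != v -> u != v' -> Lmom 2 (fun w => ip u v w - ip u v' w).
  by move=> uv uv'; apply: LmomB; exact: Lip.
have I1 := L2_int2 (Lb _ _ _ ia ib); have I2 := L2_int2 (Lb _ _ _ ja jb).
have I3 := L1M _ _ (Lb _ _ _ ia ib) (Lb _ _ _ ja jb).
rewrite E ExB ?ExD ?ExZ//; [|exact: LmomD|exact: LmomZ].
rewrite !E2 ?Sj//.
have -> : Ex (fun w => (ip i a w - ip i b w) * (ip j a w - ip j b w)) = 0.
  rewrite (_ : (fun w => _) = (fun w => (ip i a w * ip j a w - ip i a w * ip j b w) -
     (ip i b w * ip j a w - ip i b w * ip j b w))); last by apply/funext => w; ring.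
  have M u v u' v' : u != v -> u' != v' -> Lmom 1 (fun w => ip u v w * ip u' v' w).
    by move=> uv uv'; apply: L1M; exact: Lip.
  have ne u v u' v' : u != u' -> u != v' -> [set u; v]%SET != [set u'; v']%SET.
    move=> uu uv; apply/eqP => /finset.setP/(_ u); rewrite !inE eqxx /=.
    by rewrite (negbTE uu) (negbTE uv).
  rewrite ExB; [|by apply: LmomB; exact: M|by apply: LmomB; exact: M].
  by rewrite !ExB ?orth ?ne//; [ring|exact: M|exact: M|exact: M|exact: M].
ring.
Qed.

Let C0 : 0 <= C. Proof. exact: le_trans ler01 C1. Qed.
Let V0 : 0 <= V. Proof. by apply: mulr_ge0; rewrite ?exprn_ge0// mulr_ge0 ?exprn_ge0// ltW. Qed.

Let zeta (k : 'I_(n - 3)) w := xi k w - Ex (xi k).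

Let Lxi1 k : Lmom 1 (xi k). Proof. exact: (@Lmom_half _ _ _ P 1 _ (Lmom_xi k)). Qed.

Let Lzeta k : Lmom 2 (zeta k).
Proof. by apply: LmomB; [exact: Lmom_xi|exact: Lmom_cst]. Qed.

Let Ex_zeta k : Ex (zeta k) = 0.
Proof. by rewrite /zeta ExB ?Ex_cst ?subrr//; exact: Lmom_cst. Qed.

Let Ex_zeta2 k : Ex (fun w => zeta k w ^+ 2) <= V.
Proof.
by apply: (le_trans (Ex_sub_sq (Lmom_xi k))); exact: Ex_xi2.
Qed.

Let Ex_zetaM k l : Ex (fun w => zeta k w * zeta l w) <=
  if (k + 4 <= l)%N || (l + 4 <= k)%N then 0 else V.
Proof.
have LL1 : Lmom 1 (fun w => zeta k w * zeta l w) by exact: (@LmomM _ _ _ P 1).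
case: ifP => kl.
  have mz j : mfun X (blk j) (zeta j).
    by apply: mfunB; [exact: mfun_xi|exact: mfun_cst].
  have Lz j : Lmom 1 (zeta j) by exact: (@Lmom_half _ _ _ P 1 _ (Lzeta j)).
  rewrite (Ex_mfunM rvX indX (blk_disjoint kl) (mz k) (mz l))//.
  by rewrite Ex_zeta mul0r.
apply: (@le_trans _ _ (Ex (fun w => 2^-1 * (zeta k w ^+ 2 + zeta l w ^+ 2)))).
  apply: Ex_le => //.
    by apply: LmomZ; apply: LmomD; exact: L2_int2.
  move=> w; have := sqr_ge0 (zeta k w - zeta l w).
  by set a := zeta k w; set b := zeta l w => h; rewrite -subr_ge0; lra.
have I := L2_int2 (Lzeta k); have I' := L2_int2 (Lzeta l).
rewrite ExZ ?ExD//; last exact: LmomD.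
by rewrite mulrC ler_pdivrMr// mulr_natr mulr2n lerD ?Ex_zeta2.
Qed.

Let N : R := (n - 3)%:R.
Let n12 : (12 <= n)%N. Proof. by move: ts6 nts6; lia. Qed.
Let N0 : 0 < N. Proof. by rewrite ltr0n; move: n12; lia. Qed.

Lemma WhatE w : What w - Ex What = (4 * N)^-1 * \sum_k zeta k w.
Proof.
have E : What = (fun w => (4 * N)^-1 * \sum_k xi k w).
  by apply/funext => ?; rewrite /What natrM mulrC.
rewrite E ExZ ?Ex_sum//; last by apply: Lmom_sum.
by rewrite -mulrBr -sumrB.
Qed.

Lemma Lmom_What : Lmom 2 (fun w => What w - Ex What).
Proof.
apply: LmomB; last exact: Lmom_cst.
have E : What = (fun w => (4 * N)^-1 * \sum_k xi k w).
  by apply/funext => ?; rewrite /What natrM mulrC.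
by rewrite E; apply: LmomZ; apply: Lmom_sum => k _; exact: Lmom_xi.
Qed.

(** Disjoint windows are independent and each window meets at most seven, itself included, so the
    double sum has at most 7 N relevant terms. *)
Lemma What_var : Ex (fun w => (What w - Ex What) ^+ 2) <= V / N.
Proof.
have zM k l : Lmom 1 (fun w => zeta k w * zeta l w) by exact: (@LmomM _ _ _ P 1).
rewrite (_ : (fun w => _) = (fun w => ((4 * N) ^+ 2)^-1 * \sum_k \sum_l zeta k w * zeta l w)).
  rewrite ExZ; last by apply: Lmom_sum => k _; apply: Lmom_sum.
  rewrite Ex_sum; last by move=> k _; apply: Lmom_sum.
  apply: (@le_trans _ _ (((4 * N) ^+ 2)^-1 * \sum_(k < n - 3) 7 * V)).
    apply: ler_wpM2l; first by rewrite invr_ge0 sqr_ge0.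
    apply: ler_sum => k _; rewrite Ex_sum//.
    apply: (@le_trans _ _ (\sum_(l < n - 3) (if (k + 4 <= l)%N || (l + 4 <= k)%N then 0 else V))).
      by apply: ler_sum => l _; exact: Ex_zetaM.
    rewrite (eq_bigr (fun l : 'I_(n - 3) =>
      if ~~ ((k + 4 <= l)%N || (l + 4 <= k)%N) then V else 0)); last first.
      by move=> l _; case: ifP.
    rewrite -big_mkcond /= sumr_const -[leLHS]mulr_natl ler_wpM2r// ler_nat.
    exact: card_near.
  rewrite sumr_const card_ord -[X in _ * X <= _]mulr_natl -/N.
  rewrite (_ : _ * _ = 7 / 16 * (V / N)); last by field; rewrite gt_eqF.
  rewrite ler_piMl ?divr_ge0 ?(ltW N0)//; lra.
by apply/funext => w; rewrite WhatE exprMn exprVn; congr (_ * _); rewrite expr2 big_distrlr.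
Qed.

Lemma Ex_What : Ex What = (4 * N)^-1 * \sum_k Ex (xi k).
Proof.
have E : What = (fun w => (4 * N)^-1 * \sum_k xi k w).
  by apply/funext => ?; rewrite /What natrM mulrC.
by rewrite {1}E ExZ ?Ex_sum//; apply: Lmom_sum.
Qed.

Lemma Ex_What_le : Ex What <= 2 ^+ 6 * (C * sg ^+ 2).
Proof.
rewrite Ex_What; apply: (@le_trans _ _ ((4 * N)^-1 * \sum_(k < n - 3) (2 ^+ 8 * (C * sg ^+ 2)))).
  rewrite ler_wpM2l ?invr_ge0 ?mulr_ge0 ?(ltW N0)//.
  by apply: ler_sum => k _; exact: Ex_xi_le.
rewrite sumr_const card_ord -[X in _ * X <= _]mulr_natl -/N le_eqVlt; apply/orP; left; apply/eqP.
by field; rewrite gt_eqF.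
Qed.

(** Windows across the changepoint contribute a nonnegative amount and are dropped. The others
    estimate both traces, each with a share of at least 1/L of the sample up to constants, and [sgS]
    compares the sum of the traces with [sg]. *)
Lemma Ex_What_ge : sg ^+ 2 / (4 * L) <= Ex What.
Proof.
have L0 : 0 < L by exact: lt_le_trans L1.
have nR0 : 0 < nR by rewrite ltr0n (leq_trans _ n12).
have S1E (k : 'I_(n - 3)) : (k + 3 < ts)%N -> S (shift 0 k) = S1.
  move=> kt; rewrite Sg /g shiftE// (_ : (ts <= k + 0)%N = false) ?scale0r ?subr0//.
  by rewrite addn0 leqNgt (leq_ltn_trans (leq_addr 3 k) kt).
have SnE (k : 'I_(n - 3)) : (ts <= k)%N -> S (shift 0 k) = S1 - Dl.
  by move=> kt; rewrite Sg /g shiftE// addn0 kt scale1r.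
have F1 := fro_ge0 S1; have F2 := fro_ge0 (S1 - Dl).
have cnt1 := sum_ord_before R ts6 nts6; have cnt2 := sum_ord_after R ts6 nts6.
have B : 2 * (ts%:R * fro S1 + (n - ts)%:R * fro (S1 - Dl)) <= \sum_k Ex (xi k).
  apply: (@le_trans _ _ (\sum_(k < n - 3 | (k + 3 < ts)%N) 4 * fro S1 +
      \sum_(k < n - 3 | (ts <= k)%N) 4 * fro (S1 - Dl))).
    rewrite (eq_bigr (fun=> 1 * (4 * fro S1))) => [|? _]; last by rewrite mul1r.
    rewrite [X in _ <= _ + X](eq_bigr (fun=> 1 * (4 * fro (S1 - Dl)))) => [|? _]; last by rewrite mul1r.
    rewrite -!mulr_suml; nra.
  rewrite [X in X + _](eq_bigr (fun k => Ex (xi k))); last first.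
    by move=> k kt; rewrite Ex_xi_same ?kt// S1E.
  rewrite [X in _ + X](eq_bigr (fun k => Ex (xi k))); last first.
    by move=> k kt; rewrite Ex_xi_same ?kt ?orbT// SnE.
  have xi0 k : 0 <= Ex (xi k) by apply: Ex_ge0 => w; exact: sqr_ge0.
  rewrite big_mkcond [X in _ + X]big_mkcond -big_split/=; apply: ler_sum => k _.
  case: ifPn => h1; case: ifPn => h2; rewrite ?addr0 ?add0r//.
  by have := leq_trans h1 h2; rewrite ltnNge leq_addr.
rewrite Ex_What; apply: (@le_trans _ _ ((4 * N)^-1 *
    (2 * (ts%:R * fro S1 + (n - ts)%:R * fro (S1 - Dl))))); last first.
  by rewrite ler_wpM2l// invr_ge0 mulr_ge0// ltW.
have q (c F : R) : nR <= L * c -> 0 <= F -> nR / L * F <= c * F.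
  by move=> hc F0; rewrite ler_wpM2r// ler_pdivrMr// mulrC.
have q1 := q _ _ Lts F1; have q2 := q _ _ Lnts F2.
have Nn : N <= nR by rewrite ler_nat leq_subr.
apply: (@le_trans _ _ ((4 * N)^-1 * (2 * (nR / L * fro S1 + nR / L * fro (S1 - Dl))))).
  rewrite -mulrDr [leRHS](_ : _ = nR / N * ((fro S1 + fro (S1 - Dl)) * 2 / (4 * L))); last first.
    by field; rewrite !gt_eqF.
  apply: (@le_trans _ _ ((fro S1 + fro (S1 - Dl)) * 2 / (4 * L))).
    by rewrite ler_pM2r ?invr_gt0 ?mulr_gt0// mulrC.
  rewrite ler_peMl//; last by rewrite ler_pdivlMr ?mul1r.
  by rewrite divr_ge0 ?mulr_ge0 ?addr_ge0 ?(ltW L0).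
rewrite ler_wpM2l ?invr_ge0 ?mulr_ge0 ?(ltW N0)//.
by rewrite ler_pM2l// lerD.
Qed.

Lemma What_concentration : prob P [set w | sg ^+ 2 / (8 * L) < `|What w - Ex What|] <=
  2 ^+ 24 * (C ^+ 2 * L ^+ 2) / nR.
Proof.
have L0 : 0 < L by exact: lt_le_trans L1.
have nR0 : 0 < nR by rewrite ltr0n (leq_trans _ n12).
have t0 : 0 < sg ^+ 2 / (8 * L) by rewrite divr_gt0 ?exprn_gt0 ?mulr_gt0.
apply: (le_trans (markov_sq t0 Lmom_What)).
apply: (@le_trans _ _ (V / N / (sg ^+ 2 / (8 * L)) ^+ 2)).
  by rewrite ler_pM2r ?invr_gt0 ?exprn_gt0// What_var.
rewrite (_ : _ / _ = 2 ^+ 22 * (C ^+ 2 * L ^+ 2) / N); last first.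
  by rewrite /V; field; rewrite !gt_eqF.
rewrite ler_pdivrMr// [leRHS]mulrAC ler_pdivlMr//.
have nN : nR <= 4 * N.
  by rewrite /N -natrM ler_nat leq_mul_sub3.
have k0 : 0 <= 2 ^+ 22 * (C ^+ 2 * L ^+ 2).
  by apply: mulr_ge0; rewrite ?exprn_ge0// mulr_ge0 ?sqr_ge0.
apply: (le_trans (ler_wpM2l k0 nN)).
by rewrite (exprD 2 2 22) le_eqVlt; apply/orP; left; apply/eqP; ring.
Qed.

End ScaleEstimator.

(** * Gaussian tails and the drift of the combined statistic *)

Section GaussianTail.
Context {R : realType}.
Implicit Types x y z : R.

Definition gtail x : R := fine (normal_prob 0 1 `]x, +oo[).

(** Fisher's transform of a one-sided p-value; [Tstat] is the sum of two of them. *)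
Definition glog x : R := - 2 * ln (1 - Phi x).

Let nfin (A : set R) : measurable A -> normal_prob 0 1 A \is a fin_num.
Proof. by move=> mA; exact: fin_num_measure. Qed.

Lemma one_sub_Phi x : 1 - Phi x = gtail x.
Proof.
rewrite /Phi /gtail -setCitvl/=.
rewrite (@probability_setC _ _ R (normal_prob (0 : R) 1))//.
by rewrite [RHS]fineB//; exact: nfin.
Qed.

Lemma gtail_le x y : x <= y -> gtail y <= gtail x.
Proof.
move=> xy; apply: fine_le; [exact: nfin|exact: nfin|].
apply: le_measure; rewrite ?inE//.
by apply: subset_itv => //; rewrite bnd_simp.
Qed.

Lemma gtail_le1 x : gtail x <= 1.
Proof.
rewrite -lee_fin fineK; last exact: nfin.
exact: (@probability_le1 _ _ R (normal_prob (0 : R) 1)).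
Qed.

Lemma std_pdfE z : normal_pdf 0 1 z = normal_peak 1 * expR (- z ^+ 2 / 2).
Proof. by rewrite normal_pdfE// /normal_fun subr0 expr1n. Qed.

(** On ]x, x + 1], an interval of length one, the density is at least its value at x + 1. *)
Lemma gtail_ge x : 0 <= x -> normal_peak 1 * expR (- (x + 1) ^+ 2 / 2) <= gtail x.
Proof.
move=> x0; rewrite -lee_fin fineK; last exact: nfin.
apply: (@le_trans _ _ (normal_prob 0 1 `]x, x + 1]%classic)); last first.
  apply: le_measure; rewrite ?inE//.
  by apply: subset_itv => //; rewrite bnd_simp.
rewrite /normal_prob.
have -> : (normal_peak 1 * expR (- (x + 1) ^+ 2 / 2))%:E =
    (\int[lebesgue_measure]_(z in `]x, (x + 1)%R]) (normal_peak 1 * expR (- (x + 1) ^+ 2 / 2))%:E)%E.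
  rewrite integral_cst//= lebesgue_measure_itv/= lte_fin ltrDl ltr01.
  by rewrite -EFinD addrAC subrr add0r mule1.
apply: ge0_le_integral => //=.
- by move=> z _; rewrite lee_fin mulr_ge0 ?expR_ge0 ?normal_peak_ge0.
- by apply: measurable_funTS; apply/measurable_EFinP; exact: measurable_normal_pdf.
- move=> z; rewrite in_itv/= => /andP[xz zx1]; rewrite lee_fin std_pdfE.
  rewrite ler_wpM2l ?normal_peak_ge0// ler_expR ler_pM2r// lerN2.
  by rewrite lerXn2r ?nnegrE//; lra.
Qed.

Lemma gtail_gt0 x : 0 < gtail x.
Proof.
apply: (@lt_le_trans _ _ (gtail `|x|)); last by apply: gtail_le; exact: ler_norm.
apply: lt_le_trans (gtail_ge (normr_ge0 x)).
by rewrite mulr_gt0 ?expR_gt0// normal_peak_gt0// oner_eq0.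
Qed.

(** For z >= x >= 0 one has z^2 >= x^2 + (z - x)^2, so the density is at most exp(- x^2 / 2) times a
    Gaussian density centred at x. *)
Lemma gtail_upper x : 0 <= x -> gtail x <= expR (- x ^+ 2 / 2).
Proof.
move=> x0; rewrite -lee_fin fineK; last exact: nfin.
rewrite /normal_prob.
apply: (@le_trans _ _ (\int[lebesgue_measure]_(z in `]x, +oo[)
    ((expR (- x ^+ 2 / 2))%:E * (normal_pdf x 1 z)%:E)%E)%E).
  apply: ge0_le_integral => //=.
  - by move=> z _; rewrite lee_fin normal_pdf_ge0.
  - by apply: measurable_funTS; apply/measurable_EFinP; exact: measurable_normal_pdf.
  - apply: measurable_funTS; apply: measurable_funeM; apply/measurable_EFinP.
    exact: measurable_normal_pdf.
  - move=> z; rewrite in_itv/= andbT => xz; rewrite -EFinM lee_fin std_pdfE.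
    rewrite normal_pdfE// /normal_fun expr1n mulrCA -expRD.
    rewrite ler_wpM2l ?normal_peak_ge0// ler_expR -mulrDl ler_pM2r//; nra.
rewrite ge0_integralZl//=; last 2 first.
- by apply: measurable_funTS; apply/measurable_EFinP; exact: measurable_normal_pdf.
- by move=> z _; rewrite lee_fin normal_pdf_ge0.
rewrite -[leRHS]mule1; apply: lee_wpmul2l; first by rewrite lee_fin expR_ge0.
rewrite -(integral_normal_pdf x 1); apply: ge0_subset_integral => //=.
- by apply/measurable_EFinP; exact: measurable_normal_pdf.
- by move=> z _; rewrite lee_fin normal_pdf_ge0.
Qed.

Lemma glog_le x y : x <= y -> glog x <= glog y.
Proof.
move=> xy; rewrite /glog !one_sub_Phi !mulNr lerN2 ler_pM2l//.
by rewrite ler_ln ?posrE ?gtail_gt0// gtail_le.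
Qed.

Lemma glog_ge0 x : 0 <= glog x.
Proof.
rewrite /glog one_sub_Phi mulNr -mulrN mulr_ge0// oppr_ge0.
by apply: ln_le0; exact: gtail_le1.
Qed.

Lemma glog_ge_sq x : 0 <= x -> x ^+ 2 <= glog x.
Proof.
move=> x0; rewrite /glog one_sub_Phi.
have : ln (gtail x) <= - x ^+ 2 / 2.
  by rewrite -ler_expR lnK ?posrE ?gtail_gt0// gtail_upper.
lra.
Qed.

Lemma glog_le_sq x : 0 <= x -> glog x <= (x + 1) ^+ 2 + `|2 * ln (normal_peak 1 : R)|.
Proof.
move=> x0; rewrite /glog one_sub_Phi.
have pk : 0 < normal_peak 1 :> R by rewrite normal_peak_gt0// oner_eq0.
have : ln (normal_peak 1) - (x + 1) ^+ 2 / 2 <= ln (gtail x).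
  rewrite -ler_expR lnK ?posrE ?gtail_gt0// expRD lnK ?posrE// -mulNr.
  exact: gtail_ge.
have := ler_norm (- (2 * ln (normal_peak 1 : R))); rewrite normrN; lra.
Qed.

End GaussianTail.

(* The larger of the two signals produces the gain, the other one costs at most
   a small multiple of its square. *)
Lemma gap_of_larger (R : realType) (g : R -> R) (c0 A B c k k' M V M' V' : R) :
  0 <= c0 -> (forall x y, x <= y -> g x <= g y) -> (forall x, 0 <= g x) ->
  (forall x, 0 <= x -> x ^+ 2 <= g x) ->
  (forall x, 0 <= x -> g x <= (x + 1) ^+ 2 + c0) ->
  0 < c -> c <= 1 -> 0 <= B -> B <= A ->
  0 <= k' -> k' + c <= k -> k <= 1 -> 64 * (1 + c0) / c ^+ 2 <= A + B ->
  `|M - k * A| <= c ^+ 2 / 128 * (A + B) -> `|V - k * B| <= c ^+ 2 / 128 * (A + B) ->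
  `|M' - k' * A| <= c ^+ 2 / 128 * (A + B) -> `|V' - k' * B| <= c ^+ 2 / 128 * (A + B) ->
  g M' + g V' < g M + g V.
Proof.
move=> c0_ge0 g_le g_ge0 g_ge_sq g_le_sq.
move=> c_gt0 c1 B0 BA k'0 k'k k1 thr hM hV hM' hV'.
set s := A + B in thr hM hV hM' hV' *.
have A0 : 0 <= A by exact: le_trans BA.
set eta := c ^+ 2 / 128 in hM hV hM' hV' *.
have c2 : 0 < c ^+ 2 by rewrite exprn_gt0.
have c2c : c ^+ 2 <= c by rewrite expr2 ler_piMl// ltW.
have thr' : 64 * (1 + c0) <= c ^+ 2 * s.
  by move: thr; rewrite ler_pdivrMr// [leRHS]mulrC.
have s0 : 0 <= s by rewrite /s addr_ge0.
have s64 : 64 * (1 + c0) <= s.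
  by apply: (le_trans thr'); rewrite ler_piMl// (le_trans c2c).
have sA : s <= 2 * A by rewrite /s; lra.
have Bs : B <= s by rewrite /s; lra.
have es : eta * s = c ^+ 2 * s / 128 by rewrite /eta; ring.
have es0 : 0 <= eta * s by rewrite es divr_ge0// mulr_ge0// ltW.
set E := eta * s in hM hV hM' hV' es0 es *.
clearbody E => {thr}; clearbody s => {eta}.
have c2s : c ^+ 2 * s <= c * (2 * A) by rewrite ler_pM// ltW.
have cE : E <= c * A / 64 by move: c2s; rewrite es; clear; lra.
have cA : 32 * (1 + c0) <= c * A by move: c2s thr'; clear; lra.
have k0 : 0 <= k by move: k'0 k'k c_gt0; clear; lra.
have kc : c <= k by move: k'0 k'k; clear; lra.
have kk : k' <= k - c by move: k'k; clear; lra.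
have kA : c * A <= k * A by rewrite ler_wpM2r.
have kB : k * B <= s by apply: le_trans Bs; rewrite ler_piMl.
have kB0 : 0 <= k * B by rewrite mulr_ge0.
have kA' : k' * A <= k * A - c * A by rewrite -mulrBl ler_wpM2r.
have kA'0 : 0 <= k' * A by rewrite mulr_ge0.
have kB' : k' * B <= k * B by rewrite ler_wpM2r// (le_trans kk)// gerBl ltW.
have M1 : k * A - E <= M by move: hM; rewrite ler_norml; clear; lra.
have V1 : k * B - E <= V by move: hV; rewrite ler_norml; clear; lra.
have M2 : M' <= k * A - c * A + E by move: hM' kA'; rewrite ler_norml; clear; lra.
have V2 : V' <= k * B + E by move: hV' kB'; rewrite ler_norml; clear; lra.
move: cE cA c0_ge0 kA kB kB0 kA' kA'0 kB' es es0 thr' s64 => cE cA c00 kA kB kB0 kA' kA'0 kB' es es0 thr' s64.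
have gM : (k * A - E) ^+ 2 <= g M.
  by apply: le_trans (g_le _ _ M1); apply: g_ge_sq; move: cE cA c00 kA; clear; lra.
have gM' : g M' <= (k * A - c * A + E + 1) ^+ 2 + c0.
  by apply: (le_trans (g_le _ _ M2)); apply: g_le_sq; move: kA' kA'0 es0; clear; lra.
have gV' : g V' <= (k * B + E + 1) ^+ 2 + c0.
  by apply: (le_trans (g_le _ _ V2)); apply: g_le_sq; move: kB0 es0; clear; lra.
(* A difference of squares: one factor is at least [c * A / 2] because the error and the 1 are small
   against [c * A], the other at least [c * A]. *)
have gain : (c * A) ^+ 2 / 2 <= (k * A - E) ^+ 2 - (k * A - c * A + E + 1) ^+ 2.
  rewrite (_ : _ - _ = (c * A - 2 * E - 1) * (k * A + k * A - c * A + 1)); last by ring.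
  rewrite (_ : _ / 2 = (c * A / 2) * (c * A)); last by field.
  have h1 : 0 <= c * A by move: cA c00; clear; lra.
  apply: ler_pM => //; first by rewrite divr_ge0.
    by move: cE cA c00; clear; lra.
  by move: kA; clear; lra.
have loss : (k * B + E + 1) ^+ 2 - (2 * E + 1) * (2 * s + 1) <= g V.
  have E1 : 0 <= 2 * E + 1 by move: es0; clear; lra.
  have [h|h] := leP 0 (k * B - E).
    have : (k * B - E) ^+ 2 <= g V by apply: le_trans (g_le _ _ V1); exact: g_ge_sq.
    apply: le_trans; rewrite lerBlDr -lerBlDl.
    rewrite (_ : _ - _ = (2 * E + 1) * (2 * (k * B) + 1)); last by ring.
    by rewrite ler_wpM2l//; move: kB; clear; lra.
  apply: le_trans (g_ge0 V); rewrite subr_le0.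
  apply: (@le_trans _ _ ((2 * E + 1) * (2 * E + 1))).
    by rewrite expr2 ler_pM//; move: h kB0 es0; clear; lra.
  rewrite ler_wpM2l// es; have : c ^+ 2 * s <= s by rewrite ler_piMl// (le_trans c2c).
  by move: s0; clear; lra.
have gain' : (c * s) ^+ 2 / 8 <= (c * A) ^+ 2 / 2.
  have h1 : c * s <= c * (2 * A) by rewrite ler_pM2l.
  have h2 : 0 <= c * s by rewrite mulr_ge0// ltW.
  have : (c * s) ^+ 2 <= (c * (2 * A)) ^+ 2 by rewrite lerXn2r ?nnegrE// (le_trans h2).
  by clear; lra.
have cs2 : (c * s) ^+ 2 = c ^+ 2 * s * s by ring.
(* With [E = c ^+ 2 * s / 128] the product is about [c ^+ 2 * s ^+ 2 / 32], below the gain; the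
   threshold on [s] absorbs the lower-order terms. *)
have big : (2 * E + 1) * (2 * s + 1) + 2 * c0 < (c * s) ^+ 2 / 8.
  have u0 : c ^+ 2 * s <= s by rewrite ler_piMl// (le_trans c2c).
  rewrite cs2 es; move: thr' u0; set u := c ^+ 2 * s => thr' u0.
  have h1 : 64 * (1 + c0) * s <= u * s by rewrite ler_wpM2r.
  have h2 : 0 <= c0 * s by rewrite mulr_ge0.
  by move: h1 h2 c00 s64 u0; clear; lra.
by move: big gain' loss gain gV' gM' gM; clear; lra.
Qed.

Lemma glog_sum_gap (R : realType) (A B c k k' M V M' V' : R) :
  0 < c -> c <= 1 -> 0 <= A -> 0 <= B -> 0 <= k' -> k' + c <= k -> k <= 1 ->
  64 * (1 + `|2 * ln (normal_peak 1 : R)|) / c ^+ 2 <= A + B ->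
  `|M - k * A| <= c ^+ 2 / 128 * (A + B) -> `|V - k * B| <= c ^+ 2 / 128 * (A + B) ->
  `|M' - k' * A| <= c ^+ 2 / 128 * (A + B) -> `|V' - k' * B| <= c ^+ 2 / 128 * (A + B) ->
  glog M' + glog V' < glog M + glog V.
Proof.
move=> c_gt0 c1 A0 B0 k'0 k'k k1 thr hM hV hM' hV'.
have gap := gap_of_larger (normr_ge0 _) (@glog_le R) (@glog_ge0 R) (@glog_ge_sq R) (@glog_le_sq R).
have [BA|/ltW AB] := leP B A; first exact: (gap A B c k k').
rewrite [ltLHS]addrC [ltRHS]addrC; rewrite [A + B]addrC in thr hM hV hM' hV'.
exact: (gap B A c k k').
Qed.

(** * From the statistics to centred observations *)

Section Reindexing.
Context {R : realType} {p n : nat}.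
Variables (x : nat -> 'cV[R]_p) (mu : 'I_p -> R) (z : 'I_n -> 'I_p -> R).
Hypothesis xE : forall (i : 'I_n) a, x i.+1 a 0 = mu a + z i a.

Let D i k : R := \sum_a z i a * z k a.
Let E i j k l : R := \sum_a (z i a - z j a) * (z k a - z l a).

(** Observations are numbered from 1, ordinals from 0; observation i + 1 becomes the ordinal i
    throughout. *)
Lemma sum_shift a b (A : pred nat) (F : nat -> R) : (b <= n)%N ->
  \sum_(a.+1 <= i < b.+1 | A i) F i = \sum_(i < n | A i.+1 && (a <= i < b)%N) F i.+1.
Proof.
move=> bn; rewrite big_add1 /= big_geq_mkord.
rewrite (big_ord_widen_cond n (fun i => A i.+1 && (a <= i)%N) (fun i => F i.+1) bn).
by apply: eq_bigl => i; rewrite -andbA.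
Qed.

Lemma dotvE (i j k l : 'I_n) : dotv (x i.+1 - x j.+1) (x k.+1 - x l.+1) = E i j k l.
Proof. by apply: eq_bigr => a _; rewrite !mxE !xE; ring. Qed.

Lemma sum_off_diag (A : pred 'I_n) (c : R) (f : 'I_n -> R) : \sum_(i | A i) 1 = c ->
  \sum_(i | A i) \sum_(k | A k && (k != i)) f i = (c - 1) * \sum_(i | A i) f i.
Proof.
move=> Ac; rewrite mulr_sumr; apply: eq_bigr => i Ai.
have -> : c - 1 = \sum_(k | A k && (k != i)) 1 by apply/eqP; rewrite subr_eq -Ac (bigD1 i)//= addrC.
by rewrite mulr_suml; apply: eq_bigr => k _; rewrite mul1r.
Qed.

Lemma sum_off_diagC (A : pred 'I_n) (f : 'I_n -> 'I_n -> R) :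
  \sum_(i | A i) \sum_(k | A k && (k != i)) f k i =
  \sum_(i | A i) \sum_(k | A k && (k != i)) f i k.
Proof.
rewrite (exchange_big_dep A) /=; last by move=> i k _ /andP[].
apply: eq_bigr => i Ai; apply: eq_bigl => k.
by rewrite Ai eq_sym.
Qed.

(** Each summand of the statistic is a signed sum of four products [D], and summing over an index
    absent from [D] counts its free values. Both sides are compared after multiplication by the
    common denominator. *)
Lemma MstatE m : (4 <= m)%N -> (4 <= n - m)%N ->
  Mstat n x m = \sum_i \sum_(k | k != i) mcoef m i k * D i k.
Proof.
move=> m4 nm4; have mn : (m <= n)%N.
  by rewrite leqNgt; apply/negP => h; move: nm4; rewrite (eqP (ltnW h : (n - m == 0)%N)).
have p1 : 4 <= m%:R :> R by rewrite (ler_nat _ 4 m).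
have p2 : 4 <= (n - m)%:R :> R by rewrite (ler_nat _ 4 (n - m)).
pose I1 (i : 'I_n) := (i < m)%N; pose I2 (i : 'I_n) := ~~ (i < m)%N.
have C1 : \sum_(i | I1 i) 1 = m%:R :> R by exact: sum_block_lt.
have C2 : \sum_(i | I2 i) 1 = (n - m)%:R :> R by exact: sum_block_ge.
pose A := \sum_(i | I1 i) \sum_(k | I1 k && (k != i)) D i k.
pose B := \sum_(i | I1 i) \sum_(k | I2 k) D i k.
pose C := \sum_(i | I2 i) \sum_(k | I2 k && (k != i)) D i k.
have DC i k : D i k = D k i by apply: eq_bigr => a _; rewrite mulrC.
have rhs : \sum_i \sum_(k | k != i) mcoef m i k * D i k =
    A / (m%:R * (m%:R - 1)) - 2 * (B / (m%:R * (n - m)%:R)) +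
    C / ((n - m)%:R * ((n - m)%:R - 1)).
  have B' : B = \sum_(i | I2 i) \sum_(k | I1 k) D i k.
    rewrite /B exchange_big/=; apply: eq_bigr => i _; apply: eq_bigr => k _; exact: DC.
  have split2 (a b c : R) : a - 2 * b + c = (a - b) + (- b + c) by ring.
  rewrite (bigID I1)/= split2 [X in _ + (- (X / _) + _)]B'.
  rewrite /A /B /C !mulr_suml -!sumrN -!big_split/=; congr (_ + _).
    apply: eq_bigr => i i1; rewrite (bigID I1)/= !mulr_suml -sumrN; congr (_ + _).
      apply: eq_big => k; first by rewrite andbC.
      by case/andP => _ k1; rewrite /mcoef [(i < m)%N]i1 [(k < m)%N]k1 mulrC.
    apply: eq_big => k.
      rewrite /I2 -/(I1 k); case: (boolP (I1 k)) => k1; rewrite ?andbF//.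
      by rewrite andbT; apply: contraNneq k1 => ->.
    case/andP => _ k1; rewrite /mcoef [(i < m)%N]i1.
    by rewrite [(k < m)%N](negbTE k1) mulNr mulrC.
  apply: eq_bigr => i i1; rewrite (bigID I1)/= !mulr_suml -sumrN; congr (_ + _).
    apply: eq_big => k.
      case: (boolP (I1 k)) => k1; rewrite ?andbF// andbT.
      by apply: contraNneq i1 => <-.
    by case/andP => _ k1; rewrite /mcoef [(i < m)%N](negbTE i1) [(k < m)%N]k1 mulNr mulrC.
  apply: eq_big => k; first by rewrite andbC.
  by case/andP => _ k1; rewrite /mcoef [(i < m)%N](negbTE i1) [(k < m)%N](negbTE k1) mulrC.
have lhs : Mstat n x m * (m%:R * (m%:R - 1) * (n - m)%:R * ((n - m)%:R - 1)) =
    (n - m)%:R * ((n - m)%:R - 1) * A - 2 * ((m%:R - 1) * ((n - m)%:R - 1) * B) +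
    m%:R * (m%:R - 1) * C.
  rewrite /Mstat !natrM (_ : m.-1%:R = m%:R - 1 :> R); last first.
    by rewrite -subn1 natrB// (leq_trans _ m4).
  rewrite (_ : (n - m).-1%:R = (n - m)%:R - 1 :> R); last first.
    by rewrite -subn1 natrB// (leq_trans _ nm4).
  rewrite divfK; last by rewrite !mulf_neq0// gt_eqF//; lra.
  rewrite (sum_shift 0 xpredT _ mn).
  transitivity (\sum_(i1 | I1 i1) \sum_(i2 | I1 i2 && (i2 != i1))
      \sum_(j1 | I2 j1) \sum_(j2 | I2 j2 && (j2 != j1)) E i1 j1 i2 j2).
    apply: eq_bigr => i1 _; rewrite (sum_shift 0 _ _ mn).
    apply: eq_big => i2; first by rewrite eqSS eq_sym andbC.
    move=> _; rewrite (sum_shift m xpredT _ (leqnn n)).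
    apply: eq_big => j1; first by rewrite /I2 ltn_ord andbT -leqNgt.
    move=> _; rewrite (sum_shift m _ _ (leqnn n)).
    apply: eq_big => j2; first by rewrite /I2 ltn_ord andbT -leqNgt eqSS eq_sym andbC.
    by move=> _; rewrite dotvE.
  have EE i1 j1 i2 j2 : E i1 j1 i2 j2 = D i1 i2 + D j1 j2 - D i1 j2 - D i2 j1.
    by rewrite /E /D -big_split/= -!sumrB; apply: eq_bigr => a _; ring.
  have inner i1 i2 : \sum_(j1 | I2 j1) \sum_(j2 | I2 j2 && (j2 != j1)) E i1 j1 i2 j2 =
      (n - m)%:R * ((n - m)%:R - 1) * D i1 i2 + C -
      ((n - m)%:R - 1) * \sum_(j | I2 j) D i1 j - ((n - m)%:R - 1) * \sum_(j | I2 j) D i2 j.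
    rewrite -!(sum_off_diag _ C2) -(sum_off_diagC _ (fun j1 j2 => D i1 j1)) /C.
    have -> : (n - m)%:R * ((n - m)%:R - 1) * D i1 i2 =
        \sum_(j1 | I2 j1) \sum_(j2 | I2 j2 && (j2 != j1)) D i1 i2.
      rewrite (sum_off_diag (fun=> D i1 i2) C2) -[D i1 i2 in RHS]mul1r -mulr_suml C2; ring.
    rewrite -big_split -!sumrB/=; apply: eq_bigr => j1 _.
    by rewrite -big_split -!sumrB/=; apply: eq_bigr => j2 _; rewrite EE.
  under eq_bigr => i1 _ do under eq_bigr => i2 _ do rewrite inner.
  have -> : 2 * ((m%:R - 1) * ((n - m)%:R - 1) * B) =
      \sum_(i1 | I1 i1) \sum_(i2 | I1 i2 && (i2 != i1)) ((n - m)%:R - 1) * (\sum_(j | I2 j) D i1 j) +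
      \sum_(i1 | I1 i1) \sum_(i2 | I1 i2 && (i2 != i1)) ((n - m)%:R - 1) * (\sum_(j | I2 j) D i2 j).
    rewrite (sum_off_diagC _ (fun i1 i2 => ((n - m)%:R - 1) * (\sum_(j | I2 j) D i1 j))).
    rewrite !(sum_off_diag _ C1) -mulr_sumr -/B; ring.
  have -> : m%:R * (m%:R - 1) * C = \sum_(i1 | I1 i1) \sum_(i2 | I1 i2 && (i2 != i1)) C.
    rewrite (sum_off_diag (fun=> C) C1) -[C in RHS]mul1r -mulr_suml C1; ring.
  rewrite /A mulr_sumr -big_split/= -sumrB -big_split/=; apply: eq_bigr => i1 _.
  rewrite [X in _ = X - _ + _]mulr_sumr -big_split/= -sumrB -big_split/=.
  by apply: eq_bigr => i2 _; ring.
apply: (mulIf (x := m%:R * (m%:R - 1) * (n - m)%:R * ((n - m)%:R - 1))).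
  by rewrite !mulf_neq0// gt_eqF//; lra.
by rewrite lhs rhs; field; rewrite !gt_eqF//; lra.
Qed.

Let E4 (t : ('I_n * 'I_n) * ('I_n * 'I_n)) : R := E t.1.1 t.1.2 t.2.1 t.2.2 ^+ 2 / 4.

Lemma HsumE a b : (b <= n)%N -> Hsum x a.+1 b.+1 =
  \sum_(t | uniq4 t.1 t.2 && [&& (a <= t.1.1 < b)%N, (a <= t.1.2 < b)%N,
    (a <= t.2.1 < b)%N & (a <= t.2.2 < b)%N]) E4 t.
Proof.
move=> bn; rewrite /Hsum (sum_shift a xpredT _ bn).
transitivity (\sum_(i < n | (a <= i < b)%N) \sum_(j < n | (a <= j < b)%N)
    \sum_(y : 'I_n * 'I_n | (a <= y.1 < b)%N && ((a <= y.2 < b)%N && uniq4 (i, j) y)) E4 ((i, j), y)).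
  apply: eq_bigr => i _; rewrite (sum_shift a xpredT _ bn); apply: eq_bigr => j _.
  rewrite (sum_shift a xpredT _ bn).
  rewrite -(pair_big_dep (fun k : 'I_n => (a <= k < b)%N)
    (fun k l : 'I_n => (a <= l < b)%N && uniq4 (i, j) (k, l)) (fun k l => E4 ((i, j), (k, l))))/=.
  apply: eq_bigr => k _; rewrite (sum_shift a _ _ bn); apply: eq_big => l.
    by rewrite andbC /uniq4 /= !inE !eqSS.
  by move=> _; rewrite /Hker dotvE.
rewrite (pair_big (fun i : 'I_n => (a <= i < b)%N) (fun j : 'I_n => (a <= j < b)%N)
  (fun i j => \sum_(y : 'I_n * 'I_n | (a <= y.1 < b)%N && ((a <= y.2 < b)%N && uniq4 (i, j) y)) E4 ((i, j), y)))/=.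
rewrite pair_big_dep /=; apply: eq_big => [[[i j] [k l]]|[[i j] [k l]] _] //=.
case: (a <= i < b)%N; case: (a <= j < b)%N; case: (a <= k < b)%N; case: (a <= l < b)%N;
  by rewrite ?andbT ?andbF.
Qed.

Let lo m (y : 'I_n * 'I_n) := (y.1 < m)%N && (y.2 < m)%N.
Let hi m (y : 'I_n * 'I_n) := ~~ (y.1 < m)%N && ~~ (y.2 < m)%N.

Lemma crossE m : (m <= n)%N ->
  \sum_(1 <= i < m.+1) \sum_(1 <= j < m.+1 | i != j)
  \sum_(m.+1 <= k < n.+1) \sum_(m.+1 <= l < n.+1 | k != l)
    Hker (x i) (x j) (x k) (x l) =
  \sum_(t | uniq4 t.1 t.2 && (lo m t.1 && hi m t.2)) E4 t.
Proof.
move=> mn; rewrite (sum_shift 0 xpredT _ mn).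
transitivity (\sum_(i < n | (i < m)%N) \sum_(j < n | (j < m)%N && (i != j))
    \sum_(y : 'I_n * 'I_n | ~~ (y.1 < m)%N && (~~ (y.2 < m)%N && (y.1 != y.2))) E4 ((i, j), y)).
  apply: eq_bigr => i _; rewrite (sum_shift 0 _ _ mn).
  apply: eq_big => j; first by rewrite eqSS andbC.
  move=> _; rewrite (sum_shift m xpredT _ (leqnn n)).
  rewrite -(pair_big_dep (fun k : 'I_n => ~~ (k < m)%N)
    (fun k l : 'I_n => ~~ (l < m)%N && (k != l)) (fun k l => E4 ((i, j), (k, l))))/=.
  apply: eq_big => k; first by rewrite ltn_ord andbT -leqNgt.
  move=> _; rewrite (sum_shift m _ _ (leqnn n)); apply: eq_big => l.
    by rewrite ltn_ord andbT -leqNgt eqSS andbC.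
  by move=> _; rewrite /Hker dotvE.
rewrite (pair_big_dep (fun i : 'I_n => (i < m)%N) (fun i j : 'I_n => (j < m)%N && (i != j))
  (fun i j => \sum_(y : 'I_n * 'I_n | ~~ (y.1 < m)%N && (~~ (y.2 < m)%N && (y.1 != y.2))) E4 ((i, j), y)))/=.
rewrite pair_big /=; apply: eq_big => [[[i j] [k l]]|[[i j] [k l]] _] //=.
rewrite uniq4E /lo /hi /=.
have ne (u v : 'I_n) : (u < m)%N -> ~~ (v < m)%N -> u != v by move=> um; apply: contraNneq => <-.
case: (boolP (i < m)%N) => i1; case: (boolP (j < m)%N) => j1; rewrite ?andbF//=.
case: (boolP (k < m)%N) => k1; case: (boolP (l < m)%N) => l1; rewrite ?andbF//=.
by rewrite (ne i k) ?(ne i l) ?(ne j k) ?(ne j l)// andbT.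
Qed.

Lemma VstatE m : (4 <= m)%N -> (4 <= n - m)%N ->
  Vstat n x m = \sum_(t | uniq4 t.1 t.2) weight m t * E4 t.
Proof.
move=> m4 nm4; have mn : (m <= n)%N.
  by rewrite leqNgt; apply/negP => h; move: nm4; rewrite (eqP (ltnW h : (n - m == 0)%N)).
rewrite /Vstat HsumE// HsumE// crossE//.
(* The kernel is symmetric in its two pairs, so half of the doubled cross sum can be moved to the
   opposite order of blocks, as [weight] demands. *)
have swap : \sum_(t | uniq4 t.1 t.2 && (lo m t.1 && hi m t.2)) E4 t =
    \sum_(t | uniq4 t.1 t.2 && (hi m t.1 && lo m t.2)) E4 t.
  rewrite [LHS]big_mkcondr [RHS]big_mkcondr /=.
  rewrite -(uniq4_swap (fun u v => if lo m u && hi m v then E4 (u, v) else 0)).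
  apply: eq_bigr => -[[i j] [k l]] _ /=; rewrite andbC; case: ifP => // _.
  rewrite /E4 /=; congr (_ ^+ 2 / 4); apply: eq_bigr => a _; ring.
set c := (m ^_ 2 * (n - m) ^_ 2)%:R.
have split2 (a b u : R) : a + b - 2 / c * u = a + b + (- c^-1 * u - c^-1 * u) by ring.
pose U (t : ('I_n * 'I_n) * ('I_n * 'I_n)) := uniq4 t.1 t.2.
rewrite split2 {2}swap 4!(big_mkcondr _ _ U) /= {}/U.
rewrite mulr_suml mulr_suml !mulr_sumr -sumrB -!big_split/=; apply: eq_bigr => -[[i j] [k l]] u4.
rewrite /weight /lo /hi /= -/c.
rewrite !ltn_ord !andbT.
rewrite ![(m <= _)%N]leqNgt.
case: (i < m)%N; case: (j < m)%N; case: (k < m)%N; case: (l < m)%N => /=; ring.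
Qed.

End Reindexing.

Lemma add_eq4 (a b c : nat) : (a + c = 4)%N -> (2 <= a)%N -> (2 <= b)%N -> (b <= c)%N ->
  a = 2%N /\ c = 2%N.
Proof. lia. Qed.

(** * Fourth moments from fourth cumulants *)

Section FourthCumulant.
Context {d : measure_display} {T : measurableType d} {R : realType}.
Variable P : probability T R.

Let bmom (h : nat) (Z : 'I_h -> T -> R) (B : {set 'I_h}) : R :=
  fine ('E_P[fun w => (\prod_(j in B) Z j w)%R])%E.

Let i0 : 'I_4 := @Ordinal 4 0 isT.
Let i1 : 'I_4 := @Ordinal 4 1 isT.
Let i2 : 'I_4 := @Ordinal 4 2 isT.
Let i3 : 'I_4 := @Ordinal 4 3 isT.

(** The three pairings of four indices, listed by the partner of 0. *)
Let pairing (j : 'I_4) : {set {set 'I_4}} := [set [set i0; j]; ~: [set i0; j]]%SET.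

(** If the block of 0 has a nonempty complement, that complement contains a block of size at least
    2; so both have exactly two elements and no further block fits. *)
Lemma partition4 (pt : {set {set 'I_4}}) : finset.partition pt [set: 'I_4]%SET ->
  (forall B, B \in pt -> (2 <= #|B|)%N) ->
  pt = [set [set: 'I_4]%SET]%SET \/ exists2 j, j != i0 & pt = pairing j.
Proof.
move=> ppt big2; have [/eqP cov tri n0] := and3P ppt.
have in0 : i0 \in finset.cover pt by rewrite cov inE.
pose B0 := finset.pblock pt i0.
have B0pt : B0 \in pt by rewrite finset.pblock_mem.
have i0B0 : i0 \in B0 by rewrite finset.mem_pblock.
have other B : B \in pt -> B != B0 -> B \subset (~: B0)%SET.
  move=> Bpt BB0; rewrite finset.subsetC; rewrite -finset.disjoints_subset disjoint_sym.
  by have /finset.trivIsetP := tri; apply.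
have cc : (#|B0| + #|(~: B0)%SET| = 4)%N by rewrite cardsC card_ord.
have [C0|/finset.set0Pn[y yB0]] := eqVneq (~: B0)%SET finset.set0.
  left; have B0T : B0 = [set: 'I_4]%SET by rewrite -[B0]finset.setCK C0 finset.setC0.
  apply/finset.setP => B; rewrite !inE; apply/idP/eqP => [Bpt|->]; last by rewrite -B0T.
  apply/eqP; rewrite -B0T; apply: contraT => /(other _ Bpt).
  by rewrite C0 finset.subset0 => /eqP BE; move: n0; rewrite -BE Bpt.
right; have yc : y \in finset.cover pt by rewrite cov inE.
pose B1 := finset.pblock pt y.
have B1pt : B1 \in pt by rewrite finset.pblock_mem.
have yB1 : y \in B1 by rewrite finset.mem_pblock.
have B10 : B1 != B0 by apply: contraTneq yB1 => ->; rewrite finset.in_setC in yB0.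
have s1 := other _ B1pt B10.
have c0 := big2 _ B0pt; have c1 := big2 _ B1pt; have c01 := subset_leq_card s1.
have [cB0 cC] := add_eq4 cc c0 c1 c01.
have full B : B \in pt -> B != B0 -> B = (~: B0)%SET.
  move=> Bpt BB0; apply/eqP; rewrite finset.eqEcard other//= cC; exact: big2.
have : #|(B0 :\ i0)%SET| == 1%N by have := cardsD1 i0 B0; rewrite i0B0 cB0 => /eqP; rewrite (eqn_add2l 1 1) eq_sym.
move=> /cards1P[j jE]; exists j.
  by apply/eqP => j0; have := finset.in_setD1 i0 B0 i0; rewrite jE j0 finset.in_set1 eqxx.
have B0E : B0 = [set i0; j]%SET by rewrite -(finset.setD1K i0B0) jE.
apply/finset.setP => B; rewrite !inE -B0E; apply/idP/orP => [Bpt|[/eqP->|/eqP->]]//.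
  by have [->|/(full _ Bpt) ->] := eqVneq B B0; [left|right].
by rewrite -(full _ B1pt B10).
Qed.

(** The cumulant formula is solved for its one-block term. A singleton block contributes a vanishing
    mean, so only the pairings remain. *)
Lemma fourth_le_cum (Z : 'I_4 -> T -> R) : (forall j, fine ('E_P[Z j])%E = 0) ->
  `|bmom Z [set: 'I_4]%SET| <= `|cum P Z| +
  \sum_(j | j != i0) `|bmom Z [set i0; j]%SET * bmom Z (~: [set i0; j])%SET|.
Proof.
move=> Z0; pose term (pt : {set {set 'I_4}}) : R :=
  (-1) ^+ (#|pt|.-1) * (#|pt|.-1)`!%:R * \prod_(B in pt) bmom Z B.
have pT : finset.partition [set [set: 'I_4]%SET]%SET [set: 'I_4]%SET.
  apply/and3P; split; [by rewrite /finset.cover big_set1|exact: finset.trivIset1|].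
  by rewrite inE eq_sym; apply/finset.set0Pn; exists i0; rewrite inE.
have -> : bmom Z [set: 'I_4]%SET = cum P Z - \sum_(pt | finset.partition pt [set: 'I_4]%SET &&
    (pt != [set [set: 'I_4]%SET]%SET)) term pt.
  rewrite /cum (bigD1 [set [set: 'I_4]%SET]%SET)//= addrK.
  by rewrite /term big_set1 cards1 expr0 mul1r mul1r.
apply: (le_trans (ler_normB _ _)); rewrite lerD2l.
apply: (le_trans (ler_norm_sum _ _ _)).
have term0 pt : finset.partition pt [set: 'I_4]%SET ->
    (exists2 B, B \in pt & (#|B| < 2)%N) -> term pt = 0.
  move=> ppt [B Bpt B2]; rewrite /term (bigD1 B)//=.
  have -> : bmom Z B = 0; last by rewrite mul0r mulr0.
  have /and3P[_ _ n0] := ppt.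
  have : #|B| == 1%N.
    have : B != finset.set0 by apply: contraNneq n0 => <-.
    by rewrite -card_gt0 eqn_leq (B2 : (#|B| <= 1)%N).
  move=> /cards1P[j ->]; rewrite /bmom -[RHS](Z0 j); congr (fine ('E_P[_])).
  by apply/funext => w; rewrite big_set1.
have pairing_term j : j != i0 -> `|term (pairing j)| =
    `|bmom Z [set i0; j]%SET * bmom Z (~: [set i0; j])%SET|.
  move=> j0; have ne : [set i0; j]%SET != (~: [set i0; j])%SET.
    by apply/eqP => /finset.setP/(_ i0); rewrite !inE eqxx.
  rewrite /term /pairing big_setU1 ?inE//= big_set1 cards2 ne /= expr1 mulr1.
  by rewrite mulN1r normrN.
apply: (@le_trans _ _ (\sum_(pt : {set {set 'I_4}}) \sum_(j | j != i0)
    (if pt == pairing j then `|term (pairing j)| else 0))).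
  rewrite [leLHS]big_mkcond; apply: ler_sum => pt _.
  have S0 : 0 <= \sum_(j | j != i0) (if pt == pairing j then `|term (pairing j)| else 0).
    by apply: sumr_ge0 => j _; case: ifP.
  case: ifPn => // /andP[ppt piT].
  have [[B Bpt B2]|none] := pselect (exists2 B, B \in pt & (#|B| < 2)%N).
    by rewrite (term0 _ ppt) ?normr0//; exists B.
  have big2 B : B \in pt -> (2 <= #|B|)%N.
    by move=> Bpt; rewrite leqNgt; apply/negP => h; apply: none; exists B.
  case: (partition4 ppt big2) => [E|[j j0 E]]; first by rewrite E eqxx in piT.
  rewrite (bigD1 j)//= -E eqxx lerDl.
  by apply: sumr_ge0 => k _; case: ifP.
rewrite exchange_big/=; apply: ler_sum => j j0.
by rewrite -big_mkcond /= big_pred1_eq pairing_term.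
Qed.

Lemma sum_ffun4 p (F : 'I_p -> 'I_p -> 'I_p -> 'I_p -> R) :
  \sum_(l : {ffun 'I_4 -> 'I_p}) F (l i0) (l i1) (l i2) (l i3) =
  \sum_a \sum_b \sum_c \sum_e F a b c e.
Proof.
rewrite (eq_bigr (fun a => \sum_b \sum_(y : 'I_p * 'I_p) F a b y.1 y.2)); last first.
  by move=> a _; apply: eq_bigr => b _; rewrite (pair_bigA _ (F a b)).
rewrite (pair_bigA _ (fun a b => \sum_(y : 'I_p * 'I_p) F a b y.1 y.2)) pair_bigA/=.
rewrite [RHS](reindex (fun l : {ffun 'I_4 -> 'I_p} => ((l i0, l i1), (l i2, l i3))))//=.
apply: onW_bij.
exists (fun q : ('I_p * 'I_p) * ('I_p * 'I_p) =>
  [ffun j => tnth [tuple q.1.1; q.1.2; q.2.1; q.2.2] j]).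
  move=> l; apply/ffunP => j; rewrite ffunE.
  by case: j => [[|[|[|[|//]]]] h]; rewrite (tnth_nth (l i0)) /=; congr (l _); exact: val_inj.
by move=> [[a b] [c e]]; rewrite !ffunE !(tnth_nth a).
Qed.

(** A fourth moment is a cumulant plus three pairings, and the square of four summands costs the
    factor 4. Each pairing sums to [fro S ^+ 2], being a permutation of S (x) S. *)
Lemma fourth_moment_cum2 p (Y : 'I_p -> T -> R) (S : 'M[R]_p) :
  (forall a, fine ('E_P[Y a])%E = 0) ->
  (forall a b, fine ('E_P[fun w => (Y a w * Y b w)%R])%E = S a b) ->
  \sum_a \sum_b \sum_c \sum_e
    fine ('E_P[fun w => ((Y a w * Y b w) * (Y c w * Y e w))%R])%E ^+ 2 <=
  4 * (\sum_(l : {ffun 'I_4 -> 'I_p}) cum P (fun j => Y (l j)) ^+ 2 + 3 * fro S ^+ 2).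
Proof.
move=> Y0 YS.
pose q a b c e := S a b ^+ 2 * S c e ^+ 2.
have froq : fro S ^+ 2 = \sum_a \sum_b \sum_c \sum_e q a b c e by rewrite expr2 mul_sum22.
have q2 : \sum_a \sum_b \sum_c \sum_e q a c b e = fro S ^+ 2.
  by rewrite froq; apply: eq_bigr => a _; rewrite exchange_big.
have q3 : \sum_a \sum_b \sum_c \sum_e q a e b c = fro S ^+ 2.
  rewrite -q2; apply: eq_bigr => a _; apply: eq_bigr => b _.
  by rewrite exchange_big.
rewrite -(sum_ffun4 (fun a b c e => fine ('E_P[fun w => ((Y a w * Y b w) * (Y c w * Y e w))%R])%E ^+ 2)).
rewrite (_ : 3 * fro S ^+ 2 = \sum_(l : {ffun 'I_4 -> 'I_p}) (q (l i0) (l i1) (l i2) (l i3) +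
    q (l i0) (l i2) (l i1) (l i3) + q (l i0) (l i3) (l i1) (l i2))); last first.
  rewrite !big_split/= (sum_ffun4 q) (sum_ffun4 (fun a b c e => q a c b e)).
  by rewrite (sum_ffun4 (fun a b c e => q a e b c)) q2 q3 -froq; ring.
rewrite -big_split/= mulr_sumr; apply: ler_sum => l _.
pose Z (j : 'I_4) := Y (l j).
have m4E : fine ('E_P[fun w => ((Y (l i0) w * Y (l i1) w) * (Y (l i2) w * Y (l i3) w))%R])%E =
    bmom Z [set: 'I_4]%SET.
  congr (fine ('E_P[_])); apply/funext => w.
  rewrite (eq_bigl xpredT) => [|j]; last by rewrite inE.
  rewrite !big_ord_recl big_ord0 mulr1 /Z !mulrA.
  by congr (Y (l _) w * Y (l _) w * Y (l _) w * Y (l _) w); exact: val_inj.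
have m2E j k : j != k -> bmom Z [set j; k]%SET = S (l j) (l k).
  move=> jk; rewrite -YS; congr (fine ('E_P[_])); apply/funext => w.
  by rewrite big_setU1 ?inE//= big_set1.
have C1 : (~: [set i0; i1])%SET = [set i2; i3]%SET.
  by apply/finset.setP => -[[|[|[|[|//]]]] h]; rewrite !inE -!val_eqE.
have C2 : (~: [set i0; i2])%SET = [set i1; i3]%SET.
  by apply/finset.setP => -[[|[|[|[|//]]]] h]; rewrite !inE -!val_eqE.
have C3 : (~: [set i0; i3])%SET = [set i1; i2]%SET.
  by apply/finset.setP => -[[|[|[|[|//]]]] h]; rewrite !inE -!val_eqE.
have := fourth_le_cum (Z := Z) (fun j => Y0 (l j)).
rewrite big_mkcond !big_ord_recl big_ord0 /= addr0 add0r.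
have l1 : lift (@ord0 3) (@ord0 2) = i1 by exact: val_inj.
have l2 : lift (@ord0 3) (lift (@ord0 2) (@ord0 1)) = i2 by exact: val_inj.
have l3 : lift (@ord0 3) (lift (@ord0 2) (lift (@ord0 1) (@ord0 0))) = i3 by exact: val_inj.
rewrite l1 l2 l3 C1 C2 C3 !m2E// m4E.
set m := bmom _ _; set c := cum P Z; rewrite /q.
set t1 := S _ _; set t2 := S _ _; set t3 := S _ _; set t4 := S _ _; set t5 := S _ _; set t6 := S _ _.
have sq (x1 x2 x3 x4 x5 : R) : `|x1| <= `|x2| + (`|x3| + (`|x4| + `|x5|)) ->
    x1 ^+ 2 <= 4 * (x2 ^+ 2 + (x3 ^+ 2 + x4 ^+ 2 + x5 ^+ 2)).
  move=> h; rewrite -[x1 ^+ 2]real_normK ?num_real// -[x2 ^+ 2]real_normK ?num_real//.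
  rewrite -[x3 ^+ 2]real_normK ?num_real// -[x4 ^+ 2]real_normK ?num_real//.
  rewrite -[x5 ^+ 2]real_normK ?num_real//; move: h (normr_ge0 x1).
  set y1 := `|x1|; set y2 := `|x2|; set y3 := `|x3|; set y4 := `|x4|; set y5 := `|x5|.
  clearbody y1 y2 y3 y4 y5 => h y10.
  apply: (@le_trans _ _ ((y2 + (y3 + (y4 + y5))) ^+ 2)).
    by rewrite lerXn2r ?nnegrE// (le_trans y10).
  rewrite -subr_ge0 (_ : _ - _ = (y2 - y3) ^+ 2 + (y2 - y4) ^+ 2 + (y2 - y5) ^+ 2 +
    (y3 - y4) ^+ 2 + (y3 - y5) ^+ 2 + (y4 - y5) ^+ 2); last by ring.
  by rewrite !addr_ge0 ?sqr_ge0.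
move=> /sq; rewrite !exprMn; apply.
Qed.

End FourthCumulant.

(** * Localisation of the maximiser for fixed sample size *)

Section Standardization.
Context {F : realType}.
Variables (sg L C s e f nr eta : F).
Hypothesis sg0 : 0 < sg.
Hypothesis L1 : 1 <= L.
Hypothesis C1 : 1 <= C.
Hypothesis s0 : 0 < s.
Hypothesis sgs : sg <= 2 * L * s.
Hypothesis ssg : s <= 2 ^+ 4 * C * sg.
Hypothesis e0 : 0 <= e.
Hypothesis f0 : 0 <= f.
Hypothesis nr0 : 0 <= nr.
Hypothesis eta0 : 0 <= eta.

Let S := nr * (e / sg + f / sg ^+ 2).
Let A := nr * e / s.
Let B := nr * f / s ^+ 2.

Let AB0 : 0 <= A + B.
Proof. by rewrite addr_ge0 ?divr_ge0 ?mulr_ge0 ?exprn_ge0// ltW. Qed.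

(** Since [s] is at most a constant times [sg], standardising by the estimated scale instead of the
    true one shrinks the signal by a constant at most. *)
Lemma signal_le_standardized : S <= 2 ^+ 8 * C ^+ 2 * (A + B).
Proof.
have C0 := le_trans ler01 C1.
have i1 : sg^-1 <= 2 ^+ 4 * C / s by rewrite ler_pdivlMr// ler_pdivrMl// mulrC.
have i0 : 0 <= sg^-1 by rewrite invr_ge0 ltW.
have k0 : 0 <= 2 ^+ 4 * C by rewrite mulr_ge0 ?exprn_ge0.
have i2 : sg^-1 ^+ 2 <= 2 ^+ 8 * C ^+ 2 / s ^+ 2.
  rewrite (_ : _ / _ = (2 ^+ 4 * C / s) ^+ 2); last by field; rewrite gt_eqF.
  by rewrite lerXn2r ?nnegrE// divr_ge0// ltW.
rewrite /S mulrDr [leRHS]mulrDr; apply: lerD.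
  apply: (@le_trans _ _ (nr * (e * (2 ^+ 4 * C / s)))).
    by rewrite ler_wpM2l// ler_wpM2l.
  rewrite (_ : nr * _ = 2 ^+ 4 * C * A); last by rewrite /A; ring.
  apply: ler_wpM2r; first by rewrite divr_ge0 ?mulr_ge0// ltW.
  apply: ler_pM; rewrite ?exprn_ge0// ?ler_weXn2l ?ler1n//.
  by rewrite expr2 ler_peMl.
apply: (@le_trans _ _ (nr * (f * (2 ^+ 8 * C ^+ 2 / s ^+ 2)))).
  by rewrite ler_wpM2l// ler_wpM2l// -exprVn.
by rewrite le_eqVlt; apply/orP; left; apply/eqP; rewrite /B; ring.
Qed.

(** Here 2^8 C^2 converts [S] into [A + B], and 4 L^2 converts [sg ^+ 2] into [s ^+ 2]. *)
Let eta' := eta / (2 ^+ 10 * C ^+ 2 * L ^+ 2).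

Let eta'S : eta' * S * (4 * L ^+ 2) <= eta * (A + B).
Proof.
have C0 := lt_le_trans ltr01 C1; have L0 := lt_le_trans ltr01 L1.
have h : 0 <= eta' * (4 * L ^+ 2).
  by rewrite /eta' mulr_ge0 ?divr_ge0 ?mulr_ge0 ?exprn_ge0// ltW.
rewrite mulrAC; apply: (le_trans (ler_wpM2l h signal_le_standardized)).
rewrite le_eqVlt; apply/orP; left; apply/eqP; rewrite /eta'; field.
by rewrite !gt_eqF.
Qed.

Let S0 : 0 <= S.
Proof. by rewrite /S mulr_ge0// addr_ge0// divr_ge0// ?exprn_ge0// ltW. Qed.

Lemma standardize_M : s^-1 * (eta' * S * sg) <= eta * (A + B).
Proof.
have C0 := lt_le_trans ltr01 C1; have L0 := lt_le_trans ltr01 L1.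
have e'0 : 0 <= eta' by rewrite divr_ge0 ?mulr_ge0 ?exprn_ge0// ltW.
apply: le_trans eta'S; rewrite mulrCA; apply: ler_wpM2l; first exact: mulr_ge0.
rewrite mulrC ler_pdivrMr//; apply: (le_trans sgs); rewrite ler_wpM2r ?(ltW s0)//.
apply: ler_pM => //; rewrite ?(ltW L0)//; first by rewrite ler_nat.
by rewrite expr2 ler_peMl ?(ltW L0).
Qed.

Lemma standardize_V : (s ^+ 2)^-1 * (eta' * S * sg ^+ 2) <= eta * (A + B).
Proof.
have C0 := lt_le_trans ltr01 C1; have L0 := lt_le_trans ltr01 L1.
have e'0 : 0 <= eta' by rewrite divr_ge0 ?mulr_ge0 ?exprn_ge0// ltW.
apply: le_trans eta'S; rewrite mulrCA; apply: ler_wpM2l; first exact: mulr_ge0.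
rewrite mulrC ler_pdivrMr ?exprn_gt0//.
rewrite (_ : 4 * L ^+ 2 * s ^+ 2 = (2 * L * s) ^+ 2); last by ring.
by rewrite lerXn2r ?nnegrE ?mulr_ge0// ltW.
Qed.

End Standardization.

(* [e / sg] and [f / sg ^ 2] are the paper's mean and covariance gaps. *)
Lemma Vsize_bound (F : realType) (sg e f nr : F) : 0 < sg -> 0 <= e -> 0 <= f -> 0 <= nr ->
  sg ^+ 4 + nr * f * sg ^+ 2 + nr * e * sg ^+ 3 + nr ^+ 2 * e ^+ 2 * (f + e ^+ 2) <=
  sg ^+ 4 * (1 + nr * (e / sg + f / sg ^+ 2) +
    (e / sg + (e / sg) ^+ 2) * (nr * (e / sg + f / sg ^+ 2)) ^+ 2).
Proof.
move=> sg0 e0 f0 nr0; set a := e / sg; set b := f / sg ^+ 2.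
have a0 : 0 <= a by rewrite divr_ge0// ltW.
have b0 : 0 <= b by rewrite divr_ge0// exprn_ge0// ltW.
have -> : e = a * sg by rewrite /a divfK// gt_eqF.
have -> : f = b * sg ^+ 2 by rewrite /b divfK// expf_neq0// gt_eqF.
rewrite -subr_ge0 (_ : _ - _ = sg ^+ 4 * (nr ^+ 2 *
  (a ^+ 3 + a ^+ 2 * b + a * b ^+ 2 + 2 * (a ^+ 3 * b) + (a * b) ^+ 2))); last by ring.
apply: mulr_ge0; first by rewrite exprn_ge0// ltW.
apply: mulr_ge0; first exact: sqr_ge0.
have a3 := exprn_ge0 3 a0; have a2 := exprn_ge0 2 a0; have b2 := exprn_ge0 2 b0.
by rewrite !addr_ge0// ?sqr_ge0// mulr_ge0// mulr_ge0.
Qed.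

Lemma Msize_bound (F : realType) (sg e f nr : F) : 0 < sg -> 0 <= e -> 0 <= f -> 0 <= nr ->
  sg ^+ 2 + nr * e * sg <= sg ^+ 2 * (1 + nr * (e / sg + f / sg ^+ 2)).
Proof.
move=> sg0 e0 f0 nr0; rewrite mulrDr mulr1 lerD2l.
have b0 : 0 <= nr * f by rewrite mulr_ge0.
rewrite (_ : sg ^+ 2 * _ = nr * e * sg + nr * f); last by field; rewrite gt_eqF.
by rewrite lerDl.
Qed.

Lemma window_bounds (F : realType) (q m W U : F) : q + q <= m -> m <= U -> q <= U ->
  - q <= W - m -> W - m <= q -> q <= W <= U + U.
Proof. lra. Qed.

(** * One sample with a changepoint *)

Section Sample.
Context {d : measure_display} {T : measurableType d} {R : realType}.
Variable P : probability T R.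
Context {p n : nat}.
Variables (x : nat -> T -> 'cV[R]_p) (mu : nat -> 'cV[R]_p) (Sigma : nat -> 'M[R]_p).
Variables (y : nat -> T -> 'cV[R]_p) (ts : nat) (C0 : R).
Hypothesis rvx : forall i, (1 <= i <= n)%N -> random_vector (x i).
Hypothesis indx : independent_vectors P n x.
Hypothesis momx : forall i, (1 <= i <= n)%N -> finite_moments P 8 (x i).
Hypothesis muE : forall i, (1 <= i <= n)%N -> mu i = meanv P (x i).
Hypothesis SigmaE : forall i, (1 <= i <= n)%N -> Sigma i = covmx P (x i).
Hypothesis yE : forall i, (1 <= i <= n)%N -> y i = centered P (x i).
Hypothesis before : forall i, (1 <= i <= ts)%N -> (mu i, Sigma i) = (mu 1%N, Sigma 1%N).
Hypothesis after : forall i, (ts < i <= n)%N -> (mu i, Sigma i) = (mu n, Sigma n).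
Hypothesis cum4 : forall i, (1 <= i <= n)%N ->
  sum_cum2 P 4 (y i) <= C0 * (\tr (Sigma i ^+ 2)) `^ (4%:R / 2).
Hypothesis ts0 : (0 < ts)%N.
Hypothesis tsn : (ts < n)%N.

Definition smpX (i : 'I_n) := x i.+1.
Definition smpY (i : 'I_n) (a : 'I_p) w : R := x i.+1 w a 0 - mu i.+1 a 0.
Definition smpS (i : 'I_n) := Sigma i.+1.
Definition smpg (i : 'I_n) : R := (ts <= i)%N%:R.
Definition smpdl (a : 'I_p) : R := mu n a 0 - mu 1%N a 0.
(** The sign is opposite to that of [smpdl]: the means are mu_1 + g_i delta, the covariances Sigma_1
    - g_i Dl. *)
Definition smpDl : 'M[R]_p := Sigma 1%N - Sigma n.

Let inI (i : 'I_n) : (1 <= i.+1 <= n)%N. Proof. exact: ltn_ord. Qed.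

Lemma smp_rv i : random_vector (smpX i). Proof. exact: rvx. Qed.

Lemma smp_ind (J : {set 'I_n}) (B : 'I_n -> set 'cV[R]_p) :
  (forall i, borel_cV (B i)) ->
  P (\bigcap_(i in [set i | i \in J]) (smpX i @^-1` B i)) =
  (\prod_(i in J) P (smpX i @^-1` B i))%E.
Proof.
move=> mB; pose s := [seq i.+1 | i : 'I_n <- enum J].
have injS : injective (fun i : 'I_n => i.+1) by move=> i j [/val_inj].
pose B' k : set 'cV[R]_p := if insub k.-1 is Some i then B i else setT.
have B'E (i : 'I_n) : B' i.+1 = B i by rewrite /B' /= valK.
have mB' k : borel_cV (B' k).
  by rewrite /B'; case: insub => [i|]; [exact: mB|exact: borel_cVT].
have us : uniq s by rewrite map_inj_uniq ?enum_uniq.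
have sI : {subset s <= iota 1 n}.
  by move=> k /mapP[i _ ->]; rewrite mem_iota add1n; exact: ltn_ord.
have := indx us sI mB'.
rewrite big_map big_enum /= => E.
rewrite (eq_bigr (fun i : 'I_n => P (x i.+1 @^-1` B' i.+1))); last by move=> i _; rewrite B'E.
rewrite -E; congr (P _); apply/seteqP; split => w h.
  by move=> k /= /mapP[i iJ ->]; rewrite B'E; apply: h; rewrite /= -mem_enum.
move=> i /= iJ; rewrite -B'E; apply: h => /=.
by apply/mapP; exists i => //; rewrite mem_enum.
Qed.

Lemma smp_mfun i a : mfun smpX [set i]%SET (smpY i a).
Proof. by apply: mfunB; [exact: mfun_coord|exact: mfun_cst]. Qed.

Lemma smp_Lmom i a : Lmom P 8 (smpY i a).
Proof.
apply: LmomB; last exact: Lmom_cst.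
split; last exact: (momx (inI i) a).
by apply: (mfun_measurable smp_rv (J := [set i]%SET)); exact: mfun_coord.
Qed.

Lemma meanvE i a : (1 <= i <= n)%N -> mu i a 0 = Ex P (fun w => x i w a 0).
Proof. by move=> iI; rewrite muE// mxE unlock. Qed.

Lemma smp_Lx (i : 'I_n) a : Lmom P 1 (fun w => x i.+1 w a 0).
Proof.
have L8 : Lmom P 8 (fun w => x i.+1 w a 0).
  split; last exact: (momx (inI i) a).
  by apply: (mfun_measurable smp_rv (J := [set i]%SET)); exact: mfun_coord.
exact: (@Lmom_half _ _ _ P 1 _ (@Lmom_half _ _ _ P 2 _ (@Lmom_half _ _ _ P 4 _ L8))).
Qed.

Lemma smp_mean0 i a : Ex P (smpY i a) = 0.
Proof.
have L := smp_Lx i a.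
by rewrite /smpY ExB ?Ex_cst -?meanvE ?subrr//; exact: Lmom_cst.
Qed.

Lemma smp_cov i a b : Ex P (fun w => smpY i a w * smpY i b w) = smpS i a b.
Proof.
rewrite /smpS SigmaE ?inI// mxE covariance.unlock /Ex expectation.unlock.
congr (fine (integral _ _ _)); apply/funext => w /=.
by rewrite /smpY !muE ?inI// !mxE expectation.unlock.
Qed.

Lemma smp_S1 (i : 'I_n) : smpS i = Sigma 1%N - smpg i *: smpDl.
Proof.
rewrite /smpS /smpg /smpDl; have [tsi|its] := leqP ts i.
  have [_ ->] := after (i := i.+1) (introT andP (conj tsi (ltn_ord i))).
  by rewrite scale1r subKr.
by have [_ ->] := before (i := i.+1) its; rewrite scale0r subr0.
Qed.

Lemma smp_xE (i : 'I_n) a w :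
  x i.+1 w a 0 = mu 1%N a 0 + (smpY i a w + smpg i * smpdl a).
Proof.
rewrite /smpY /smpg /smpdl; have [tsi|its] := leqP ts i.
  have [-> _] := after (i := i.+1) (introT andP (conj tsi (ltn_ord i))); rewrite mul1r; ring.
have [-> _] := before (i := i.+1) its; rewrite mul0r; ring.
Qed.

Lemma smp_Ssym i a b : smpS i a b = smpS i b a.
Proof. by rewrite -!smp_cov; congr (Ex _ _); apply/funext => w; rewrite mulrC. Qed.

Lemma tr_sq_fro (K : 'M[R]_p) : (forall a b, K a b = K b a) -> \tr (K ^+ 2) = fro K.
Proof.
move=> Ks; rewrite expr2 /mxtrace /fro; apply: eq_bigr => a _.
by rewrite mxE; apply: eq_bigr => b _; rewrite [K b a]Ks expr2.
Qed.

Let o1 : 'I_n := Ordinal (ltn_trans ts0 tsn).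
Let o2 : 'I_n := Ordinal tsn.

Let S_o1 : smpS o1 = Sigma 1%N. Proof. by []. Qed.

Let S_o2 : smpS o2 = Sigma n.
Proof. by have [_ E] := after (i := ts.+1) (introT andP (conj (leqnn _) tsn)). Qed.

Lemma smp_S2 (i : 'I_n) : smpS i = Sigma 1%N \/ smpS i = Sigma n.
Proof.
rewrite /smpS; have [tsi|its] := leqP ts i; [right|left].
  by have [_ ->] := after (i := i.+1) (introT andP (conj tsi (ltn_ord i))).
by have [_ ->] := before (i := i.+1) its.
Qed.

Let sym1 a b : Sigma 1%N a b = Sigma 1%N b a. Proof. by rewrite -S_o1 smp_Ssym. Qed.
Let symn a b : Sigma n a b = Sigma n b a. Proof. by rewrite -S_o2 smp_Ssym. Qed.

(** The trace of the product of the two covariance matrices is the second moment of the inner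
    product of two independent observations, hence nonnegative. This makes [smpsg] dominate both
    covariances in [smp_Ssg]. *)
Lemma smp_ipm_ge0 : 0 <= ipm (Sigma 1%N) (Sigma n).
Proof.
rewrite -S_o1 -S_o2 -(Ex_ipE smp_rv smp_ind smp_mfun smp_Lmom smp_cov).
  by apply: Ex_ge0 => w; exact: sqr_ge0.
by rewrite -val_eqE /= eq_sym -lt0n.
Qed.

Definition smpsg : R := Num.sqrt (\tr ((Sigma 1%N + Sigma n) ^+ 2)).

Lemma fro_expand (A B : 'M[R]_p) (c : R) : fro (A + c *: B) = fro A + c ^+ 2 * fro B + 2 * c * ipm A B.
Proof.
rewrite /fro /ipm !mulr_sumr -!big_split/=; apply: eq_bigr => a _.
by rewrite !mulr_sumr -!big_split/=; apply: eq_bigr => b _; rewrite !mxE; ring.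
Qed.

Lemma smpsg_tr : smpsg ^+ 2 = \tr ((Sigma 1%N + Sigma n) ^+ 2).
Proof.
rewrite /smpsg tr_sq_fro => [|a b]; last by rewrite !mxE sym1 symn.
by rewrite sqr_sqrtr// fro_ge0.
Qed.

Lemma smpsg_sq : smpsg ^+ 2 = fro (Sigma 1%N) + fro (Sigma n) + 2 * ipm (Sigma 1%N) (Sigma n).
Proof.
rewrite smpsg_tr tr_sq_fro => [|a b]; last by rewrite !mxE sym1 symn.
by rewrite -[Sigma n]scale1r fro_expand scale1r; ring.
Qed.

Lemma smp_DlE : \tr ((Sigma 1%N - Sigma n) ^+ 2) = fro smpDl.
Proof. by apply: tr_sq_fro => a b; rewrite !mxE sym1 symn. Qed.

Lemma smp_dlE : enorm (mu 1%N - mu n) ^+ 2 = nsq smpdl.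
Proof.
rewrite /enorm sqr_sqrtr; last by apply: sumr_ge0 => a _; rewrite -expr2 sqr_ge0.
by apply: eq_bigr => a _; rewrite !mxE /smpdl; ring.
Qed.

Lemma smp_Ssg i : fro (smpS i) <= smpsg ^+ 2.
Proof.
have h := smp_ipm_ge0; have h1 := fro_ge0 (Sigma 1%N); have h2 := fro_ge0 (Sigma n).
rewrite smpsg_sq; case: (smp_S2 i) => ->; lra.
Qed.

Lemma smpsg_le : smpsg ^+ 2 <= 2 * (fro (Sigma 1%N) + fro (Sigma 1%N - smpDl)).
Proof.
rewrite subKr smpsg_sq; have := fro_ge0 (Sigma 1%N - Sigma n).
by rewrite -[- Sigma n]scaleN1r fro_expand; lra.
Qed.

(** The constant of [fourth_moment_cum2]; the absolute value allows for any sign of [C0] and keeps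
    the result at least 1. *)
Definition smpC : R := 4 * (`|C0| + 3).

Lemma smpC_ge1 : 1 <= smpC.
Proof. by have := normr_ge0 C0; rewrite /smpC; lra. Qed.

Lemma smp_fourth i :
  \sum_a \sum_b \sum_c \sum_e fourth P smpY i a b c e ^+ 2 <= smpC * smpsg ^+ 4.
Proof.
have E0 a : fine ('E_P[smpY i a])%E = 0 by rewrite -(smp_mean0 i a) expectation.unlock.
have ES a b : fine ('E_P[fun w => (smpY i a w * smpY i b w)%R])%E = smpS i a b.
  by rewrite -smp_cov expectation.unlock.
have := fourth_moment_cum2 E0 ES.
rewrite expectation.unlock -[X in X <= _ -> _]/(\sum_a \sum_b \sum_c \sum_e fourth P smpY i a b c e ^+ 2).
move=> /le_trans; apply; rewrite /smpC -mulrA ler_pM2l//.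
have F := smp_Ssg i; have F0 := fro_ge0 (smpS i).
have F2 : fro (smpS i) ^+ 2 <= smpsg ^+ 4.
  by rewrite -[smpsg ^+ 4]/(smpsg ^+ (2 * 2)) exprM lerXn2r ?nnegrE ?sqr_ge0.
have Cc : \sum_(l : {ffun 'I_4 -> 'I_p}) cum P (fun j => smpY i (l j)) ^+ 2 <= `|C0| * fro (smpS i) ^+ 2.
  have := cum4 (inI i).
  rewrite tr_sq_fro => [|a b]; last exact: smp_Ssym.
  rewrite (_ : 4%:R / 2 = 2%:R :> R); last by field.
  rewrite powR_mulrn//.
  move=> h; apply: (@le_trans _ _ (C0 * fro (smpS i) ^+ 2)); last first.
    by rewrite ler_wpM2r ?sqr_ge0// ler_norm.
  apply: le_trans h; rewrite /sum_cum2 le_eqVlt; apply/orP; left; apply/eqP.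
  apply: eq_bigr => l _; congr (cum _ _ ^+ 2); apply/funext => j; apply/funext => w.
  by rewrite yE ?inI// /centered mxE [in RHS]mxE /smpY muE ?inI.
have := normr_ge0 C0; have := sqr_ge0 (fro (smpS i)); nra.
Qed.

Local Notation sc := (@scale R n).

Variables (r : seq nat) (L : R).
Hypothesis sg0 : 0 < smpsg.
Hypothesis dlsg : nsq smpdl <= smpsg.
Hypothesis L1 : 1 <= L.
Hypothesis rL : forall m, m \in r -> [/\ (4 <= m)%N, (4 <= n - m)%N,
  n%:R <= L * m%:R & n%:R <= L * (n - m)%:R].
Hypothesis rn : (size r <= n)%N.

Let n0 : (0 < n)%N. Proof. exact: ltn_trans tsn. Qed.

Lemma smp_g01 i : 0 <= smpg i <= 1.
Proof. by rewrite /smpg ler0n lern1 leq_b1. Qed.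

Lemma smp_tailbound_M : tailbound P r (fun m w =>
  sc m * Mstat n (fun i => x i w) m - sc m * (dcoef1 smpg m ^+ 2 * nsq smpdl))
  (2 ^+ 18 * (L ^+ 4 * smpC ^+ 2 * (@Msize R p n smpsg smpdl))).
Proof.
apply: (tailbound_eq _ (tailbound_Mord smp_rv smp_ind smp_mfun smp_Lmom smp_mean0
  sg0 smpC_ge1 smp_fourth smp_g01 dlsg L1 n0 rL)).
move=> m w /rL[m4 nm4 _ _]; congr (_ * _ - _).
by rewrite (MstatE (fun i a => smp_xE i a w) m4 nm4).
Qed.

Lemma smp_tailbound_V : tailbound P r (fun m w =>
  sc m * Vstat n (fun i => x i w) m - sc m * (dcoef1 smpg m ^+ 2 * fro smpDl))
  (2 ^+ 32 * (L ^+ 2 * (Gc smpC L * (@Vsize R p n smpsg smpdl smpDl)))).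
Proof.
apply: (tailbound_eq _ (tailbound_Vord smp_rv smp_ind smp_mfun smp_Lmom smp_mean0 smp_cov
  sg0 smpC_ge1 smp_Ssg smp_fourth smp_g01 smp_S1 dlsg L1 n0 rL rn)).
move=> m w /rL[m4 nm4 _ _]; congr (_ * _ - _).
rewrite (VstatE (fun i a => smp_xE i a w) m4 nm4); apply: eq_bigr => t _.
rewrite /HH /dd /zz /gg; congr (_ * (_ ^+ 2 / 4)); apply: eq_bigr => a _; ring.
Qed.

Hypothesis ts6 : (6 <= ts)%N.
Hypothesis nts6 : (6 <= n - ts)%N.
Hypothesis Lts : n%:R <= L * ts%:R.
Hypothesis Lnts : n%:R <= L * (n - ts)%:R.

Lemma trS2hatE w : trS2hat n (fun i => x i w) = What smpY ts smpdl w.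
Proof.
rewrite /trS2hat /What big_add1 /= big_mkord; congr (_ / _); apply: eq_bigr => k _.
have sE s : (s <= 3)%N -> x (k + s).+1 = x (shift s k).+1 by move=> s3; rewrite shiftE.
have := sE 0%N isT; have := sE 1%N isT; have := sE 2%N isT; have := sE 3%N isT.
rewrite addn0 addn1 addn2 addn3 => -> -> -> ->.
have /= -> := dotvE (x := fun i => x i w) (fun i a => smp_xE i a w)
  (shift 0 k) (shift 1 k) (shift 2 k) (shift 3 k).
rewrite /xi /dd /zz /gg.
by congr (_ ^+ 2); apply: eq_bigr => a _; rewrite /smpg; ring.
Qed.

Definition badW : set T := [set w | smpsg ^+ 2 / (8 * L) <
  `|What smpY ts smpdl w - Ex P (What smpY ts smpdl)|].

Lemma measurable_badW : measurable badW.
Proof.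
apply: measurable_gt; apply: (@Lmom_meas _ _ _ P 2).
exact: (Lmom_What smp_rv smp_ind smp_mfun smp_Lmom sg0 smpC_ge1 smp_fourth _ dlsg).
Qed.

Lemma prob_badW : prob P badW <= 2 ^+ 24 * (smpC ^+ 2 * L ^+ 2) / n%:R.
Proof.
exact: (What_concentration smp_rv smp_ind smp_mfun smp_Lmom sg0 smpC_ge1 smp_fourth
  dlsg L1 ts6 nts6 Lts Lnts smpsg_le).
Qed.

(** The deviation allowed by [badW] is half the lower bound of the mean and is also below its upper
    bound. *)
Lemma trS2hat_bounds w : ~ badW w ->
  smpsg ^+ 2 / (8 * L) <= trS2hat n (fun i => x i w) <= 2 ^+ 7 * (smpC * smpsg ^+ 2).
Proof.
have L0 : 0 < L by exact: lt_le_trans L1.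
have ge := Ex_What_ge smp_rv smp_ind smp_mfun smp_Lmom smp_mean0 smp_cov sg0 smpC_ge1
  smp_fourth smp_S1 dlsg L1 ts6 nts6 Lts Lnts smpsg_le.
have le := Ex_What_le smp_rv smp_ind smp_mfun smp_Lmom sg0 smpC_ge1 smp_fourth
  dlsg L1 ts6 nts6 Lts Lnts smpsg_le.
rewrite /badW /= trS2hatE => /negP; rewrite -leNgt ler_norml.
move: ge le; set W := What _ _ _ w; set m := Ex _ _ => ge le /andP[h1 h2].
have q : smpsg ^+ 2 / (4 * L) = smpsg ^+ 2 / (8 * L) + smpsg ^+ 2 / (8 * L).
  by field; rewrite gt_eqF.
have u : smpsg ^+ 2 / (8 * L) <= 2 ^+ 6 * (smpC * smpsg ^+ 2).
  have C1 := smpC_ge1; have s2 := sqr_ge0 smpsg.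
  apply: (@le_trans _ _ (smpsg ^+ 2)).
    rewrite ler_pdivrMr ?mulr_gt0// ler_peMr//.
    by rewrite -[leLHS]mulr1 ler_pM// ler1n.
  rewrite mulrA ler_peMl//.
  by apply: (@le_trans _ _ (2 ^+ 6 * 1)); rewrite ?ler_pM2l ?exprn_gt0// mulr1 exprn_ege1// ler1n.
have e7 : 2 ^+ 7 * (smpC * smpsg ^+ 2) = 2 ^+ 6 * (smpC * smpsg ^+ 2) + 2 ^+ 6 * (smpC * smpsg ^+ 2) by ring.
rewrite q in ge; rewrite e7; exact: (window_bounds ge le u h1 h2).
Qed.

Local Notation nR := (n%:R : R).
Local Notation e := (nsq smpdl).
Local Notation f := (fro smpDl).

(** The common shape of both signals, by [scale_kap]. As the mean and the covariance part peak at
    the same place, no case distinction by type of change is needed. *)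
Definition kap m : R := m%:R * (n - m)%:R / nR ^+ 2 * dcoef1 smpg m ^+ 2.

Let nR0 : 0 < nR. Proof. by rewrite ltr0n. Qed.
Let L0 : 0 < L. Proof. exact: lt_le_trans L1. Qed.
Let tsR0 : 0 < ts%:R :> R. Proof. by rewrite ltr0n. Qed.
Let ntsR : (n - ts)%:R = nR - ts%:R :> R. Proof. by rewrite natrB// ltnW. Qed.
Let nts0 : 0 < nR - ts%:R. Proof. by rewrite subr_gt0 ltr_nat. Qed.

Lemma scale_kap m (v : R) : sc m * (dcoef1 smpg m ^+ 2 * v) = nR * kap m * v.
Proof. by rewrite /scale /kap; field; rewrite gt_eqF. Qed.

Lemma kap_ge0 m : 0 <= kap m.
Proof. by rewrite /kap mulr_ge0 ?sqr_ge0// divr_ge0// ?sqr_ge0 ?mulr_ge0. Qed.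

Lemma sum_smpg_ge m : (m <= n)%N ->
  \sum_(i < n | ~~ (i < m)%N) smpg i = (n - maxn m ts)%:R.
Proof.
move=> mn; have mtn : (maxn m ts <= n)%N by rewrite geq_max mn ltnW.
rewrite -(sum_block_ge mtn) [LHS]big_mkcond [RHS]big_mkcond /=; apply: eq_bigr => i _.
rewrite /smpg -!leqNgt geq_max.
by case: (m <= i)%N; case: (ts <= i)%N.
Qed.

Lemma sum_smpg_lt m : (m <= n)%N ->
  \sum_(i < n | (i < m)%N) smpg i = (maxn m ts)%:R - ts%:R.
Proof.
move=> mn; have mtn : (maxn m ts <= n)%N by rewrite geq_max mn ltnW.
have h0 := sum_smpg_ge (leq0n n); have hm := sum_smpg_ge mn.
have : \sum_(i < n) smpg i = (n - ts)%:R.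
  by rewrite -[in RHS](max0n ts) -h0; apply: eq_bigl.
rewrite (bigID (fun i : 'I_n => (i < m)%N))/= hm natrB// ntsR.
by move=> E; lra.
Qed.

Lemma dcoef1_le_ts m : m \in r -> (m <= ts)%N -> dcoef1 smpg m = (nR - ts%:R) / (nR - m%:R).
Proof.
move=> mr mts; have [p1 p2 mn _ _] := r_facts rL mr.
rewrite /dcoef1 /gbar1 /gbar2 sum_smpg_ge// sum_smpg_lt// (maxn_idPr mts).
by rewrite subrr mulr0 subr0 ntsR natrB// mulrC.
Qed.

Lemma dcoef1_ge_ts m : m \in r -> (ts <= m)%N -> dcoef1 smpg m = ts%:R / m%:R.
Proof.
move=> mr tsm; have [p1 p2 mn _ _] := r_facts rL mr.
rewrite /dcoef1 /gbar1 /gbar2 sum_smpg_ge// sum_smpg_lt// (maxn_idPl tsm).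
by field; rewrite !gt_eqF.
Qed.

Hypothesis tsr : ts \in r.

Lemma kap_ts : kap ts = ts%:R * (nR - ts%:R) / nR ^+ 2.
Proof. by rewrite /kap dcoef1_le_ts// divff ?gt_eqF// expr1n mulr1 ntsR. Qed.

Lemma kap_ts_le1 : kap ts <= 1.
Proof.
rewrite kap_ts ler_pdivrMr ?exprn_gt0// mul1r expr2; apply: ler_pM; [exact: ltW|exact: ltW|by rewrite ler_nat ltnW|].
by rewrite gerBl ltW.
Qed.

(** The drop factors exactly: it is ((n - ts) / n) ((ts - m) / (n - m)) to the left of [ts] and (ts
    / n) ((m - ts) / m) to the right. The first factor is at least 1/L and the second at least
    [c]. *)
Lemma kap_gap m (c : R) : m \in r -> 0 <= c -> c * nR <= `|m%:R - ts%:R| ->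
  kap m + c / L <= kap ts.
Proof.
move=> mr c0 far; have [p1 p2 mn mn' _] := r_facts rL mr.
have nmE : (n - m)%:R = nR - m%:R :> R by rewrite natrB.
rewrite nmE in p2; have Lts' := Lts; have Lnts' := Lnts; rewrite ntsR in Lnts'.
rewrite -lerBrDl kap_ts /kap nmE.
have [mts|/ltnW tsm] := leqP m ts.
  have mts' : m%:R <= ts%:R :> R by rewrite ler_nat.
  rewrite dcoef1_le_ts// (_ : _ - _ = (nR - ts%:R) / nR * ((ts%:R - m%:R) / (nR - m%:R))); last first.
    by field; rewrite !gt_eqF.
  rewrite distrC ger0_norm ?subr_ge0// in far.
  rewrite mulrC; apply: ler_pM; rewrite ?invr_ge0 ?(ltW L0)//.
    by rewrite ler_pdivlMr// mulrC ler_pdivrMr// mulrC.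
  rewrite ler_pdivlMr//; apply: le_trans far; rewrite ler_wpM2l// gerBl.
  exact: ltW.
have tsm' : ts%:R <= m%:R :> R by rewrite ler_nat.
rewrite dcoef1_ge_ts// (_ : _ - _ = ts%:R / nR * ((m%:R - ts%:R) / m%:R)); last first.
  by field; rewrite !gt_eqF.
rewrite ger0_norm ?subr_ge0// in far.
rewrite mulrC; apply: ler_pM; rewrite ?invr_ge0 ?(ltW L0)//.
  by rewrite ler_pdivlMr// mulrC ler_pdivrMr// mulrC.
by rewrite ler_pdivlMr//; apply: le_trans far; rewrite ler_wpM2l.
Qed.

Variable eps : R.
Hypothesis eps0 : 0 < eps.
Hypothesis eps1 : eps <= 1.

Let c : R := eps / L.
(** The drop of [kap] at distance [eps * n] is at least [c]; the tolerance [c ^+ 2 / 128] is the one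
    of [glog_sum_gap], expressed in the true scale by the factor of [standardize_M] and
    [standardize_V]. *)
Let eta' : R := c ^+ 2 / 128 / (2 ^+ 10 * smpC ^+ 2 * L ^+ 2).
Let signal : R := nR * (e / smpsg + f / smpsg ^+ 2).

Hypothesis signal_large :
  2 ^+ 8 * smpC ^+ 2 * (64 * (1 + `|2 * ln (normal_peak 1 : R)|) / c ^+ 2) <= signal.

Let xiM m w : R := sc m * Mstat n (fun i => x i w) m - sc m * (dcoef1 smpg m ^+ 2 * e).
Let xiV m w : R := sc m * Vstat n (fun i => x i w) m - sc m * (dcoef1 smpg m ^+ 2 * f).

Definition badM : set T :=
  [set w | exists2 m, m \in r & eta' * signal * smpsg < `|xiM m w|].
Definition badV : set T :=
  [set w | exists2 m, m \in r & eta' * signal * smpsg ^+ 2 < `|xiV m w|].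

Let c_gt0 : 0 < c. Proof. exact: divr_gt0. Qed.
Let smpC0 : 0 < smpC. Proof. exact: lt_le_trans smpC_ge1. Qed.
Let e0 : 0 <= e. Proof. exact: nsq_ge0. Qed.
Let f0 : 0 <= f. Proof. exact: fro_ge0. Qed.

(** Off the three exceptional events both standardised statistics follow [kap] up to the tolerance
    at [ts] and at [tau], so a distant [tau] would contradict [glog_sum_gap]. *)
Lemma argmax_close w tau : ~ badM w -> ~ badV w -> ~ badW w -> tau \in r ->
  Tstat n (fun i => x i w) ts <= Tstat n (fun i => x i w) tau ->
  `|tau%:R - ts%:R| <= eps * nR.
Proof.
move=> nM nV nW taur Tle; rewrite leNgt; apply/negP => far.
have /andP[W1 W2] := trS2hat_bounds nW; set W := trS2hat _ _ in W1 W2.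
have W0 : 0 < W by apply: lt_le_trans W1; rewrite divr_gt0 ?exprn_gt0// mulr_gt0.
(* The random scale itself: the mean statistic is divided by [s] and the covariance statistic by
   [s ^+ 2]. *)
pose s := Num.sqrt (2 * W).
have s0 : 0 < s by rewrite sqrtr_gt0 mulr_gt0.
have s2 : s ^+ 2 = 2 * W by rewrite sqr_sqrtr// ltW// mulr_gt0.
have sgs : smpsg <= 2 * L * s.
  have k0 : 0 <= 2 * L * s by rewrite !mulr_ge0// ltW.
  rewrite -(ler_pXn2r (ltn0Sn 1)) ?nnegrE ?(ltW sg0)//.
  rewrite (_ : (2 * L * s) ^+ 2 = L * (8 * L * W)); last by rewrite -[2 * L * s]mulrA exprMn exprMn s2; ring.
  move: W1; rewrite ler_pdivrMr ?mulr_gt0// mulrC => W1.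
  have k8 : 0 < 8 * L * W by apply: mulr_gt0 => //; exact: mulr_gt0.
  by apply: (le_trans W1); rewrite ler_peMl// ltW.
have ssg : s <= 2 ^+ 4 * smpC * smpsg.
  have k0 : 0 <= 2 ^+ 4 * smpC * smpsg.
    by apply: mulr_ge0; [apply: mulr_ge0; [exact: exprn_ge0|exact: ltW]|exact: ltW].
  rewrite -(ler_pXn2r (ltn0Sn 1)) ?nnegrE ?(ltW s0)// s2.
  apply: (@le_trans _ _ (2 * (2 ^+ 7 * (smpC * smpsg ^+ 2)))); first by rewrite ler_pM2l.
  rewrite (_ : (_ * _) ^+ 2 = 2 ^+ 8 * (smpC * (smpC * smpsg ^+ 2))); last by ring.
  rewrite mulrA -exprS ler_wpM2l ?exprn_ge0//.
  by rewrite ler_peMl ?smpC_ge1// mulr_ge0 ?sqr_ge0// ltW.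
have nR0' := ltW nR0.
have eta0 : 0 <= c ^+ 2 / 128 by rewrite divr_ge0// sqr_ge0.
have stM := standardize_M sg0 L1 smpC_ge1 s0 sgs ssg e0 f0 nR0' eta0.
have stV := standardize_V sg0 L1 smpC_ge1 s0 sgs ssg e0 f0 nR0' eta0.
have sig := signal_le_standardized sg0 smpC_ge1 s0 ssg e0 f0 nR0'.
pose A := nR * e / s; pose B := nR * f / s ^+ 2.
have A0 : 0 <= A by rewrite divr_ge0 ?mulr_ge0// ltW.
have B0 : 0 <= B by apply: divr_ge0; [exact: mulr_ge0|exact: sqr_ge0].
have MtE m : Mtilde n (fun i => x i w) m - kap m * A = s^-1 * xiM m w.
  rewrite /Mtilde /xiM scale_kap powRN -/W (_ : 1 / 2 = 2^-1); last by rewrite div1r.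
  have W20 : 0 <= 2 * W by apply: mulr_ge0 => //; exact: ltW.
  rewrite (powR12_sqrt W20) -/s natrM /A /scale; ring.
have VtE m : Vtilde n (fun i => x i w) m - kap m * B = (s ^+ 2)^-1 * xiV m w.
  by rewrite /Vtilde /xiV scale_kap -/W -s2 natrM /B /scale; ring.
have bM m : m \in r -> `|Mtilde n (fun i => x i w) m - kap m * A| <= c ^+ 2 / 128 * (A + B).
  move=> mr; rewrite MtE normrM gtr0_norm ?invr_gt0//; apply: le_trans stM.
  rewrite ler_pM2l ?invr_gt0// leNgt; apply/negP => h; apply: nM.
  by exists m.
have bV m : m \in r -> `|Vtilde n (fun i => x i w) m - kap m * B| <= c ^+ 2 / 128 * (A + B).
  move=> mr; rewrite VtE normrM gtr0_norm ?invr_gt0 ?exprn_gt0//; apply: le_trans stV.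
  rewrite ler_pM2l ?invr_gt0 ?exprn_gt0// leNgt; apply/negP => h; apply: nV.
  by exists m.
have c1 : c <= 1 by rewrite /c ler_pdivrMr// mul1r (le_trans eps1).
have gap := kap_gap taur (ltW eps0) (ltW far).
have thr : 64 * (1 + `|2 * ln (normal_peak 1 : R)|) / c ^+ 2 <= A + B.
  have K0 : 0 < 2 ^+ 8 * smpC ^+ 2 by rewrite mulr_gt0 ?exprn_gt0.
  by rewrite -(ler_pM2l K0); exact: le_trans signal_large sig.
have := glog_sum_gap c_gt0 c1 A0 B0 (kap_ge0 tau) gap kap_ts_le1 thr
  (bM _ tsr) (bV _ tsr) (bM _ taur) (bV _ taur).
have TE m : Tstat n (fun i => x i w) m =
    glog (Mtilde n (fun i => x i w) m) + glog (Vtilde n (fun i => x i w) m).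
  by rewrite /Tstat /glog !mulNr.
by rewrite -!TE ltNge Tle.
Qed.

(** The exponent is 32 + 1: [badM] and [badV] share the bound of the worse of the two. *)
Let bound : R := 2 ^+ 33 * (L ^+ 10 * smpC ^+ 2) / eta' ^+ 2 *
  ((1 + signal) / signal ^+ 2 + (e / smpsg + (e / smpsg) ^+ 2)) +
  2 ^+ 24 * (smpC ^+ 2 * L ^+ 2) / nR.

Let signal0 : 0 < signal.
Proof.
apply: lt_le_trans signal_large.
have h : 0 < 1 + `|2 * ln (normal_peak 1 : R)| by rewrite ltr_pwDl.
have k : 0 < 2 ^+ 8 * smpC ^+ 2 by rewrite mulr_gt0 ?exprn_gt0.
by rewrite mulr_gt0// divr_gt0 ?exprn_gt0// mulr_gt0.
Qed.

Let eta'0 : 0 < eta'.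
Proof.
have k : 0 < 2 ^+ 10 * smpC ^+ 2 * L ^+ 2 by rewrite !mulr_gt0 ?exprn_gt0.
by rewrite divr_gt0// divr_gt0 ?exprn_gt0.
Qed.

Lemma measurable_badM : measurable badM.
Proof. by have [h _] := smp_tailbound_M; apply: measurable_exceed. Qed.

Lemma measurable_badV : measurable badV.
Proof. by have [h _] := smp_tailbound_V; apply: measurable_exceed. Qed.

Let K : R := 2 ^+ 32 * (L ^+ 10 * smpC ^+ 2) / eta' ^+ 2.

Let K0 : 0 <= K.
Proof.
rewrite divr_ge0 ?sqr_ge0// mulr_ge0 ?exprn_ge0// mulr_ge0 ?exprn_ge0//; exact: ltW.
Qed.

Lemma prob_badM : prob P badM <= K * ((1 + signal) / signal ^+ 2).
Proof.
have [_ tb] := smp_tailbound_M.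
have t0 := mulr_gt0 (mulr_gt0 eta'0 signal0) sg0.
apply: (le_trans (tb _ t0)); rewrite ler_pdivrMr ?exprn_gt0//.
rewrite [leRHS](_ : _ = 2 ^+ 32 * (L ^+ 10 * smpC ^+ 2 * (smpsg ^+ 2 * (1 + signal)))); last first.
  by rewrite /K; field; rewrite !gt_eqF.
have MS := Msize_bound sg0 e0 f0 (ltW nR0).
have C2 : 0 <= smpC ^+ 2 by exact: sqr_ge0.
apply: ler_pM; rewrite ?exprn_ge0//; last 2 first.
- by rewrite ler_weXn2l// ler1n.
- apply: ler_pM => //.
  + by rewrite mulr_ge0 ?exprn_ge0// ltW.
  + by rewrite /Msize addr_ge0 ?sqr_ge0// !mulr_ge0// ltW.
  + by rewrite ler_wpM2r// ler_weXn2l.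
rewrite mulr_ge0 ?mulr_ge0 ?exprn_ge0 ?(ltW L0)//.
by rewrite /Msize addr_ge0 ?sqr_ge0// !mulr_ge0// ltW.
Qed.

Lemma prob_badV : prob P badV <= K * ((1 + signal) / signal ^+ 2 +
  (e / smpsg + (e / smpsg) ^+ 2)).
Proof.
have [_ tb] := smp_tailbound_V.
have t0 := mulr_gt0 (mulr_gt0 eta'0 signal0) (exprn_gt0 2 sg0).
apply: (le_trans (tb _ t0)); rewrite ler_pdivrMr ?exprn_gt0//.
set a := e / smpsg + _.
rewrite [leRHS](_ : _ = 2 ^+ 32 * (L ^+ 10 * smpC ^+ 2 *
    (smpsg ^+ 4 * (1 + signal + a * signal ^+ 2)))); last first.
  by rewrite /K; field; rewrite !gt_eqF.
have VS := Vsize_bound sg0 e0 f0 (ltW nR0).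
rewrite ler_pM2l ?exprn_gt0// /Gc mulrA [L ^+ 2 * (_ * _)]mulrA -exprD.
apply: ler_wpM2l => //.
by rewrite mulr_ge0 ?exprn_ge0// ltW.
Qed.

Lemma smp_consistency (tauhat : T -> nat) (lo hi : nat) :
  measurable_fun setT tauhat ->
  (forall w, is_argmax (Tstat n (fun i => x i w)) lo hi (tauhat w)) ->
  (forall m, (lo <= m <= hi)%N -> m \in r) -> (lo <= ts <= hi)%N ->
  prob P [set w | eps < `|((tauhat w)%:R - ts%:R) / nR|] <= bound.
Proof.
move=> mt amax hr tsI.
have mE : measurable [set w | eps < `|((tauhat w)%:R - ts%:R) / nR|].
  have := mt measurableT [set k | eps < `|(k%:R - ts%:R) / nR|] I.
  by rewrite setTI.
have mM := measurable_badM; have mV := measurable_badV; have mW := measurable_badW.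
apply: (@le_trans _ _ (prob P (badM `|` badV `|` badW))).
  apply: prob_mono => //; first by apply: measurableU => //; exact: measurableU.
  move=> w /= far; apply: contrapT => /not_orP[/not_orP[nM nV] nW].
  have [tauI tauM] := amax w.
  have := argmax_close nM nV nW (hr _ tauI) (tauM _ tsI).
  move=> close; move: far; rewrite normrM [`|nR^-1|]gtr0_norm ?invr_gt0// ltr_pdivlMr//.
  by rewrite ltNge close.
have hU := le_trans (prob_setU P (measurableU _ _ mM mV) mW)
  (lerD (prob_setU P mM mV) (lexx _)).
apply: (le_trans hU); rewrite /bound.
have hM := prob_badM; have hV := prob_badV; have hW := prob_badW.
have a0 : 0 <= e / smpsg + (e / smpsg) ^+ 2.
  by apply: addr_ge0; [apply: divr_ge0 => //; exact: ltW|exact: sqr_ge0].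
apply: lerD => //; apply: (le_trans (lerD hM hV)).
apply: (@le_trans _ _ (K * ((1 + signal) / signal ^+ 2 + (e / smpsg + (e / smpsg) ^+ 2)) +
    K * ((1 + signal) / signal ^+ 2 + (e / smpsg + (e / smpsg) ^+ 2)))).
  by rewrite lerD2r ler_wpM2l// lerDl.
rewrite -mulrDl le_eqVlt; apply/orP; left; apply/eqP; congr (_ * _).
by rewrite /K (exprS 2 32) -mulr2n -[LHS]mulr_natl -!mulrA.
Qed.

End Sample.

Lemma search_window (lo ts n m : nat) : (6 <= lo)%N -> (lo <= ts <= n - lo)%N ->
  (lo <= m <= n - lo)%N ->
  [/\ (6 <= m)%N, (6 <= n - m)%N, (lo <= n - m)%N, (m < n)%N & ((n - lo).+1 - lo <= n)%N].
Proof. by move=> h1 h2 h3; split; lia. Qed.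

(** [A] and [K] are chosen before the probability space, the dimension and the sample size; this
    uniformity is what the passage to the limit uses. *)
Lemma argmax_far_prob (R : realType) (L C0 eps : R) : 1 <= L -> 0 < eps <= 1 ->
  exists A K : R, 0 < A /\ forall (d : measure_display) (T : measurableType d)
    (P : probability T R) (p n ts lo : nat) (x : nat -> T -> 'cV[R]_p)
    (mu : nat -> 'cV[R]_p) (Sigma : nat -> 'M[R]_p) (y : nat -> T -> 'cV[R]_p)
    (tauhat : T -> nat),
  let a := mean_gap (mu 1%N) (mu n) (Sigma 1%N) (Sigma n) in
  let S := n%:R * (a + cov_gap (Sigma 1%N) (Sigma n)) in
  (forall i, (1 <= i <= n)%N -> random_vector (x i)) ->
  independent_vectors P n x ->
  (forall i, (1 <= i <= n)%N -> finite_moments P 8 (x i)) ->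
  (forall i, (1 <= i <= n)%N -> mu i = meanv P (x i)) ->
  (forall i, (1 <= i <= n)%N -> Sigma i = covmx P (x i)) ->
  (forall i, (1 <= i <= n)%N -> y i = centered P (x i)) ->
  (forall i, (1 <= i <= ts)%N -> (mu i, Sigma i) = (mu 1%N, Sigma 1%N)) ->
  (forall i, (ts < i <= n)%N -> (mu i, Sigma i) = (mu n, Sigma n)) ->
  (forall i, (1 <= i <= n)%N ->
    sum_cum2 P 4 (y i) <= C0 * (\tr (Sigma i ^+ 2)) `^ (4%:R / 2)) ->
  (6 <= lo)%N -> (lo <= ts <= n - lo)%N -> n%:R <= L * lo%:R ->
  measurable_fun setT tauhat ->
  (forall w, is_argmax (Tstat n (fun i => x i w)) lo (n - lo) (tauhat w)) ->
  A <= S -> a <= 1 ->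
  (P [set w | eps < `|((tauhat w)%:R - ts%:R) / n%:R|]%R <=
    (K * ((S^-1 + S^-1 ^+ 2) + (a + a ^+ 2) + n%:R^-1))%:E)%E.
Proof.
move=> L1 /andP[eps0 eps1]; have L0 : 0 < L by exact: lt_le_trans L1.
pose c := eps / L; have c0 : 0 < c by exact: divr_gt0.
have sC1 := smpC_ge1 C0; have sC0 : 0 < smpC C0 by exact: lt_le_trans sC1.
pose A := 2 ^+ 8 * smpC C0 ^+ 2 * (64 * (1 + `|2 * ln (normal_peak 1 : R)|) / c ^+ 2).
pose eta := c ^+ 2 / 128 / (2 ^+ 10 * smpC C0 ^+ 2 * L ^+ 2).
pose K1 := 2 ^+ 33 * (L ^+ 10 * smpC C0 ^+ 2) / eta ^+ 2.
pose K2 := 2 ^+ 24 * (smpC C0 ^+ 2 * L ^+ 2).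
have K10 : 0 <= K1.
  apply: divr_ge0; last exact: sqr_ge0.
  by apply: mulr_ge0; [exact: exprn_ge0|apply: mulr_ge0; apply: exprn_ge0; exact: ltW].
have K20 : 0 <= K2.
  by apply: mulr_ge0; [exact: exprn_ge0|apply: mulr_ge0; apply: exprn_ge0; exact: ltW].
have A0 : 0 < A.
  have h : 0 < 1 + `|2 * ln (normal_peak 1 : R)| by rewrite ltr_pwDl.
  apply: mulr_gt0; first by apply: mulr_gt0; exact: exprn_gt0.
  by apply: divr_gt0; [exact: mulr_gt0|exact: exprn_gt0].
exists A, (K1 + K2); split => //.
move=> d T P p n ts lo x mu Sigma y tauhat a S rvx indx momx muE SigmaE yE before after cum4
  lo6 tsI nL mt amax AS a1.
have /andP[lots tshi] := tsI.
have [ts6 nts6 lonts tsn wn] := search_window lo6 tsI tsI.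
have ts0 : (0 < ts)%N by exact: leq_trans ts6.
have sE := smpsg_tr muE SigmaE after ts0 tsn.
have DE := smp_DlE muE SigmaE after ts0 tsn.
have dE := smp_dlE (n:=n) mu.
have SE : S = n%:R * (nsq (smpdl (n:=n) mu) / smpsg (n:=n) Sigma +
    fro (smpDl (n:=n) Sigma) / smpsg (n:=n) Sigma ^+ 2).
  by rewrite /S /a /mean_gap /cov_gap dE DE sE.
have nR : 0 < n%:R :> R by rewrite ltr0n (leq_trans ts0)// ltnW.
have S0 : 0 < S by exact: lt_le_trans AS.
(* Division by zero gives zero, so a vanishing scale would force S = 0. *)
have sg0 : 0 < smpsg (n:=n) Sigma.
  rewrite lt_def sqrtr_ge0 andbT; apply: contraTneq S0 => sg0.
  by rewrite SE sg0 expr0n/= invr0 !mulr0 addr0 mulr0 ltxx.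
have dlsg : nsq (smpdl (n:=n) mu) <= smpsg (n:=n) Sigma.
  by move: a1; rewrite /a /mean_gap dE ler_pdivrMr// mul1r.
have far m : (lo <= m)%N -> n%:R <= L * m%:R.
  by move=> lom; apply: (le_trans nL); rewrite ler_pM2l// ler_nat.
pose r := index_iota lo (n - lo).+1.
have rE m : (m \in r) = (lo <= m <= n - lo)%N by rewrite mem_index_iota ltnS.
have rL m : m \in r -> [/\ (4 <= m)%N, (4 <= n - m)%N, n%:R <= L * m%:R & n%:R <= L * (n - m)%:R].
  rewrite rE => mI; have [m6 nm6 lonm _ _] := search_window lo6 tsI mI.
  by have /andP[lom _] := mI; split; [exact: leq_trans m6|exact: leq_trans nm6|exact: far|exact: far].
have rn : (size r <= n)%N by rewrite size_iota.
have Lts := far _ lots.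
have Lnts : n%:R <= L * (n - ts)%:R by exact: far.
have tsr : ts \in r by rewrite rE.
have large : 2 ^+ 8 * smpC C0 ^+ 2 * (64 * (1 + `|2 * ln (normal_peak 1 : R)|) / (eps / L) ^+ 2) <=
  n%:R * (nsq (smpdl (n:=n) mu) / smpsg (n:=n) Sigma +
    fro (smpDl (n:=n) Sigma) / smpsg (n:=n) Sigma ^+ 2) by rewrite -SE.
have rI m : (lo <= m <= n - lo)%N -> m \in r by rewrite rE.
have mE : measurable [set w | eps < `|((tauhat w)%:R - ts%:R) / n%:R|].
  have := mt measurableT [set k | eps < `|(k%:R - ts%:R) / n%:R|] I.
  by rewrite setTI.
rewrite -probK// lee_fin.
have := smp_consistency rvx indx momx muE SigmaE yE before after cum4 ts0 tsn sg0 dlsg L1 rL rn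
  ts6 nts6 Lts Lnts tsr eps0 eps1 large mt amax rI tsI.
rewrite -/eta -SE -dE -/K1 -/K2 => /le_trans; apply.
rewrite -/a -[_ / smpsg _]/a.
have a0 : 0 <= a by rewrite divr_ge0 ?sqr_ge0// sqrtr_ge0.
have Si : 0 <= S^-1 by rewrite invr_ge0 ltW.
have ni : 0 <= n%:R^-1 :> R by rewrite invr_ge0 ltW.
have -> : (1 + S) / S ^+ 2 = S^-1 + S^-1 ^+ 2 by field; rewrite gt_eqF.
set u := S^-1 + _ + _.
have u0 : 0 <= u by apply: addr_ge0; apply: addr_ge0 => //; exact: exprn_ge0.
by rewrite [leRHS]mulrDl; apply: lerD; apply: ler_wpM2l => //; rewrite ?lerDl ?lerDr.
Qed.

(** * Passage to the limit *)

Lemma argmax_far_cvg (R : realType) (S a : nat -> R) (K : R) :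
  S n @[n --> \oo] --> +oo -> a n @[n --> \oo] --> 0 ->
  K * (((S n)^-1 + (S n)^-1 ^+ 2) + (a n + a n ^+ 2) + n%:R^-1) @[n --> \oo] --> 0.
Proof.
move=> Soo a0.
have Si : (S n)^-1 @[n --> \oo] --> 0.
  apply/gtr0_cvgV0 => //; first by have /cvgryPgt := Soo; exact.
have ni : (n%:R^-1 : R) @[n --> \oo] --> 0.
  apply/gtr0_cvgV0; last exact: cvgr_idn.
  by near=> n; rewrite ltr0n; near: n; exists 1%N.
have e (u : nat -> R) : u n @[n --> \oo] --> 0 -> u n + u n ^+ 2 @[n --> \oo] --> 0.
  by move=> u0; have := cvgD u0 (cvgM u0 u0); rewrite mul0r addr0; exact.
have := cvgM (cvg_cst K) (cvgD (cvgD (e _ Si) (e _ a0)) ni).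
by rewrite !addr0 mulr0; exact.
Unshelve. all: by end_near. Qed.

(** Truncation loses less than one, so lo is at least half of lambda n, whence [L = 2 / lambda]. The
    right end of the window is respected because lambda + rho <= 1. *)
Lemma trunc_window (R : realType) (lambda rho : R) (n : nat) : 0 < lambda ->
  lambda <= rho <= 1 - lambda -> 7 <= lambda * n%:R ->
  let lo := Num.truncn (lambda * n%:R) in
  [/\ (6 <= lo)%N, (lo <= Num.truncn (rho * n%:R) <= n - lo)%N
    & n%:R <= 2 / lambda * lo%:R].
Proof.
move=> l0 /andP[lr rl] n7 lo.
have [ln0 rn0] : 0 <= lambda * n%:R /\ 0 <= rho * n%:R.
  by split; apply: mulr_ge0 => //; [exact: ltW|exact: ltW (lt_le_trans l0 lr)].
have /andP[lo1 lo2] := truncn_itv ln0.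
have /andP[t1 t2] := truncn_itv rn0.
rewrite -/lo -natr1 in lo1 lo2; set t := Num.truncn (rho * _) in t1 t2 *.
have lt : (lo <= t)%N by apply: le_truncn; apply: ler_wpM2r.
split.
- by rewrite truncn_ge_nat//; apply: le_trans n7; rewrite ler_nat.
- rewrite lt/= leq_subRL; last first.
    rewrite -(ler_nat R); apply: (le_trans lo1); apply: ler_piMl => //.
    by move: lr rl; clear -l0; lra.
  rewrite -(ler_nat R) natrD; apply: (le_trans (lerD lo1 t1)).
  by rewrite -mulrDl; apply: ler_piMl => //; move: rl; clear; lra.
- rewrite mulrAC ler_pdivlMr// mulrC; move: lo2 n7; clear; lra.
Qed.

Lemma covmx_sym (d : measure_display) (T : measurableType d) (R : realType)
    (P : probability T R) p (X : T -> 'cV[R]_p) k l : covmx P X k l = covmx P X l k.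
Proof. by rewrite !mxE covarianceC. Qed.

(** Either gap alone drives the sum to infinity, as the other is nonnegative. In the second case a
    -> 0 is not assumed but follows from n a = O(1). *)
Lemma gaps_cvg (R : realType) (a b : nat -> R) :
  (forall n, 0 <= a n) -> (\forall n \near \oo, 0 <= b n) ->
  [\/ [/\ n%:R * a n @[n --> \oo] --> +oo, a =o_\oo (fun=> 1 : R)
        & (fun n => n%:R * b n) =O_\oo (fun=> 1 : R)],
      (fun n => n%:R * a n) =O_\oo (fun=> 1 : R) /\ n%:R * b n @[n --> \oo] --> +oo
    | [/\ n%:R * a n @[n --> \oo] --> +oo, a =o_\oo (fun=> 1 : R)
        & n%:R * b n @[n --> \oo] --> +oo]] ->
  (n%:R * (a n + b n) @[n --> \oo] --> +oo) /\ (a n @[n --> \oo] --> 0).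
Proof.
move=> a0 b0.
have na n : 0 <= n%:R * a n by exact: mulr_ge0.
have oA : n%:R * a n @[n --> \oo] --> +oo -> n%:R * (a n + b n) @[n --> \oo] --> +oo.
  move=> /cvgryPge h; apply/cvgryPge => A; near=> n.
  rewrite mulrDr; apply: le_trans (_ : A <= n%:R * a n) _; [by near: n; exact: h|].
  by rewrite lerDl mulr_ge0//; near: n.
have oB : n%:R * b n @[n --> \oo] --> +oo -> n%:R * (a n + b n) @[n --> \oo] --> +oo.
  move=> /cvgryPge h; apply/cvgryPge => A; near=> n.
  by rewrite mulrDr; apply: le_trans (_ : A <= n%:R * b n) _; [near: n; exact: h|rewrite lerDr].
have oC : a =o_\oo (fun=> 1 : R) -> a n @[n --> \oo] --> 0.
  move=> /eqoP h; apply/cvgr0Pnorm_le => eps eps0.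
  by have := h eps eps0; apply: filterS => n; rewrite normr1 mulr1.
case=> [[h1 h2 _]|[h1 h2]|[h1 h2 _]]; split; [exact: oA|exact: oC|exact: oB| |exact: oA|exact: oC].
have /eqOP[k [_ hk]] := h1.
have ni : (n%:R^-1 : R) @[n --> \oo] --> 0.
  apply/gtr0_cvgV0; last exact: cvgr_idn.
  by near=> n; rewrite ltr0n; near: n; exists 1%N.
apply: (@squeeze_cvgr _ _ _ _ (fun=> 0) (fun n => (k + 1) * n%:R^-1)).
- near=> n; rewrite a0 /= ler_pdivlMr; last by rewrite ltr0n; near: n; exists 1%N.
  rewrite mulrC -[leLHS]ger0_norm//.
  suff : `|n%:R * a n| <= (k + 1) * `|1 : R| by rewrite normr1 mulr1.
  by near: n; apply: hk; rewrite ltrDl.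
- exact: cvg_cst.
- by have := cvgM (cvg_cst (k + 1)) ni; rewrite mulr0; exact.
Unshelve. all: by end_near. Qed.

Theorem theorem3 (R : realType)
  (p : nat -> nat) (p_infty : p @ \oo --> \oo)
  (d : nat -> measure_display) (Omega : forall n, measurableType (d n))
  (P : forall n, probability (Omega n) R)
  (x : forall n, nat -> Omega n -> 'cV[R]_(p n))
  (mu : forall n, nat -> 'cV[R]_(p n))
  (Sigma : forall n, nat -> 'M[R]_(p n))
  (y : forall n, nat -> Omega n -> 'cV[R]_(p n))
  (rho lambda : R)
  (taustar lambdan : nat -> nat)
  (tauhat : forall n, Omega n -> nat) :
  (* sampling model *)
  (forall n i, (1 <= i <= n)%N -> random_vector (x n i)) ->
  (forall n, independent_vectors (P n) n (x n)) ->
  (forall n i, (1 <= i <= n)%N -> finite_moments (P n) 8 (x n i)) ->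
  (forall n i, (1 <= i <= n)%N -> mu n i = meanv (P n) (x n i)) ->
  (forall n i, (1 <= i <= n)%N -> Sigma n i = covmx (P n) (x n i)) ->
  (forall n i, (1 <= i <= n)%N -> y n i = centered (P n) (x n i)) ->
  (* changepoint and search range *)
  0 < rho < 1 ->
  (forall n, taustar n = Num.truncn (rho * n%:R)) ->
  (\forall n \near \oo,
     [/\ forall i, (1 <= i <= taustar n)%N ->
           (mu n i, Sigma n i) = (mu n 1%N, Sigma n 1%N),
         forall i, (taustar n < i <= n)%N ->
           (mu n i, Sigma n i) = (mu n n, Sigma n n)
       & (mu n 1%N, Sigma n 1%N) <> (mu n n, Sigma n n)]) ->
  0 < lambda < 1 / 2 ->
  (forall n, lambdan n = Num.truncn (lambda * n%:R)) ->
  lambda <= rho <= 1 - lambda ->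
  (* (1) *)
  (forall eps : R, 0 < eps -> \forall n \near \oo,
     forall i, (1 <= i <= n)%N ->
       \tr (Sigma n i ^+ 4) <= eps * (\tr (Sigma n i ^+ 2)) ^+ 2) ->
  (* (2) *)
  (exists C : R, forall n i h, (1 <= i <= n)%N -> (2 <= h <= 4)%N ->
     sum_cum2 (P n) h (y n i) <= C * (\tr (Sigma n i ^+ 2)) `^ (h%:R / 2)) ->
  (* (3) *)
  (exists C : R, forall n i h, (1 <= i <= n)%N -> (5 <= h <= 8)%N ->
     sum_cum2 (P n) h (y n i) <= C * (\tr (Sigma n i ^+ 2)) `^ (h%:R / 2)) ->
  (forall eps : R, 0 < eps -> \forall n \near \oo,
     forall i, (1 <= i <= n)%N ->
       sum_cum2 (P n) 4 (y n i) <= eps * (\tr (Sigma n i ^+ 2)) ^+ 2) ->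
  (* (i), (ii), (iii) *)
  (let a n := mean_gap (mu n 1%N) (mu n n) (Sigma n 1%N) (Sigma n n) in
   let b n := cov_gap (Sigma n 1%N) (Sigma n n) in
   [\/ [/\ n%:R * a n @[n --> \oo] --> +oo,
           a =o_\oo (fun=> 1 : R)
         & (fun n => n%:R * b n) =O_\oo (fun=> 1 : R)],
       (fun n => n%:R * a n) =O_\oo (fun=> 1 : R) /\
       n%:R * b n @[n --> \oo] --> +oo
     | [/\ n%:R * a n @[n --> \oo] --> +oo,
           a =o_\oo (fun=> 1 : R)
         & n%:R * b n @[n --> \oo] --> +oo]]) ->
  (* estimator *)
  (forall n, measurable_fun setT (tauhat n)) ->
  (forall n w, is_argmax (Tstat n (fun i => x n i w))
                 (lambdan n) (n - lambdan n) (tauhat n w)) ->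
  op1 P (fun n w => ((tauhat n w)%:R - (taustar n)%:R) / n%:R).
Proof.
move=> rvx indx momx muE SigmaE yE rho01 tsE change /andP[l0 l1] loE lrho _ [C0 cum4] _ _ gaps
  mt amax eps eps0.
set a := fun n => mean_gap _ _ _ _ in gaps.
set b := fun n => cov_gap _ _ in gaps.
have trsq n (M : 'M[R]_(p n)) : (forall k l, M k l = M l k) -> 0 <= \tr (M ^+ 2).
  by move=> Ms; rewrite tr_sq_fro// fro_ge0.
have Ssym n i k l : (1 <= i <= n)%N -> Sigma n i k l = Sigma n i l k.
  by move=> /SigmaE ->; exact: covmx_sym.
have a0 n : 0 <= a n by rewrite divr_ge0 ?sqr_ge0// sqrtr_ge0.
(* Only eventually: for n = 0 the indices 1 and n lie outside the sample, where [Sigma] is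
   arbitrary. *)
have b0 : \forall n \near \oo, 0 <= b n.
  near=> n; have n1 : (0 < n)%N by near: n; exists 1%N.
  by apply: divr_ge0; apply: trsq => k l; rewrite !mxE ![Sigma n _ k l]Ssym ?n1 ?leqnn.
have [Soo aoo] := gaps_cvg a0 b0 gaps.
(* The fixed-sample bound asks for a threshold at most 1; lowering the threshold only enlarges the
   event. *)
pose del := Num.min eps 1.
have del01 : 0 < del <= 1 by rewrite lt_min eps0 ltr01 ge_min lexx orbT.
have L1 : 1 <= 2 / lambda by rewrite ler_pdivlMr// mul1r; move: l1; clear; lra.
have [A [K [A0 far]]] := argmax_far_prob C0 L1 del01.
pose u n : R := K * (((n%:R * (a n + b n))^-1 + (n%:R * (a n + b n))^-1 ^+ 2) +
  (a n + a n ^+ 2) + n%:R^-1).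
have u0 : u n @[n --> \oo] --> 0 by exact: argmax_far_cvg.
apply: (@squeeze_cvge _ _ _ _ (fun=> 0%E) _ (fun n => (u n)%:E)).
- near=> n; rewrite measure_ge0/=.
  have n7 : 7 <= lambda * n%:R.
    rewrite mulrC -ler_pdivrMr//; near: n; exact: nbhs_infty_ger.
  have [lo6 tsI nL] := trunc_window l0 lrho n7.
  rewrite -loE -tsE in lo6 tsI nL.
  have [before after _] : [/\ forall i, (1 <= i <= taustar n)%N ->
           (mu n i, Sigma n i) = (mu n 1%N, Sigma n 1%N),
         forall i, (taustar n < i <= n)%N ->
           (mu n i, Sigma n i) = (mu n n, Sigma n n)
       & (mu n 1%N, Sigma n 1%N) <> (mu n n, Sigma n n)] by near: n.
  have AS : A <= n%:R * (a n + b n) by near: n; move/cvgryPge: Soo; exact.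
  have a1 : a n <= 1.
    rewrite -[leLHS]ger0_norm//; near: n.
    by move/cvgr0Pnorm_le: aoo; apply; exact: ltr01.
  have mE (e : R) : measurable [set w | e < `|((tauhat n w)%:R - (taustar n)%:R) / n%:R|].
    have := mt n measurableT [set k | e < `|(k%:R - (taustar n)%:R) / n%:R|] I.
    by rewrite setTI.
  apply: (@le_trans _ _ (P n [set w | del < `|((tauhat n w)%:R - (taustar n)%:R) / n%:R|]%R)).
    apply: le_measure; rewrite ?inE//=.
    by move=> w /=; apply: le_lt_trans; rewrite ge_min lexx.
  apply: (far _ _ _ _ _ _ (lambdan n) _ _ _ _ _ (rvx n) (indx n) (momx n) (muE n) (SigmaE n) (yE n)) => //.
  by move=> i iI; exact: cum4.
- exact: cvg_cst.
- by apply: cvg_EFin u0; near=> n.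
Unshelve. all: by end_near. Qed.
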